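(* Assume $\beta\geq0$, $\gamma\geq0$, and that one of the conditions $C_1$, $C_{2a}$, $C_{2b}$, $C_3$ holds. Then: (1) For every pair of nonnegative $\mathcal F_0$-measurable initial values $(X_0,Y_0)$ with $\mathbb P((X_0,Y_0)=(0,0))=0$, there exists a strong O2BP with these initial values, it takes values in $S\setminus\{(0,0)\}$ at all times, and it is pathwise unique (any two O2BPs driven by the same $(B,C)$ with the same initial values are indistinguishable). (2) There exists an O2BP with $X_0=Y_0=0$. (3) If moreover $\alpha\delta\geq\beta\gamma$, then for every pair of nonnegative $\mathcal F_0$-measurable initial values (including the corner) there exists a pathwise unique O2BP.
   Context: On a complete filtered probability space with usual conditions, $(B,C)$ is an adapted planar Brownian motion started at $0$ with $\langle B\rangle_t=\langle C\rangle_t=t$, $\langle B,C\rangle_t=\rho t$, $\rho\in[-1,1]$. $S=[0,\infty)^2$. With $\alpha>0,\delta>0,\beta,\gamma\in\mathbb R$, an O2BP is an adapted continuous $S$-valued process $(X,Y)$ with $X_t=X_0+B_t+\alpha\int_0^t\frac{ds}{X_s}+\beta\int_0^t\frac{ds}{Y_s}$, $Y_t=Y_0+C_t+\gamma\int_0^t\frac{ds}{X_s}+\delta\int_0^t\frac{ds}{Y_s}$ for all $t\ge0$, nonnegative $\mathcal F_0$-measurable $X_0,Y_0$, $\int_0^t\mathbf 1_{\{X_s=0\}}ds=\int_0^t\mathbf 1_{\{Y_s=0\}}ds=0$ and $\int_0^t\mathbf 1_{\{X_s>0\}}\frac{ds}{X_s}<\infty$, $\int_0^t\mathbf 1_{\{Y_s>0\}}\frac{ds}{Y_s}<\infty$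 for all $t$. Conditions: $C_1$: $\beta\geq0,\gamma\geq0$, $-1\leq\rho\leq\alpha+\delta$. $C_{2a}$: $\alpha\geq\frac12$, $\beta\geq0$. $C_{2b}$: $\delta\geq\frac12$, $\gamma\geq0$. $C_3$: there exist $\lambda>0,\mu>0$ with $\lambda\alpha+\mu\gamma\geq0$, $\lambda\beta+\mu\delta\geq0$ and $\big(\sqrt{\lambda(\lambda\alpha+\mu\gamma)}+\sqrt{\mu(\lambda\beta+\mu\delta)}\big)^2\geq\frac12(\lambda^2+\mu^2+2\rho\lambda\mu)$. *)

(* Defs.v *)
From HB Require Import structures.
From mathcomp Require Import all_boot all_order all_algebra.
From mathcomp Require Import all_classical all_reals all_analysis.
Set Implicit Arguments. Unset Strict Implicit. Unset Printing Implicit Defensive.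
Import Order.TTheory GRing.Theory Num.Theory.
Import numFieldNormedType.Exports.
Local Open Scope classical_set_scope.
Local Open Scope ring_scope.

Section O2BP_defs.
Context {R : realType} {d : measure_display} {Omega : measurableType d}.
Variable P : probability Omega R.

(** A real-valued process indexed by time [t : R] (only [t >= 0] matters). *)
Definition process := R -> Omega -> R.

Definition complete_prob_space : Prop :=
  forall N N' : set Omega, measurable N' -> P N' = 0%E -> N `<=` N' -> measurable N.

Definition Pnull (N : set Omega) : Prop :=
  exists N', [/\ measurable N', P N' = 0%E & N `<=` N'].

Definition usual_filtration (F : R -> set (set Omega)) : Prop :=
  [/\ (forall t, 0 <= t -> sigma_algebra setT (F t) /\ F t `<=` measurable),
      (forall s t, 0 <= s -> s <= t -> F s `<=` F t),
      (forall N, Pnull N -> F 0 N) &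
      (forall t A, 0 <= t -> (forall s, t < s -> F s A) -> F t A)].

Definition G_measurable (G : set (set Omega)) (Z : Omega -> R) : Prop :=
  forall U : set R, measurable U -> G (Z @^-1` U).

Definition adapted (F : R -> set (set Omega)) (X : process) : Prop :=
  forall t, 0 <= t -> G_measurable (F t) (X t).

Definition continuous_paths (X : process) : Prop :=
  forall w, {within `[0, +oo[, continuous (fun t => X t w)}.

(** (B, C) is an (F_t)-planar Brownian motion started at 0 with
    <B>_t = <C>_t = t and <B,C>_t = rho t: continuous adapted paths started
    at 0, and for s <= t the increment (B_t - B_s, C_t - C_s) is independent
    of F_s with centered Gaussian law of covariance (t-s)[[1,rho],[rho,1]];
    this is expressed through the conditional joint characteristic function:
    for all A in F_s and all reals l, m,
    E[1_A exp(i(l dB + m dC))] = P(A) exp(-(t-s)(l^2+2 rho l m+m^2)/2). *)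
Definition correlated_BM (F : R -> set (set Omega)) (rho : R) (B C : process) : Prop :=
  [/\ (forall w, B 0 w = 0 /\ C 0 w = 0),
      continuous_paths B /\ continuous_paths C,
      adapted F B /\ adapted F C &
      (forall s t, 0 <= s -> s <= t -> forall A, F s A -> forall l m : R,
        (\int[P]_(w in A) (cos (l * (B t w - B s w) + m * (C t w - C s w)))%:E
           = P A * (expR (- ((t - s) * (l ^+ 2 + 2 * rho * l * m + m ^+ 2)) / 2))%:E)%E
        /\ (\int[P]_(w in A) (sin (l * (B t w - B s w) + m * (C t w - C s w)))%:E
           = 0)%E)].

(** O2BP with initial values (X0, Y0) driven by (B, C).  Note that for
    x >= 0, x^-1 in MathComp equals 1_{x>0}/x (since 0^-1 = 0). *)
Definition O2BP (F : R -> set (set Omega)) (B C : process)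
    (alpha beta gamma delta : R) (X0 Y0 : Omega -> R) (X Y : process) : Prop :=
  [/\ adapted F X /\ adapted F Y, continuous_paths X /\ continuous_paths Y,
      (forall t w, 0 <= t -> 0 <= X t w /\ 0 <= Y t w),
      (forall w, X 0 w = X0 w /\ Y 0 w = Y0 w) &
      {ae P, forall w, forall t, 0 <= t ->
        [/\ lebesgue_measure (`[0%R, t] `&` [set s | X s w = 0]) = 0%E /\
            lebesgue_measure (`[0%R, t] `&` [set s | Y s w = 0]) = 0%E,
            (\int[lebesgue_measure]_(s in `[0%R, t]) ((X s w)^-1)%:E < +oo)%E,
            (\int[lebesgue_measure]_(s in `[0%R, t]) ((Y s w)^-1)%:E < +oo)%E,
            X t w = X0 w + B t w
                    + alpha * Rintegral lebesgue_measure `[0%R, t] (fun s => (X s w)^-1)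
                    + beta * Rintegral lebesgue_measure `[0%R, t] (fun s => (Y s w)^-1) &
            Y t w = Y0 w + C t w
                    + gamma * Rintegral lebesgue_measure `[0%R, t] (fun s => (X s w)^-1)
                    + delta * Rintegral lebesgue_measure `[0%R, t] (fun s => (Y s w)^-1)]}].

Definition generators (B C : process) (X0 Y0 : Omega -> R) (t : R) : set (set Omega) :=
  [set A | exists U : set R, measurable U /\
     (A = X0 @^-1` U \/ A = Y0 @^-1` U \/
      exists u, [/\ 0 <= u, u <= t & (A = B u @^-1` U \/ A = C u @^-1` U)])].

Definition augmented_natural_filtration (B C : process) (X0 Y0 : Omega -> R)
    : R -> set (set Omega) :=
  fun t => [set A | exists G0, <<s setT, generators B C X0 Y0 t >> G0 /\
                               Pnull ((A `\` G0) `|` (G0 `\` A))].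

Definition strong_O2BP F B C alpha beta gamma delta X0 Y0 (X Y : process) : Prop :=
  O2BP F B C alpha beta gamma delta X0 Y0 X Y /\
  adapted (augmented_natural_filtration B C X0 Y0) X /\
  adapted (augmented_natural_filtration B C X0 Y0) Y.

Definition pathwise_unique F B C alpha beta gamma delta (X0 Y0 : Omega -> R) : Prop :=
  forall X Y X' Y',
    O2BP F B C alpha beta gamma delta X0 Y0 X Y ->
    O2BP F B C alpha beta gamma delta X0 Y0 X' Y' ->
    {ae P, forall w, forall t, 0 <= t -> X t w = X' t w /\ Y t w = Y' t w}.

End O2BP_defs.

Section conditions.
Context {R : realType}.
Definition cond_C1 (rho alpha beta gamma delta : R) : Prop :=
  [/\ 0 <= beta, 0 <= gamma & -1 <= rho <= alpha + delta].
Definition cond_C2a (alpha beta : R) : Prop := 1 / 2 <= alpha /\ 0 <= beta.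
Definition cond_C2b (gamma delta : R) : Prop := 1 / 2 <= delta /\ 0 <= gamma.
Definition cond_C3 (rho alpha beta gamma delta : R) : Prop :=
  exists lambda mu : R, [/\ 0 < lambda, 0 < mu,
    0 <= lambda * alpha + mu * gamma, 0 <= lambda * beta + mu * delta &
    (Num.sqrt (lambda * (lambda * alpha + mu * gamma))
       + Num.sqrt (mu * (lambda * beta + mu * delta))) ^+ 2
      >= (lambda ^+ 2 + mu ^+ 2 + 2 * rho * lambda * mu) / 2].
End conditions.

(* Main.v *)
(* A pathwise construction reduces everything to the one-dimensional Bessel equations
   [x = B + alpha int 1/x] and [y = C + delta int 1/y] started at 0.  Given such paths, the
   system is solved by monotone iteration: adding the nonnegative drifts [beta int 1/Y] and
   [gamma int 1/X] only raises the paths above [x] and [y], so [1/x] and [1/y] dominate every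
   integrand.  The Bessel path itself is the increasing limit of the solutions with the capped
   drift [1 / max(x, 1/(n+1))]; no mass of the drift is lost in the limit because Ito's formula
   for [- x log (1 + 1/(b + x))] makes the drifts uniformly integrable.

   Ito's formula enters only as an inequality in expectation, obtained from a third order Taylor
   bound along a partition and the first four moments of the increments, which are read off the
   characteristic function.

   The corner is avoided because [log (1 + 1/(e + |U|^2)) / 2] is almost a supermartingale for a
   suitable [U]: [U = (X, Y)] under C1, [U = X] or [U = Y] under C2, [U = lambda X + mu Y] under
   C3; a maximal inequality along a grid and [e -> 0] conclude.

   Two solutions have the same noise, so their difference is of bounded variation; if
   [beta gamma <= alpha delta] the monotonicity of [1/x] forces it to vanish, and away from the
   corner one of the two drifts is locally Lipschitz, which gives uniqueness step by step. *)
Require Import Defs.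
From HB Require Import structures.
From mathcomp Require Import all_boot all_order all_algebra.
From mathcomp Require Import all_classical all_reals all_analysis.
From mathcomp Require Import measurable_realfun ring lra.
Set Implicit Arguments. Unset Strict Implicit. Unset Printing Implicit Defensive.
Import Order.TTheory GRing.Theory Num.Theory.
Import numFieldNormedType.Exports.
Local Open Scope classical_set_scope.
Local Open Scope ring_scope.

(** * Time integrals *)

Section Rintegral_extra.
Context {d : measure_display} {T : measurableType d} {R : realType}.
Variable mu : {measure set T -> \bar R}.
Implicit Types (D : set T) (f g : T -> R).

(* [filterS] and [filterS2] do not infer their filter instance when [mu] is [lebesgue_measure]. *)
Lemma ae_imply (U W : T -> Prop) : (forall x, U x -> W x) ->
  {ae mu, forall x, U x} -> {ae mu, forall x, W x}.
Proof. by move=> UW; apply: filterS. Qed.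

Lemma ae_imply2 (U V W : T -> Prop) : (forall x, U x -> V x -> W x) ->
  {ae mu, forall x, U x} -> {ae mu, forall x, V x} -> {ae mu, forall x, W x}.
Proof. by move=> UVW; apply: filterS2. Qed.

Lemma integral_EFin_Rintegral D f : measurable D -> mu.-integrable D (EFin \o f) ->
  (\int[mu]_(x in D) (f x)%:E)%E = (Rintegral mu D f)%:E.
Proof. by move=> mD fi; rewrite /Rintegral fineK//; exact: integrable_fin_num. Qed.

Lemma integrableD_EFin D f g : measurable D ->
  mu.-integrable D (EFin \o f) -> mu.-integrable D (EFin \o g) ->
  mu.-integrable D (EFin \o (fun x => f x + g x)).
Proof. by move=> mD fi gi; have := integrableD mD fi gi. Qed.

Lemma integrableZ_EFin D (k : R) f : measurable D ->
  mu.-integrable D (EFin \o f) ->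
  mu.-integrable D (EFin \o (fun x => k * f x)).
Proof. by move=> mD fi; have := integrableZl mD k fi. Qed.

Lemma integrableB_EFin D f g : measurable D ->
  mu.-integrable D (EFin \o f) -> mu.-integrable D (EFin \o g) ->
  mu.-integrable D (EFin \o (fun x => f x - g x)).
Proof. by move=> mD fi gi; have := integrableB mD fi gi. Qed.

Lemma le_integrable_EFin D f g : measurable D -> measurable_fun D f ->
  (forall x, D x -> `|f x| <= g x) ->
  mu.-integrable D (EFin \o g) -> mu.-integrable D (EFin \o f).
Proof.
move=> mD mf fg; apply: le_integrable => //; first exact/measurable_EFinP.
by move=> x Dx /=; rewrite lee_fin (le_trans (fg x Dx))// ler_norm.
Qed.

Lemma integrable_sum_EFin D (I : Type) (s : seq I) (h : I -> T -> R) :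
  measurable D -> (forall i, mu.-integrable D (EFin \o h i)) ->
  mu.-integrable D (EFin \o (fun x => \sum_(i <- s) h i x)).
Proof.
move=> mD hi; have := integrable_sum mD s (P := predT) (fun i _ => hi i).
by apply: eq_integrable => // x _ /=; rewrite sumEFin.
Qed.

Lemma Rintegral_sum D (I : Type) (s : seq I) (h : I -> T -> R) :
  measurable D -> (forall i, mu.-integrable D (EFin \o h i)) ->
  Rintegral mu D (fun x => \sum_(i <- s) h i x) = \sum_(i <- s) Rintegral mu D (h i).
Proof.
move=> mD hi; elim: s => [|i s IH].
  have -> : Rintegral mu D (fun x => \sum_(i <- [::]) h i x) = Rintegral mu D (fun=> 0).
    by apply: eq_Rintegral => x _; rewrite big_nil.
  by rewrite big_nil Rintegral_cst// mul0r.
rewrite big_cons -IH -RintegralD//; last exact: integrable_sum_EFin.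
by apply: eq_Rintegral => x _; rewrite big_cons.
Qed.

Lemma bounded_integrable_EFin D f (c : R) : measurable D -> (mu D < +oo)%E ->
  measurable_fun D f -> (forall x, D x -> `|f x| <= c) ->
  mu.-integrable D (EFin \o f).
Proof.
move=> mD muD mf fc; apply: (le_integrable_EFin mD mf fc).
apply/integrableP; split; first by apply/measurable_EFinP; exact: measurable_cst.
under eq_integral do rewrite /=.
by rewrite integral_cst// lte_mul_pinfty.
Qed.

Lemma ae_le_Rintegral D f g : measurable D ->
  mu.-integrable D (EFin \o f) -> mu.-integrable D (EFin \o g) ->
  {ae mu, forall x, D x -> f x <= g x} ->
  Rintegral mu D f <= Rintegral mu D g.
Proof.
move=> mD fi gi fg; rewrite -subr_ge0 -RintegralB//.
have hi := integrableB_EFin mD gi fi.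
rewrite -lee_fin -integral_EFin_Rintegral//.
have /integrableP[mh _] := hi.
rewrite (_ : (\int[mu]_(x in D) (g x - f x)%:E =
  \int[mu]_(x in D) (Num.max (g x - f x) 0)%:E)%E).
  by apply: integral_ge0 => x _; rewrite lee_fin le_max lexx orbT.
apply: ae_eq_integral => //.
  by apply/measurable_EFinP/measurable_maxr => //; exact/measurable_EFinP.
apply: filterS fg => x fg Dx; congr EFin.
by apply/esym/max_idPl; rewrite subr_ge0 fg.
Qed.

Lemma Rintegral_dominated_cvg D (f_ : nat -> T -> R) f g : measurable D ->
  (forall n, measurable_fun D (f_ n)) -> measurable_fun D f ->
  {ae mu, forall x, D x -> f_ ^~ x @ \oo --> f x} ->
  mu.-integrable D (EFin \o g) ->
  {ae mu, forall x, forall n, D x -> `|f_ n x| <= g x} ->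
  mu.-integrable D (EFin \o f) /\
  (fun n => Rintegral mu D (f_ n)) @ \oo --> Rintegral mu D f.
Proof.
move=> mD mf_ mf cf gi fg.
have cf' : {ae mu, forall x, D x -> (EFin \o f_ n) x @[n --> \oo] --> (EFin \o f) x}.
  by apply: filterS cf => x cf Dx; apply: cvg_EFin; [exact: nearW|exact: cf].
have fg' : {ae mu, forall x, forall n, D x -> (`|(EFin \o f_ n) x| <= (EFin \o g) x)%E}.
  by apply: filterS fg => x fg n Dx /=; rewrite lee_fin; exact: fg.
have mf_' n : measurable_fun D (EFin \o f_ n) by apply/measurable_EFinP.
have mf' : measurable_fun D (EFin \o f) by apply/measurable_EFinP.
have [fi _ c] := dominated_convergence mD mf_' mf' cf' gi fg'.
split => //; move: c; rewrite (integral_EFin_Rintegral mD fi) => /fine_cvg; exact.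
Qed.
End Rintegral_extra.

Section real_extra.
Context {R : realType}.

Lemma cvg_maxr {T : Type} (F : set_system T) {FF : Filter F} (f g : T -> R) (a b : R) :
  f @ F --> a -> g @ F --> b -> (fun x => Num.max (f x) (g x)) @ F --> Num.max a b.
Proof.
move=> fa gb; rewrite maxr_absE.
rewrite (_ : (fun x => _) = (fun x => (f x + g x + `|f x - g x|) / 2)); last first.
  by apply/funext => x; rewrite maxr_absE.
apply: cvgMr_tmp; apply: cvgD; first exact: cvgD.
by apply: cvg_norm; exact: cvgB.
Qed.

Lemma measurable_invr : measurable_fun [set: R] (fun x : R => x^-1).
Proof.
have pos (n : nat) (x : R) : 0 < x ^+ 2 + n.+1%:R^-1 by rewrite ltr_wpDl// ?sqr_ge0// invr_gt0.
apply: (@measurable_fun_cvg _ _ R _ (fun (n : nat) (x : R) => x / (x ^+ 2 + n.+1%:R^-1) : R)).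
  move=> n; apply: continuous_measurable_fun => x.
  apply: cvgM; first exact: cvg_id.
  apply: cvgV; first by rewrite gt_eqF.
  by apply: cvgD; [exact: exprn_continuous|exact: cvg_cst].
move=> x _; have [->|x0] := eqVneq x 0.
  by rewrite invr0; under eq_fun do rewrite mul0r; exact: cvg_cst.
have -> : x^-1 = x / (x ^+ 2 + 0) by rewrite addr0; field.
apply: cvgM; first exact: cvg_cst.
apply: cvgV; first by rewrite addr0 expf_neq0.
by apply: cvgD; [exact: cvg_cst|exact: cvg_harmonic].
Qed.
End real_extra.

Section real_functions.
Context {R : realType}.
Implicit Types (f : R -> R) (a b h : R).

Lemma segment_unif_continuous f a b (e : R) : continuous f -> 0 < e ->
  exists2 h : R, 0 < h & forall x y, a <= x <= b -> `|x - y| < h -> `|f x - f y| < e.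
Proof.
move=> cf e0.
have /compact_near_coveringP/(_ R (0^'+)) := @segment_compact R a b.
move=> /(_ (fun h x => forall y, `|x - y| < h -> `|f x - f y| < e) _).
case=> [x _|h /= h0 hh].
  have e2 : 0 < e / 2 by rewrite divr_gt0.
  have /cvgrPdist_lt/(_ _ e2)[h /= h0 hh] := cf x.
  exists (ball x (h / 2), [set k | 0 < k < h / 2]).
    split; first by apply: nbhsx_ballx; rewrite divr_gt0.
    exists (h / 2) => /=; first by rewrite divr_gt0.
    by move=> k /=; rewrite sub0r normrN => /ltr_normlP[_ ->] ->.
  move=> [z k] /= [xz /andP[k0 kh]] y zy.
  have -> : f z - f y = (f x - f y) - (f x - f z) by ring.
  rewrite (le_lt_trans (ler_normB _ _))// (splitr e) ltrD// hh//=.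
    rewrite (_ : x - y = (x - z) + (z - y)); last by ring.
    by rewrite (le_lt_trans (ler_normD _ _))// (splitr h) ltrD// (lt_trans zy).
  by rewrite (lt_trans xz)// gtr_pMr// invf_lt1// ltr1n.
exists (h / 2) => [|x y xab]; first by rewrite divr_gt0.
apply: (hh (h / 2)) => //=; last by rewrite divr_gt0.
by rewrite sub0r normrN gtr0_norm ?divr_gt0// gtr_pMr// invf_lt1// ltr1n.
Qed.

Lemma continuous_max0 f : {within `[0, +oo[, continuous f} ->
  continuous (fun t : R => f (Num.max t 0)).
Proof.
move=> /continuous_within_itvcyP[ci c0] r.
have [r0|r0|r0] := ltgtP r 0.
- have E : \forall x \near r, f 0 = f (Num.max x 0).
    near=> x; rewrite (max_idPr _)//; apply: ltW; near: x; exact: lt_nbhsl.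
  rewrite /continuous_at (max_idPr (ltW r0)).
  by apply: cvg_trans (near_eq_cvg E) _; exact: cvg_cst.
- have E : \forall x \near r, f x = f (Num.max x 0).
    near=> x; rewrite (max_idPl _)//; apply: ltW; near: x; exact: lt_nbhsr.
  rewrite /continuous_at (max_idPl (ltW r0)).
  by apply: cvg_trans (near_eq_cvg E) _; apply: ci; rewrite in_itv/= r0.
- rewrite r0 /continuous_at maxxx; apply/cvgrPdist_lt => e e0.
  have /cvgrPdist_lt /(_ e e0) [h /= h0 hh] := c0.
  exists h => //= x xh.
  have [x0|x0] := leP x 0; first by rewrite subrr normr0.
  exact: hh.
Unshelve. all: by end_near. Qed.

Lemma max0_unif_continuous f a b (e : R) : continuous (fun t : R => f (Num.max t 0)) ->
  0 <= a -> 0 < e ->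
  exists2 h : R, 0 < h &
    forall x y, a <= x <= b -> a <= y <= b -> `|x - y| < h -> `|f x - f y| < e.
Proof.
move=> cf a0 e0; have [h h0 hh] := segment_unif_continuous a b cf e0; exists h => //.
move=> x y xab /andP[ya _] xy; have := hh x y xab xy; case/andP: xab => xa _.
by rewrite !(max_idPl _)//; [exact: le_trans ya|exact: le_trans xa].
Qed.

Lemma exists_last_zero f a b : continuous f -> a <= b -> 0 <= f a -> f b < 0 ->
  exists s, [/\ a <= s, s < b, f s = 0 & forall r, s < r <= b -> f r < 0].
Proof.
move=> cf ab fa fb.
pose E := `[a, b]%classic `&` f @^-1` `[0, +oo[%classic.
have inE_ r : E r <-> a <= r <= b /\ 0 <= f r by rewrite /E/= !in_itv/= andbT.
have cE : compact E.
  apply: (subclosed_compact _ (@segment_compact R a b)); last exact: subIsetl.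
  apply: closedI; first exact: interval_closed.
  by apply: closed_comp => [r _|]; [exact: cf|exact: interval_closed].
have nE : E !=set0 by exists a; apply/inE_; rewrite lexx.
have [s + smax] := compact_EVT_max nE cE (continuous_subspaceT (fun r => @cvg_id _ (nbhs r))).
rewrite inE => /inE_[/andP[sa sb] fs0].
have sup_s r : a <= r <= b -> 0 <= f r -> r <= s.
  by move=> rab fr; apply: smax; rewrite inE; apply/inE_.
have [c /[!in_itv]/= /andP[sc cb] fc0] : exists2 c, c \in `[s, b] & f c = 0.
  apply: IVT => //; first exact: continuous_subspaceT.
  by rewrite ge_min le_max (ltW fb) fs0 orbT.
have cs : c = s by apply: le_anti; rewrite sup_s ?(le_trans sa sc) ?cb ?fc0.
have sltb : s < b.
  by rewrite lt_neqAle sb andbT; apply: contraTneq fb => <-; rewrite -cs fc0 ltxx.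
exists s; split => //; first by rewrite -cs.
move=> r /andP[sr rb]; rewrite ltNge; apply/negP => fr0.
by have := sup_s r _ fr0; rewrite rb (le_trans sa (ltW sr)) leNgt sr => /(_ isT).
Qed.

Lemma eq0_continuation f : continuous f -> f 0 = 0 ->
  (forall s, 0 <= s -> (forall r, 0 <= r <= s -> f r = 0) ->
     exists2 h, 0 < h & forall r, s <= r <= s + h -> f r = 0) ->
  forall t, 0 <= t -> f t = 0.
Proof.
move=> cf f0 ext t t0; apply: contrapT => /eqP ft.
pose E := [set r | 0 <= r /\ f r != 0].
have hE : has_inf E by split; [exists t|exists 0 => r []].
pose s := inf E.
have s0 : 0 <= s by apply: lb_le_inf; [case: hE|move=> r []].
have below r : 0 <= r -> r < s -> f r = 0.
  move=> r0 rs; apply: contrapT => /eqP fr; move: rs; rewrite ltNge => /negP; apply.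
  by apply: ge_inf; [case: hE|].
have fs : f s = 0.
  apply/eqP/negPn/negP => fs.
  have s_gt0 : 0 < s by rewrite lt_neqAle s0 andbT; apply: contraNneq fs => <-; rewrite f0.
  have : \forall r \near s^'-, f r = 0 /\ f r != 0.
    near=> r; split.
      have r0 : 0 < r by near: r; exact: nbhs_left_gt.
      by apply: below (ltW r0) _; near: r; exact: nbhs_left_lt.
    near: r; exact: (cvgr_neq0 _ (cvg_at_left_filter (cf s))).
  by case/(@filter_ex _ _ (at_left_proper_filter s)) => r [-> /eqP].
have vanish r : 0 <= r <= s -> f r = 0.
  by move=> /andP[r0]; rewrite le_eqVlt => /predU1P[->//|]; exact: below.
have [h h0 hh] := ext s s0 vanish.
have [r [r0 /eqP fr] rh] := inf_adherent h0 hE.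
apply: fr; have [rs|sr] := ltP r s; first exact: below.
by apply: hh; rewrite sr ltW.
Unshelve. all: by end_near. Qed.

End real_functions.

Section partition.
Context {R : realType}.
Variables (a b : R).
Implicit Types (n i : nat).

Definition grid n i : R := a + (b - a) / n.+1%:R * i%:R.

Lemma grid0 n : grid n 0 = a.
Proof. by rewrite /grid mulr0 addr0. Qed.

Lemma grid_last n : grid n n.+1 = b.
Proof. by rewrite /grid mulfVK ?pnatr_eq0//; ring. Qed.

Lemma gridS n i : grid n i.+1 = grid n i + (b - a) / n.+1%:R.
Proof. by rewrite /grid -natr1; ring. Qed.

Lemma sum_mesh n (k : R) : \sum_(i < n.+1) k * ((b - a) / n.+1%:R) = k * (b - a).
Proof.
by rewrite sumr_const card_ord -(mulr_natr (k * _)) -mulrA mulfVK.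
Qed.

Lemma mesh_lt (h : R) : 0 < h -> \forall n \near \oo, (b - a) / n.+1%:R < h.
Proof.
move=> h0; near=> n; rewrite ltr_pdivrMr// mulrC -ltr_pdivrMr//.
apply: (@lt_trans _ _ n%:R); last by rewrite ltr_nat.
by near: n; exact: nbhs_infty_gtr.
Unshelve. all: by end_near. Qed.

Hypothesis ab : a <= b.

Lemma mesh_ge0 n : 0 <= (b - a) / n.+1%:R.
Proof. by rewrite divr_ge0// subr_ge0. Qed.

Lemma grid_ge n i : a <= grid n i.
Proof. by rewrite lerDl mulr_ge0// mesh_ge0. Qed.

Lemma grid_le n i : (i <= n.+1)%N -> grid n i <= b.
Proof. by move=> ik; rewrite -[leRHS](grid_last n) lerD2l ler_wpM2l ?mesh_ge0// ler_nat. Qed.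

Lemma grid_leS n i : grid n i <= grid n i.+1.
Proof. by rewrite gridS lerDl mesh_ge0. Qed.

Lemma grid_itv n i r : (i < n.+1)%N -> grid n i <= r <= grid n i.+1 -> a <= r <= b.
Proof.
by move=> ni /andP[ir ri]; rewrite (le_trans (grid_ge n i) ir) (le_trans ri (grid_le ni)).
Qed.

Lemma exists_grid_near n t : a <= t <= b ->
  exists2 i, (i <= n.+1)%N & `|t - grid n i| <= (b - a) / n.+1%:R.
Proof.
move=> /andP[at_ tb]; have := mesh_ge0 n; rewrite le_eqVlt => /orP[/eqP mesh0|mesh_gt0].
  have abE : a = b by rewrite -(grid_last n) /grid -mesh0 mul0r addr0.
  by exists 0%N => //; rewrite grid0 -mesh0 normr_le0 subr_eq0 eq_le at_ abE tb.
have ta0 : 0 <= (t - a) / ((b - a) / n.+1%:R) by rewrite divr_ge0 ?subr_ge0// ltW.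
have /andP[lo hi] := truncn_itv ta0; exists (Num.truncn ((t - a) / ((b - a) / n.+1%:R))).
  by rewrite -(ler_nat R) (le_trans lo)// ler_pdivrMr// mulrC mulfVK// lerB.
rewrite ler_pdivlMr// in lo; rewrite ltr_pdivrMr// -natr1 mulrDl mul1r in hi.
move: lo hi; rewrite /grid; move: (Num.truncn _)%:R => k.
by move: (_ / n.+1%:R) => mesh lo hi; rewrite ger0_norm; lra.
Qed.

End partition.

Lemma le_of_le_short (R : realType) (g : R -> R) (a b h : R) : a <= b -> 0 < h ->
  (forall s t, a <= s -> s <= t -> t <= b -> t - s < h -> g s <= g t) -> g a <= g b.
Proof.
move=> ab h0 short; have /filter_ex[n nh] := mesh_lt a b h0.
suff climb i : (i <= n.+1)%N -> g a <= g (grid a b n i).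
  by rewrite -[in leRHS](grid_last a b n) climb.
elim: i => [|i IH] ni; first by rewrite grid0.
apply: le_trans (IH (ltnW ni)) _; apply: short; rewrite ?grid_ge ?grid_le ?grid_leS//.
by rewrite gridS addrC addKr.
Qed.

Section time_integral.
Context {R : realType}.
Implicit Types (f g : R -> R) (a b c t : R).
Notation mu := (@lebesgue_measure R).

Definition itv_integral f a b : R := Rintegral mu `[a, b] f.
Definition itv_integrable f a b : Prop := mu.-integrable `[a, b] (EFin \o f).

Lemma itv_integrable_measurable f a b : itv_integrable f a b -> measurable_fun `[a, b] f.
Proof. by case/integrableP => /measurable_EFinP. Qed.

Lemma lebesgue_measure_itv_lty a b : (mu `[a, b] < +oo)%E.
Proof. by rewrite lebesgue_measure_itv/=; case: ifP => // _; rewrite -EFinD ltry. Qed.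

Lemma bounded_itv_integrable f a b k : measurable_fun `[a, b] f ->
  (forall x, a <= x <= b -> `|f x| <= k) -> itv_integrable f a b.
Proof.
move=> mf fk; apply: (@bounded_integrable_EFin _ _ _ mu _ _ k) => //;
  exact: lebesgue_measure_itv_lty.
Qed.

Lemma continuous_itv_integrable f a b : continuous f -> itv_integrable f a b.
Proof.
move=> cf; apply: continuous_compact_integrable; first exact: segment_compact.
by apply: continuous_subspaceT => x; exact: cf.
Qed.

Lemma itv_integrableS f a b a' b' : a <= a' -> b' <= b -> itv_integrable f a b ->
  itv_integrable f a' b'.
Proof.
move=> aa bb; apply: integrableS => //.
by apply: subset_itv; rewrite bnd_simp.
Qed.

Lemma itv_integrableD f g a b : itv_integrable f a b -> itv_integrable g a b ->
  itv_integrable (fun x => f x + g x) a b.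
Proof. exact: integrableD_EFin. Qed.
Lemma itv_integrableB f g a b : itv_integrable f a b -> itv_integrable g a b ->
  itv_integrable (fun x => f x - g x) a b.
Proof. exact: integrableB_EFin. Qed.
Lemma itv_integrableZ k f a b : itv_integrable f a b -> itv_integrable (fun x => k * f x) a b.
Proof. exact: integrableZ_EFin. Qed.
Lemma le_itv_integrable f g a b : measurable_fun `[a, b] f ->
  (forall x, a <= x <= b -> `|f x| <= g x) -> itv_integrable g a b -> itv_integrable f a b.
Proof.
move=> mf fg; apply: le_integrable_EFin => // x /=; rewrite in_itv/=; exact: fg.
Qed.
Lemma itv_integrable_norm f a b : itv_integrable f a b -> itv_integrable (fun x => `|f x|) a b.
Proof. by move=> fi; have := integrable_norm fi. Qed.
Lemma itv_integrable_cst k a b : itv_integrable (fun=> k) a b.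
Proof. by apply: (@bounded_itv_integrable _ _ _ `|k|) => //; exact: measurable_cst. Qed.

Lemma itv_integralD f g a b : itv_integrable f a b -> itv_integrable g a b ->
  itv_integral (fun x => f x + g x) a b = itv_integral f a b + itv_integral g a b.
Proof. exact: RintegralD. Qed.
Lemma itv_integralB f g a b : itv_integrable f a b -> itv_integrable g a b ->
  itv_integral (fun x => f x - g x) a b = itv_integral f a b - itv_integral g a b.
Proof. exact: RintegralB. Qed.
Lemma itv_integralZ k f a b : itv_integrable f a b ->
  itv_integral (fun x => k * f x) a b = k * itv_integral f a b.
Proof. exact: RintegralZl. Qed.
Lemma itv_integral_cst k a b : a <= b -> itv_integral (fun=> k) a b = k * (b - a).
Proof.
move=> ab; have -> : b - a = fine (mu `[a, b]).
  rewrite lebesgue_measure_itv/= lte_fin.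
  by case: ltgtP ab => //= -> _; rewrite subrr.
exact: Rintegral_cst.
Qed.
Lemma le_itv_integral f g a b : itv_integrable f a b -> itv_integrable g a b ->
  (forall x, a <= x <= b -> f x <= g x) -> itv_integral f a b <= itv_integral g a b.
Proof. by move=> fi gi fg; apply: le_Rintegral => // x /=; rewrite in_itv/=; exact: fg. Qed.
Lemma ae_le_itv_integral f g a b : itv_integrable f a b -> itv_integrable g a b ->
  {ae mu, forall x, a <= x <= b -> f x <= g x} -> itv_integral f a b <= itv_integral g a b.
Proof.
move=> fi gi fg; exact: ae_le_Rintegral.
Qed.
Lemma eq_itv_integral f g a b : (forall x, a <= x <= b -> f x = g x) ->
  itv_integral f a b = itv_integral g a b.
Proof. by move=> fg; apply: eq_Rintegral => x; rewrite inE/= in_itv/=; exact: fg. Qed.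
Lemma eq_itv_integrable f g a b : (forall x, a <= x <= b -> f x = g x) ->
  itv_integrable f a b -> itv_integrable g a b.
Proof.
by move=> fg; apply: eq_integrable => // x; rewrite inE/= in_itv/= => /fg ->.
Qed.
Lemma itv_integral_ge0 f a b : (forall x, a <= x <= b -> 0 <= f x) -> 0 <= itv_integral f a b.
Proof. by move=> f0; apply: Rintegral_ge0 => x /=; rewrite in_itv/=; exact: f0. Qed.
Lemma le_normr_itv_integral f a b : itv_integrable f a b ->
  `|itv_integral f a b| <= itv_integral (fun x => `|f x|) a b.
Proof. exact: le_normr_Rintegral. Qed.
Lemma itv_integral_point f a : itv_integral f a a = 0.
Proof. by rewrite /itv_integral set_itv1 Rintegral_set1. Qed.
Lemma itv_integral_set0 f a b : b < a -> itv_integral f a b = 0.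
Proof. by move=> ba; rewrite /itv_integral set_itv_ge ?Rintegral_set0// bnd_simp -ltNge. Qed.

Lemma itv_integral_cat f a b c : a <= b -> b <= c -> itv_integrable f a c ->
  itv_integral f a c = itv_integral f a b + itv_integral f b c.
Proof.
move=> ab bc fi.
have := @Rintegral_itvB R f (BLeft a) (BRight c) b fi.
rewrite !bnd_simp => /(_ ab bc) /eqP; rewrite subr_eq => /eqP; rewrite /itv_integral => ->.
rewrite addrC; congr (_ + _); apply: Rintegral_itv_obnd_cbnd.
by apply: integrableS fi => //; apply: subset_itv; rewrite bnd_simp.
Qed.

Lemma itv_integral_dominated_cvg (f_ : nat -> R -> R) f g a b :
  (forall n, measurable_fun `[a, b] (f_ n)) ->
  measurable_fun `[a, b] f ->
  {ae mu, forall x, a <= x <= b -> f_ ^~ x @ \oo --> f x} ->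
  itv_integrable g a b ->
  {ae mu, forall x, forall n, a <= x <= b -> `|f_ n x| <= g x} ->
  itv_integrable f a b /\ (fun n => itv_integral (f_ n) a b) @ \oo --> itv_integral f a b.
Proof.
move=> mf_ mf cf gi fg; apply: (@Rintegral_dominated_cvg _ _ _ mu `[a, b]%classic f_ f g) => //.
Qed.

Lemma continuous_itv_integral f : (forall T, itv_integrable f 0 T) ->
  continuous (fun t => itv_integral f 0 t).
Proof.
move=> fi t.
pose f0 := f \_ `[0, +oo[%classic.
pose T := `|t| + 1.
have T0 : 0 < T by rewrite ltr_wpDl.
have tT : - T < t < T.
  by rewrite -ltr_norml ltr_pwDr.
have f0i : itv_integrable f0 (- T) T.
  rewrite /itv_integrable (_ : EFin \o f0 = (EFin \o f) \_ `[0, +oo[);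
    last by rewrite -restrict_EFin.
  apply/integrable_restrict => //.
  apply: integrableS (fi T) => //; first exact: measurableI.
  by move=> x [] /=; rewrite !in_itv/= andbT => /andP[_ ->] ->.
have eqJ x : - T <= x -> itv_integral f 0 x = itv_integral f0 (- T) x.
  move=> Tx; rewrite /itv_integral /f0 -Rintegral_mkcondr; congr Rintegral.
  apply/seteqP; split => y /=; rewrite !in_itv/=.
    by move=> /andP[y0 ->]; rewrite y0; split => //; rewrite andbT; lra.
  by move=> [/andP[_ ->]]; rewrite andbT => ->.
have Tlt : - T < T by rewrite (lt_trans _ T0)// oppr_lt0.
have := parameterized_integral_continuous (ltW Tlt) f0i.
move=> /(continuous_within_itvP _ Tlt)[+ _ _] => /(_ t).
rewrite in_itv/= tT => /(_ isT) /=.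
rewrite /prop_for /continuous_at /parameterized_integral => c.
rewrite /itv_integral in eqJ; rewrite /itv_integral eqJ ?ltW//; last by case/andP: tT.
apply: cvg_trans c; apply: near_eq_cvg.
have [Tt _] := andP tT.
near=> x; rewrite eqJ//.
by apply: ltW; near: x; exact: lt_nbhsr.
Unshelve. all: by end_near. Qed.

Lemma le_itv_integral_widen f a b c : a <= b -> b <= c -> itv_integrable f a c ->
  (forall x, b <= x <= c -> 0 <= f x) -> itv_integral f a b <= itv_integral f a c.
Proof. by move=> ab bc fi f0; rewrite (itv_integral_cat ab bc fi) lerDl itv_integral_ge0. Qed.

Lemma itv_integral_dist_le f (k e : R) a b : a <= b -> itv_integrable f a b ->
  (forall x, a <= x <= b -> `|f x - k| <= e) ->
  `|itv_integral f a b - (b - a) * k| <= e * (b - a).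
Proof.
move=> ab fi fk; have ik := itv_integrable_cst k a b.
rewrite (mulrC (b - a)) -!itv_integral_cst// -itv_integralB//.
apply: le_trans (le_normr_itv_integral (itv_integrableB fi ik)) _.
apply: le_itv_integral => //; last exact: itv_integrable_cst.
exact/itv_integrable_norm/itv_integrableB.
Qed.

Lemma itv_integral_grid_sum f a b n k : a <= b -> itv_integrable f a b -> (k <= n.+1)%N ->
  \sum_(i < k) itv_integral f (grid a b n i) (grid a b n i.+1) = itv_integral f a (grid a b n k).
Proof.
move=> ab fi; elim: k => [|k IH] kn; first by rewrite big_ord0 grid0 itv_integral_point.
rewrite big_ord_recr/= IH ?(ltnW kn)// -itv_integral_cat ?grid_ge ?grid_leS//.
by apply: itv_integrableS fi; rewrite ?grid_le.
Qed.

Lemma riemann_sum_dist_le f a b n (e : R) : continuous f -> a <= b ->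
  (forall x y, a <= x <= b -> a <= y <= b -> `|x - y| <= (b - a) / n.+1%:R ->
     `|f x - f y| <= e) ->
  `|itv_integral f a b - (b - a) / n.+1%:R * \sum_(i < n.+1) f (grid a b n i)| <= e * (b - a).
Proof.
move=> cf ab osc; have fi c d := continuous_itv_integrable c d cf.
rewrite -[b in itv_integral f a b](grid_last a b n) -itv_integral_grid_sum//.
rewrite mulr_sumr -sumrB; apply: le_trans (ler_norm_sum _ _ _) _.
rewrite -(sum_mesh a b n e).
apply: ler_sum => i _; have step := gridS a b n i.
have <- : grid a b n i.+1 - grid a b n i = (b - a) / n.+1%:R by rewrite step addrC addKr.
apply: itv_integral_dist_le => // [|x /andP[ix xi]]; first exact: grid_leS.
apply: osc; rewrite ?grid_ge ?grid_le ?(ltnW (ltn_ord i))//.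
  by apply: grid_itv (ltn_ord i) _ => //; rewrite ix.
by rewrite ger0_norm ?subr_ge0// lerBlDl -step.
Qed.

Lemma riemann_sum_cvg f a b : continuous f -> a <= b ->
  (fun n => (b - a) / n.+1%:R * \sum_(i < n.+1) f (grid a b n i)) @ \oo --> itv_integral f a b.
Proof.
move=> cf ab; apply/cvgrPdist_le => e e0.
have ba1 : 0 < b - a + 1 by rewrite ltr_wpDl// subr_ge0.
have [h h0 hh] := segment_unif_continuous a b cf (divr_gt0 e0 ba1).
near=> n; apply: (@le_trans _ _ (e / (b - a + 1) * (b - a))).
  apply: riemann_sum_dist_le => // x y xab _ xy; apply/ltW/hh => //.
  by apply: le_lt_trans xy _; near: n; exact: mesh_lt.
by rewrite mulrAC ler_pdivrMr// ler_pM2l// lerDl.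
Unshelve. all: by end_near. Qed.

Lemma gronwall_eq0_short (u : R -> R) (K a b : R) : continuous u -> a <= b ->
  0 <= K -> K * (b - a) < 1 -> (forall t, a <= t <= b -> 0 <= u t) ->
  (forall t, a <= t <= b -> u t <= K * itv_integral u a t) ->
  forall t, a <= t <= b -> u t = 0.
Proof.
move=> cu ab K0 Kba u0 uK t tab.
have [c /[!in_itv]/= /andP[ac cb] cmax] := EVT_max ab (continuous_subspaceT cu).
have uc0 : 0 <= u c by rewrite u0// ac.
have : u c <= K * (u c * (b - a)).
  rewrite (le_trans (uK c _)) ?ac// ler_wpM2l//.
  apply: (@le_trans _ _ (itv_integral (fun=> u c) a c)).
    apply: le_itv_integral; [exact: continuous_itv_integrable|exact: itv_integrable_cst|].
    by move=> x /andP[ax xc]; apply: cmax; rewrite in_itv/= ax (le_trans xc).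
  by rewrite itv_integral_cst// ler_wpM2l// lerB.
move=> uc; have {}uc : u c <= 0 by nra.
by apply: le_anti; rewrite u0// andbT (le_trans _ uc)// cmax.
Qed.

Lemma gronwall_eq0 (u : R -> R) (K a b : R) : continuous u -> 0 <= K ->
  (forall t, a <= t <= b -> 0 <= u t) ->
  (forall t, a <= t <= b -> u t <= K * itv_integral u a t) ->
  forall t, a <= t <= b -> u t = 0.
Proof.
move=> cu K0 u0 uK t /andP[at_ tb]; have ab := le_trans at_ tb.
have K1 : 0 < K + 1 by rewrite ltr_wpDl.
have iK1 : 0 < (K + 1)^-1 by rewrite invr_gt0.
have /filter_ex[n mesh] := mesh_lt a b iK1.
suff vanish i : (i <= n.+1)%N -> forall r, a <= r <= grid a b n i -> u r = 0.
  by apply: (vanish n.+1) => //; rewrite grid_last at_.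
elim: i => [_ r|i IH ni r].
  rewrite grid0 => /andP[ar ra]; have -> : r = a by apply: le_anti; rewrite ra.
  by apply: le_anti; rewrite u0 ?lexx// andbT (le_trans (uK _ _)) ?lexx// itv_integral_point mulr0.
have [ap pq qb] := And3 (grid_ge ab n i) (grid_leS ab n i) (grid_le ab ni).
have [rp /andP[ar _]|pr /andP[_ rq]] := leP r (grid a b n i).
  by apply: IH (ltnW ni) _ _; rewrite ar.
have in_ab x : grid a b n i <= x <= grid a b n i.+1 -> a <= x <= b by exact: grid_itv.
apply: (gronwall_eq0_short cu pq K0) => [||x xpq|]; last by rewrite (ltW pr).
- rewrite gridS addrC addKr; apply: (@le_lt_trans _ _ (K * (K + 1)^-1)).
    by rewrite ler_wpM2l// ltW.
  by rewrite ltr_pdivrMr// mul1r ltrDl.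
- by move=> x xpq; exact/u0/in_ab.
- have /andP[px xq] := xpq; have := uK x (in_ab x xpq).
  rewrite (itv_integral_cat ap px (continuous_itv_integrable _ _ cu)).
  rewrite (@eq_itv_integral u (fun=> 0) a (grid a b n i)); last exact: IH (ltnW ni).
  by rewrite itv_integral_cst// mul0r add0r.
Qed.

End time_integral.

(** * Monotone integral equations *)

Section ode.
Context {R : realType}.

Definition monotone_field (K L : R) (phi : R -> R -> R) : Prop :=
  [/\ 0 <= L, forall s x, `|phi s x| <= K,
      forall s x y, x <= y -> phi s x <= phi s y,
      forall s x y, `|phi s x - phi s y| <= L * `|x - y| &
      forall u, continuous u -> continuous (fun s => phi s (u s))].

Variables (a : R -> R) (phi : R -> R -> R) (K : R).

(* Starting from the lower bound [a - K t], the iterates of the antitone Picard operator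
   increase along even indices and decrease along odd ones; Gronwall identifies the limits. *)
Fixpoint picard (k : nat) : R -> R :=
  if k is k'.+1 then fun t => a t - itv_integral (fun s => phi s (picard k' s)) 0 t
  else fun t => a t - itv_integral (fun=> K) 0 t.

Definition ode_solution (t : R) : R := limn (fun k => picard k.*2 t).

Variable L : R.
Hypotheses (ca : continuous a) (phi_field : monotone_field K L phi).

Let L0 : 0 <= L. Proof. by case: phi_field. Qed.
Let phiK s x : `|phi s x| <= K. Proof. by case: phi_field. Qed.
Let phi_mono s x y : x <= y -> phi s x <= phi s y.
Proof. by case: phi_field => _ _ + _ _; exact. Qed.
Let phi_lipschitz s x y : `|phi s x - phi s y| <= L * `|x - y|.
Proof. by case: phi_field. Qed.
Let phi_continuous u : continuous u -> continuous (fun s => phi s (u s)).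
Proof. by case: phi_field => _ _ _ _; exact. Qed.

Lemma picard_continuous k : continuous (picard k).
Proof.
elim: k => [|k IH] t /=; (apply: cvgB; first exact: ca); apply: continuous_itv_integral => T.
  exact: itv_integrable_cst.
exact/continuous_itv_integrable/phi_continuous.
Qed.

Let picard_integrable k T : itv_integrable (fun s => phi s (picard k s)) 0 T.
Proof. exact/continuous_itv_integrable/phi_continuous/picard_continuous. Qed.

Let picardS_antitone i j : (forall s, picard i s <= picard j s) ->
  forall t, picard j.+1 t <= picard i.+1 t.
Proof.
by move=> ij t /=; rewrite lerD2l lerN2; apply: le_itv_integral => // s _; exact: phi_mono.
Qed.

Let picard0_le k t : picard 0 t <= picard k t.
Proof.
case: k => // k /=; rewrite lerD2l lerN2; apply: le_itv_integral => //.
  exact: itv_integrable_cst.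
by move=> s _; rewrite (le_trans (ler_norm _)).
Qed.

Let picard_le1 k t : picard k t <= picard 1 t.
Proof.
by case: k => [|k]; [exact: picard0_le|apply: picardS_antitone => s; exact: picard0_le].
Qed.

Let picard_even_nondecreasing k t : picard k.*2 t <= picard k.+1.*2 t.
Proof.
by elim: k t => [|k IH] t; [exact: picard0_le|do 2 apply: picardS_antitone => ?; exact: IH].
Qed.

Let picard_odd_nonincreasing k t : picard k.+1.*2.+1 t <= picard k.*2.+1 t.
Proof. by apply: picardS_antitone => s; exact: picard_even_nondecreasing. Qed.

Let upper (t : R) : R := limn (fun k => picard k.*2.+1 t).

Lemma ode_solution_cvg t : (fun k => picard k.*2 t) @ \oo --> ode_solution t.
Proof.
apply: nondecreasing_is_cvgn.
  by apply/nondecreasing_seqP => k; exact: picard_even_nondecreasing.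
by exists (picard 1 t) => _ [k _ <-].
Qed.

Let upper_cvg t : (fun k => picard k.*2.+1 t) @ \oo --> upper t.
Proof.
apply: nonincreasing_is_cvgn.
  by apply/nonincreasing_seqP => k; exact: picard_odd_nonincreasing.
by exists (picard 0 t) => _ [k _ <-].
Qed.

Let phi_cvg s (u : nat -> R) l : u @ \oo --> l -> (fun k => phi s (u k)) @ \oo --> phi s l.
Proof.
move=> ul.
have Lu : (fun k => L * `|u k - l|) @ \oo --> 0.
  rewrite -(mulr0 L) -(normr0 R) -(subrr l); apply: cvgMl_tmp; apply: cvg_norm.
  by apply: cvgB => //; exact: cvg_cst.
apply: (@squeeze_cvgr _ _ _ _ (fun k => phi s l - L * `|u k - l|)
  (fun k => phi s l + L * `|u k - l|)).
- by apply: nearW => k; rewrite -ler_distl.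
- by rewrite -[X in _ --> X]subr0; apply: cvgB; first exact: cvg_cst.
- by rewrite -[X in _ --> X]addr0; apply: cvgD; first exact: cvg_cst.
Qed.

Let picard_limit (i : nat -> nat) (u w : R -> R) :
  (forall t, (fun k => picard (i k) t) @ \oo --> u t) ->
  (forall t, (fun k => picard (i k).+1 t) @ \oo --> w t) ->
  [/\ forall T, itv_integrable (fun s => phi s (u s)) 0 T,
      forall t, w t = a t - itv_integral (fun s => phi s (u s)) 0 t & continuous w].
Proof.
move=> cu cw.
have lim t : itv_integrable (fun s => phi s (u s)) 0 t /\
    (fun k => itv_integral (fun s => phi s (picard (i k) s)) 0 t) @ \oo -->
    itv_integral (fun s => phi s (u s)) 0 t.
  apply: (@itv_integral_dominated_cvg R _ _ (fun=> K)).
  - by move=> k; exact: itv_integrable_measurable.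
  - apply: (@measurable_fun_cvg _ _ _ _ (fun k s => phi s (picard (i k) s))).
      by move=> k; exact: itv_integrable_measurable.
    by move=> s _; exact: phi_cvg.
  - by apply: aeW => s _; exact: phi_cvg.
  - exact: itv_integrable_cst.
  - by apply: aeW.
have wE t : w t = a t - itv_integral (fun s => phi s (u s)) 0 t.
  apply: cvg_unique (cw t) _; first exact: Rhausdorff.
  by apply: cvgB; [exact: cvg_cst|have [] := lim t].
have iu T : itv_integrable (fun s => phi s (u s)) 0 T by have [] := lim T.
split => //; rewrite (funext wE) => t.
by apply: cvgB; [exact: ca|exact: continuous_itv_integral].
Qed.

Lemma ode_solutionP : continuous ode_solution /\
  forall t, ode_solution t = a t - itv_integral (fun s => phi s (ode_solution s)) 0 t.
Proof.
have [iu upperE c_upper] := picard_limit ode_solution_cvg upper_cvg.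
have even_cvg t : (fun k => picard k.*2.+2 t) @ \oo --> ode_solution t.
  by have := @ode_solution_cvg t; rewrite -(cvg_shiftS (fun k => picard k.*2 t)).
have [iv solE c_sol] := @picard_limit (fun k => k.*2.+1) upper ode_solution upper_cvg even_cvg.
split => // t.
have [t0|t0] := ltP t 0; first by rewrite solE !itv_integral_set0.
suff coincide s : 0 <= s <= t -> `|ode_solution s - upper s| = 0.
  rewrite solE; congr (_ - _); apply: eq_itv_integral => s /coincide /eqP.
  by rewrite normr_eq0 subr_eq0 => /eqP ->.
have cd : continuous (fun s => `|ode_solution s - upper s|).
  by move=> r; apply: cvg_norm; apply: cvgB; [exact: c_sol|exact: c_upper].
move: s; apply: (@gronwall_eq0 _ _ L) => // s /andP[s0 _]; rewrite solE upperE.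
rewrite (_ : _ - _ = itv_integral (fun r => phi r (ode_solution r) - phi r (upper r)) 0 s).
  apply: le_trans (le_normr_itv_integral _) _; first exact: itv_integrableB.
  have id := continuous_itv_integrable 0 s cd; rewrite -itv_integralZ//.
  by apply: le_itv_integral => //; [exact/itv_integrable_norm/itv_integrableB|
    exact: itv_integrableZ].
by rewrite itv_integralB//; ring.
Qed.

End ode.

Lemma comparison (R : realType) (a a' p p' w w' : R -> R) :
  continuous w -> continuous w' ->
  (forall T, itv_integrable p 0 T) -> (forall T, itv_integrable p' 0 T) ->
  (forall t, 0 <= t -> w t = a t - itv_integral p 0 t) ->
  (forall t, 0 <= t -> w' t = a' t - itv_integral p' 0 t) ->
  a 0 <= a' 0 ->
  (forall s t, 0 <= s -> s <= t -> a' s - a s <= a' t - a t) ->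
  {ae @lebesgue_measure R, forall s, 0 <= s -> w' s < w s -> p' s <= p s} ->
  forall t, 0 <= t -> w t <= w' t.
Proof.
move=> cw cw' ip ip' wE w'E a0 aa pp t t0; rewrite leNgt; apply/negP => wt.
have cd : continuous (fun s => w' s - w s).
  by move=> s; apply: cvgB; [exact: cw'|exact: cw].
have [||s [s0 st /eqP ws neg]] := exists_last_zero cd t0.
- by rewrite wE// w'E// !itv_integral_point; lra.
- by rewrite subr_lt0.
have drift_le : itv_integral p' s t <= itv_integral p s t.
  apply: ae_le_itv_integral; [exact: itv_integrableS (ip' t)|exact: itv_integrableS (ip t)|].
  have ae_s : {ae @lebesgue_measure R, forall x, x != s}.
    exists [set s]; split => //; first exact: lebesgue_measure_set1.
    by move=> x /= /negP; rewrite negbK => /eqP.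
  apply: (ae_imply2 _ ae_s pp) => r rs p_le /andP[sr rt]; apply: p_le; first exact: le_trans sr.
  by rewrite -subr_lt0; apply: neg; rewrite rt lt_neqAle sr eq_sym rs.
have := wE t t0; have := w'E t t0.
rewrite (itv_integral_cat s0 (ltW st) (ip t)) (itv_integral_cat s0 (ltW st) (ip' t)).
have := wE s s0; have := w'E s s0; have := aa s t s0 (ltW st).
move: ws; lra.
Qed.

Section regularized_inverse.
Context {R : realType}.
Implicit Types (c u v : R) (f g : R -> R).

Lemma continuous_maxr f g : continuous f -> continuous g ->
  continuous (fun s => Num.max (f s) (g s)).
Proof. by move=> cf cg s; apply: continuous_max; [exact: cf|exact: cg]. Qed.

Lemma maxr0_ge0 u : 0 <= Num.max u 0.
Proof. by rewrite le_max lexx orbT. Qed.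

Lemma maxr0_lipschitz u v : `|Num.max u 0 - Num.max v 0| <= `|u - v|.
Proof.
rewrite /Num.max; case: ltP => u0; case: ltP => v0; rewrite ?subrr ?normr0//.
- by rewrite sub0r normrN ger0_norm// ler_normr; apply/orP; right; lra.
- by rewrite subr0 ger0_norm// ler_normr; apply/orP; left; lra.
Qed.

Definition posinv c u : R := (c + Num.max u 0)^-1.

Section posinv.
Variable c : R.
Hypothesis c0 : 0 < c.
Let den_gt0 u : 0 < c + Num.max u 0. Proof. by rewrite ltr_wpDr// maxr0_ge0. Qed.

Lemma posinv_gt0 u : 0 < posinv c u. Proof. by rewrite invr_gt0. Qed.

Lemma posinv_le u : posinv c u <= c^-1.
Proof. by rewrite lef_pV2 ?posrE// lerDl maxr0_ge0. Qed.

Lemma posinvB u v :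
  posinv c u - posinv c v = (Num.max v 0 - Num.max u 0) * (posinv c u * posinv c v).
Proof.
by rewrite /posinv; have := den_gt0 u; have := den_gt0 v => p q; field; rewrite !gt_eqF.
Qed.

Lemma posinv_lipschitz u v : `|posinv c u - posinv c v| <= (c^-1 * c^-1) * `|u - v|.
Proof.
rewrite posinvB normrM mulrC distrC.
apply: ler_pM => //; last exact: maxr0_lipschitz.
have p := posinv_gt0 u; have q := posinv_gt0 v.
by rewrite gtr0_norm ?mulr_gt0// ler_pM ?posinv_le// ltW.
Qed.

Lemma posinv_antitone u v : u <= v -> posinv c v <= posinv c u.
Proof.
move=> uv; rewrite -subr_ge0 posinvB.
apply: mulr_ge0; last by apply: ltW; rewrite mulr_gt0// posinv_gt0.
by rewrite subr_ge0 ge_max !le_max uv lexx orbT.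
Qed.

Lemma measurable_posinv : measurable_fun setT (posinv c).
Proof.
apply: measurableT_comp; first exact: measurable_invr.
apply: measurable_funD; first exact: measurable_cst.
by apply: measurable_maxr => //; exact: measurable_cst.
Qed.

End posinv.

Lemma posinv_le0 c u : u <= 0 -> posinv c u = c^-1.
Proof. by move=> u0; rewrite /posinv (max_idPr u0) addr0. Qed.

Lemma posinv_ge0 c u : 0 <= u -> posinv c u = (c + u)^-1.
Proof. by move=> u0; rewrite /posinv (max_idPl u0). Qed.

Definition floorr (n : nat) u : R := Num.max u n.+1%:R^-1.
Definition capinv n u : R := (floorr n u)^-1.

Lemma floorr_gt0 n u : 0 < floorr n u.
Proof. by rewrite lt_max invr_gt0 ltr0Sn orbT. Qed.

Lemma floorr_ge n u : u <= floorr n u.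
Proof. by rewrite le_max lexx. Qed.

Lemma floorr_nonincreasing n m u : (n <= m)%N -> floorr m u <= floorr n u.
Proof.
by move=> nm; rewrite ge_max !le_max lexx/= lef_pV2 ?posrE// ler_nat ltnS nm orbT.
Qed.

Lemma continuous_floorr n f : continuous f -> continuous (fun s => floorr n (f s)).
Proof. by move=> cf; apply: continuous_maxr => // s; exact: cvg_cst. Qed.

Lemma floorr_cvg u : 0 <= u -> floorr ^~ u @ \oo --> u.
Proof.
move=> u0; rewrite -[X in _ --> X](max_idPl u0).
by apply: cvg_maxr; [exact: cvg_cst|exact: cvg_harmonic].
Qed.

Lemma capinv_gt0 n u : 0 < capinv n u.
Proof. by rewrite invr_gt0 floorr_gt0. Qed.

Lemma capinv_le n u : capinv n u <= n.+1%:R.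
Proof.
rewrite -[leRHS]invrK lef_pV2 ?posrE ?floorr_gt0 ?invr_gt0//.
by rewrite le_max lexx orbT.
Qed.

Lemma capinv_le_inv n u : 0 < u -> capinv n u <= u^-1.
Proof. by move=> u0; rewrite lef_pV2 ?posrE ?floorr_gt0// floorr_ge. Qed.

Lemma capinv_le0 n u : u <= 0 -> capinv n u = n.+1%:R.
Proof. by move=> u0; rewrite /capinv /floorr (max_idPr _) ?invrK// (le_trans u0). Qed.

Lemma capinv_posinv n u : capinv n u = posinv n.+1%:R^-1 (u - n.+1%:R^-1).
Proof.
rewrite /capinv /posinv; congr (_^-1).
by rewrite -[0](subrr n.+1%:R^-1) -addr_maxl addrC subrK.
Qed.

Lemma capinv_antitone n u v : u <= v -> capinv n v <= capinv n u.
Proof.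
by move=> uv; rewrite !capinv_posinv posinv_antitone ?invr_gt0// lerB.
Qed.

Lemma capinv_lipschitz n u v : `|capinv n u - capinv n v| <= n.+1%:R ^+ 2 * `|u - v|.
Proof.
have e0 : 0 < n.+1%:R^-1 :> R by rewrite invr_gt0.
rewrite !capinv_posinv; apply: le_trans (posinv_lipschitz e0 _ _) _.
by rewrite invrK -expr2 opprB addrA subrK.
Qed.

Lemma capinv_nondecreasing n m u : (n <= m)%N -> capinv n u <= capinv m u.
Proof. by move=> nm; rewrite lef_pV2 ?posrE ?floorr_gt0// floorr_nonincreasing. Qed.

Lemma continuous_capinv n f : continuous f -> continuous (fun s => capinv n (f s)).
Proof.
by move=> cf s; apply: cvgV; [rewrite gt_eqF// floorr_gt0|exact: continuous_floorr].
Qed.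

Lemma measurable_capinv n : measurable_fun setT (capinv n).
Proof.
apply: continuous_measurable_fun; apply: (@continuous_capinv n id) => u.
exact: cvg_id.
Qed.

Lemma capinv_cvg u : 0 < u -> capinv ^~ u @ \oo --> u^-1.
Proof. by move=> u0; apply: cvgV; [rewrite gt_eqF|exact/floorr_cvg/ltW]. Qed.

End regularized_inverse.

(** * Bessel-type equations with additional forcing *)

Notation inv_integral X t := (itv_integral (fun s => (X s)^-1) 0 t).
Notation inv_integrable X := (forall T, itv_integrable (fun s => (X s)^-1) 0 T).

Section bessel_shift.
Context {R : realType}.
Notation mu := (@lebesgue_measure R).
Implicit Types (x A : R -> R) (alpha : R).

(* [1 / x] dominates the integrands of every solution lying above [x]. *)
Definition regular_path x :=
  [/\ continuous x, forall t, 0 <= x t, {ae mu, forall s, 0 <= s -> 0 < x s} &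
      inv_integrable x].

Definition shift_drift x alpha n (s w : R) : R :=
  alpha * (capinv n (x s) - posinv (floorr n (x s)) w).

(* The solution [w] of [w = A - alpha * int (1 / x - 1 / (x + w))], so that [x + w] solves the
   equation of [x] with the additional forcing [A]. *)
Definition bessel_shift alpha x A (t : R) : R :=
  limn (fun n => ode_solution A (shift_drift x alpha n) (alpha * n.+1%:R) t).

Section shift_drift.
Variables (alpha : R) (x : R -> R).
Hypothesis alpha0 : 0 <= alpha.

Lemma shift_drift_ge0 n s w : 0 <= shift_drift x alpha n s w.
Proof. by rewrite mulr_ge0// subr_ge0 posinv_le// floorr_gt0. Qed.

Lemma shift_drift_le0 n s w : w <= 0 -> shift_drift x alpha n s w = 0.
Proof. by move=> w0; rewrite /shift_drift posinv_le0// subrr mulr0. Qed.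

Lemma shift_drift_le n s w : shift_drift x alpha n s w <= alpha * capinv n (x s).
Proof. by rewrite ler_wpM2l// gerBl ltW// posinv_gt0// floorr_gt0. Qed.

Lemma shift_drift_homo n s w w' : w <= w' ->
  shift_drift x alpha n s w <= shift_drift x alpha n s w'.
Proof. by move=> ww; rewrite ler_wpM2l// lerB// posinv_antitone// floorr_gt0. Qed.

Lemma shift_drift_nondecreasing n s w :
  shift_drift x alpha n s w <= shift_drift x alpha n.+1 s w.
Proof.
apply: ler_wpM2l => //; rewrite /capinv.
have := floorr_gt0 n.+1 (x s); have := floorr_gt0 n (x s).
have := floorr_nonincreasing (x s) (leqnSn n).
move: (floorr n.+1 (x s)) (floorr n (x s)) => g f gf f0 g0; have m0 := maxr0_ge0 w.
have inv_gap (h : R) : 0 < h -> h^-1 - posinv h w = Num.max w 0 * (h^-1 * posinv h w).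
  by move=> h0; rewrite /posinv; field; rewrite !gt_eqF// ltr_wpDr.
have pf := posinv_gt0 f0 w.
rewrite !inv_gap//; apply: ler_wpM2l => //; apply: ler_pM; rewrite ?(ltW pf)//.
- by rewrite invr_ge0 ltW.
- by rewrite lef_pV2 ?posrE.
- by rewrite lef_pV2 ?posrE ?ltr_wpDr// lerD2r.
Qed.

Lemma shift_drift_field n : continuous x ->
  monotone_field (alpha * n.+1%:R) (alpha * n.+1%:R ^+ 2) (shift_drift x alpha n).
Proof.
move=> cx; split.
- by rewrite mulr_ge0// exprn_ge0.
- move=> s w; rewrite ger0_norm ?shift_drift_ge0//.
  by apply: le_trans (shift_drift_le _ _ _) _; rewrite ler_wpM2l// capinv_le.
- by move=> s w w'; exact: shift_drift_homo.
- move=> s w w'; rewrite -mulrBr normrM ger0_norm// -mulrA ler_wpM2l//.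
  rewrite opprB addrC addrA subrK distrC.
  apply: le_trans (posinv_lipschitz (floorr_gt0 _ _) _ _) _; rewrite ler_wpM2r// expr2.
  by rewrite ler_pM ?capinv_le// ltW// capinv_gt0.
- move=> u cu s; apply: cvgMl_tmp; apply: cvgB; first exact: continuous_capinv.
  apply: cvgV; first by rewrite gt_eqF// ltr_wpDr ?maxr0_ge0 ?floorr_gt0.
  apply: cvgD; first exact: continuous_floorr.
  by apply: continuous_maxr => // r; exact: cvg_cst.
Qed.

End shift_drift.

Section forced.
Variables (alpha : R) (x A : R -> R).
Hypotheses (alpha_gt0 : 0 < alpha) (rx : regular_path x) (cA : continuous A) (A0 : 0 <= A 0)
  (A_nd : forall s t, 0 <= s -> s <= t -> A s <= A t).

Let alpha0 : 0 <= alpha := ltW alpha_gt0.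
Let cx : continuous x. Proof. by case: rx. Qed.
Let shift n := ode_solution A (shift_drift x alpha n) (alpha * n.+1%:R).
Let w := bessel_shift alpha x A.

Let shiftP n : continuous (shift n) /\
  forall t, shift n t = A t - itv_integral (fun s => shift_drift x alpha n s (shift n s)) 0 t.
Proof. exact: ode_solutionP cA (shift_drift_field alpha0 n cx). Qed.

Let drift_integrable n T : itv_integrable (fun s => shift_drift x alpha n s (shift n s)) 0 T.
Proof.
have [c _] := shiftP n; have [_ _ _ _ cont] := shift_drift_field alpha0 n cx.
exact/continuous_itv_integrable/cont.
Qed.

Let shift_ge0 n t : 0 <= t -> 0 <= shift n t.
Proof.
have [c_shift shiftE] := shiftP n.
apply: (comparison (a := fun=> 0) (a' := A) (p := fun=> 0) _ c_shift _ (drift_integrable n)) => //.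
- by move=> s; exact: cvg_cst.
- by move=> T; exact: itv_integrable_cst.
- by move=> s s0; rewrite itv_integral_cst// mul0r subr0.
- by move=> s r s0 sr; rewrite !subr0; exact: A_nd.
- by apply: aeW => s _ /ltW w0; rewrite shift_drift_le0.
Qed.

Let shift_nonincreasing n t : 0 <= t -> shift n.+1 t <= shift n t.
Proof.
have [c_shift shiftE] := shiftP n; have [c_shift' shiftE'] := shiftP n.+1.
apply: (comparison (a := A) (a' := A) c_shift' c_shift
  (drift_integrable n.+1) (drift_integrable n)) => //.
- by move=> s r _ _; rewrite !subrr.
- apply: aeW => s _ /ltW ws; apply: (le_trans (shift_drift_homo _ alpha0 _ _ ws)).
  exact: shift_drift_nondecreasing.
Qed.

Lemma bessel_shift_cvg t : 0 <= t ->
  (fun n => ode_solution A (shift_drift x alpha n) (alpha * n.+1%:R) t) @ \oo --> w t.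
Proof.
move=> t0; apply: nonincreasing_is_cvgn.
  by apply/nonincreasing_seqP => k; exact: shift_nonincreasing.
by exists 0 => _ [k _ <-]; exact: shift_ge0.
Qed.

Lemma bessel_shift_lt0 t : t < 0 -> w t = A t.
Proof.
move=> t0; rewrite /w /bessel_shift (_ : (fun n => _) = fun=> A t); first exact: lim_cst.
apply/funext => n; rewrite -[LHS]/(shift n t).
by have [_ ->] := shiftP n; rewrite itv_integral_set0// subr0.
Qed.

Lemma bessel_shift_ge0 t : 0 <= t -> 0 <= w t.
Proof.
move=> t0; apply: limr_ge; first by apply/cvg_ex; eexists; exact: bessel_shift_cvg.
by apply: nearW => n; exact: shift_ge0.
Qed.

Let drift_cvg s : 0 <= s -> 0 < x s ->
  (fun n => shift_drift x alpha n s (shift n s)) @ \oo --> alpha * ((x s)^-1 - (x s + w s)^-1).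
Proof.
move=> s0 xs; have ws := bessel_shift_ge0 s0.
apply: cvgMl_tmp; apply: cvgB; first exact: capinv_cvg.
apply: cvgV; first by rewrite gt_eqF// ltr_wpDr.
apply: cvgD; first exact/floorr_cvg/ltW.
rewrite -[X in _ --> X](max_idPl ws).
by apply: cvg_maxr; [exact: bessel_shift_cvg|exact: cvg_cst].
Qed.

Let drift_integral_cvg t : 0 <= t ->
  itv_integrable (fun s => alpha * ((x s)^-1 - (x s + w s)^-1)) 0 t /\
  (fun n => itv_integral (fun s => shift_drift x alpha n s (shift n s)) 0 t) @ \oo -->
  itv_integral (fun s => alpha * ((x s)^-1 - (x s + w s)^-1)) 0 t.
Proof.
move=> t0; have [_ _ xpos ix] := rx.
have mw : measurable_fun `[0, t] w.
  apply: (@measurable_fun_cvg _ _ _ _ shift).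
    move=> n; apply: itv_integrable_measurable; apply: continuous_itv_integrable.
    by have [] := shiftP n.
  by move=> s; rewrite /= in_itv/= => /andP[s0 _]; exact: bessel_shift_cvg.
have mx : measurable_fun `[0, t] x.
  exact: itv_integrable_measurable (continuous_itv_integrable _ _ cx).
have mVx : measurable_fun `[0, t] (fun s => (x s)^-1) by exact: itv_integrable_measurable.
apply: (@itv_integral_dominated_cvg _ _ _ (fun s => alpha * (x s)^-1)).
- by move=> n; exact: itv_integrable_measurable.
- apply: measurable_funM; first exact: measurable_cst.
  apply: measurable_funB => //; apply: measurableT_comp; last exact: measurable_funD.
  exact: measurable_invr.
- by apply: ae_imply xpos => s xs /andP[s0 st]; apply: drift_cvg => //; exact: xs.
- exact: itv_integrableZ.
- apply: ae_imply xpos => s xs n /andP[s0 st]; have {}xs := xs s0.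
  rewrite ger0_norm ?shift_drift_ge0// (le_trans (shift_drift_le _ alpha0 _ _ _))//.
  by rewrite ler_wpM2l// capinv_le_inv.
Qed.

Lemma bessel_shiftP : [/\ continuous w,
  forall T, itv_integrable (fun s => (x s)^-1 - (x s + w s)^-1) 0 T &
  forall t, w t = A t - alpha * itv_integral (fun s => (x s)^-1 - (x s + w s)^-1) 0 t].
Proof.
have iw T : itv_integrable (fun s => (x s)^-1 - (x s + w s)^-1) 0 T.
  have [T0|T0] := ltP T 0.
    by rewrite /itv_integrable set_itv_ge ?bnd_simp -?ltNge//; exact: integrable_set0.
  have := itv_integrableZ alpha^-1 (drift_integral_cvg T0).1; apply: eq_itv_integrable => s _.
  by rewrite mulrA mulVf ?mul1r// gt_eqF.
have wE t : w t = A t - alpha * itv_integral (fun s => (x s)^-1 - (x s + w s)^-1) 0 t.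
  have [t0|t0] := ltP t 0; first by rewrite itv_integral_set0// mulr0 subr0 bessel_shift_lt0.
  apply: cvg_unique (bessel_shift_cvg t0) _; first exact: Rhausdorff.
  rewrite (_ : (fun n => _) =
    fun n => A t - itv_integral (fun s => shift_drift x alpha n s (shift n s)) 0 t).
    by rewrite -itv_integralZ//; apply: cvgB; [exact: cvg_cst|have [] := drift_integral_cvg t0].
  by apply/funext => n; have [_ <-] := shiftP n.
split => //; rewrite (funext wE) => t; apply: cvgB; first exact: cA.
by apply: cvgMl_tmp; apply: continuous_itv_integral.
Qed.

End forced.
End bessel_shift.

(** * Pathwise construction of the system *)

Section system.
Context {R : realType}.
Notation mu := (@lebesgue_measure R).
Implicit Types (x y X Y : R -> R).

Definition path_above x X := continuous X /\ forall t, 0 <= t -> x t <= X t.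

Lemma path_above_refl x : regular_path x -> path_above x x.
Proof. by case. Qed.

Lemma path_above_ge0 x X t : regular_path x -> path_above x X -> 0 <= t -> 0 <= X t.
Proof. by move=> [_ x0 _ _] [_ xX] t0; apply: le_trans (x0 t) (xX t t0). Qed.

Lemma path_above_gt0 x X : regular_path x -> path_above x X ->
  {ae mu, forall s, 0 <= s -> 0 < X s}.
Proof.
move=> [_ _ xp _] [_ xX]; apply: (ae_imply _ xp) => s xs s0.
exact: lt_le_trans (xs s0) (xX _ s0).
Qed.

Lemma path_above_inv_cvg x (X_ : nat -> R -> R) X T : regular_path x ->
  (forall k, path_above x (X_ k)) -> (forall t, 0 <= t -> X_^~ t @ \oo --> X t) ->
  itv_integrable (fun s => (X s)^-1) 0 T /\
  (fun k => inv_integral (X_ k) T) @ \oo --> inv_integral X T.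
Proof.
move=> [cx x0 xp ix] xX cX.
have mX_ k : measurable_fun `[0, T] (X_ k).
  by apply: itv_integrable_measurable; apply: continuous_itv_integrable; have [] := xX k.
have mX : measurable_fun `[0, T] X.
  apply: (@measurable_fun_cvg _ _ _ _ X_) => // s.
  by rewrite /= in_itv/= => /andP[s0 _]; exact: cX.
apply: (@itv_integral_dominated_cvg _ _ _ (fun s => (x s)^-1)).
- by move=> k; apply: measurableT_comp (mX_ k); exact: measurable_invr.
- by apply: measurableT_comp mX; exact: measurable_invr.
- apply: (ae_imply _ xp) => s xs /andP[s0 _]; apply: cvgV; last exact: cX.
  rewrite gt_eqF// (lt_le_trans (xs s0))//.
  apply: cvgr_to_ge (cX _ s0) _.
  by apply: nearW => k; have [_] := xX k; apply.
- exact: ix.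
- apply: (ae_imply _ xp) => s xs k /andP[s0 _]; have {}xs := xs s0.
  have xXs : x s <= X_ k s by have [_] := xX k; apply.
  have Xp := lt_le_trans xs xXs.
  by rewrite ger0_norm ?invr_ge0 ?(ltW Xp)// lef_pV2 ?posrE.
Qed.

Lemma path_above_inv_integrable x X : regular_path x -> path_above x X -> inv_integrable X.
Proof.
move=> rx xX T; have [] := @path_above_inv_cvg x (fun=> X) X T rx (fun=> xX) => //.
by move=> t _; exact: cvg_cst.
Qed.

Lemma le_inv_integral x X Y s t : regular_path x -> path_above x X -> path_above x Y ->
  (forall r, 0 <= r -> X r <= Y r) -> 0 <= s -> s <= t ->
  itv_integral (fun r => (Y r)^-1) s t <= itv_integral (fun r => (X r)^-1) s t.
Proof.
move=> rx xX xY XY s0 st.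
have iX := path_above_inv_integrable rx xX t; have iY := path_above_inv_integrable rx xY t.
apply: ae_le_itv_integral; [exact: itv_integrableS iY|exact: itv_integrableS iX|].
apply: (ae_imply _ (path_above_gt0 rx xX)) => r Xr /andP[sr _].
have r0 := le_trans s0 sr; have {}Xr := Xr r0.
by rewrite lef_pV2 ?posrE ?XY// (lt_le_trans Xr)// XY.
Qed.

Definition forcing beta p Y (t : R) : R := p + beta * inv_integral Y t.

Definition forced_path alpha beta p x Y (t : R) : R :=
  x t + bessel_shift alpha x (forcing beta p Y) t.

Section forced_path.
Variables (alpha beta p : R) (x y : R -> R).
Hypotheses (alpha0 : 0 < alpha) (beta0 : 0 <= beta) (p0 : 0 <= p).
Hypotheses (rx : regular_path x) (ry : regular_path y).

Lemma forcing_continuous Y : path_above y Y -> continuous (forcing beta p Y).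
Proof.
move=> yY t; apply: cvgD; first exact: cvg_cst.
apply: cvgMl_tmp; apply: continuous_itv_integral.
exact: path_above_inv_integrable ry yY.
Qed.

Lemma forcing_ge0 Y : 0 <= forcing beta p Y 0.
Proof. by rewrite /forcing itv_integral_point mulr0 addr0. Qed.

Lemma forcing_nondecreasing Y : path_above y Y ->
  forall s t, 0 <= s -> s <= t -> forcing beta p Y s <= forcing beta p Y t.
Proof.
move=> yY s t s0 st; rewrite lerD2l ler_wpM2l// le_itv_integral_widen//.
  exact: (path_above_inv_integrable ry yY).
by move=> r /andP[sr _]; rewrite invr_ge0 (path_above_ge0 ry yY)// (le_trans s0).
Qed.

Let shiftP Y (yY : path_above y Y) := bessel_shiftP alpha0 rx
  (forcing_continuous yY) (forcing_ge0 Y) (forcing_nondecreasing yY).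
Let shift_ge0 Y (yY : path_above y Y) := bessel_shift_ge0 alpha0 rx
  (forcing_continuous yY) (forcing_ge0 Y) (forcing_nondecreasing yY).

Lemma forced_path_above Y : path_above y Y -> path_above x (forced_path alpha beta p x Y).
Proof.
move=> yY; have [cw _ _] := shiftP yY; have [cx _ _ _] := rx.
split=> [t|t t0]; first by apply: cvgD; [exact: cx|exact: cw].
by rewrite lerDl (shift_ge0 yY t0).
Qed.

Lemma forced_pathE Y : path_above y Y -> let X := forced_path alpha beta p x Y in forall t,
  X t = x t - alpha * inv_integral x t + p + beta * inv_integral Y t + alpha * inv_integral X t.
Proof.
move=> yY X t; have [_ _ wE] := shiftP yY.
have ix : itv_integrable (fun s => (x s)^-1) 0 t by case: rx.
have iX := path_above_inv_integrable rx (forced_path_above yY) t.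
by rewrite {1}/X /forced_path wE (itv_integralB ix iX) /X /forced_path /forcing; ring.
Qed.

Lemma forced_path_lt0 Y t : path_above y Y -> t < 0 -> forced_path alpha beta p x Y t = x t + p.
Proof.
move=> yY t0; rewrite /forced_path bessel_shift_lt0//; last exact: forcing_continuous.
by rewrite /forcing itv_integral_set0// mulr0 addr0.
Qed.

Lemma forced_path_antitone Y Y' : path_above y Y -> path_above y Y' ->
  (forall t, 0 <= t -> Y t <= Y' t) ->
  forall t, 0 <= t -> forced_path alpha beta p x Y' t <= forced_path alpha beta p x Y t.
Proof.
move=> yY yY' YY t t0; rewrite lerD2l; move: t t0.
move: (shiftP yY) (shiftP yY') (shift_ge0 yY).
move: (bessel_shift alpha x (forcing beta p Y)) (bessel_shift alpha x (forcing beta p Y')).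
move=> w w' [cw iw wE] [cw' iw' wE'] w0.
apply: (comparison (a := forcing beta p Y') (a' := forcing beta p Y)
  (p := fun s => alpha * ((x s)^-1 - (x s + w' s)^-1))
  (p' := fun s => alpha * ((x s)^-1 - (x s + w s)^-1)) cw' cw).
- by move=> T; exact: itv_integrableZ.
- by move=> T; exact: itv_integrableZ.
- by move=> t t0; rewrite itv_integralZ.
- by move=> t t0; rewrite itv_integralZ.
- by rewrite /forcing !itv_integral_point.
- move=> s t s0 st; rewrite /forcing.
  have iY := path_above_inv_integrable ry yY t; have iY' := path_above_inv_integrable ry yY' t.
  rewrite (itv_integral_cat s0 st iY) (itv_integral_cat s0 st iY').
  by have := ler_wpM2l beta0 (le_inv_integral ry yY yY' YY s0 st); lra.
- case: rx => _ _ xp _; apply: (ae_imply _ xp) => s xs s0 ww; have {}xs := xs s0.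
  have ws0 := w0 s s0; rewrite ler_wpM2l ?(ltW alpha0)//.
  by rewrite lerD2l lerN2 lef_pV2 ?posrE; lra.
Qed.

End forced_path.

Section limit.
Variables (alpha beta gamma delta p q : R) (x y : R -> R).
Hypotheses (alpha0 : 0 < alpha) (beta0 : 0 <= beta) (gamma0 : 0 <= gamma) (delta0 : 0 < delta)
  (p0 : 0 <= p) (q0 : 0 <= q) (rx : regular_path x) (ry : regular_path y).

Fixpoint iterX (k : nat) : R -> R :=
  if k is k'.+1 then forced_path alpha beta p x (forced_path delta gamma q y (iterX k')) else x.
Definition iterY k := forced_path delta gamma q y (iterX k).
Definition solX (t : R) : R := limn (fun k => iterX k.+1 t).
Definition solY (t : R) : R := limn (fun k => iterY k t).

Lemma iterX_above k : path_above x (iterX k).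
Proof.
elim: k => [|k IH]; first exact: path_above_refl.
exact: (forced_path_above alpha0 beta0 p0 rx ry (forced_path_above delta0 gamma0 q0 ry rx IH)).
Qed.

Lemma iterY_above k : path_above y (iterY k).
Proof. exact: (forced_path_above delta0 gamma0 q0 ry rx (iterX_above k)). Qed.

Let iterX_nondecreasing k t : 0 <= t -> iterX k t <= iterX k.+1 t.
Proof.
elim: k t => [|k IH] t t0; first by have [_] := iterX_above 1; apply.
have YY s : 0 <= s -> iterY k.+1 s <= iterY k s.
  exact: (forced_path_antitone delta0 gamma0 q0 ry rx (iterX_above k) (iterX_above k.+1) IH
    (t := s)).
exact: (forced_path_antitone alpha0 beta0 p0 rx ry (iterY_above k.+1) (iterY_above k) YY t0).
Qed.

Let iterX_le k t : 0 <= t -> iterX k.+1 t <= forced_path alpha beta p x y t.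
Proof.
have [_ yY] := iterY_above k.
exact: (forced_path_antitone alpha0 beta0 p0 rx ry (path_above_refl ry) (iterY_above k) yY).
Qed.

Lemma solX_cvg t : (fun k => iterX k.+1 t) @ \oo --> solX t.
Proof.
have [t0|t0] := ltP t 0.
  apply/cvg_ex; exists (x t + p); rewrite (_ : (fun k => _) = fun=> x t + p); first exact: cvg_cst.
  by apply/funext => k; exact: (forced_path_lt0 beta p alpha0 rx ry (iterY_above k) t0).
apply: nondecreasing_is_cvgn.
  by apply/nondecreasing_seqP => k; exact: iterX_nondecreasing.
by exists (forced_path alpha beta p x y t) => _ [k _ <-]; exact: iterX_le.
Qed.

Lemma solY_cvg t : (fun k => iterY k t) @ \oo --> solY t.
Proof.
have [t0|t0] := ltP t 0.
  apply/cvg_ex; exists (y t + q); rewrite (_ : (fun k => _) = fun=> y t + q); first exact: cvg_cst.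
  by apply/funext => k; exact: (forced_path_lt0 gamma q delta0 ry rx (iterX_above k) t0).
apply: nonincreasing_is_cvgn.
  apply/nonincreasing_seqP => k; apply: (forced_path_antitone delta0 gamma0 q0 ry rx
    (iterX_above k) (iterX_above k.+1) _ t0) => s; exact: iterX_nondecreasing.
by exists (y t) => _ [k _ <-]; have [_] := iterY_above k; apply.
Qed.

Let solX_ge t : 0 <= t -> x t <= solX t.
Proof.
move=> t0; apply: cvgr_to_ge (@solX_cvg t) _.
by apply: nearW => k; have [_] := iterX_above k.+1; apply.
Qed.

Let solY_ge t : 0 <= t -> y t <= solY t.
Proof.
move=> t0; apply: cvgr_to_ge (@solY_cvg t) _.
by apply: nearW => k; have [_] := iterY_above k; apply.
Qed.

Let invX_cvg T := path_above_inv_cvg T rx (fun k => iterX_above k.+1) (fun t _ => @solX_cvg t).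
Let invY_cvg T := path_above_inv_cvg T ry iterY_above (fun t _ => @solY_cvg t).

Lemma solXE t : solX t = x t - alpha * inv_integral x t + p
  + beta * inv_integral solY t + alpha * inv_integral solX t.
Proof.
apply: cvg_unique (@solX_cvg t) _; first exact: Rhausdorff.
have -> : (fun k => iterX k.+1 t) = (fun k => x t - alpha * inv_integral x t + p
    + beta * inv_integral (iterY k) t + alpha * inv_integral (iterX k.+1) t).
  by apply/funext => k; exact: (forced_pathE alpha0 beta0 p0 rx ry (iterY_above k) t).
apply: cvgD; last by apply: cvgMl_tmp; have [] := invX_cvg t.
by apply: cvgD; [exact: cvg_cst|apply: cvgMl_tmp; have [] := invY_cvg t].
Qed.

Lemma solYE t : solY t = y t - delta * inv_integral y t + q
  + gamma * inv_integral solX t + delta * inv_integral solY t.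
Proof.
have solY_cvgS : (fun k => iterY k.+1 t) @ \oo --> solY t.
  by rewrite (cvg_shiftS (iterY ^~ t)); exact: solY_cvg.
apply: cvg_unique solY_cvgS _; first exact: Rhausdorff.
have -> : (fun k => iterY k.+1 t) = (fun k => y t - delta * inv_integral y t + q
    + gamma * inv_integral (iterX k.+1) t + delta * inv_integral (iterY k.+1) t).
  by apply/funext => k; exact: (forced_pathE delta0 gamma0 q0 ry rx (iterX_above k.+1) t).
apply: cvgD; first by apply: cvgD; [exact: cvg_cst|apply: cvgMl_tmp; have [] := invX_cvg t].
apply: cvgMl_tmp; rewrite (cvg_shiftS (fun k => inv_integral (iterY k) t)).
by have [] := invY_cvg t.
Qed.

Let integral_equation_continuous (z Y X : R -> R) (a b c r : R) : regular_path z ->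
  inv_integrable Y -> inv_integrable X ->
  continuous (fun t => z t - a * inv_integral z t + r + b * inv_integral Y t
    + c * inv_integral X t).
Proof.
move=> [cz _ _ iz] iY iX t; have cI Z (iZ : inv_integrable Z) := continuous_itv_integral iZ.
apply: cvgD; last by apply: cvgMl_tmp; exact: cI.
apply: cvgD; last by apply: cvgMl_tmp; exact: cI.
apply: cvgD; last exact: cvg_cst.
by apply: cvgB; [exact: cz|apply: cvgMl_tmp; exact: cI].
Qed.

Let iX T : itv_integrable (fun s => (solX s)^-1) 0 T. Proof. by have [] := invX_cvg T. Qed.
Let iY T : itv_integrable (fun s => (solY s)^-1) 0 T. Proof. by have [] := invY_cvg T. Qed.

Lemma solX_above : path_above x solX.
Proof. by split=> //; rewrite (funext solXE); exact: integral_equation_continuous. Qed.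

Lemma solY_above : path_above y solY.
Proof. by split=> //; rewrite (funext solYE); exact: integral_equation_continuous. Qed.

End limit.
End system.

(** * Adaptedness *)

Section G_measurable_theory.
Context {R : realType} {d : measure_display} {Omega : measurableType d}.
Variable G : set (set Omega).
Hypothesis sG : sigma_algebra setT G.
Implicit Types f g : Omega -> R.

Lemma G_measurableP f : G_measurable G f <-> measurable_fun [set: g_sigma_algebraType G] f.
Proof.
split=> [mf _ U mU|mf U mU].
  by rewrite setTI measurable_g_measurableTypeE//; exact: mf.
by have := mf measurableT U mU; rewrite setTI measurable_g_measurableTypeE.
Qed.

Lemma sigma_algebraI A B : G A -> G B -> G (A `&` B).
Proof.
move=> GA GB.
have mA : measurable (A : set (g_sigma_algebraType G)) by rewrite measurable_g_measurableTypeE.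
have mB : measurable (B : set (g_sigma_algebraType G)) by rewrite measurable_g_measurableTypeE.
by have := measurableI _ _ mA mB; rewrite measurable_g_measurableTypeE.
Qed.

Lemma G_measurable_cst (r : R) : G_measurable G (fun=> r).
Proof. by apply/G_measurableP; exact: measurable_cst. Qed.

Lemma G_measurableD f g : G_measurable G f -> G_measurable G g ->
  G_measurable G (fun w => f w + g w).
Proof.
move=> /G_measurableP mf /G_measurableP mg; apply/G_measurableP.
exact: measurable_funD.
Qed.

Lemma G_measurableB f g : G_measurable G f -> G_measurable G g ->
  G_measurable G (fun w => f w - g w).
Proof.
move=> /G_measurableP mf /G_measurableP mg; apply/G_measurableP.
exact: measurable_funB.
Qed.

Lemma G_measurableM f g : G_measurable G f -> G_measurable G g ->
  G_measurable G (fun w => f w * g w).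
Proof.
move=> /G_measurableP mf /G_measurableP mg; apply/G_measurableP.
exact: measurable_funM.
Qed.

Lemma G_measurable_comp (h : R -> R) f : measurable_fun setT h -> G_measurable G f ->
  G_measurable G (fun w => h (f w)).
Proof. by move=> mh /G_measurableP mf; apply/G_measurableP; exact: measurableT_comp mf. Qed.

Lemma G_measurableZ (k : R) f : G_measurable G f -> G_measurable G (fun w => k * f w).
Proof. by apply: G_measurableM; exact: G_measurable_cst. Qed.

Lemma G_measurable_sum (I : Type) (s : seq I) (h : I -> Omega -> R) :
  (forall i, G_measurable G (h i)) -> G_measurable G (fun w => \sum_(i <- s) h i w).
Proof.
by move=> mh; apply/G_measurableP/measurable_sum => i; exact/G_measurableP.
Qed.

Lemma G_measurable_cvg (f_ : nat -> Omega -> R) f : (forall n, G_measurable G (f_ n)) ->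
  (forall w, f_^~ w @ \oo --> f w) -> G_measurable G f.
Proof.
move=> mf cf; apply/G_measurableP.
apply: (@measurable_fun_cvg _ _ _ _ (f_ : nat -> g_sigma_algebraType G -> R)) => //.
by move=> n; exact/G_measurableP.
Qed.

Lemma G_measurable_indic (A : set Omega) : G A -> G_measurable G (\1_A : Omega -> R).
Proof.
by move=> GA; apply/G_measurableP/measurable_indic; rewrite measurable_g_measurableTypeE.
Qed.

Lemma G_measurable_if (A : set Omega) f g : G A -> G_measurable G f -> G_measurable G g ->
  G_measurable G (fun w => if w \in A then f w else g w).
Proof.
move=> GA /G_measurableP mf /G_measurableP mg; apply/G_measurableP.
have mA : measurable (A : set (g_sigma_algebraType G)) by rewrite measurable_g_measurableTypeE.
apply: measurable_fun_ifT => //; apply: (@measurable_fun_bool _ _ _ _ true) => //.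
rewrite setTI (_ : _ @^-1` _ = A)//.
by apply/seteqP; split => w /=; [move/set_mem|move/mem_set].
Qed.

End G_measurable_theory.

Section adapted_theory.
Context {R : realType} {d : measure_display} {Omega : measurableType d}.

Definition filtration (H : R -> set (set Omega)) : Prop :=
  (forall t, 0 <= t -> sigma_algebra setT (H t)) /\
  (forall s t, 0 <= s -> s <= t -> H s `<=` H t).

Variable H : R -> set (set Omega).
Hypothesis fH : filtration H.
Implicit Types A Z X Y : R -> Omega -> R.

Let sH t : 0 <= t -> sigma_algebra setT (H t). Proof. by case: fH => + _; exact. Qed.

Lemma G_measurable_mono s t (f : Omega -> R) : 0 <= s -> s <= t ->
  G_measurable (H s) f -> G_measurable (H t) f.
Proof. by case: fH => _ ndH s0 st mf U mU; apply: (ndH s t s0 st); exact: mf. Qed.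

Lemma adapted_cst (r : R) : adapted H (fun _ _ => r).
Proof. by move=> t t0; apply: G_measurable_cst; exact: sH. Qed.

Lemma adapted_itv_integral Z : (forall w, continuous (Z^~ w)) -> adapted H Z ->
  adapted H (fun t w => itv_integral (Z^~ w) 0 t).
Proof.
move=> cZ aZ t t0.
apply: (G_measurable_cvg (sH t0) (f_ := fun n w => (t - 0) / n.+1%:R *
    \sum_(i < n.+1) Z (grid 0 t n i) w)); last first.
  by move=> w; apply: riemann_sum_cvg; [exact: cZ|].
move=> n; apply: (G_measurableZ (sH t0)); apply: (G_measurable_sum (sH t0)) => i.
have gi0 := grid_ge t0 n i.
by apply: G_measurable_mono gi0 _ (aZ _ gi0); rewrite grid_le// ltnW.
Qed.

Lemma adapted_ode_solution A (phi : Omega -> R -> R -> R) K L :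
  (forall w, monotone_field K L (phi w)) -> (forall w, continuous (A^~ w)) -> adapted H A ->
  (forall Z, adapted H Z -> adapted H (fun s w => phi w s (Z s w))) ->
  adapted H (fun t w => ode_solution (A^~ w) (phi w) K t).
Proof.
move=> field cA aA aphi.
have cp k w := picard_continuous (@cA w) (field w) (k := k).
have ap k : adapted H (fun t w => picard (A^~ w) (phi w) K k t).
  elim: k => [|k IH] t t0 /=; apply: (G_measurableB (sH t0)) => //; [exact: aA|..].
  - exact: G_measurable_cst (sH t0) _.
  - exact: aA.
  - apply: (@adapted_itv_integral (fun s w => phi w s (picard (A^~ w) (phi w) K k s))) => //.
      by move=> w; have [_ _ _ _] := field w; apply; exact: cp.
    exact: aphi.
move=> t t0; apply: (G_measurable_cvg (sH t0)
   (f_ := fun k w => picard (A^~ w) (phi w) K k.*2 t)) => [k|w]; first exact: ap.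
exact: ode_solution_cvg (@cA w) (field w) t.
Qed.

Lemma adapted_bessel_shift alpha X A : 0 < alpha ->
  (forall w, regular_path (X^~ w)) -> adapted H X ->
  (forall w, continuous (A^~ w)) -> (forall w, 0 <= A 0 w) ->
  (forall w s t, 0 <= s -> s <= t -> A s w <= A t w) -> adapted H A ->
  adapted H (fun t w => bessel_shift alpha (X^~ w) (A^~ w) t).
Proof.
move=> alpha0 rX aX cA A0 And aA t t0.
apply: (G_measurable_cvg (sH t0) (f_ := fun n w =>
    ode_solution (A^~ w) (shift_drift (X^~ w) alpha n) (alpha * n.+1%:R) t)); last first.
  by move=> w; apply: bessel_shift_cvg => //; exact: And.
move=> n; apply: (adapted_ode_solution (phi := fun w => shift_drift (X^~ w) alpha n)
  (L := alpha * n.+1%:R ^+ 2)) => //.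
  by move=> w; apply: shift_drift_field; [exact: ltW|case: (rX w)].
move=> Z aZ s s0; apply: (G_measurableZ (sH s0)).
have mfloor : G_measurable (H s) (fun w => floorr n (X s w)).
  apply: (G_measurable_comp (sH s0) (h := floorr n)) (aX s s0).
  by apply: measurable_maxr => //; exact: measurable_cst.
apply: (G_measurableB (sH s0)).
  exact: (G_measurable_comp (sH s0) (@measurable_invr R) mfloor).
apply: (G_measurable_comp (sH s0) (@measurable_invr R)); apply: (G_measurableD (sH s0)) => //.
apply: (G_measurable_comp (sH s0) (h := fun u => Num.max u 0)) (aZ s s0).
by apply: measurable_maxr => //; exact: measurable_cst.
Qed.

Definition adapted_with_inv Z := adapted H Z /\ adapted H (fun t w => inv_integral (Z^~ w) t).

Lemma adapted_forced_path alpha beta (p : Omega -> R) X Y0 Y :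
  0 < alpha -> 0 <= beta -> (forall w, 0 <= p w) -> G_measurable (H 0) p ->
  (forall w, regular_path (X^~ w)) -> (forall w, regular_path (Y0^~ w)) ->
  (forall w, path_above (Y0^~ w) (Y^~ w)) -> adapted_with_inv X -> adapted_with_inv Y ->
  adapted_with_inv (fun t w => forced_path alpha beta (p w) (X^~ w) (Y^~ w) t).
Proof.
move=> alpha0 beta0 p0 mp rX rY yY [aX aIX] [aY aIY].
have mpt t (t0 : 0 <= t) := G_measurable_mono (lexx 0) t0 mp.
have aForcing : adapted H (fun t w => forcing beta (p w) (Y^~ w) t).
  by move=> t t0; apply: (G_measurableD (sH t0) (mpt t t0));
    exact: (G_measurableZ (sH t0) _ (aIY t t0)).
have aForced : adapted H (fun t w => forced_path alpha beta (p w) (X^~ w) (Y^~ w) t).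
  move=> t t0; apply: (G_measurableD (sH t0)); first exact: aX.
  apply: (@adapted_bessel_shift alpha X (fun t w => forcing beta (p w) (Y^~ w) t)) => // w.
  - exact: forcing_continuous (yY w).
  - exact: forcing_ge0.
  - exact: forcing_nondecreasing (yY w).
split=> // t t0; have sHt := sH t0.
have invE w : inv_integral (fun s => forced_path alpha beta (p w) (X^~ w) (Y^~ w) s) t =
  alpha^-1 * (forced_path alpha beta (p w) (X^~ w) (Y^~ w) t - X t w
    + alpha * inv_integral (X^~ w) t - p w - beta * inv_integral (Y^~ w) t).
  have := forced_pathE alpha0 beta0 (p0 w) (rX w) (rY w) (yY w) t => /= ->.
  by field; rewrite gt_eqF.
rewrite (funext invE); apply: (G_measurableZ sHt); apply: (G_measurableB sHt); last first.
  exact: (G_measurableZ sHt _ (aIY t t0)).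
apply: (G_measurableB sHt) (mpt t t0); apply: (G_measurableD sHt); last first.
  exact: (G_measurableZ sHt _ (aIX t t0)).
by apply: (G_measurableB sHt); [exact: aForced|exact: aX].
Qed.

Lemma adapted_sol alpha beta gamma delta (p q : Omega -> R) X Y :
  0 < alpha -> 0 <= beta -> 0 <= gamma -> 0 < delta ->
  (forall w, 0 <= p w) -> (forall w, 0 <= q w) -> G_measurable (H 0) p -> G_measurable (H 0) q ->
  (forall w, regular_path (X^~ w)) -> (forall w, regular_path (Y^~ w)) ->
  adapted_with_inv X -> adapted_with_inv Y ->
  adapted H (fun t w => solX alpha beta gamma delta (p w) (q w) (X^~ w) (Y^~ w) t) /\
  adapted H (fun t w => solY alpha beta gamma delta (p w) (q w) (X^~ w) (Y^~ w) t).
Proof.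
move=> alpha0 beta0 gamma0 delta0 p0 q0 mp mq rX rY aX aY.
pose iX k t w := iterX alpha beta gamma delta (p w) (q w) (X^~ w) (Y^~ w) k t.
pose iY k t w := iterY alpha beta gamma delta (p w) (q w) (X^~ w) (Y^~ w) k t.
have aboveX k w : path_above (X^~ w) (fun t => iX k t w) by exact: iterX_above.
have aboveY k w : path_above (Y^~ w) (fun t => iY k t w) by exact: iterY_above.
have adaptedY k : adapted_with_inv (iX k) -> adapted_with_inv (iY k).
  by move=> aK; apply: (@adapted_forced_path delta gamma q Y X (iX k)).
have adaptedX k : adapted_with_inv (iX k).
  elim: k => [|k IH]; first exact aX.
  exact (adapted_forced_path alpha0 beta0 p0 mp rX rY (aboveY k) aX (adaptedY k IH)).
split=> t t0.
  apply: (G_measurable_cvg (sH t0) (f_ := fun k w => iX k.+1 t w)) => [k|w].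
    exact: (adaptedX k.+1).1.
  exact: (solX_cvg alpha0 beta0 gamma0 delta0 (p0 w) (q0 w) (rX w) (rY w)).
apply: (G_measurable_cvg (sH t0) (f_ := fun k w => iY k t w)) => [k|w].
  exact: (adaptedY k (adaptedX k)).1.
exact: (solY_cvg alpha0 beta0 gamma0 delta0 (p0 w) (q0 w) (rX w) (rY w)).
Qed.

End adapted_theory.

(** * Pathwise uniqueness *)

Section normr_drift.
Context {R : realType}.
Notation mu := (@lebesgue_measure R).

Definition restoring (z u : R) : Prop := z * u <= 0 /\ (z = 0 -> u = 0).

Lemma restoring_inv_diff (x y : R) : 0 < x -> 0 < y -> restoring (x - y) (x^-1 - y^-1).
Proof.
move=> x0 y0; split; last by move=> /eqP; rewrite subr_eq0 => /eqP ->; rewrite subrr.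
have -> : (x - y) * (x^-1 - y^-1) = - ((x - y) ^+ 2 / (x * y)) by field; rewrite !gt_eqF.
by rewrite oppr_le0 divr_ge0 ?sqr_ge0// ltW// mulr_gt0.
Qed.

(* At least [1] for [|z| <= 2 e], and vanishing as [e -> 0] unless [z = 0]. *)
Definition near_zero_weight (e z : R) : R := 5 * e ^+ 2 / (e ^+ 2 + z ^+ 2).

Section weight.
Variable e : R.
Hypothesis e0 : 0 < e.
Let e2 : 0 < e ^+ 2. Proof. by rewrite exprn_gt0. Qed.
Let den_gt0 (z : R) : 0 < e ^+ 2 + z ^+ 2. Proof. by rewrite ltr_wpDr ?sqr_ge0. Qed.

Lemma near_zero_weight_bounds z : 0 <= near_zero_weight e z <= 5.
Proof.
apply/andP; split; first by rewrite divr_ge0 ?mulr_ge0// ltW.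
by rewrite ler_pdivrMr ?den_gt0//; have := sqr_ge0 z; lra.
Qed.

Lemma near_zero_weight_ge1 z : `|z| <= 2 * e -> 1 <= near_zero_weight e z.
Proof.
move=> ze; rewrite ler_pdivlMr ?den_gt0//.
have : z ^+ 2 <= (2 * e) ^+ 2.
  rewrite -(ger0_norm (sqr_ge0 z)) normrX ler_pXn2r ?nnegrE//.
  by rewrite mulr_ge0// ltW.
by rewrite exprMn; lra.
Qed.

Lemma continuous_near_zero_weight (Z : R -> R) : continuous Z ->
  continuous (fun r => near_zero_weight e (Z r)).
Proof.
move=> cZ r; apply: cvgM; first exact: cvg_cst.
apply: cvgV; first by rewrite gt_eqF.
apply: cvgD; first exact: cvg_cst.
by have := @exprn_continuous R 2 (Z r); apply: continuous_comp; exact: cZ.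
Qed.

End weight.

Lemma near_zero_weight_cvg z : z != 0 ->
  (fun n => near_zero_weight n.+1%:R^-1 z) @ \oo --> (0 : R).
Proof.
move=> z0; have e2_cvg : (fun n : nat => n.+1%:R^-1 ^+ 2 : R) @ \oo --> (0 ^+ 2 : R).
  by rewrite expr2; under eq_fun do rewrite expr2; apply: cvgM; exact: cvg_harmonic.
have -> : 0 = 5 * 0 ^+ 2 / (0 ^+ 2 + z ^+ 2) :> R by rewrite expr0n/= mulr0 !mul0r.
apply: cvgM; first exact: cvgMl_tmp.
apply: cvgV; first by rewrite expr0n/= add0r expf_neq0.
by apply: cvgD => //; exact: cvg_cst.
Qed.

Variables (alpha beta a b : R) (Z u v : R -> R).
Hypotheses (alpha0 : 0 <= alpha) (beta0 : 0 <= beta) (cZ : continuous Z).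
Hypotheses (iu : itv_integrable u a b) (iv : itv_integrable v a b).
Hypothesis ZE : forall t, a <= t <= b ->
  Z t = Z a + alpha * itv_integral u a t + beta * itv_integral v a t.
Hypothesis restore : {ae mu, forall r, a <= r <= b -> restoring (Z r) (u r)}.

Let ZB s t : a <= s -> s <= t -> t <= b ->
  Z t = Z s + alpha * itv_integral u s t + beta * itv_integral v s t.
Proof.
move=> as_ st tb; rewrite (ZE (t := t)) ?(le_trans as_ st)// (ZE (t := s)) ?as_ ?(le_trans st)//.
have sub f : itv_integrable f a b -> itv_integrable f a t by exact: itv_integrableS.
by rewrite (itv_integral_cat as_ st (sub _ iu)) (itv_integral_cat as_ st (sub _ iv)); ring.
Qed.

Let weighted_integrable e : 0 < e ->
  itv_integrable (fun r => near_zero_weight e (Z r) * `|u r|) a b.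
Proof.
move=> e0; apply: (le_itv_integrable (g := fun r => 5 * `|u r|)).
- apply: measurable_funM; apply: itv_integrable_measurable; last exact: itv_integrable_norm.
  exact/continuous_itv_integrable/continuous_near_zero_weight.
- move=> r _; have /andP[w0 w5] := near_zero_weight_bounds e0 (Z r).
  by rewrite normrM normr_id ler_wpM2r// ger0_norm.
- exact/itv_integrableZ/itv_integrable_norm.
Qed.

Let small_drift_le e s t : 0 < e -> `|Z t| < e -> itv_integrable u s t ->
  itv_integrable (fun r => near_zero_weight e (Z r) * `|u r|) s t ->
  (forall r, s <= r <= t -> `|Z t - Z r| < e) ->
  itv_integral (fun r => `|u r|) s t <=
  itv_integral (fun r => near_zero_weight e (Z r) * `|u r|) s t.
Proof.
move=> e0 small /itv_integrable_norm iau iw osc.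
apply: le_itv_integral => // r rs; rewrite ler_peMl//; apply: near_zero_weight_ge1 => //.
have := ler_normD (Z r - Z t) (Z t); rewrite subrK distrC.
by have := osc r rs; move: small; lra.
Qed.

Let normr_drift_step e s t : 0 < e -> a <= s -> s <= t -> t <= b ->
  (forall r, s <= r <= t -> `|Z t - Z r| < e) ->
  `|Z t| <= `|Z s| - alpha * itv_integral (fun r => `|u r|) s t
    + beta * itv_integral (fun r => `|v r|) s t
    + 2 * alpha * itv_integral (fun r => near_zero_weight e (Z r) * `|u r|) s t.
Proof.
move=> e0 as_ st tb osc.
have sub f : itv_integrable f a b -> itv_integrable f s t by exact: itv_integrableS.
have [iu' iv' iw'] := And3 (sub _ iu) (sub _ iv) (sub _ (weighted_integrable e0)).
have iau' := itv_integrable_norm iu'.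
have restore' : {ae mu, forall r, s <= r <= t -> restoring (Z r) (u r)}.
  apply: (ae_imply _ restore) => r res /andP[sr rt].
  by apply: res; rewrite (le_trans as_ sr) (le_trans rt tb).
have W0 : 0 <= alpha * itv_integral (fun r => near_zero_weight e (Z r) * `|u r|) s t.
  rewrite mulr_ge0// itv_integral_ge0// => r _; rewrite mulr_ge0//.
  by have /andP[] := near_zero_weight_bounds e0 (Z r).
have Jv := ler_wpM2l beta0 (le_normr_itv_integral iv').
have bv : `|beta * itv_integral v s t| = beta * `|itv_integral v s t|.
  by rewrite normrM (ger0_norm beta0).
have /ler_normlP[bv1 bv2] : `|beta * itv_integral v s t| <= beta * `|itv_integral v s t|.
  by rewrite bv.
have ZtE := ZB as_ st tb.
have [small|large] := ltP `|Z t| e.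
  have := ler_wpM2l alpha0 (small_drift_le e0 small iu' iw' osc).
  have := ler_wpM2l alpha0 (le_normr_itv_integral iu').
  have := ler_normD (Z s + alpha * itv_integral u s t) (beta * itv_integral v s t).
  have := ler_normD (Z s) (alpha * itv_integral u s t).
  by rewrite -ZtE bv normrM (ger0_norm alpha0); lra.
have [Zp|Zn] := leP 0 (Z t).
  have norm_le : itv_integral (fun r => `|u r|) s t <= itv_integral (fun r => -1 * u r) s t.
    apply: ae_le_itv_integral => //; first exact: itv_integrableZ.
    apply: (ae_imply _ restore') => r res rs; have [Zu _] := res rs.
    have Zr : 0 < Z r by have := osc r rs; rewrite ger0_norm// in large; move=> /ltr_normlP[]; lra.
    by rewrite ler0_norm ?mulN1r//; move: Zu; rewrite pmulr_rle0.
  rewrite itv_integralZ// mulN1r in norm_le.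
  by have := ler_wpM2l alpha0 norm_le; have := ler_norm (Z s); rewrite (ger0_norm Zp); lra.
have norm_le : itv_integral (fun r => `|u r|) s t <= itv_integral u s t.
  apply: ae_le_itv_integral => //.
  apply: (ae_imply _ restore') => r res rs; have [Zu _] := res rs.
  have Zr : Z r < 0 by have := osc r rs; rewrite ltr0_norm// in large; move=> /ltr_normlP[]; lra.
  by rewrite ger0_norm//; move: Zu; rewrite nmulr_rle0.
have := ler_wpM2l alpha0 norm_le.
by have := ler_norm (- Z s); rewrite normrN (ltr0_norm Zn); lra.
Qed.

Let normr_drift_weighted_le e : a <= b -> 0 < e ->
  `|Z b| <= `|Z a| - alpha * itv_integral (fun r => `|u r|) a b
    + beta * itv_integral (fun r => `|v r|) a b
    + 2 * alpha * itv_integral (fun r => near_zero_weight e (Z r) * `|u r|) a b.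
Proof.
move=> ab e0; have iw := weighted_integrable e0.
have [iau iav] := (itv_integrable_norm iu, itv_integrable_norm iv).
pose slack t := - alpha * itv_integral (fun r => `|u r|) a t
  + beta * itv_integral (fun r => `|v r|) a t
  + 2 * alpha * itv_integral (fun r => near_zero_weight e (Z r) * `|u r|) a t - `|Z t|.
have [h h0 osc] := segment_unif_continuous a b cZ e0.
suff : slack a <= slack b by rewrite /slack !itv_integral_point; lra.
apply: (le_of_le_short ab h0) => s t as_ st tb ts.
have sub f : itv_integrable f a b -> itv_integrable f a t by exact: itv_integrableS.
rewrite /slack !(itv_integral_cat as_ st (sub _ _))//.
have := @normr_drift_step e s t e0 as_ st tb; rewrite -/mu => step.
suff /step : forall r, s <= r <= t -> `|Z t - Z r| < e by lra.
move=> r /andP[sr rt]; apply: osc; first by rewrite (le_trans as_ st).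
by rewrite ger0_norm ?subr_ge0//; lra.
Qed.

Lemma normr_drift_le : a <= b ->
  `|Z b| <= `|Z a| - alpha * itv_integral (fun r => `|u r|) a b
    + beta * itv_integral (fun r => `|v r|) a b.
Proof.
move=> ab.
pose W n := itv_integral (fun r => near_zero_weight n.+1%:R^-1 (Z r) * `|u r|) a b.
have n0 n : 0 < n.+1%:R^-1 :> R by rewrite invr_gt0.
have [_ W_cvg] : itv_integrable (fun=> 0 : R) a b /\ W @ \oo --> itv_integral (fun=> 0) a b.
  apply: (@itv_integral_dominated_cvg _ _ _ (fun r => 5 * `|u r|)).
  - by move=> n; apply: itv_integrable_measurable; exact: weighted_integrable.
  - exact: measurable_cst.
  - apply: (ae_imply _ restore) => r res rab; have [_ u0] := res rab.
    have [Z0|Z0] := eqVneq (Z r) 0.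
      by rewrite u0// normr0; under eq_fun do rewrite mulr0; exact: cvg_cst.
    by rewrite -(mul0r `|u r|); apply: cvgMr_tmp; exact: near_zero_weight_cvg.
  - exact/itv_integrableZ/itv_integrable_norm.
  - apply: aeW => r n _; have /andP[w0 w5] := near_zero_weight_bounds (n0 n) (Z r).
    by rewrite normrM normr_id ler_wpM2r// ger0_norm.
rewrite itv_integral_cst// mul0r in W_cvg.
set bound := _ + _; suff : (fun n => bound + 2 * alpha * W n) @ \oo --> bound.
  by move/cvgr_to_ge; apply; apply: nearW => n; exact: normr_drift_weighted_le.
rewrite -[X in _ --> X]addr0 -(mulr0 (2 * alpha)).
by apply: cvgD; [exact: cvg_cst|exact: cvgMl_tmp].
Qed.

End normr_drift.

Section uniqueness.
Context {R : realType}.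
Notation mu := (@lebesgue_measure R).

(* [b] and [c] carry the initial values; [t < 0] is immaterial. *)
Definition path_solution (alpha beta gamma delta : R) (b c X Y : R -> R) : Prop :=
  [/\ continuous X /\ continuous Y, (forall t, 0 <= t -> 0 <= X t /\ 0 <= Y t),
   {ae mu, forall s, 0 <= s -> 0 < X s /\ 0 < Y s},
   inv_integrable X /\ inv_integrable Y &
   forall t, 0 <= t ->
     X t = b t + alpha * inv_integral X t + beta * inv_integral Y t /\
     Y t = c t + gamma * inv_integral X t + delta * inv_integral Y t].

Lemma path_solutionC alpha beta gamma delta b c X Y :
  path_solution alpha beta gamma delta b c X Y -> path_solution delta gamma beta alpha c b Y X.
Proof.
move=> [[cX cY] ge0 pos [iX iY] E]; split => //.
- by move=> t t0; have [] := ge0 t t0.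
- by apply: (ae_imply _ pos) => s h s0; have [] := h s0.
- by move=> t t0; have [XE YE] := E t t0; rewrite {1}XE {1}YE; split; ring.
Qed.

Lemma path_solution_init alpha beta gamma delta b c X Y X' Y' :
  path_solution alpha beta gamma delta b c X Y ->
  path_solution alpha beta gamma delta b c X' Y' -> X 0 = X' 0 /\ Y 0 = Y' 0.
Proof.
move=> [_ _ _ _ E] [_ _ _ _ E'].
have [X0 Y0] := E 0 (lexx 0); have [X0' Y0'] := E' 0 (lexx 0).
by rewrite X0 Y0 X0' Y0' !itv_integral_point.
Qed.

Definition inv_dist (X X' : R -> R) (s t : R) : R :=
  itv_integral (fun r => `|(X r)^-1 - (X' r)^-1|) s t.

Lemma inv_dist_ge0 X X' s t : 0 <= inv_dist X X' s t.
Proof. by apply: itv_integral_ge0 => r _; exact: normr_ge0. Qed.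

Lemma inv_dist_eq0 X X' s t : s <= t -> (forall r, s <= r <= t -> X r = X' r) ->
  inv_dist X X' s t = 0.
Proof.
move=> st XX; rewrite /inv_dist (@eq_itv_integral _ _ (fun=> 0)) ?itv_integral_cst ?mul0r//.
by move=> r /XX ->; rewrite subrr normr0.
Qed.

Lemma dist_fst_le alpha beta gamma delta b c X Y X' Y' a t : 0 <= alpha -> 0 <= beta ->
  path_solution alpha beta gamma delta b c X Y ->
  path_solution alpha beta gamma delta b c X' Y' -> 0 <= a -> a <= t ->
  `|X t - X' t| <= `|X a - X' a| - alpha * inv_dist X X' a t + beta * inv_dist Y Y' a t.
Proof.
move=> alpha0 beta0 [[cX _] _ pos [iX iY] E] [[cX' _] _ pos' [iX' iY'] E'] a0 at_.
apply: (@normr_drift_le _ alpha beta a t (fun r => X r - X' r)) => //.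
- by move=> s; apply: cvgB; [exact: cX|exact: cX'].
- exact: itv_integrableS (itv_integrableB (iX t) (iX' t)).
- exact: itv_integrableS (itv_integrableB (iY t) (iY' t)).
- move=> s /andP[as_ st]; have s0 := le_trans a0 as_.
  have [[XE _] [XE' _]] := (E s s0, E' s s0); have [[XEa _] [XEa' _]] := (E a a0, E' a a0).
  have sub f : itv_integrable f 0 s -> itv_integrable f a s by exact: itv_integrableS.
  rewrite XE XE' XEa XEa' (itv_integralB (sub _ (iX s)) (sub _ (iX' s))).
  rewrite (itv_integralB (sub _ (iY s)) (sub _ (iY' s))).
  by rewrite !(itv_integral_cat a0 as_)//; ring.
- apply: (ae_imply2 _ pos pos') => r h h' /andP[ar _].
  have r0 := le_trans a0 ar.
  by have [[xr _] [xr' _]] := (h r0, h' r0); exact: restoring_inv_diff.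
Qed.

Lemma dist_snd_le alpha beta gamma delta b c X Y X' Y' a t : 0 <= gamma -> 0 <= delta ->
  path_solution alpha beta gamma delta b c X Y ->
  path_solution alpha beta gamma delta b c X' Y' -> 0 <= a -> a <= t ->
  `|Y t - Y' t| <= `|Y a - Y' a| + gamma * inv_dist X X' a t - delta * inv_dist Y Y' a t.
Proof.
move=> gamma0 delta0 S S' a0 at_; rewrite addrAC.
exact: dist_fst_le delta0 gamma0 (path_solutionC S) (path_solutionC S') a0 at_.
Qed.

Lemma path_solution_unique_weak_coupling alpha beta gamma delta b c X Y X' Y' :
  0 < alpha -> 0 <= beta -> 0 <= gamma -> 0 < delta -> beta * gamma <= alpha * delta ->
  path_solution alpha beta gamma delta b c X Y ->
  path_solution alpha beta gamma delta b c X' Y' ->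
  forall t, 0 <= t -> X t = X' t /\ Y t = Y' t.
Proof.
move=> alpha0 beta0 gamma0 delta0 weak S S' t t0.
have := dist_fst_le (ltW alpha0) beta0 S S' (lexx 0) t0.
have := dist_snd_le gamma0 (ltW delta0) S S' (lexx 0) t0.
have [-> ->] := path_solution_init S S'; rewrite !subrr !normr0.
move: (inv_dist_ge0 X X' 0 t) (inv_dist_ge0 Y Y' 0 t) (normr_ge0 (X t - X' t))
  (normr_ge0 (Y t - Y' t)).
move: (inv_dist X X' 0 t) (inv_dist Y Y' 0 t) => U V U0 V0 dX0 dY0 dY_le dX_le.
have combined : (delta + gamma) * `|X t - X' t| + (alpha + beta) * `|Y t - Y' t| <= 0 by nra.
have dX : `|X t - X' t| = 0 by nra.
have dY : `|Y t - Y' t| = 0 by nra.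
by move/normr0P: dX; move/normr0P: dY; rewrite !subr_eq0 => /eqP -> /eqP ->.
Qed.

Lemma continuous_ge_half (X : R -> R) s : continuous X -> 0 < X s ->
  exists2 h, 0 < h & forall r, s <= r <= s + h -> X s / 2 <= X r.
Proof.
move=> cX Xs; have half : X s / 2 < X s by rewrite gtr_pMr// invf_lt1// ltr1n.
have /cvgr_gt /(_ _ half) [h /= h0 hh] := cX s; exists (h / 2); first by rewrite divr_gt0.
by move=> r /andP[sr rh]; apply/ltW/hh; rewrite /= distrC ger0_norm; lra.
Qed.

Lemma normr_invB_le (e x y : R) : 0 < e -> e <= x -> e <= y ->
  `|x^-1 - y^-1| <= `|x - y| / e ^+ 2.
Proof.
move=> e0 ex ey; have [x0 y0] := (lt_le_trans e0 ex, lt_le_trans e0 ey).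
have -> : x^-1 - y^-1 = (x * y)^-1 * (y - x) by field; rewrite !gt_eqF.
rewrite normrM mulrC distrC ler_wpM2l// gtr0_norm ?invr_gt0 ?mulr_gt0//.
by rewrite lef_pV2 ?posrE ?mulr_gt0 ?exprn_gt0// expr2 ler_pM// ltW.
Qed.

(* While [X] stays away from [0], the drift [1 / X] is Lipschitz, and the combination cancelling
   the contributions of [1 / Y] satisfies a Gronwall inequality. *)
Lemma path_solution_dist_gronwall alpha beta gamma delta b c X Y X' Y' s h e :
  0 <= alpha -> 0 <= beta -> 0 <= gamma -> 0 < delta -> 0 < e ->
  path_solution alpha beta gamma delta b c X Y ->
  path_solution alpha beta gamma delta b c X' Y' ->
  0 <= s -> X s = X' s -> Y s = Y' s ->
  (forall r, s <= r <= s + h -> e <= X r /\ e <= X' r) ->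
  forall r, s <= r <= s + h -> delta * `|X r - X' r| + beta * `|Y r - Y' r| = 0.
Proof.
move=> alpha0 beta0 gamma0 delta0 e0 S S' s0 Xs Ys away.
have [[cX cY] _ _ _ _] := S; have [[cX' cY'] _ _ _ _] := S'.
pose Phi r := delta * `|X r - X' r| + beta * `|Y r - Y' r|.
pose K := beta * gamma / e ^+ 2 / delta.
have e2 : 0 < e ^+ 2 by rewrite exprn_gt0.
have K0 : 0 <= K by rewrite /K !divr_ge0 ?mulr_ge0// ltW.
have cPhi : continuous Phi.
  move=> r; apply: cvgD; apply: cvgMl_tmp; apply: cvg_norm; apply: cvgB;
    [exact: cX|exact: cX'|exact: cY|exact: cY'].
apply: (@gronwall_eq0 _ Phi K) => // [t _|t /andP[st th]].
  by rewrite addr_ge0// mulr_ge0// ltW.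
have := ler_wpM2l (ltW delta0) (dist_fst_le alpha0 beta0 S S' s0 st).
have := ler_wpM2l beta0 (dist_snd_le gamma0 (ltW delta0) S S' s0 st).
rewrite Xs Ys !subrr !normr0.
have inv_dist_le : beta * gamma * inv_dist X X' s t <= K * itv_integral Phi s t.
  have i_inv : itv_integrable (fun r => `|(X r)^-1 - (X' r)^-1|) s t.
    have [_ _ _ [iX _] _] := S; have [_ _ _ [iX' _] _] := S'.
    by apply/itv_integrable_norm/(itv_integrableS _ _ (itv_integrableB (iX t) (iX' t))).
  have iPhi := continuous_itv_integrable s t cPhi.
  rewrite -!itv_integralZ//; apply: le_itv_integral; [exact: itv_integrableZ..|].
  move=> r /andP[sr rt]; have [eX eX'] : e <= X r /\ e <= X' r.
    by apply: away; rewrite sr (le_trans rt th).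
  apply: (@le_trans _ _ (beta * gamma * (`|X r - X' r| / e ^+ 2))).
    by rewrite ler_wpM2l ?mulr_ge0// normr_invB_le.
  have -> : beta * gamma * (`|X r - X' r| / e ^+ 2) = K * (delta * `|X r - X' r|).
    by rewrite /K; field; rewrite !gt_eqF.
  by rewrite ler_wpM2l// lerDl mulr_ge0.
have := mulr_ge0 (mulr_ge0 alpha0 (ltW delta0)) (inv_dist_ge0 X X' s t).
by rewrite [Phi t]/Phi; lra.
Qed.

Lemma path_solution_unique_local alpha beta gamma delta b c X Y X' Y' s :
  0 < alpha -> 0 <= beta -> 0 <= gamma -> 0 < delta ->
  path_solution alpha beta gamma delta b c X Y ->
  path_solution alpha beta gamma delta b c X' Y' ->
  0 <= s -> X s = X' s -> Y s = Y' s -> 0 < X s ->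
  exists2 h, 0 < h & forall r, s <= r <= s + h -> X r = X' r /\ Y r = Y' r.
Proof.
move=> alpha0 beta0 gamma0 delta0 S S' s0 Xs Ys Xp.
have [[cX _] _ _ _ _] := S; have [[cX' _] _ _ _ _] := S'.
have [h1 h10 X_ge] := continuous_ge_half cX Xp.
have [|h2 h20 X'_ge] := @continuous_ge_half X' s cX'; first by rewrite -Xs.
pose h := Num.min h1 h2; exists h; first by rewrite lt_min h10.
have away r : s <= r <= s + h -> X s / 2 <= X r /\ X s / 2 <= X' r.
  move=> /andP[sr rh]; rewrite -lerBlDl le_min !lerBlDl in rh; case/andP: rh => rh1 rh2.
  by rewrite X_ge ?sr// [in X in _ /\ X]Xs X'_ge ?sr.
have half0 : 0 < X s / 2 by rewrite divr_gt0.
have Phi0 := path_solution_dist_gronwall (ltW alpha0) beta0 gamma0 delta0 half0 S S' s0 Xs Ys away.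
have XX r : s <= r <= s + h -> X r = X' r.
  move=> rs; have /eqP := Phi0 r rs.
  rewrite paddr_eq0 ?mulr_ge0 ?(ltW delta0)// mulf_eq0 gt_eqF//= => /andP[+ _].
  by rewrite normr_eq0 subr_eq0 => /eqP.
move=> r /andP[sr rh]; split; first by apply: XX; rewrite sr.
have := dist_snd_le gamma0 (ltW delta0) S S' s0 sr; rewrite Ys subrr normr0 inv_dist_eq0//.
  have := mulr_ge0 (ltW delta0) (inv_dist_ge0 Y Y' s r) => dY0 dY.
  have : `|Y r - Y' r| <= 0 by lra.
  by rewrite normr_le0 subr_eq0 => /eqP.
by move=> x /andP[sx xr]; rewrite XX// sx (le_trans xr).
Qed.

Lemma path_solution_unique_off_corner alpha beta gamma delta b c X Y X' Y' :
  0 < alpha -> 0 <= beta -> 0 <= gamma -> 0 < delta ->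
  path_solution alpha beta gamma delta b c X Y ->
  path_solution alpha beta gamma delta b c X' Y' ->
  (forall t, 0 <= t -> ~ (X t = 0 /\ Y t = 0)) ->
  forall t, 0 <= t -> X t = X' t /\ Y t = Y' t.
Proof.
move=> alpha0 beta0 gamma0 delta0 S S' off.
have [[cX cY] ge0 _ _ _] := S; have [[cX' cY'] _ _ _ _] := S'.
have dist0 r : `|X r - X' r| + `|Y r - Y' r| = 0 <-> X r = X' r /\ Y r = Y' r.
  split=> [/eqP|[-> ->]]; last by rewrite !subrr !normr0 addr0.
  by rewrite paddr_eq0// !normr_eq0 !subr_eq0 => /andP[/eqP -> /eqP ->].
suff vanish t : 0 <= t -> `|X t - X' t| + `|Y t - Y' t| = 0.
  by move=> t t0; apply/dist0/vanish.
move: t; apply: eq0_continuation.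
- move=> r; apply: cvgD; apply: cvg_norm; apply: cvgB;
    [exact: cX|exact: cX'|exact: cY|exact: cY'].
- exact/dist0/(path_solution_init S S').
move=> s s0 fs.
have [Xs Ys] : X s = X' s /\ Y s = Y' s by apply/dist0/fs; rewrite s0 lexx.
have [Xs0 Ys0] := ge0 s s0.
have [Xp|Xn] := ltP 0 (X s).
  have [h h0 hh] := path_solution_unique_local alpha0 beta0 gamma0 delta0 S S' s0 Xs Ys Xp.
  by exists h => // r /hh /dist0.
have Yp : 0 < Y s.
  rewrite lt_neqAle Ys0 andbT; apply/eqP => Y00; apply: (off s s0); split => //.
  by apply: le_anti; rewrite Xn.
have [h h0 hh] := path_solution_unique_local delta0 gamma0 beta0 alpha0
  (path_solutionC S) (path_solutionC S') s0 Ys Xs Yp.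
by exists h => // r /hh [? ?]; apply/dist0.
Qed.

End uniqueness.

(** * Moments from characteristic functions *)

Section trigonometry.
Context {R : realType}.

Lemma is_derive_continuous (f df : R -> R) : (forall x : R, is_derive x 1 f (df x)) ->
  continuous f.
Proof.
by move=> fd x; apply: differentiable_continuous; apply/derivable1_diffP; have [] := fd x.
Qed.

Lemma is_derive_lipschitz (f df : R -> R) (K : R) : (forall x : R, is_derive x 1 f (df x)) ->
  (forall x, `|df x| <= K) -> forall a b, `|f b - f a| <= K * `|b - a|.
Proof.
move=> fd dK a b; wlog ab : a b / a <= b.
  by move=> h; have [/h//|/ltW /h] := leP a b; rewrite distrC (distrC b a).
have cf := is_derive_continuous fd.
have [c _ ->] := MVT_segment ab (fun x _ => fd x) (continuous_subspaceT cf).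
by rewrite normrM ler_wpM2r.
Qed.

Lemma normr_sin_le (x : R) : `|sin x| <= `|x|.
Proof.
have := @is_derive_lipschitz sin cos 1 _ (@cos_max R) 0 x.
by rewrite sin0 !subr0 mul1r; apply.
Qed.

Lemma normr_cosB1_le (x : R) : `|cos x - 1| <= `|x|.
Proof.
have bound (y : R) : `|- sin y| <= 1 by rewrite normrN sin_max.
have := is_derive_lipschitz (fun y => is_derive_cos y) bound 0 x.
by rewrite cos0 subr0 mul1r.
Qed.

Lemma normr_sin_subr_le (x : R) : `|sin x - x| <= x ^+ 2.
Proof.
wlog x0 : x / 0 <= x.
  move=> h; have [/h//|/ltW x0] := leP 0 x.
  have := h (- x); rewrite oppr_ge0 => /(_ x0).
  by rewrite sinN -opprD normrN sqrrN.
have fd (y : R) : is_derive y 1 (fun z : R => sin z - z) (cos y - 1) by exact: is_deriveB.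
have [c /[!in_itv]/= /andP[c0 cx]] :=
  MVT_segment x0 (fun y _ => fd y) (continuous_subspaceT (is_derive_continuous fd)).
rewrite sin0 !subr0 => ->; rewrite normrM expr2 (ger0_norm x0) ler_wpM2r//.
by apply: le_trans (normr_cosB1_le c) _; rewrite ger0_norm.
Qed.

Lemma mulr_sin_divr_cvg (x : R) : (fun n : nat => n.+1%:R * sin (x / n.+1%:R)) @ \oo --> x.
Proof.
have h0 : (fun n : nat => x ^+ 2 * n.+1%:R^-1 : R) @ \oo --> (0 : R).
  by rewrite -(mulr0 (x ^+ 2)); apply: cvgMl_tmp; exact: cvg_harmonic.
have dist (n : nat) : `|n.+1%:R * sin (x / n.+1%:R) - x| <= x ^+ 2 * n.+1%:R^-1.
  have : (0 : R) < n.+1%:R by [].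
  move: n.+1%:R => N N0.
  have -> : N * sin (x / N) - x = N * (sin (x / N) - x / N).
    by rewrite mulrBr; congr (_ - _); field; rewrite gt_eqF.
  rewrite normrM gtr0_norm//.
  have -> : x ^+ 2 * N^-1 = N * (x / N) ^+ 2 by field; rewrite gt_eqF.
  by apply: ler_wpM2l; [exact: ltW|exact: normr_sin_subr_le].
apply: (@squeeze_cvgr _ _ _ _ (fun n => x - x ^+ 2 * n.+1%:R^-1)
  (fun n => x + x ^+ 2 * n.+1%:R^-1)).
- by apply: nearW => n; rewrite -ler_distl.
- by rewrite -[X in _ --> X]subr0; apply: cvgB => //; exact: cvg_cst.
- by rewrite -[X in _ --> X]addr0; apply: cvgD => //; exact: cvg_cst.
Qed.

(* The second difference quotient at [0] of [- cos (x l)] in [l], with step [1 / (n + 1)]. *)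
Definition cos_quotient (n : nat) (x : R) : R := 2 * n.+1%:R ^+ 2 * (1 - cos (x / n.+1%:R)).

Lemma cos_quotientE n x : cos_quotient n x = (n.+1%:R * sin (x / 2 / n.+1%:R) * 2) ^+ 2.
Proof.
rewrite /cos_quotient; have : (0 : R) < n.+1%:R by [].
move: n.+1%:R => N N0; have -> : x / N = (x / 2 / N) *+ 2.
  by rewrite -mulr_natr; field; rewrite gt_eqF.
rewrite cos_mulr2n -mulr_natr cos2sin2; ring.
Qed.

Lemma cos_quotient_ge0 n x : 0 <= cos_quotient n x.
Proof. by rewrite cos_quotientE sqr_ge0. Qed.

Lemma cos_quotient_le n x : cos_quotient n x <= x ^+ 2.
Proof.
rewrite cos_quotientE; have : (0 : R) < n.+1%:R by [].
move: n.+1%:R => N n0; rewrite -[leRHS]ger0_norm ?sqr_ge0// -[leLHS]ger0_norm ?sqr_ge0// !normrX.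
rewrite ler_pXn2r ?nnegrE// !normrM (gtr0_norm n0) (@gtr0_norm _ 2)//.
have := normr_sin_le (x / 2 / N).
rewrite !normrM !normfV (gtr0_norm n0) (@gtr0_norm _ 2)// => h.
have -> : `|x| = N * (`|x| / 2 / N) * 2 by field; rewrite gt_eqF.
by rewrite ler_pM2r// ler_pM2l.
Qed.

Lemma cos_quotient_cvg x : cos_quotient^~ x @ \oo --> x ^+ 2.
Proof.
rewrite (_ : cos_quotient^~ x = fun n => (n.+1%:R * sin (x / 2 / n.+1%:R) * 2) *
   (n.+1%:R * sin (x / 2 / n.+1%:R) * 2)); last by apply/funext => n; rewrite cos_quotientE expr2.
have -> : x ^+ 2 = (x / 2 * 2) * (x / 2 * 2) by field.
by apply: cvgM; apply: cvgMr_tmp; exact: mulr_sin_divr_cvg.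
Qed.

Lemma cos_quotient_sqr n x : cos_quotient n x ^+ 2 = 2 * n.+1%:R ^+ 4 *
  (3 + ((-4) * cos (n.+1%:R^-1 * x) + cos ((2 * n.+1%:R^-1) * x))).
Proof.
rewrite /cos_quotient; have : (0 : R) < n.+1%:R by [].
move: n.+1%:R => N N0; have -> : (2 * N^-1) * x = (x / N) *+ 2.
  by rewrite -mulr_natr; field; rewrite gt_eqF.
rewrite cos_mulr2n -mulr_natr (mulrC _ x); ring.
Qed.

Lemma expR_second_difference_le (y : R) : 0 <= y ->
  3 - 4 * expR (- y) + expR (- y) ^+ 4 <= 6 * y ^+ 2.
Proof.
move=> y0; have z0 := expR_ge0 (- y).
have z1 : expR (- y) <= 1 by rewrite -(@expR0 R) ler_expR oppr_le0.
have zy : 1 - expR (- y) <= y by have := expR_ge1Dx (- y); lra.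
move: (expR (- y)) z0 z1 zy => z z0 z1 zy.
have -> : 3 - 4 * z + z ^+ 4 = (1 - z) ^+ 2 * (3 + 2 * z + z ^+ 2) by ring.
rewrite mulrC; apply: ler_pM; rewrite ?sqr_ge0//; [nra|nra|].
by rewrite ler_pXn2r// ?nnegrE//; lra.
Qed.

Lemma expR_quotient_cvg (v : R) : 0 <= v ->
  (fun n => 2 * n.+1%:R ^+ 2 * (1 - expR (- (n.+1%:R^-1 ^+ 2 * v) / 2))) @ \oo --> v.
Proof.
move=> v0; apply: (@squeeze_cvgr _ _ _ _ (fun n => v / (1 + v / 2 * n.+1%:R^-1)) (fun=> v)).
- apply: nearW => n; have : (1 : R) <= n.+1%:R by rewrite ler1n.
  move: n.+1%:R => N N1; have N0 : 0 < N by lra.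
  set y := N^-1 ^+ 2 * v / 2.
  have -> : - (N^-1 ^+ 2 * v) / 2 = - y by rewrite /y; ring.
  have y0 : 0 <= y by rewrite /y divr_ge0// mulr_ge0// sqr_ge0.
  have vE : v = 2 * N ^+ 2 * y by rewrite /y; field; rewrite gt_eqF.
  have c0 : 0 <= 2 * N ^+ 2 by rewrite mulr_ge0// sqr_ge0.
  apply/andP; split; last first.
    by rewrite [leRHS]vE; apply: ler_wpM2l => //; have := expR_ge1Dx (- y); lra.
  rewrite [X in X / _]vE -[leLHS]mulrA; apply: ler_wpM2l => //.
  set k := v / 2 * N^-1.
  have yk : y <= k.
    have -> : k = N * y by rewrite /k vE; field; rewrite gt_eqF.
    by rewrite ler_peMl.
  have ey : expR (- y) <= (1 + y)^-1.
    by rewrite expRN lef_pV2 ?posrE ?expR_gt0 ?expR_ge1Dx//; lra.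
  have k1 : (1 + k)^-1 <= (1 + y)^-1 by rewrite lef_pV2 ?posrE; lra.
  have : y * (1 + k)^-1 <= y * (1 + y)^-1 by apply: ler_wpM2l.
  have : 1 - (1 + y)^-1 = y * (1 + y)^-1 by field; rewrite gt_eqF//; lra.
  by lra.
- rewrite -[X in _ --> X](_ : v / (1 + v / 2 * 0) = v); last by rewrite mulr0 addr0 divr1.
  apply: cvgMl_tmp; apply: cvgV; first by rewrite mulr0 addr0.
  by apply: cvgD; [exact: cvg_cst|apply: cvgMl_tmp; exact: cvg_harmonic].
- exact: cvg_cst.
Qed.

End trigonometry.

Lemma fatou_Rintegral (d : measure_display) (T : measurableType d) (R : realType)
  (mu : {measure set T -> \bar R}) (D : set T) (f_ : nat -> T -> R) (f : T -> R) (c : R) :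
  measurable D -> (forall n, mu.-integrable D (EFin \o f_ n)) ->
  (forall n x, D x -> 0 <= f_ n x) -> (forall x, D x -> f_^~ x @ \oo --> f x) ->
  (forall n, Rintegral mu D (f_ n) <= c) ->
  mu.-integrable D (EFin \o f) /\ Rintegral mu D f <= c.
Proof.
move=> mD fi f0 cf fc.
have mf_ n : measurable_fun D (f_ n) by case/integrableP: (fi n) => /measurable_EFinP.
have mf : measurable_fun D f by exact: (@measurable_fun_cvg _ _ _ _ f_).
have f0' x : D x -> 0 <= f x.
  by move=> Dx; apply: cvgr_to_ge (cf x Dx) _; apply: nearW => n; exact: f0.
have le : (\int[mu]_(x in D) (f x)%:E <= c%:E)%E.
  have := @fatou _ _ _ mu D mD (fun n => EFin \o f_ n) (fun n => (measurable_EFinP _ _).2 (mf_ n))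
    (fun n x Dx => f0 n x Dx).
  rewrite (_ : (\int[mu]_(x in D) limn_einf (fun n => (EFin \o f_ n) x) =
     \int[mu]_(x in D) (f x)%:E)%E); last first.
    apply: eq_integral => x /set_mem Dx.
    have : (fun n => (f_ n x)%:E) @ \oo --> (f x)%:E.
      by apply: cvg_EFin; [exact: nearW|exact: cf].
    by move=> /cvg_limn_einf_sup[-> _].
  move=> /le_trans; apply; rewrite limn_einf_lim.
  apply: lime_le; first exact: is_cvg_einfs.
  apply: nearW => n; apply: (@le_trans _ _ (\int[mu]_(x in D) (f_ n x)%:E)%E).
    by apply: ereal_inf_lbound; exists n => //=.
  by rewrite integral_EFin_Rintegral// lee_fin.
have fi' : mu.-integrable D (EFin \o f).
  apply/integrableP; split; first exact/measurable_EFinP.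
  rewrite (_ : (\int[mu]_(x in D) `|(EFin \o f) x| = \int[mu]_(x in D) (f x)%:E)%E).
    by rewrite (le_lt_trans le)// ltry.
  by apply: eq_integral => x /set_mem Dx /=; rewrite ger0_norm// f0'.
by split => //; rewrite -lee_fin -integral_EFin_Rintegral.
Qed.

Section gaussian_moments.
Context {R : realType} {d : measure_display} {Omega : measurableType d}.
Variable P : probability Omega R.

Definition gaussian_on (A : set Omega) (X : Omega -> R) (v : R) : Prop := forall l : R,
  (\int[P]_(w in A) (cos (l * X w))%:E = P A * (expR (- (l ^+ 2 * v) / 2))%:E)%E /\
  (\int[P]_(w in A) (sin (l * X w))%:E = 0)%E.

Variables (A : set Omega) (X : Omega -> R) (v : R).
Hypotheses (mA : measurable A) (mX : measurable_fun setT X) (v0 : 0 <= v).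
Hypothesis gX : gaussian_on A X v.

Let pA : R := fine (P A).
Let PA : P A = pA%:E. Proof. by rewrite /pA fineK// fin_num_measure. Qed.
Let pA0 : 0 <= pA. Proof. by rewrite -lee_fin -PA. Qed.

Let bounded_integrable (f : R -> R) (c : R) : continuous f -> (forall x, `|f x| <= c) ->
  P.-integrable A (EFin \o (fun w => f (X w))).
Proof.
move=> cf fc; apply: (@bounded_integrable_EFin _ _ _ P _ _ c) => //.
  by rewrite -ge0_fin_numE ?measure_ge0// fin_num_measure.
by apply: measurable_funTS; apply: measurableT_comp => //; exact: continuous_measurable_fun.
Qed.

Let i_cos l : P.-integrable A (EFin \o (fun w => cos (l * X w))).
Proof.
apply: (@bounded_integrable (fun x => cos (l * x)) 1) => x; last exact: cos_max.
apply: continuous_comp; last exact: continuous_cos.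
by apply: cvgMl_tmp; exact: cvg_id.
Qed.

Let i_sin l : P.-integrable A (EFin \o (fun w => sin (l * X w))).
Proof.
apply: (@bounded_integrable (fun x => sin (l * x)) 1) => x; last exact: sin_max.
apply: continuous_comp; last exact: continuous_sin.
by apply: cvgMl_tmp; exact: cvg_id.
Qed.

Let i_cst (k : R) : P.-integrable A (EFin \o (fun=> k)).
Proof. by apply: (@bounded_integrable (fun=> k) `|k|) => // x; exact: cvg_cst. Qed.

Let integral_cos l :
  Rintegral P A (fun w => cos (l * X w)) = expR (- (l ^+ 2 * v) / 2) * pA.
Proof. by rewrite /Rintegral (gX l).1 PA -EFinM/= mulrC. Qed.

Let integral_cst (k : R) : Rintegral P A (fun=> k) = k * pA.
Proof. exact: Rintegral_cst. Qed.

Let i_quotient n : P.-integrable A (EFin \o (fun w => cos_quotient n (X w))).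
Proof.
have i1 := integrableB_EFin mA (i_cst 1) (i_cos n.+1%:R^-1).
have := integrableZ_EFin (2 * n.+1%:R ^+ 2) mA i1.
by apply: eq_integrable => // w _ /=; rewrite /cos_quotient (mulrC (X w)).
Qed.

Let i_inner n : P.-integrable A
  (EFin \o (fun w => (-4) * cos (n.+1%:R^-1 * X w) + cos ((2 * n.+1%:R^-1) * X w))).
Proof.
exact: (integrableD_EFin mA (integrableZ_EFin (-4) mA (i_cos n.+1%:R^-1)) (i_cos _)).
Qed.

Let integral_quotient_sqr n : Rintegral P A (fun w => cos_quotient n (X w) ^+ 2) =
  2 * n.+1%:R ^+ 4 * (3 * pA + ((-4) * (expR (- (n.+1%:R^-1 ^+ 2 * v) / 2) * pA)
    + expR (- ((2 * n.+1%:R^-1) ^+ 2 * v) / 2) * pA)).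
Proof.
under eq_Rintegral do rewrite cos_quotient_sqr.
rewrite RintegralZl//; last exact: (integrableD_EFin mA (i_cst 3) (i_inner n)).
congr (_ * _).
rewrite RintegralD// integral_cst; congr (_ + _); rewrite RintegralD//.
  by rewrite RintegralZl// !integral_cos.
exact: (integrableZ_EFin (-4) mA (i_cos n.+1%:R^-1)).
Qed.

Lemma gaussian_moment4 : P.-integrable A (EFin \o (fun w => X w ^+ 4)) /\
  Rintegral P A (fun w => X w ^+ 4) <= 3 * v ^+ 2 * pA.
Proof.
apply: (@fatou_Rintegral _ _ _ P A (fun n w => cos_quotient n (X w) ^+ 2)) => //.
- move=> n; have := integrableD_EFin mA (i_cst 3) (i_inner n).
  move=> /(integrableZ_EFin (2 * n.+1%:R ^+ 4) mA).
  by apply: eq_integrable => // w _ /=; rewrite cos_quotient_sqr.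
- by move=> n w _; exact: sqr_ge0.
- move=> w _; have -> : X w ^+ 4 = X w ^+ 2 * X w ^+ 2 by ring.
  by under eq_fun do rewrite expr2; apply: cvgM; exact: cos_quotient_cvg.
move=> n; rewrite integral_quotient_sqr.
have : (0 : R) < n.+1%:R by [].
move: n.+1%:R => N n0; set y := N^-1 ^+ 2 * v / 2.
have y0 : 0 <= y by rewrite /y divr_ge0// mulr_ge0// sqr_ge0.
have -> : expR (- (N^-1 ^+ 2 * v) / 2) = expR (- y) by rewrite /y; congr expR; ring.
have -> : expR (- ((2 * N^-1) ^+ 2 * v) / 2) = expR (- y) ^+ 4.
  by rewrite -expRM_natl /y; congr expR; field; rewrite gt_eqF.
have -> : 3 * v ^+ 2 * pA = 2 * N ^+ 4 * (6 * y ^+ 2 * pA).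
  by rewrite /y; field; rewrite gt_eqF.
apply: ler_wpM2l; first by rewrite mulr_ge0// exprn_ge0// ltW.
have := ler_wpM2r pA0 (expR_second_difference_le y0); lra.
Qed.

Lemma gaussian_integrable k : (k <= 4)%N -> P.-integrable A (EFin \o (fun w => `|X w| ^+ k)).
Proof.
move=> k4.
apply: (@le_integrable_EFin _ _ _ P A _ (fun w => 1 + X w ^+ 4)) => //.
- apply: measurable_funTS; apply: measurable_funX; exact: measurableT_comp.
- move=> w _; rewrite ger0_norm ?exprn_ge0//.
  have X4 : `|X w| ^+ 4 = X w ^+ 4 by rewrite -normrX ger0_norm// exprn_even_ge0.
  have X0 := normr_ge0 (X w).
  have [X1|X1] := leP `|X w| 1.
    apply: (@le_trans _ _ 1); first exact: exprn_ile1.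
    by rewrite lerDl -X4 exprn_ge0.
  apply: (@le_trans _ _ (`|X w| ^+ 4)); last by rewrite X4 lerDr.
  by rewrite ler_weXn2l// ltW.
- by apply: integrableD_EFin => //; case: gaussian_moment4.
Qed.

Lemma gaussian_sqr_integrable : P.-integrable A (EFin \o (fun w => X w ^+ 2)).
Proof.
have := gaussian_integrable (k := 2) isT; apply: eq_integrable => // w _ /=.
by rewrite real_normK// num_real.
Qed.

Lemma gaussian_moment2 : Rintegral P A (fun w => X w ^+ 2) = v * pA.
Proof.
have integral_quotient n : Rintegral P A (fun w => cos_quotient n (X w)) =
    2 * n.+1%:R ^+ 2 * (1 - expR (- (n.+1%:R^-1 ^+ 2 * v) / 2)) * pA.
  have -> : Rintegral P A (fun w => cos_quotient n (X w)) =
      Rintegral P A (fun w => 2 * n.+1%:R ^+ 2 * (1 - cos (n.+1%:R^-1 * X w))).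
    by apply: eq_Rintegral => w _; rewrite /cos_quotient (mulrC (X w)).
  rewrite RintegralZl//; last exact: (integrableB_EFin mA (i_cst 1) (i_cos _)).
  by rewrite RintegralB// integral_cst integral_cos; ring.
have [_ lim] : P.-integrable A (EFin \o (fun w => X w ^+ 2)) /\
   (fun n => Rintegral P A (fun w => cos_quotient n (X w))) @ \oo -->
   Rintegral P A (fun w => X w ^+ 2).
  have i2 := gaussian_sqr_integrable.
  apply: (@Rintegral_dominated_cvg _ _ _ P A _ _ (fun w => X w ^+ 2)) => //.
  - by move=> n; case/integrableP: (i_quotient n) => /measurable_EFinP.
  - by case/integrableP: i2 => /measurable_EFinP.
  - by apply: aeW => w _; exact: cos_quotient_cvg.
  - by apply: aeW => w n _; rewrite ger0_norm ?cos_quotient_ge0// cos_quotient_le.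
rewrite (funext integral_quotient) in lim; apply: (cvg_unique _ lim) => //.
by apply: cvgMr_tmp; exact: expR_quotient_cvg.
Qed.

Lemma gaussian_mean0 : P.-integrable A (EFin \o X) /\ Rintegral P A X = 0.
Proof.
have iN : P.-integrable A (EFin \o (fun w => `|X w|)).
  by have := gaussian_integrable (k := 1) isT; apply: eq_integrable => // w _ /=; rewrite expr1.
have mXA : measurable_fun A X by exact: measurable_funTS.
have iX : P.-integrable A (EFin \o X) by exact: (le_integrable_EFin mA mXA _ iN).
split => //.
have [_ lim] : P.-integrable A (EFin \o X) /\
   (fun n : nat => Rintegral P A (fun w => n.+1%:R * sin (n.+1%:R^-1 * X w))) @ \oo -->
   Rintegral P A X.
  apply: (@Rintegral_dominated_cvg _ _ _ P A _ _ (fun w => `|X w|)) => //.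
  - move=> n; have := integrableZ_EFin n.+1%:R mA (i_sin n.+1%:R^-1).
    by case/integrableP => /measurable_EFinP.
  - apply: aeW => w _; under eq_fun do rewrite mulrC (mulrC _ (X w)) mulrC.
    exact: mulr_sin_divr_cvg.
  - apply: aeW => w n _; have n0 : (0 : R) < n.+1%:R by [].
    rewrite normrM gtr0_norm//; have := normr_sin_le (n.+1%:R^-1 * X w).
    rewrite normrM normfV (gtr0_norm n0) => /(ler_wpM2l (ltW n0)).
    by rewrite mulrA mulfV ?mul1r// gt_eqF.
have integral0 n : Rintegral P A (fun w => n.+1%:R * sin (n.+1%:R^-1 * X w)) = 0.
  by rewrite RintegralZl// /Rintegral (gX _).2 mulr0.
rewrite (funext integral0) in lim; apply: (cvg_unique _ lim) => //.
exact: cvg_cst.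
Qed.

End gaussian_moments.

Section staircase.
Context {R : realType} {T : Type}.
Implicit Types (phi : T -> R) (n k : nat) (w : T).

Definition level phi n k : set T := [set w | k%:R <= n.+1%:R * phi w < k.+1%:R].

Definition staircase phi (c : R) n w : R :=
  \sum_(k < (Num.truncn (n.+1%:R * c)).+1) (k%:R / n.+1%:R) * \1_(level phi n k) w.

Lemma staircase_dist phi (c : R) n w : 0 <= phi w <= c ->
  `|phi w - staircase phi c n w| <= n.+1%:R^-1.
Proof.
move=> /andP[phi0 phic]; have n0 : (0 : R) < n.+1%:R by [].
pose k0 := Num.truncn (n.+1%:R * phi w).
have /andP[k1 k2] : k0%:R <= n.+1%:R * phi w < k0.+1%:R by rewrite truncn_itv// mulr_ge0.
have k0K : (k0 < (Num.truncn (n.+1%:R * c)).+1)%N by rewrite ltnS le_truncn// ler_pM2l.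
have -> : staircase phi c n w = k0%:R / n.+1%:R.
  rewrite /staircase (bigD1 (Ordinal k0K))//= big1 ?addr0 => [|i ik].
    by rewrite indicE mem_set ?mulr1// /level/= k1 k2.
  rewrite indicE memNset ?mulr0// /level/= => /andP[i1 i2].
  move/eqP: ik; apply; apply: val_inj => /=.
  apply/eqP; rewrite eqn_leq; apply/andP; split.
    by rewrite -ltnS -(ltr_nat R) (le_lt_trans i1).
  by rewrite -ltnS -(ltr_nat R) (le_lt_trans k1).
have -> : phi w - k0%:R / n.+1%:R = n.+1%:R^-1 * (n.+1%:R * phi w - k0%:R).
  by field; rewrite gt_eqF.
rewrite ger0_norm; last by rewrite mulr_ge0 ?invr_ge0 ?subr_ge0// ltW.
rewrite -[leRHS]mulr1; apply: ler_wpM2l; first by rewrite invr_ge0 ltW.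
by rewrite -natr1 in k2; lra.
Qed.

End staircase.

Section conditional.
Context {R : realType} {d : measure_display} {Omega : measurableType d}.
Variable P : probability Omega R.
Implicit Types (Z phi : Omega -> R).

Notation E f := (Rintegral P setT f).

Lemma Rintegral_indic (A : set Omega) Z : Rintegral P A Z = E (fun w => \1_A w * Z w).
Proof.
rewrite Rintegral_mkcond; apply: eq_Rintegral => w _.
by rewrite patchE indicE; case: ifPn => _; rewrite ?mul1r ?mul0r.
Qed.

Lemma integrable_boundedM Z phi (c : R) : P.-integrable setT (EFin \o Z) ->
  measurable_fun setT phi -> (forall w, `|phi w| <= c) ->
  P.-integrable setT (EFin \o (fun w => phi w * Z w)).
Proof.
move=> iZ mphi phic; have := integrableMr measurableT mphi _ iZ; apply.
exists c; split; first exact: num_real.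
by move=> M cM w _; exact: le_trans (phic w) (ltW cM).
Qed.

Variables (G : set (set Omega)) (Z : Omega -> R).
Hypotheses (sG : sigma_algebra setT G) (Gm : G `<=` measurable).
Hypotheses (iZ : P.-integrable setT (EFin \o Z)) (Z0 : forall A, G A -> Rintegral P A Z = 0).

Let G_level phi n k : G_measurable G phi -> G (level phi n k).
Proof.
move=> gphi; have -> : level phi n k = (fun w => n.+1%:R * phi w) @^-1` `[k%:R, k.+1%:R[.
  by apply/seteqP; split => w; rewrite /level/= in_itv.
exact: (G_measurableZ sG).
Qed.

Let staircaseM_eq0 phi (c : R) n : G_measurable G phi ->
  P.-integrable setT (EFin \o (fun w => staircase phi c n w * Z w)) /\
  E (fun w => staircase phi c n w * Z w) = 0.
Proof.
move=> gphi; set K := (Num.truncn (n.+1%:R * c)).+1.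
pose term k w := k%:R / n.+1%:R * (\1_(level phi n k) w * Z w).
have i1 k : P.-integrable setT (EFin \o (fun w => \1_(level phi n k) w * Z w)).
  apply: (@integrable_boundedM Z _ 1) => // [|w].
    by apply: measurable_indic; exact/Gm/G_level.
  by rewrite indicE; case: (_ \in _); rewrite ?normr1 ?normr0.
have iterm k : P.-integrable setT (EFin \o term k) by exact: integrableZ_EFin.
have stairE w : staircase phi c n w * Z w = \sum_(k < K) term k w.
  by rewrite mulr_suml; apply: eq_bigr => k _; rewrite /term mulrA.
split.
  have := integrable_sum_EFin (index_enum 'I_K) measurableT (fun k => iterm k).
  by apply: eq_integrable => // w _ /=; rewrite stairE.
under eq_Rintegral do rewrite stairE.
rewrite Rintegral_sum// big1// => k _.
by rewrite RintegralZl// -Rintegral_indic Z0 ?mulr0//; exact: G_level.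
Qed.

Let nonneg_boundedM_eq0 phi (c : R) : G_measurable G phi -> (forall w, 0 <= phi w <= c) ->
  E (fun w => phi w * Z w) = 0.
Proof.
move=> gphi phi0c.
have mphi : measurable_fun setT phi by move=> _ U mU; rewrite setTI; exact/Gm/gphi.
have iphi : P.-integrable setT (EFin \o (fun w => phi w * Z w)).
  apply: (integrable_boundedM iZ mphi (c := c)) => w.
  by case/andP: (phi0c w) => p0 pc; rewrite ger0_norm.
have bound n : `|E (fun w => phi w * Z w)| <= E (fun w => `|Z w|) * n.+1%:R^-1.
  have [istair stair0] := staircaseM_eq0 c n gphi.
  rewrite -[E _]subr0 -stair0 -RintegralB//; have idiff := integrableB_EFin measurableT iphi istair.
  apply: le_trans (le_normr_Rintegral _ idiff) _ => //.
  have iN := integrable_norm iZ; rewrite mulrC -RintegralZl//.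
  apply: le_Rintegral => //; [exact: integrable_norm|exact: integrableZ_EFin|move=> w _].
  by rewrite -mulrBl normrM ler_wpM2r// staircase_dist.
apply/eqP; rewrite -normr_le0 -(mulr0 (E (fun w => `|Z w|))).
have lim : (fun n : nat => E (fun w => `|Z w|) * n.+1%:R^-1) @ \oo --> E (fun w => `|Z w|) * 0.
  by apply: cvgMl_tmp; exact: cvg_harmonic.
by apply: cvgr_to_ge lim _; exact: nearW.
Qed.

Lemma Rintegral_boundedM_eq0 phi (c : R) : G_measurable G phi -> (forall w, `|phi w| <= c) ->
  E (fun w => phi w * Z w) = 0.
Proof.
move=> gphi phic.
have bounds w : 0 <= phi w + c <= c + c.
  by have /ler_normlP[p1 p2] := phic w; apply/andP; split; lra.
have gshift : G_measurable G (fun w => phi w + c).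
  by apply: (G_measurableD sG) => //; exact: (G_measurable_cst sG).
have mphi : measurable_fun setT phi by move=> _ U mU; rewrite setTI; exact/Gm/gphi.
have iphi := integrable_boundedM iZ mphi phic.
have EZ : E Z = 0.
  by apply: Z0; have [G0 GC _] := sG; rewrite -(setD0 setT); exact: GC.
have := nonneg_boundedM_eq0 gshift bounds; under eq_Rintegral do rewrite mulrDl.
rewrite RintegralD//; last exact: integrableZ_EFin.
by rewrite RintegralZl// EZ mulr0 addr0.
Qed.

End conditional.

(** * A one-sided Ito formula *)

Record jet2 (R : Type) := Jet2 {
  jet_val :> R -> R -> R;
  jet_x : R -> R -> R; jet_y : R -> R -> R;
  jet_xx : R -> R -> R; jet_xy : R -> R -> R; jet_yy : R -> R -> R }.

Section test_functions.
Context {R : realType}.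
Implicit Types (f : R -> R -> R) (V : jet2 R) (K x y a b : R).

Definition bounded2 K f := forall x y, `|f x y| <= K.
Definition lipschitz2 K f :=
  forall x y x' y', `|f x y - f x' y'| <= K * (`|x - x'| + `|y - y'|).
Definition measurable2 f := measurable_fun [set: R * R] (fun p => f p.1 p.2).
Definition bounded_lipschitz_by K f := [/\ bounded2 K f, lipschitz2 K f & measurable2 f].

Definition jet_linear V x y a b : R := jet_x V x y * a + jet_y V x y * b.
Definition jet_quadratic V x y a b : R :=
  jet_xx V x y * a ^+ 2 + 2 * jet_xy V x y * a * b + jet_yy V x y * b ^+ 2.
Definition diffusion (s11 s12 s22 : R) V x y : R :=
  s11 * jet_xx V x y + 2 * s12 * jet_xy V x y + s22 * jet_yy V x y.

(* The components of the jet need not be the derivatives of [V]: only this one-sided Taylor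
   bound enters the Ito estimates. *)
Definition test_jet K V :=
  [/\ lipschitz2 K V /\ measurable2 V,
      bounded_lipschitz_by K (jet_x V) /\ bounded_lipschitz_by K (jet_y V),
      [/\ bounded_lipschitz_by K (jet_xx V), bounded_lipschitz_by K (jet_xy V) &
          bounded_lipschitz_by K (jet_yy V)] &
      forall x y a b, V (x + a) (y + b) <=
        V x y + jet_linear V x y a b + jet_quadratic V x y a b / 2 + K * (`|a| ^+ 3 + `|b| ^+ 3)].

Definition cov_norm (s11 s12 s22 : R) : R := `|s11| + 2 * `|s12| + `|s22|.

Lemma cov_norm_ge0 s11 s12 s22 : 0 <= cov_norm s11 s12 s22.
Proof. by rewrite !addr_ge0// mulr_ge0. Qed.

Lemma cov_form_le s11 s12 s22 (k p q r : R) : `|p| <= k -> `|q| <= k -> `|r| <= k ->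
  `|s11 * p + 2 * s12 * q + s22 * r| <= cov_norm s11 s12 s22 * k.
Proof.
move=> pk qk rk; rewrite /cov_norm [leRHS]mulrDl [X in _ <= X + _]mulrDl.
apply: le_trans (ler_normD _ _) _; apply: lerD; last by rewrite normrM ler_wpM2l.
apply: le_trans (ler_normD _ _) _; apply: lerD; first by rewrite normrM ler_wpM2l.
by rewrite normrM normrM (@ger0_norm _ 2)// ler_wpM2l// mulr_ge0.
Qed.

Lemma G_measurable_comp2 (d : measure_display) (Omega : measurableType d) (G : set (set Omega)) f
    (X Y : Omega -> R) : sigma_algebra setT G -> measurable2 f ->
  G_measurable G X -> G_measurable G Y -> G_measurable G (fun w => f (X w) (Y w)).
Proof.
move=> sG mf /(G_measurableP sG) mX /(G_measurableP sG) mY; apply/(G_measurableP sG).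
by have := measurableT_comp mf (measurable_fun_pair mX mY).
Qed.

Section fixed_jet.
Variables (K : R) (V : jet2 R).
Hypothesis tV : test_jet K V.

Lemma test_jet_ge0 : 0 <= K.
Proof. by have [_ [[b _ _] _] _ _] := tV; exact: le_trans (b 0 0). Qed.

Lemma diffusion_bounded s11 s12 s22 :
  bounded2 (cov_norm s11 s12 s22 * K) (diffusion s11 s12 s22 V).
Proof. by have [_ _ [[b1 _ _] [b2 _ _] [b3 _ _]] _] := tV => x y; exact: cov_form_le. Qed.

Lemma diffusion_lipschitz s11 s12 s22 :
  lipschitz2 (cov_norm s11 s12 s22 * K) (diffusion s11 s12 s22 V).
Proof.
have [_ _ [[_ l1 _] [_ l2 _] [_ l3 _]] _] := tV => x y x' y'.
rewrite -mulrA (_ : diffusion _ _ _ V x y - diffusion _ _ _ V x' y' =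
  s11 * (jet_xx V x y - jet_xx V x' y') + (2 * s12) * (jet_xy V x y - jet_xy V x' y') +
  s22 * (jet_yy V x y - jet_yy V x' y')); last by rewrite /diffusion; ring.
exact: cov_form_le.
Qed.

Lemma measurable_diffusion s11 s12 s22 : measurable2 (diffusion s11 s12 s22 V).
Proof.
have [_ _ [[_ _ m1] [_ _ m2] [_ _ m3]] _] := tV.
by apply: measurable_funD; [apply: measurable_funD|]; apply: measurable_funM.
Qed.

Lemma test_jet_taylor_le x y a b (e : R) : e <= 1 -> 0 <= a <= 2 * e -> 0 <= b <= 2 * e ->
  V (x + a) (y + b) - V x y <= jet_linear V x y a b + 7 * K * e * (a + b).
Proof.
move=> e1 /andP[a0 ae] /andP[b0 be]; have K0 := test_jet_ge0.
have [_ _ [[bxx _ _] [bxy _ _] [byy _ _]] taylor] := tV.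
have e0 : 0 <= e by lra.
have quad : jet_quadratic V x y a b <= 2 * K * e * (a + 3 * b).
  apply: le_trans (ler_norm _) _.
  rewrite (_ : jet_quadratic V x y a b =
    a ^+ 2 * jet_xx V x y + 2 * (a * b) * jet_xy V x y + b ^+ 2 * jet_yy V x y); last first.
    by rewrite /jet_quadratic; ring.
  apply: le_trans (cov_form_le _ _ _ (bxx _ _) (bxy _ _) (byy _ _)) _.
  rewrite /cov_norm !ger0_norm ?sqr_ge0 ?mulr_ge0//.
  have sqr_a : a ^+ 2 <= 2 * e * a by rewrite expr2 ler_wpM2r.
  have cross : a * b <= 2 * e * b by rewrite ler_wpM2r.
  have sqr_b : b ^+ 2 <= 2 * e * b by rewrite expr2 ler_wpM2r.
  have -> : 2 * K * e * (a + 3 * b) = (2 * e * a + 2 * (2 * e * b) + 2 * e * b) * K by ring.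
  by rewrite ler_wpM2r//; lra.
have cube (c : R) : 0 <= c -> c <= 2 * e -> c ^+ 3 <= 4 * e * c.
  move=> c0 ce; rewrite exprS mulrC ler_wpM2r// expr2.
  by apply: (@le_trans _ _ (2 * e * (2 * e))); [exact: ler_pM|nra].
have cubes : K * (a ^+ 3 + b ^+ 3) <= K * (4 * e * a + 4 * e * b).
  by rewrite ler_wpM2l// lerD// cube.
have := taylor x y a b; rewrite !ger0_norm//.
have Ke0 := mulr_ge0 K0 e0; have := mulr_ge0 Ke0 a0; have := mulr_ge0 Ke0 b0; lra.
Qed.

End fixed_jet.
End test_functions.

Section increasing_drift.
Context {R : realType}.
Implicit Types (u m dr : R -> R) (a b : R).

Definition increasing_drift u m dr a b : Prop :=
  [/\ itv_integrable dr a b, (forall r, a <= r <= b -> 0 <= dr r) &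
      forall r, a <= r <= b -> u r = u a + (m r - m a) + itv_integral dr a r].

Lemma increasing_driftS u m dr a b a' b' : a <= a' -> a' <= b' -> b' <= b ->
  increasing_drift u m dr a b -> increasing_drift u m dr a' b'.
Proof.
move=> aa' ab' bb' [dri dr0 uE]; split; first exact: itv_integrableS dri.
  by move=> r /andP[ar rb]; apply: dr0; rewrite (le_trans aa' ar) (le_trans rb bb').
move=> r /andP[ar rb].
have arb : a <= r <= b by rewrite (le_trans aa' ar) (le_trans rb bb').
have aab : a <= a' <= b by rewrite aa' (le_trans ab' bb').
rewrite (uE r)// (uE a')// (itv_integral_cat aa' ar); first by ring.
by apply: itv_integrableS dri => //; exact: le_trans rb bb'.
Qed.

Lemma increasing_drift_integral u m dr a b : a <= b -> increasing_drift u m dr a b ->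
  itv_integral dr a b = u b - u a - (m b - m a).
Proof. by move=> ab [_ _ uE]; rewrite (uE b) ?ab ?lexx//; ring. Qed.

Lemma increasing_drift_integral_ge0 u m dr a b : increasing_drift u m dr a b ->
  0 <= itv_integral dr a b.
Proof. by move=> [_ dr0 _]; exact: itv_integral_ge0. Qed.

End increasing_drift.

Section ito_path.
Context {R : realType}.
Notation mu := (@lebesgue_measure R).
Variables (K : R) (V : jet2 R) (s11 s12 s22 : R) (u1 u2 m1 m2 dx dy th : R -> R).
Hypothesis tV : test_jet K V.
Local Notation lap := (diffusion s11 s12 s22 V).
Local Notation sg := (cov_norm s11 s12 s22).

(* Along [u = m + drift], the increment of [V] is that of the martingale part started at [u a]
   plus this correction. *)
Definition ito_correction a b : R :=
  V (u1 b) (u2 b) - V (u1 a + (m1 b - m1 a)) (u2 a + (m2 b - m2 a))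
    + (b - a) * lap (u1 a) (u2 a) / 2.

Definition generator_le r : Prop :=
  jet_linear V (u1 r) (u2 r) (dx r) (dy r) + lap (u1 r) (u2 r) / 2 <= th r.

Section one_interval.
Variables (a b : R).
Hypotheses (ab : a <= b).
Hypotheses (Dx : increasing_drift u1 m1 dx a b) (Dy : increasing_drift u2 m2 dy a b).
Local Notation Ix := (itv_integral dx a b).
Local Notation Iy := (itv_integral dy a b).

Let Ix0 : 0 <= Ix. Proof. exact: increasing_drift_integral_ge0 Dx. Qed.
Let Iy0 : 0 <= Iy. Proof. exact: increasing_drift_integral_ge0 Dy. Qed.
Let ba0 : 0 <= b - a. Proof. by rewrite subr_ge0. Qed.

Lemma normr_ito_correction_le : `|ito_correction a b| <= K * (Ix + Iy) + sg * K * (b - a).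
Proof.
have [[LV _] _ _ _] := tV.
apply: le_trans (ler_normD _ _) _; apply: lerD.
  apply: le_trans (LV _ _ _ _) _.
  rewrite -[in leRHS](ger0_norm Ix0) -[in leRHS](ger0_norm Iy0).
  by rewrite (increasing_drift_integral ab Dx) (increasing_drift_integral ab Dy) !opprD !addrA.
have bound := diffusion_bounded tV s11 s12 s22 (u1 a) (u2 a).
rewrite normrM (@ger0_norm _ 2^-1)// normrM (ger0_norm ba0).
apply: (@le_trans _ _ ((b - a) * `|lap (u1 a) (u2 a)|)); last by rewrite mulrC ler_wpM2r.
by rewrite ler_piMr//; [exact: mulr_ge0|lra].
Qed.

Variable e : R.
Hypotheses (e1 : e <= 1) (ith : itv_integrable th a b).
Hypothesis osc1 : forall r, a <= r <= b -> `|u1 r - u1 a| <= e.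
Hypothesis osc2 : forall r, a <= r <= b -> `|u2 r - u2 a| <= e.
Hypotheses (step1 : `|m1 b - m1 a| <= e) (step2 : `|m2 b - m2 a| <= e).
Hypothesis gen : {ae mu, forall r, a <= r <= b -> generator_le r}.

Let q1 : R := u1 a + (m1 b - m1 a).
Let q2 : R := u2 a + (m2 b - m2 a).

Let drift_le u m dr : increasing_drift u m dr a b ->
  (forall r, a <= r <= b -> `|u r - u a| <= e) -> `|m b - m a| <= e ->
  itv_integral dr a b <= 2 * e.
Proof.
move=> D /(_ b) osc step; rewrite (increasing_drift_integral ab D).
have := osc; rewrite ab lexx => /(_ isT) /ler_normlP[_ ub].
by move: step => /ler_normlP[mb _]; lra.
Qed.

Let frozen_generator_le r : a <= r <= b -> generator_le r ->
  jet_linear V q1 q2 (dx r) (dy r) <=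
    th r + 4 * K * e * (dx r + dy r) + (sg * K * e - lap (u1 a) (u2 a) / 2).
Proof.
move=> rab; rewrite /generator_le /jet_linear => genr; have K0 := test_jet_ge0 tV.
have [_ [[_ lx _] [_ ly _]] _ _] := tV.
have [_ /(_ r rab) dx0 _] := Dx; have [_ /(_ r rab) dy0 _] := Dy.
have dist1 : `|q1 - u1 r| <= 2 * e.
  have -> : q1 - u1 r = (m1 b - m1 a) - (u1 r - u1 a) by rewrite /q1; ring.
  by apply: le_trans (ler_normB _ _) _; move: (osc1 rab) step1; lra.
have dist2 : `|q2 - u2 r| <= 2 * e.
  have -> : q2 - u2 r = (m2 b - m2 a) - (u2 r - u2 a) by rewrite /q2; ring.
  by apply: le_trans (ler_normB _ _) _; move: (osc2 rab) step2; lra.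
have Kdist : K * (`|q1 - u1 r| + `|q2 - u2 r|) <= 4 * K * e.
  by apply: (@le_trans _ _ (K * (4 * e))); [rewrite ler_wpM2l//; lra|lra].
have := le_trans (lx q1 q2 (u1 r) (u2 r)) Kdist => /ler_normlP[_ /(ler_wpM2r dx0) freeze_x].
have := le_trans (ly q1 q2 (u1 r) (u2 r)) Kdist => /ler_normlP[_ /(ler_wpM2r dy0) freeze_y].
have freeze_diffusion : lap (u1 a) (u2 a) - lap (u1 r) (u2 r) <= sg * K * (2 * e).
  apply: le_trans (ler_norm _) _; rewrite distrC.
  apply: le_trans (diffusion_lipschitz tV _ _ _ _ _ _ _) _.
  by rewrite ler_wpM2l ?mulr_ge0 ?cov_norm_ge0//; have := osc1 rab; have := osc2 rab; lra.
by lra.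
Qed.

Let drift_integral_le : jet_linear V q1 q2 Ix Iy <=
  itv_integral th a b - (b - a) * lap (u1 a) (u2 a) / 2 + sg * K * e * (b - a)
    + 4 * K * e * (Ix + Iy).
Proof.
have [idx _ _] := Dx; have [idy _ _] := Dy.
have -> : jet_linear V q1 q2 Ix Iy = itv_integral (fun r => jet_linear V q1 q2 (dx r) (dy r)) a b.
  by rewrite itv_integralD ?itv_integralZ//; exact: itv_integrableZ.
pose k := sg * K * e - lap (u1 a) (u2 a) / 2.
have idxy := itv_integrableD idx idy; have iK := itv_integrableZ (4 * K * e) idxy.
have -> : itv_integral th a b - (b - a) * lap (u1 a) (u2 a) / 2 + sg * K * e * (b - a)
    + 4 * K * e * (Ix + Iy) = itv_integral (fun r => th r + 4 * K * e * (dx r + dy r) + k) a b.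
  rewrite (itv_integralD (itv_integrableD ith iK) (itv_integrable_cst k a b)).
  by rewrite (itv_integralD ith iK) itv_integralZ// itv_integralD// itv_integral_cst// /k; ring.
apply: ae_le_itv_integral.
- by apply: itv_integrableD; exact: itv_integrableZ.
- by apply: itv_integrableD; [exact: itv_integrableD|exact: itv_integrable_cst].
- by apply: (ae_imply _ gen) => r genr rab; exact/frozen_generator_le/genr.
Qed.

Lemma ito_correction_le : ito_correction a b <=
  itv_integral th a b + 11 * K * e * (Ix + Iy) + sg * K * e * (b - a).
Proof.
have Ixe : 0 <= Ix <= 2 * e by rewrite Ix0 (drift_le Dx osc1 step1).
have Iye : 0 <= Iy <= 2 * e by rewrite Iy0 (drift_le Dy osc2 step2).
have := test_jet_taylor_le tV q1 q2 e1 Ixe Iye.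
have -> : q1 + Ix = u1 b by rewrite (increasing_drift_integral ab Dx) /q1; ring.
have -> : q2 + Iy = u2 b by rewrite (increasing_drift_integral ab Dy) /q2; ring.
by have := drift_integral_le; rewrite /ito_correction -/q1 -/q2; lra.
Qed.

End one_interval.

Section partition.
Variables (s t : R).
Hypotheses (st : s <= t).
Hypotheses (Dx : increasing_drift u1 m1 dx s t) (Dy : increasing_drift u2 m2 dy s t).
Local Notation g := (grid s t).
Local Notation Ix := (itv_integral dx).
Local Notation Iy := (itv_integral dy).

Definition ito_sum n : R := \sum_(i < n.+1) ito_correction (g n i) (g n i.+1).

Let drift_grid u m dr n (i : 'I_n.+1) : increasing_drift u m dr s t ->
  increasing_drift u m dr (g n i) (g n i.+1).
Proof. by apply: increasing_driftS; rewrite ?grid_ge ?grid_leS ?grid_le. Qed.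

Let grid_sum f n : itv_integrable f s t ->
  \sum_(i < n.+1) itv_integral f (g n i) (g n i.+1) = itv_integral f s t.
Proof. by move=> fi; rewrite itv_integral_grid_sum// grid_last. Qed.

Let idx : itv_integrable dx s t. Proof. by case: Dx. Qed.
Let idy : itv_integrable dy s t. Proof. by case: Dy. Qed.

Let gridB n i : g n i.+1 - g n i = (t - s) / n.+1%:R.
Proof. by rewrite gridS addrC addKr. Qed.

Lemma normr_ito_sum_le n : `|ito_sum n| <= K * (Ix s t + Iy s t) + sg * K * (t - s).
Proof.
have cell_le (i : 'I_n.+1) : `|ito_correction (g n i) (g n i.+1)| <=
    K * (Ix (g n i) (g n i.+1) + Iy (g n i) (g n i.+1)) + sg * K * ((t - s) / n.+1%:R).
  rewrite -(gridB n i).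
  by apply: normr_ito_correction_le; [exact: grid_leS|exact: drift_grid Dx|exact: drift_grid Dy].
apply: le_trans (ler_norm_sum _ _ _) _; apply: le_trans (ler_sum _ (fun i _ => cell_le i)) _.
by rewrite big_split/= -mulr_sumr big_split/= !grid_sum// sum_mesh.
Qed.

Lemma ito_sum_le (e : R) n : e <= 1 -> itv_integrable th s t ->
  {ae mu, forall r, s <= r <= t -> generator_le r} ->
  (forall r r', s <= r <= t -> s <= r' <= t -> `|r - r'| <= (t - s) / n.+1%:R ->
     [/\ `|u1 r - u1 r'| <= e, `|u2 r - u2 r'| <= e, `|m1 r - m1 r'| <= e &
         `|m2 r - m2 r'| <= e]) ->
  ito_sum n <= itv_integral th s t + (11 * K * (Ix s t + Iy s t) + sg * K * (t - s)) * e.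
Proof.
move=> e1 ith gen osc.
have -> : (11 * K * (Ix s t + Iy s t) + sg * K * (t - s)) * e =
    11 * K * e * (Ix s t + Iy s t) + sg * K * e * (t - s) by ring.
rewrite addrA -(sum_mesh s t n) -!(grid_sum n)// -big_split/= mulr_sumr -!big_split/=.
apply: ler_sum => i _; rewrite -(gridB n i).
have cell r : g n i <= r <= g n i.+1 -> s <= r <= t by exact: grid_itv.
have osc_cell r : g n i <= r <= g n i.+1 -> [/\ `|u1 r - u1 (g n i)| <= e,
    `|u2 r - u2 (g n i)| <= e, `|m1 r - m1 (g n i)| <= e & `|m2 r - m2 (g n i)| <= e].
  move=> rg; apply: osc; [exact: cell|by apply: cell; rewrite lexx grid_leS|].
  by case/andP: rg => gr rg; rewrite ger0_norm ?subr_ge0// -(gridB n i) lerB.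
have [|_ _ step1 step2] := osc_cell (g n i.+1); first by rewrite lexx grid_leS.
apply: ito_correction_le => //; [exact: grid_leS|exact: drift_grid Dx|exact: drift_grid Dy| | | |].
- by apply: itv_integrableS ith; rewrite ?grid_ge ?grid_le.
- by move=> r /osc_cell[].
- by move=> r /osc_cell[].
- by apply: (ae_imply _ gen) => r genr /cell.
Qed.

Hypotheses (s0 : 0 <= s) (ith : itv_integrable th s t).
Hypothesis gen : {ae mu, forall r, s <= r <= t -> generator_le r}.
Hypotheses (cu1 : continuous (fun r : R => u1 (Num.max r 0)))
  (cu2 : continuous (fun r : R => u2 (Num.max r 0)))
  (cm1 : continuous (fun r : R => m1 (Num.max r 0)))
  (cm2 : continuous (fun r : R => m2 (Num.max r 0))).

Lemma ito_excess_cvg : (fun n => Num.max (ito_sum n - itv_integral th s t) 0) @ \oo --> 0.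
Proof.
pose c := 11 * K * (Ix s t + Iy s t) + sg * K * (t - s).
have c0 : 0 <= c.
  have K0 := test_jet_ge0 tV; rewrite addr_ge0// mulr_ge0 ?mulr_ge0 ?cov_norm_ge0 ?subr_ge0//.
  by rewrite addr_ge0//; [exact: increasing_drift_integral_ge0 Dx
    |exact: increasing_drift_integral_ge0 Dy].
have c1 : 0 < c + 1 by rewrite ltr_wpDl.
apply/cvgrPdist_le => e e0; pose e' := Num.min 1 (e / (c + 1)).
have e'0 : 0 < e' by rewrite lt_min ltr01 divr_gt0.
have ce' : c * e' <= e.
  apply: (@le_trans _ _ (c * (e / (c + 1)))); first by rewrite ler_wpM2l// ge_min lexx orbT.
  by rewrite mulrCA ler_piMr ?(ltW e0)// ler_pdivrMr// mul1r lerDl.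
have [h1 h10 osc1] := max0_unif_continuous t cu1 s0 e'0.
have [h2 h20 osc2] := max0_unif_continuous t cu2 s0 e'0.
have [h3 h30 osc3] := max0_unif_continuous t cm1 s0 e'0.
have [h4 h40 osc4] := max0_unif_continuous t cm2 s0 e'0.
near=> n.
have sum_le : ito_sum n <= itv_integral th s t + c * e'.
  apply: ito_sum_le => // [|r r' rst r'st rr']; first by rewrite ge_min lexx.
  split; apply: ltW; [apply: osc1|apply: osc2|apply: osc3|apply: osc4] => //;
    by apply: le_lt_trans rr' _; near: n; exact: mesh_lt.
rewrite sub0r normrN ger0_norm; last by rewrite le_max lexx orbT.
by rewrite ge_max (ltW e0) andbT; lra.
Unshelve. all: by end_near. Qed.

End partition.
End ito_path.

Section zero_mean.
Context {R : realType} {d : measure_display} {Omega : measurableType d}.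
Variable P : probability Omega R.
Implicit Types f g : Omega -> R.

Lemma probability_integrable_cst (r : R) : P.-integrable setT (EFin \o (fun=> r)).
Proof. exact: finite_measure_integrable_cst. Qed.

Lemma probability_Rintegral_cst (r : R) : Rintegral P setT (fun=> r) = r.
Proof.
have PT : fine (P setT) = 1 by rewrite probability_setT.
by rewrite Rintegral_cst// PT mulr1.
Qed.

Definition zero_mean f : Prop := P.-integrable setT (EFin \o f) /\ Rintegral P setT f = 0.

Lemma zero_meanD f g : zero_mean f -> zero_mean g -> zero_mean (fun w => f w + g w).
Proof.
move=> [fi f0] [gi g0]; split; first exact: integrableD_EFin.
by rewrite RintegralD// f0 g0 addr0.
Qed.

Lemma zero_meanZ (k : R) f : zero_mean f -> zero_mean (fun w => k * f w).
Proof.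
move=> [fi f0]; split; first exact: integrableZ_EFin.
by rewrite RintegralZl// f0 mulr0.
Qed.

Lemma ae_le_integrable f g : measurable_fun setT f ->
  P.-integrable setT (EFin \o g) -> {ae P, forall w, `|f w| <= g w} ->
  P.-integrable setT (EFin \o f).
Proof.
move=> mf gi fg.
have [] := @Rintegral_dominated_cvg _ _ _ P setT (fun=> f) f g measurableT (fun=> mf) mf _ gi _
  => //.
- by apply: aeW => w _; exact: cvg_cst.
- by apply: (ae_imply _ fg) => w ? ? _.
Qed.

End zero_mean.

Section usual.
Context {R : realType} {d : measure_display} {Omega : measurableType d}.
Variable P : probability Omega R.
Variable F : R -> set (set Omega).
Hypothesis uF : usual_filtration P F.

Lemma usual_filtration_filtration : filtration F.
Proof. by case: uF => sF ndF _ _; split=> // t /sF[]. Qed.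

Lemma usual_sigma_algebra t : 0 <= t -> sigma_algebra setT (F t).
Proof. by case: usual_filtration_filtration => + _; exact. Qed.

Lemma usual_sub_measurable t : 0 <= t -> F t `<=` measurable.
Proof. by case: uF => sF _ _ _ /sF[]. Qed.

Lemma usual_measurable_fun t (f : Omega -> R) : 0 <= t -> G_measurable (F t) f ->
  measurable_fun setT f.
Proof.
by move=> t0 mf _ U mU; rewrite setTI; apply: (usual_sub_measurable t0); exact: mf.
Qed.

End usual.

Section brownian.
Context {R : realType} {d : measure_display} {Omega : measurableType d}.
Variable P : probability Omega R.
Variables (F : R -> set (set Omega)) (rho : R) (B C : R -> Omega -> R).
Hypotheses (uF : usual_filtration P F) (rho1 : -1 <= rho <= 1) (bm : correlated_BM P F rho B C).
Notation E f := (Rintegral P setT f).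

Let fF : filtration F := usual_filtration_filtration uF.
Let sF t : 0 <= t -> sigma_algebra setT (F t) := @usual_sigma_algebra _ _ _ _ _ uF t.

Definition BM_comb (l m t : R) (w : Omega) : R := l * B t w + m * C t w.
Definition BM_var (l m : R) : R := l ^+ 2 + 2 * rho * l * m + m ^+ 2.
Definition BM_cov (l m l' m' : R) : R := l * l' + rho * (l * m' + l' * m) + m * m'.

Lemma adapted_BM_comb l m : adapted F (BM_comb l m).
Proof.
have [_ _ [aB aC] _] := bm => t t0.
by apply: (G_measurableD (sF t0)); apply: (G_measurableZ (sF t0)); [exact: aB|exact: aC].
Qed.

Lemma continuous_BM_comb l m w : continuous (fun r : R => BM_comb l m (Num.max r 0) w).
Proof.
have [_ [cB cC] _ _] := bm => r; apply: cvgD; apply: cvgMl_tmp.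
  exact: (continuous_max0 (cB w)).
exact: (continuous_max0 (cC w)).
Qed.

Lemma BM_var_ge0 l m : 0 <= BM_var l m.
Proof.
case/andP: rho1 => r1 r2.
have -> : BM_var l m = (1 + rho) / 2 * (l + m) ^+ 2 + (1 - rho) / 2 * (l - m) ^+ 2.
  by rewrite /BM_var; field.
by rewrite addr_ge0// mulr_ge0 ?sqr_ge0//; lra.
Qed.

Lemma BM_varD l m l' m' :
  BM_var (l + l') (m + m') = BM_var l m + 2 * BM_cov l m l' m' + BM_var l' m'.
Proof. by rewrite /BM_var /BM_cov; ring. Qed.

Section increments.
Variables (s t : R).
Hypotheses (s0 : 0 <= s) (st : s < t).
Let t0 : 0 <= t. Proof. exact: le_trans (ltW st). Qed.

Definition BM_incr l m w : R := BM_comb l m t w - BM_comb l m s w.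

Lemma BM_incrD l m l' m' w : BM_incr (l + l') (m + m') w = BM_incr l m w + BM_incr l' m' w.
Proof. by rewrite /BM_incr /BM_comb; ring. Qed.

Lemma G_measurable_BM_incr l m : G_measurable (F t) (BM_incr l m).
Proof.
apply: (G_measurableB (sF t0)); first exact: adapted_BM_comb.
by apply: (G_measurable_mono fF s0 (ltW st)); exact: adapted_BM_comb.
Qed.

Lemma measurable_BM_incr l m : measurable_fun setT (BM_incr l m).
Proof. exact: (usual_measurable_fun uF t0 (G_measurable_BM_incr l m)). Qed.

Let v l m : R := (t - s) * BM_var l m.

Let v_ge0 l m : 0 <= v l m.
Proof. by rewrite mulr_ge0 ?BM_var_ge0// subr_ge0 ltW. Qed.

Lemma gaussian_on_BM_incr l m A : F s A -> gaussian_on P A (BM_incr l m) (v l m).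
Proof.
move=> FA k; have [_ _ _ /(_ s t s0 (ltW st) A FA (k * l) (k * m))[cosE sinE]] := bm.
have incrE w : k * l * (B t w - B s w) + k * m * (C t w - C s w) = k * BM_incr l m w.
  by rewrite /BM_incr /BM_comb; ring.
split; last by rewrite -sinE; apply: eq_integral => w _; rewrite incrE.
rewrite (_ : - (k ^+ 2 * v l m) / 2 =
  - ((t - s) * ((k * l) ^+ 2 + 2 * rho * (k * l) * (k * m) + (k * m) ^+ 2)) / 2).
  by rewrite -cosE; apply: eq_integral => w _; rewrite incrE.
by rewrite /v /BM_var; field.
Qed.

Let FsT : F s setT.
Proof. by have [? FC _] := sF s0; rewrite -(setD0 setT); exact: FC. Qed.

Lemma BM_incr_integrable l m k : (k <= 4)%N ->
  P.-integrable setT (EFin \o (fun w => `|BM_incr l m w| ^+ k)).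
Proof.
exact: (gaussian_integrable measurableT (measurable_BM_incr l m) (v_ge0 l m)
  (gaussian_on_BM_incr l m FsT)).
Qed.

Definition BM_moment3 l m : R := (BM_var l m + 3 * BM_var l m ^+ 2) / 2.

(* [2 a y^3 <= a^2 y^2 + y^4] with [a = sqrt (t - s)] reduces to the second and fourth moments. *)
Lemma BM_incr_abs3_le l m : E (fun w => `|BM_incr l m w| ^+ 3) <=
  BM_moment3 l m * ((t - s) * Num.sqrt (t - s)).
Proof.
have h0 : 0 < t - s by rewrite subr_gt0.
set D := BM_incr l m; set a := Num.sqrt (t - s).
have a0 : 0 < a by rewrite sqrtr_gt0.
have aE : t - s = a ^+ 2 by rewrite sqr_sqrtr// ltW.
have gD := gaussian_on_BM_incr l m FsT; have mD := measurable_BM_incr l m.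
have [i4 moment4] := gaussian_moment4 measurableT mD (v_ge0 l m) gD.
have moment2 := gaussian_moment2 measurableT mD (v_ge0 l m) gD.
have i2 := gaussian_sqr_integrable measurableT mD (v_ge0 l m) gD.
have PT : fine (P setT) = 1 by rewrite probability_setT.
rewrite PT mulr1 in moment4; rewrite PT mulr1 in moment2.
apply: (@le_trans _ _ (E (fun w => a / 2 * D w ^+ 2 + a^-1 / 2 * D w ^+ 4))).
  apply: le_Rintegral => //; first exact: BM_incr_integrable.
    by apply: integrableD_EFin => //; exact: integrableZ_EFin.
  move=> w _; have -> : D w ^+ 2 = `|D w| ^+ 2 by rewrite -normrX ger0_norm// sqr_ge0.
  have -> : D w ^+ 4 = `|D w| ^+ 4 by rewrite -normrX ger0_norm// exprn_even_ge0.
  move: (normr_ge0 (D w)); set y := `|D w| => y0.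
  have -> : a / 2 * y ^+ 2 + a^-1 / 2 * y ^+ 4 = y ^+ 3 + (a - y) ^+ 2 * y ^+ 2 * (a^-1 / 2).
    by field; rewrite gt_eqF.
  have aV0 : 0 <= a^-1 / 2 by rewrite divr_ge0// invr_ge0 ltW.
  by rewrite lerDl mulr_ge0// mulr_ge0// sqr_ge0.
rewrite RintegralD//; try exact: integrableZ_EFin.
rewrite !RintegralZl// moment2 /v aE.
have -> : BM_moment3 l m * (a ^+ 2 * a) =
  a / 2 * (a ^+ 2 * BM_var l m) + a^-1 / 2 * (3 * (a ^+ 2 * BM_var l m) ^+ 2).
  by rewrite /BM_moment3; field; rewrite gt_eqF.
rewrite lerD2l; apply: ler_wpM2l; first by rewrite divr_ge0// invr_ge0 ltW.
by rewrite -aE.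
Qed.

Variables (phi : Omega -> R) (c : R).
Hypotheses (gphi : G_measurable (F s) phi) (phic : forall w, `|phi w| <= c).

Let boundedM_zero_mean Z : P.-integrable setT (EFin \o Z) ->
  (forall A, F s A -> Rintegral P A Z = 0) -> zero_mean P (fun w => phi w * Z w).
Proof.
move=> iZ Z0; split.
  exact: (integrable_boundedM iZ (usual_measurable_fun uF s0 gphi) phic).
exact: (Rintegral_boundedM_eq0 (sF s0) (usual_sub_measurable uF s0) iZ Z0 gphi phic).
Qed.

Lemma BM_incr_zero_mean l m : zero_mean P (fun w => phi w * BM_incr l m w).
Proof.
have mean0 A (FA : F s A) := gaussian_mean0 (usual_sub_measurable uF s0 FA)
  (measurable_BM_incr l m) (v_ge0 l m) (gaussian_on_BM_incr l m FA).
apply: boundedM_zero_mean; first by have [] := mean0 _ FsT.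
by move=> A /mean0[].
Qed.

Lemma BM_incr_sqr_zero_mean l m :
  zero_mean P (fun w => phi w * (BM_incr l m w ^+ 2 - (t - s) * BM_var l m)).
Proof.
have mD := measurable_BM_incr l m.
have i2 := gaussian_sqr_integrable measurableT mD (v_ge0 l m) (gaussian_on_BM_incr l m FsT).
have ic : P.-integrable setT (EFin \o (fun=> v l m)) by exact: finite_measure_integrable_cst.
apply: boundedM_zero_mean; first exact: (integrableB_EFin measurableT i2 ic).
move=> A FA; have mA := usual_sub_measurable uF s0 FA.
rewrite RintegralB//; [|exact: integrableS i2|exact: integrableS ic].
rewrite (gaussian_moment2 mA mD (v_ge0 l m) (gaussian_on_BM_incr l m FA)).
by rewrite Rintegral_cst// subrr.
Qed.

End increments.

Section dynkin.
Variables (K : R) (V : jet2 R) (l1 m1 l2 m2 : R).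
Hypothesis tV : test_jet K V.
Local Notation s11 := (BM_var l1 m1).
Local Notation s12 := (BM_cov l1 m1 l2 m2).
Local Notation s22 := (BM_var l2 m2).
Local Notation lap := (diffusion s11 s12 s22 V).
Local Notation M1 := (BM_comb l1 m1).
Local Notation M2 := (BM_comb l2 m2).

Definition compensated_increment s t (X Y : Omega -> R) w : R :=
  V (X w + BM_incr s t l1 m1 w) (Y w + BM_incr s t l2 m2 w) - V (X w) (Y w)
  - (t - s) * lap (X w) (Y w) / 2.

Section one_step.
Variables (s t : R) (phi X Y : Omega -> R).
Hypotheses (s0 : 0 <= s) (st : s < t).
Hypotheses (gphi : G_measurable (F s) phi) (phi01 : forall w, 0 <= phi w <= 1).
Hypotheses (gX : G_measurable (F s) X) (gY : G_measurable (F s) Y).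
Local Notation a := (BM_incr s t l1 m1).
Local Notation b := (BM_incr s t l2 m2).

Let t0 : 0 <= t. Proof. exact: le_trans (ltW st). Qed.
Let phi_le1 w : `|phi w| <= 1. Proof. by case/andP: (phi01 w) => p0 p1; rewrite ger0_norm. Qed.

Let weight_measurable f : bounded_lipschitz_by K f ->
  G_measurable (F s) (fun w => phi w * f (X w) (Y w)).
Proof.
by move=> [_ _ mf]; apply: (G_measurableM (sF s0)) => //; exact: (G_measurable_comp2 (sF s0)).
Qed.

Let weight_le f : bounded_lipschitz_by K f -> forall w, `|phi w * f (X w) (Y w)| <= K.
Proof. by move=> [bf _ _] w; rewrite normrM -[leRHS]mul1r ler_pM. Qed.

Let linear_zero_mean f l m : bounded_lipschitz_by K f ->
  zero_mean P (fun w => phi w * f (X w) (Y w) * BM_incr s t l m w).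
Proof.
by move=> nf; exact: (BM_incr_zero_mean s0 st (weight_measurable nf) (weight_le nf)).
Qed.

Let quadratic_zero_mean f l m : bounded_lipschitz_by K f ->
  zero_mean P (fun w => phi w * f (X w) (Y w) * (BM_incr s t l m w ^+ 2 - (t - s) * BM_var l m)).
Proof.
by move=> nf; exact: (BM_incr_sqr_zero_mean s0 st (weight_measurable nf) (weight_le nf)).
Qed.

Definition taylor_increment w : R := jet_linear V (X w) (Y w) (a w) (b w)
  + (jet_quadratic V (X w) (Y w) (a w) (b w) - (t - s) * lap (X w) (Y w)) / 2.

(* The cross term is recovered by polarization from the square of [a + b]. *)
Let taylor_zero_mean : zero_mean P (fun w => phi w * taylor_increment w).
Proof.
have [_ [nx ny] [nxx nxy nyy] _] := tV.
have linear := zero_meanD (linear_zero_mean l1 m1 nx) (linear_zero_mean l2 m2 ny).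
have diagonal := zero_meanD (quadratic_zero_mean l1 m1 nxx) (quadratic_zero_mean l2 m2 nyy).
have cross := zero_meanD (quadratic_zero_mean (l1 + l2) (m1 + m2) nxy) (zero_meanZ (-1)
  (zero_meanD (quadratic_zero_mean l1 m1 nxy) (quadratic_zero_mean l2 m2 nxy))).
have := zero_meanD linear (zero_meanZ 2^-1 (zero_meanD diagonal cross)).
congr zero_mean; apply/funext => w; rewrite BM_incrD BM_varD.
by rewrite /taylor_increment /jet_linear /jet_quadratic /diffusion; field.
Qed.

Let compensated_increment_measurable :
  measurable_fun setT (fun w => phi w * compensated_increment s t X Y w).
Proof.
have sFt := sF t0; have [[_ mV] _ _ _] := tV.
have mono (Z : Omega -> R) : G_measurable (F s) Z -> G_measurable (F t) Z.
  exact: (G_measurable_mono fF s0 (ltW st)).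
have gXt := mono _ gX; have gYt := mono _ gY.
apply: (usual_measurable_fun uF t0); apply: (G_measurableM sFt); first exact: mono.
apply: (G_measurableB sFt); last first.
  under eq_fun do rewrite mulrAC; apply: (G_measurableZ sFt).
  exact: (G_measurable_comp2 sFt (measurable_diffusion tV _ _ _)).
apply: (G_measurableB sFt); apply: (G_measurable_comp2 sFt mV) => //.
  by apply: (G_measurableD sFt) => //; exact: G_measurable_BM_incr.
by apply: (G_measurableD sFt) => //; exact: G_measurable_BM_incr.
Qed.

Lemma compensated_increment_integrable :
  P.-integrable setT (EFin \o (fun w => phi w * compensated_increment s t X Y w)).
Proof.
have [[LV _] _ _ _] := tV; have h0 : 0 <= t - s by rewrite subr_ge0 ltW.
apply: (@le_integrable_EFin _ _ _ P setT _
  (fun w => K * (`|a w| ^+ 1 + `|b w| ^+ 1) + (t - s) * (cov_norm s11 s12 s22 * K))) => //;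
    last first.
  apply: integrableD_EFin => //; last exact: finite_measure_integrable_cst.
  by apply: integrableZ_EFin => //; apply: integrableD_EFin => //; exact: BM_incr_integrable.
move=> w _; rewrite normrM -[leRHS]mul1r ler_pM// ?phi_le1//.
apply: le_trans (ler_normB _ _) _; apply: lerD.
  by apply: le_trans (LV _ _ _ _) _; rewrite !expr1 [X w + _]addrC [Y w + _]addrC !addrK.
have bound := diffusion_bounded tV s11 s12 s22 (X w) (Y w).
rewrite !normrM (@ger0_norm _ 2^-1)// (ger0_norm h0).
apply: (@le_trans _ _ ((t - s) * `|lap (X w) (Y w)|)); last by rewrite ler_wpM2l.
by rewrite ler_piMr//; [exact: mulr_ge0|lra].
Qed.

Lemma compensated_increment_le : E (fun w => phi w * compensated_increment s t X Y w) <=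
  K * (BM_moment3 l1 m1 + BM_moment3 l2 m2) * ((t - s) * Num.sqrt (t - s)).
Proof.
have [_ _ _ taylor] := tV; have K0 := test_jet_ge0 tV.
have [itaylor taylor0] := taylor_zero_mean.
have i3 l m := BM_incr_integrable s0 st l m (k := 3) isT.
have icubes : P.-integrable setT (EFin \o (fun w => K * (`|a w| ^+ 3 + `|b w| ^+ 3))).
  by apply: integrableZ_EFin => //; exact: integrableD_EFin.
apply: (@le_trans _ _
  (E (fun w => phi w * taylor_increment w + K * (`|a w| ^+ 3 + `|b w| ^+ 3)))).
  apply: le_Rintegral => //; first exact: compensated_increment_integrable.
    exact: integrableD_EFin.
  move=> w _; have /andP[p0 p1] := phi01 w.
  rewrite -lerBlDl -mulrBr.
  have remainder : compensated_increment s t X Y w - taylor_increment w <=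
      K * (`|a w| ^+ 3 + `|b w| ^+ 3).
    rewrite /compensated_increment /taylor_increment.
    by have := taylor (X w) (Y w) (a w) (b w); lra.
  apply: le_trans (ler_wpM2l p0 remainder) _.
  by rewrite ler_piMl// mulr_ge0// addr_ge0// exprn_ge0.
rewrite RintegralD// taylor0 add0r RintegralZl//; last exact: integrableD_EFin.
by rewrite -mulrA ler_wpM2l// RintegralD// mulrDl lerD//; exact: BM_incr_abs3_le.
Qed.

End one_step.

Definition ito_path (s t : R) (u1 u2 n1 n2 : R -> R) (Th : R) :=
  exists dx dy th : R -> R,
  [/\ increasing_drift u1 n1 dx s t, increasing_drift u2 n2 dy s t, itv_integrable th s t,
      {ae lebesgue_measure, forall r, s <= r <= t ->
        generator_le V s11 s12 s22 u1 u2 dx dy th r} &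
      Th = itv_integral th s t].

Section formula.
Variables (s t : R) (U1 U2 : R -> Omega -> R) (Th phi : Omega -> R).
Hypotheses (s0 : 0 <= s) (st : s < t) (aU1 : adapted F U1) (aU2 : adapted F U2).
Let D1 w : R := U1 t w - U1 s w - (M1 t w - M1 s w).
Let D2 w : R := U2 t w - U2 s w - (M2 t w - M2 s w).
Hypotheses (iTh : P.-integrable setT (EFin \o Th)).
Hypotheses (iD1 : P.-integrable setT (EFin \o D1)) (iD2 : P.-integrable setT (EFin \o D2)).
Hypothesis path : {ae P, forall w, [/\ continuous (fun r : R => U1 (Num.max r 0) w),
  continuous (fun r : R => U2 (Num.max r 0) w) &
  ito_path s t (U1^~ w) (U2^~ w) (M1^~ w) (M2^~ w) (Th w)]}.
Hypotheses (gphi : G_measurable (F s) phi) (phi01 : forall w, 0 <= phi w <= 1).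

Let t0 : 0 <= t. Proof. exact: le_trans (ltW st). Qed.
Let phi_le1 w : `|phi w| <= 1. Proof. by case/andP: (phi01 w) => p0 p1; rewrite ger0_norm. Qed.
Let mphi : measurable_fun setT phi. Proof. exact: (usual_measurable_fun uF s0 gphi). Qed.

Let g n i : R := grid s t n i.
Let g_ge n i : s <= g n i. Proof. exact: grid_ge (ltW st) _ _. Qed.
Let g_ge0 n i : 0 <= g n i. Proof. exact: le_trans (g_ge n i). Qed.
Let g_le n i : (i <= n.+1)%N -> g n i <= t. Proof. exact: grid_le (ltW st) _ _. Qed.
Let gB n i : g n i.+1 - g n i = (t - s) / n.+1%:R. Proof. by rewrite /g gridS addrC addKr. Qed.
Let g_lt n i : g n i < g n i.+1.
Proof. by rewrite -subr_gt0 gB divr_gt0// subr_gt0. Qed.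

Let grid_measurable Z n i : adapted F Z -> (i <= n.+1)%N -> G_measurable (F t) (Z (g n i)).
Proof. by move=> aZ ni; apply: (G_measurable_mono fF (g_ge0 n i) (g_le ni)); exact: aZ. Qed.

Let S n w : R := ito_sum V s11 s12 s22 (U1^~ w) (U2^~ w) (M1^~ w) (M2^~ w) s t n.
Let T n i w : R := phi w * compensated_increment (g n i) (g n i.+1) (U1 (g n i)) (U2 (g n i)) w.

Let decomposition n w : phi w * (V (U1 t w) (U2 t w) - V (U1 s w) (U2 s w)) =
  phi w * S n w + \sum_(i < n.+1) T n i w.
Proof.
rewrite /S /ito_sum /T -mulr_sumr -mulrDr -big_split/=; congr (_ * _).
pose v i := V (U1 (g n i) w) (U2 (g n i) w).
transitivity (\sum_(i < n.+1) (v i.+1 - v i)).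
  rewrite -(big_mkord xpredT (fun i => v i.+1 - v i)) telescope_sumr//.
  by rewrite /v /g grid_last grid0.
apply: eq_bigr => i _; rewrite /ito_correction /compensated_increment /BM_incr /v /g; ring.
Qed.

Let T_integrable n i : P.-integrable setT (EFin \o T n i).
Proof.
apply: compensated_increment_integrable (g_ge0 n i) (g_lt n i) _ phi01 _ _.
- exact: (G_measurable_mono fF s0 (g_ge n i)).
- exact: aU1.
- exact: aU2.
Qed.

Let c : R := K * (BM_moment3 l1 m1 + BM_moment3 l2 m2).

Let sum_T_le n : E (fun w => \sum_(i < n.+1) T n i w) <=
  c * Num.sqrt ((t - s) / n.+1%:R) * (t - s).
Proof.
rewrite Rintegral_sum// -(sum_mesh s t n); apply: ler_sum => i _.
rewrite -(gB n i) -mulrA [X in _ <= _ * X]mulrC.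
apply: compensated_increment_le (g_ge0 n i) (g_lt n i) _ phi01 _ _.
- exact: (G_measurable_mono fF s0 (g_ge n i)).
- exact: aU1.
- exact: aU2.
Qed.

Let measurable_S n : measurable_fun setT (S n).
Proof.
have sFt := sF t0; have [[_ mV] _ _ _] := tV; have mlap := measurable_diffusion tV s11 s12 s22.
have gS Z (i : 'I_n.+1) : adapted F Z -> G_measurable (F t) (Z (g n i.+1)).
  by move=> aZ; exact: grid_measurable.
have gi Z (i : 'I_n.+1) : adapted F Z -> G_measurable (F t) (Z (g n i)).
  by move=> aZ; apply: grid_measurable => //; exact: ltnW.
have aM l m := adapted_BM_comb l m.
apply: (usual_measurable_fun uF t0); apply: (G_measurable_sum sFt) => i.
apply: (G_measurableD sFt).
  apply: (G_measurableB sFt); apply: (G_measurable_comp2 sFt mV); try exact: gS.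
    by apply: (G_measurableD sFt); [|apply: (G_measurableB sFt)]; [exact: gi|exact: gS|exact: gi].
  by apply: (G_measurableD sFt); [|apply: (G_measurableB sFt)]; [exact: gi|exact: gS|exact: gi].
under eq_fun do rewrite mulrAC; apply: (G_measurableZ sFt).
by apply: (G_measurable_comp2 sFt mlap); exact: gi.
Qed.

Let bound w : R := K * (D1 w + D2 w) + cov_norm s11 s12 s22 * K * (t - s).

Let bound_integrable : P.-integrable setT (EFin \o bound).
Proof.
apply: integrableD_EFin => //; last exact: finite_measure_integrable_cst.
by apply: integrableZ_EFin => //; exact: integrableD_EFin.
Qed.

Let S_le : {ae P, forall w, forall n, `|S n w| <= bound w}.
Proof.
apply: (ae_imply _ path) => w [_ _ [dx [dy [th [Dx Dy _ _ _]]]]] n.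
rewrite /bound /D1 /D2 -(increasing_drift_integral (ltW st) Dx).
rewrite -(increasing_drift_integral (ltW st) Dy).
exact: (normr_ito_sum_le _ _ _ tV (ltW st) Dx Dy).
Qed.

Let S_integrable n : P.-integrable setT (EFin \o S n).
Proof.
apply: ae_le_integrable (measurable_S n) bound_integrable _.
by apply: (ae_imply _ S_le) => w; exact.
Qed.

Lemma dynkin_integrable :
  P.-integrable setT (EFin \o (fun w => phi w * (V (U1 t w) (U2 t w) - V (U1 s w) (U2 s w)))).
Proof.
have iS := integrable_boundedM (S_integrable 0) mphi phi_le1.
have := integrableD_EFin measurableT iS (integrable_sum_EFin (index_enum 'I_1) measurableT
  (fun i => T_integrable 0 i)).
by apply: eq_integrable => // w _ /=; rewrite (decomposition 0).
Qed.

Let W n w : R := Num.max (S n w - Th w) 0.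

Let W_cvg : (forall n, P.-integrable setT (EFin \o W n)) /\ (fun n => E (W n)) @ \oo --> 0.
Proof.
have mW n : measurable_fun setT (W n).
  apply: measurable_maxr; last exact: measurable_cst.
  by apply: measurable_funB => //; case/integrableP: iTh => /measurable_EFinP.
have ibound : P.-integrable setT (EFin \o (fun w => bound w + `|Th w|)).
  by apply: integrableD_EFin => //; exact: integrable_norm.
have W_le : {ae P, forall w, forall n, setT w -> `|W n w| <= bound w + `|Th w|}.
  apply: (ae_imply _ S_le) => w Sw n _; have := Sw n => /ler_normlP[_ Sn].
  rewrite ger0_norm; last by rewrite le_max lexx orbT.
  have := ler_norm (- Th w); rewrite normrN; have := normr_ge0 (Th w).
  by have := le_trans (normr_ge0 _) (Sw n); rewrite /W ge_max => *; apply/andP; split; lra.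
split=> [n|].
  by apply: ae_le_integrable (mW n) ibound _; apply: (ae_imply _ W_le) => w; exact.
have -> : (0 : R) = E (fun=> 0) by rewrite Rintegral_cst// mul0r.
apply: (Rintegral_dominated_cvg measurableT mW _ _ ibound W_le).2 => //.
apply: (ae_imply _ path) => w [cU1 cU2 [dx [dy [th [Dx Dy ith gen ThE]]]]] _.
rewrite /W ThE; apply: (ito_excess_cvg tV (ltW st) Dx Dy s0 ith gen) => //.
  exact: continuous_BM_comb.
exact: continuous_BM_comb.
Qed.

Theorem dynkin_formula : E (fun w => phi w * (V (U1 t w) (U2 t w) - V (U1 s w) (U2 s w))) <=
  E (fun w => phi w * Th w).
Proof.
have [iW EW] := W_cvg.
have iphiS n := integrable_boundedM (S_integrable n) mphi phi_le1.
have iphiTh := integrable_boundedM iTh mphi phi_le1.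
have isumT n := integrable_sum_EFin (index_enum 'I_n.+1) measurableT (fun i => T_integrable n i).
have excess n : E (fun w => phi w * S n w) <= E (fun w => phi w * Th w) + E (W n).
  have -> : E (fun w => phi w * Th w) + E (W n) = E (fun w => phi w * Th w + W n w).
    by rewrite RintegralD.
  apply: le_Rintegral => //; first exact: integrableD_EFin.
  move=> w _; have /andP[p0 p1] := phi01 w; rewrite -lerBlDl -mulrBr.
  apply: (@le_trans _ _ (phi w * W n w)); first by rewrite ler_wpM2l// le_max lexx.
  by rewrite ler_piMl// le_max lexx orbT.
have upper n : E (fun w => phi w * (V (U1 t w) (U2 t w) - V (U1 s w) (U2 s w))) <=
   E (fun w => phi w * Th w) + E (W n) + c * Num.sqrt ((t - s) / n.+1%:R) * (t - s).
  under eq_Rintegral do rewrite (decomposition n).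
  rewrite (RintegralD measurableT (iphiS n) (isumT n)).
  by apply: lerD; [exact: excess|exact: sum_T_le].
have mesh : (fun n : nat => Num.sqrt ((t - s) / n.+1%:R)) @ \oo --> (0 : R).
  rewrite -(@sqrtr0 R); apply: continuous_cvg; first exact: sqrt_continuous.
  by rewrite -(mulr0 (t - s)); apply: cvgMl_tmp; exact: cvg_harmonic.
have lim : (fun n : nat => E (fun w => phi w * Th w) + E (W n)
    + c * Num.sqrt ((t - s) / n.+1%:R) * (t - s)) @ \oo -->
    E (fun w => phi w * Th w) + 0 + c * 0 * (t - s).
  apply: cvgD; last by apply: cvgMr_tmp; exact: cvgMl_tmp.
  by apply: cvgD => //; exact: cvg_cst.
rewrite mulr0 mul0r !addr0 in lim; apply: cvgr_to_ge lim _.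
exact: nearW.
Qed.

End formula.
End dynkin.
End brownian.

(** * Logarithmic test functions *)

Section derivatives.
Context {R : realType}.
Implicit Types (f g : R -> R) (x a b h k : R).

Lemma is_derive_addf f g x a b : is_derive x 1 f a -> is_derive x 1 g b ->
  is_derive x 1 (fun y => f y + g y) (a + b).
Proof. by move=> df dg; exact: is_deriveD. Qed.

Lemma is_derive_addcf k f x a : is_derive x 1 f a -> is_derive x 1 (fun y => k + f y) a.
Proof.
by move=> df; apply: (is_derive_eq (is_derive_addf (is_derive_cst k x 1) df)); rewrite add0r.
Qed.

Lemma is_derive_mulf f g x a b : is_derive x 1 f a -> is_derive x 1 g b ->
  is_derive x 1 (fun y => f y * g y) (a * g x + f x * b).
Proof.
move=> df dg; apply: (is_derive_eq (is_deriveM df dg)).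
by rewrite /GRing.scale/= addrC (mulrC a).
Qed.

Lemma is_derive_scalef k f x a : is_derive x 1 f a -> is_derive x 1 (fun y => k * f y) (k * a).
Proof.
by move=> df; apply: (is_derive_eq (is_derive_mulf (is_derive_cst k x 1) df)); rewrite mul0r add0r.
Qed.

Lemma is_derive_invf f x a : f x != 0 -> is_derive x 1 f a ->
  is_derive x 1 (fun y => (f y)^-1) (- a / f x ^+ 2).
Proof.
move=> fx df; apply: (is_derive_eq (is_deriveV fx df)).
by rewrite /GRing.scale/=; field.
Qed.

Lemma is_derive_lnf f x a : 0 < f x -> is_derive x 1 f a ->
  is_derive x 1 (fun y => ln (f y)) (a / f x).
Proof.
move=> fx df; have dl := is_derive1_ln fx.
by apply: (is_derive_eq (is_derive1_comp dl df)); rewrite mulrC.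
Qed.

Lemma is_derive_affine x a h : is_derive h 1 (fun t : R => x + t * a) a.
Proof.
apply: is_derive_addcf;
  apply: (is_derive_eq (is_derive_mulf (is_derive_id h 1) (is_derive_cst a h 1))).
by rewrite mul1r mulr0 addr0.
Qed.

Lemma is_derive_le_segment f df k a b : a <= b ->
  (forall x : R, a <= x <= b -> is_derive x 1 f (df x)) ->
  (forall x, a <= x <= b -> df x <= k) -> f b <= f a + k * (b - a).
Proof.
move=> ab fd dfk.
have [||c /[!in_itv]/= /andP[ac cb] fE] := MVT_segment (f := f) (df := df) ab.
- by move=> x; rewrite in_itv/= => /andP[ax xb]; apply: fd; rewrite !ltW.
- apply: continuous_in_subspaceT => x; rewrite inE/= in_itv/= => xab.
  by apply: differentiable_continuous; apply/derivable1_diffP; have [] := fd x xab.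
by rewrite -lerBlDl fE ler_wpM2r ?subr_ge0// dfk ?ac.
Qed.

(* Only an upper bound [c + k] of the second derivative is used, so [f'] may have kinks whose
   second derivative is overestimated. *)
Lemma taylor2_le f df ddf (c k : R) : 0 <= k ->
  (forall x : R, 0 <= x <= 1 -> is_derive x 1 f (df x)) ->
  (forall x : R, 0 <= x <= 1 -> is_derive x 1 df (ddf x)) ->
  (forall x, 0 <= x <= 1 -> ddf x <= c + k) ->
  f 1 <= f 0 + df 0 + c / 2 + k.
Proof.
move=> k0 fd dfd ddfk.
pose r x := f x + (- df 0 * x + - (c / 2) * (x * x)); pose dr x := df x + (- df 0 + - c * x).
have r_derive (x : R) : 0 <= x <= 1 -> is_derive x 1 r (dr x).
  move=> x01; apply: (is_derive_eq (is_derive_addf (fd x x01) (is_derive_addf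
    (is_derive_scalef _ (is_derive_id x 1))
    (is_derive_scalef _ (is_derive_mulf (is_derive_id x 1) (is_derive_id x 1)))))).
  by rewrite /dr; field.
have dr_derive (x : R) : 0 <= x <= 1 -> is_derive x 1 dr (ddf x - c).
  move=> x01; apply: (is_derive_eq (is_derive_addf (dfd x x01) (is_derive_addf
    (is_derive_cst _ x 1) (is_derive_scalef _ (is_derive_id x 1))))).
  by rewrite add0r mulr1.
have dr_le x : 0 <= x <= 1 -> dr x <= k.
  move=> /andP[x0 x1]; have le1 y : 0 <= y <= x -> 0 <= y <= 1.
    by move=> /andP[-> yx]; exact: le_trans x1.
  apply: (@le_trans _ _ (dr 0 + k * (x - 0))).
    apply: (is_derive_le_segment x0) => y /le1 y01; first exact: dr_derive.
    by rewrite lerBlDl ddfk.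
  by rewrite /dr mulr0 addr0 subrr add0r subr0 ler_piMr.
by have := is_derive_le_segment ler01 r_derive dr_le; rewrite /r; lra.
Qed.

End derivatives.

Section gradients.
Context {R : realType}.
Implicit Types f g fx fy gx gy : R -> R -> R.

Definition has_gradient f fx fy : Prop := forall x y a b h : R,
  is_derive h 1 (fun t => f (x + t * a) (y + t * b))
    (fx (x + h * a) (y + h * b) * a + fy (x + h * a) (y + h * b) * b).

Lemma has_gradient_eq f fx fy gx gy : (forall x y, fx x y = gx x y) ->
  (forall x y, fy x y = gy x y) -> has_gradient f fx fy -> has_gradient f gx gy.
Proof. by move=> fgx fgy df x y a b h; rewrite -fgx -fgy; exact: df. Qed.

Lemma has_gradient_cst (k : R) : has_gradient (fun _ _ => k) (fun _ _ => 0) (fun _ _ => 0).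
Proof. by move=> x y a b h; apply: is_derive_eq (is_derive_cst k h 1) _; rewrite !mul0r addr0. Qed.

Lemma has_gradient_fst : has_gradient (fun x _ => x) (fun _ _ => 1) (fun _ _ => 0).
Proof.
by move=> x y a b h; apply: is_derive_eq (is_derive_affine x a h) _; rewrite mul1r mul0r addr0.
Qed.

Lemma has_gradient_swap f fx fy : has_gradient f fx fy ->
  has_gradient (fun x y => f y x) (fun x y => fy y x) (fun x y => fx y x).
Proof. by move=> df x y a b h; apply: is_derive_eq (df y x b a h) _; rewrite addrC. Qed.

Lemma has_gradientD f fx fy g gx gy : has_gradient f fx fy -> has_gradient g gx gy ->
  has_gradient (fun x y => f x y + g x y) (fun x y => fx x y + gx x y) (fun x y => fy x y + gy x y).
Proof.
move=> df dg x y a b h; apply: is_derive_eq (is_derive_addf (df x y a b h) (dg x y a b h)) _.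
by rewrite !mulrDl addrACA.
Qed.

Lemma has_gradientM f fx fy g gx gy : has_gradient f fx fy -> has_gradient g gx gy ->
  has_gradient (fun x y => f x y * g x y) (fun x y => fx x y * g x y + f x y * gx x y)
    (fun x y => fy x y * g x y + f x y * gy x y).
Proof.
move=> df dg x y a b h; apply: is_derive_eq (is_derive_mulf (df x y a b h) (dg x y a b h)) _.
by ring.
Qed.

Lemma has_gradientZ (k : R) f fx fy : has_gradient f fx fy ->
  has_gradient (fun x y => k * f x y) (fun x y => k * fx x y) (fun x y => k * fy x y).
Proof.
by move=> df x y a b h; apply: is_derive_eq (is_derive_scalef k (df x y a b h)) _;
  rewrite mulrDr !mulrA.
Qed.

Lemma has_gradientV f fx fy : (forall x y, f x y != 0) -> has_gradient f fx fy ->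
  has_gradient (fun x y => (f x y)^-1) (fun x y => - fx x y / f x y ^+ 2)
    (fun x y => - fy x y / f x y ^+ 2).
Proof.
move=> f0 df x y a b h; apply: is_derive_eq (is_derive_invf (f0 _ _) (df x y a b h)) _.
by field; exact: f0.
Qed.

Lemma has_gradient_ln f fx fy : (forall x y, 0 < f x y) -> has_gradient f fx fy ->
  has_gradient (fun x y => ln (f x y)) (fun x y => fx x y / f x y) (fun x y => fy x y / f x y).
Proof.
move=> f0 df x y a b h; apply: is_derive_eq (is_derive_lnf (f0 _ _) (df x y a b h)) _.
by rewrite mulrDl mulrAC (mulrAC _ b).
Qed.

Lemma has_gradient_lipschitz2 f fx fy (K : R) : has_gradient f fx fy ->
  bounded2 K fx -> bounded2 K fy -> lipschitz2 K f.
Proof.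
move=> df bx by_ x y x' y'.
have := is_derive_lipschitz (df x' y' (x - x') (y - y')) (K := K * (`|x - x'| + `|y - y'|)) _ 0 1.
rewrite !mul0r !mul1r !addr0 !(addrC _ (_ - _)) !subrK subr0 normr1 mulr1; apply => h.
by apply: le_trans (ler_normD _ _) _; rewrite !normrM [leRHS]mulrDr; apply: lerD; apply: ler_wpM2r.
Qed.

End gradients.

Section bounded_lipschitz.
Context {R : realType}.
Implicit Types f g : R -> R -> R.

Definition bounded_lipschitz f := exists K, bounded_lipschitz_by K f.

Lemma bounded_lipschitz_by_le K K' f : K <= K' ->
  bounded_lipschitz_by K f -> bounded_lipschitz_by K' f.
Proof.
move=> KK' [b l m]; split => //.
  by move=> x y; exact: le_trans (b x y) _.
by move=> x y x' y'; apply: le_trans (l _ _ _ _) _; rewrite ler_wpM2r// addr_ge0.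
Qed.

Lemma bounded_lipschitz_cst (k : R) : bounded_lipschitz (fun _ _ => k).
Proof.
exists `|k|; split => // [x y x' y'|]; first by rewrite subrr normr0 mulr_ge0// addr_ge0.
exact: measurable_cst.
Qed.

Lemma bounded_lipschitz_swap f : bounded_lipschitz f -> bounded_lipschitz (fun x y => f y x).
Proof.
move=> [K [b l m]]; exists K; split => // [x y x' y'|]; first by rewrite (addrC `|x - x'|).
have := measurableT_comp m
  (measurable_fun_pair (@measurable_snd _ _ R R) (@measurable_fst _ _ R R)).
exact.
Qed.

Lemma bounded_lipschitzD f g : bounded_lipschitz f -> bounded_lipschitz g ->
  bounded_lipschitz (fun x y => f x y + g x y).
Proof.
move=> [K [b l m]] [K' [b' l' m']]; exists (K + K'); split.
- by move=> x y; apply: le_trans (ler_normD _ _) _; exact: lerD.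
- move=> x y x' y'; rewrite mulrDl.
  have -> : f x y + g x y - (f x' y' + g x' y') = (f x y - f x' y') + (g x y - g x' y') by ring.
  by apply: le_trans (ler_normD _ _) _; exact: lerD.
- exact: measurable_funD.
Qed.

Lemma bounded_lipschitzM f g : bounded_lipschitz f -> bounded_lipschitz g ->
  bounded_lipschitz (fun x y => f x y * g x y).
Proof.
move=> [K [b l m]] [K' [b' l' m']].
have K0 : 0 <= K by exact: le_trans (b 0 0).
have K'0 : 0 <= K' by exact: le_trans (b' 0 0).
exists (K * K' + K * K'); split.
- move=> x y; rewrite normrM; apply: (@le_trans _ _ (K * K')); first exact: ler_pM.
  by rewrite lerDl mulr_ge0.
- move=> x y x' y'; rewrite mulrDl.
  have -> : f x y * g x y - f x' y' * g x' y' =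
    f x y * (g x y - g x' y') + (f x y - f x' y') * g x' y' by ring.
  apply: le_trans (ler_normD _ _) _; rewrite !normrM; apply: lerD.
    by rewrite -mulrA ler_pM.
  by rewrite (mulrC K K') -mulrA mulrC ler_pM.
- exact: measurable_funM.
Qed.

Lemma bounded_lipschitzZ (k : R) f : bounded_lipschitz f ->
  bounded_lipschitz (fun x y => k * f x y).
Proof. by move=> nf; apply: bounded_lipschitzM => //; exact: bounded_lipschitz_cst. Qed.

Lemma bounded_lipschitzB f g : bounded_lipschitz f -> bounded_lipschitz g ->
  bounded_lipschitz (fun x y => f x y - g x y).
Proof.
move=> nf ng; have := bounded_lipschitzD nf (bounded_lipschitzZ (-1) ng).
by congr bounded_lipschitz; apply/funext => x; apply/funext => y; rewrite mulN1r.
Qed.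

End bounded_lipschitz.

Section smooth_jets.
Context {R : realType}.
Implicit Types U V : jet2 R.

Lemma exists_test_jet V : (exists K, lipschitz2 K V) -> measurable2 V ->
  bounded_lipschitz (jet_x V) -> bounded_lipschitz (jet_y V) ->
  bounded_lipschitz (jet_xx V) -> bounded_lipschitz (jet_xy V) -> bounded_lipschitz (jet_yy V) ->
  (exists K, forall x y a b, V (x + a) (y + b) <=
     V x y + jet_linear V x y a b + jet_quadratic V x y a b / 2 + K * (`|a| ^+ 3 + `|b| ^+ 3)) ->
  exists K, test_jet K V.
Proof.
move=> [K lV] mV [K1 n1] [K2 n2] [K3 n3] [K4 n4] [K5 n5] [T taylor].
pose M := Num.max K (Num.max K1 (Num.max K2 (Num.max K3 (Num.max K4 (Num.max K5 T))))).
exists M; split.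
- split => // x y x' y'; apply: le_trans (lV _ _ _ _) _; rewrite ler_wpM2r ?addr_ge0//.
  by rewrite /M le_max lexx.
- by split; [apply: bounded_lipschitz_by_le n1|apply: bounded_lipschitz_by_le n2];
    rewrite /M !le_max lexx ?orbT.
- by split; [apply: bounded_lipschitz_by_le n3|apply: bounded_lipschitz_by_le n4
    |apply: bounded_lipschitz_by_le n5]; rewrite /M !le_max lexx ?orbT.
- move=> x y a b; apply: le_trans (taylor x y a b) _; rewrite lerD2l.
  by apply: ler_wpM2r; [rewrite addr_ge0// exprn_ge0|rewrite /M !le_max lexx !orbT].
Qed.

Definition smooth_jet V : Prop :=
  [/\ measurable2 V,
      [/\ has_gradient V (jet_x V) (jet_y V), has_gradient (jet_x V) (jet_xx V) (jet_xy V) &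
          has_gradient (jet_y V) (jet_xy V) (jet_yy V)],
      bounded_lipschitz (jet_x V) /\ bounded_lipschitz (jet_y V) &
      [/\ bounded_lipschitz (jet_xx V), bounded_lipschitz (jet_xy V) &
          bounded_lipschitz (jet_yy V)]].

Lemma cube_addr_le (a b : R) : 0 <= a -> 0 <= b -> (a + b) ^+ 3 <= 4 * (a ^+ 3 + b ^+ 3).
Proof.
move=> a0 b0; rewrite -subr_ge0.
have -> : 4 * (a ^+ 3 + b ^+ 3) - (a + b) ^+ 3 = 3 * (a + b) * (a - b) ^+ 2 by ring.
by rewrite mulr_ge0 ?sqr_ge0// mulr_ge0// addr_ge0.
Qed.

Lemma jet_quadratic_dist_le V (K : R) x y x' y' a b : lipschitz2 K (jet_xx V) ->
  lipschitz2 K (jet_xy V) -> lipschitz2 K (jet_yy V) ->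
  jet_quadratic V x y a b - jet_quadratic V x' y' a b <=
    (`|a| + `|b|) ^+ 2 * (K * (`|x - x'| + `|y - y'|)).
Proof.
move=> lxx lxy lyy; apply: le_trans (ler_norm _) _.
have -> : jet_quadratic V x y a b - jet_quadratic V x' y' a b =
    a ^+ 2 * (jet_xx V x y - jet_xx V x' y') + 2 * (a * b) * (jet_xy V x y - jet_xy V x' y')
    + b ^+ 2 * (jet_yy V x y - jet_yy V x' y') by rewrite /jet_quadratic; ring.
apply: le_trans (cov_form_le _ _ _ (lxx _ _ _ _) (lxy _ _ _ _) (lyy _ _ _ _)) _.
rewrite (_ : cov_norm _ _ _ = (`|a| + `|b|) ^+ 2)//.
by rewrite /cov_norm !normrX normrM; ring.
Qed.

Lemma smooth_jet_taylor V : smooth_jet V -> exists K, forall x y a b, V (x + a) (y + b) <=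
  V x y + jet_linear V x y a b + jet_quadratic V x y a b / 2 + K * (`|a| ^+ 3 + `|b| ^+ 3).
Proof.
move=> [_ [dV dx dy] _ [[K1 n1] [K2 n2] [K3 n3]]].
pose K := Num.max K1 (Num.max K2 K3).
have [_ lxx _] : bounded_lipschitz_by K (jet_xx V).
  by apply: bounded_lipschitz_by_le n1; rewrite le_max lexx.
have [_ lxy _] : bounded_lipschitz_by K (jet_xy V).
  by apply: bounded_lipschitz_by_le n2; rewrite !le_max lexx orbT.
have [byy lyy _] : bounded_lipschitz_by K (jet_yy V).
  by apply: bounded_lipschitz_by_le n3; rewrite !le_max lexx !orbT.
have K0 : 0 <= K by exact: le_trans (byy 0 0).
exists (4 * K) => x y a b; set D := `|a| + `|b|.
have D0 : 0 <= D by rewrite addr_ge0.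
pose f h := V (x + h * a) (y + h * b); pose df h := jet_linear V (x + h * a) (y + h * b) a b.
pose ddf h := jet_quadratic V (x + h * a) (y + h * b) a b.
have f_derive (h : R) : 0 <= h <= 1 -> is_derive h 1 f (df h) by move=> _; exact: dV.
have df_derive (h : R) : 0 <= h <= 1 -> is_derive h 1 df (ddf h).
  move=> _; apply: is_derive_eq (is_derive_addf
    (is_derive_mulf (dx x y a b h) (is_derive_cst a h 1))
    (is_derive_mulf (dy x y a b h) (is_derive_cst b h 1))) _.
  by rewrite /ddf /jet_quadratic /cst; ring.
have ddf_le h : 0 <= h <= 1 -> ddf h <= jet_quadratic V x y a b + K * D ^+ 3.
  move=> /andP[h0 h1]; rewrite -lerBlDl.
  apply: le_trans (jet_quadratic_dist_le _ _ _ _ _ _ lxx lxy lyy) _.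
  rewrite [D ^+ 3]exprSr mulrCA ler_wpM2l// ler_wpM2l ?sqr_ge0//.
  by rewrite ![_ + _ * _]addrC !addrK !normrM (ger0_norm h0) -mulrDr ler_piMl.
have := taylor2_le (mulr_ge0 K0 (exprn_ge0 3 D0)) f_derive df_derive ddf_le.
rewrite /f /df !mul1r !mul0r !addr0 => /le_trans; apply; rewrite lerD2l (mulrC 4) -mulrA.
by rewrite ler_wpM2l// cube_addr_le.
Qed.

Lemma smooth_jet_test V : smooth_jet V -> exists K, test_jet K V.
Proof.
move=> sV; have [mV [dV _ _] [nx ny] [nxx nxy nyy]] := sV.
apply: exists_test_jet => //; last exact: smooth_jet_taylor.
have [[K [bx _ _]] [K' [by_ _ _]]] := (nx, ny).
exists (Num.max K K'); apply: has_gradient_lipschitz2 dV _ _ => x y.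
  by rewrite le_max bx.
by rewrite le_max by_ orbT.
Qed.

Definition jet_comb (k : R) U (l : R) V : jet2 R := Jet2
  (fun x y => k * U x y + l * V x y)
  (fun x y => k * jet_x U x y + l * jet_x V x y) (fun x y => k * jet_y U x y + l * jet_y V x y)
  (fun x y => k * jet_xx U x y + l * jet_xx V x y) (fun x y => k * jet_xy U x y + l * jet_xy V x y)
  (fun x y => k * jet_yy U x y + l * jet_yy V x y).

Lemma smooth_jet_comb (k : R) U (l : R) V : smooth_jet U -> smooth_jet V ->
  smooth_jet (jet_comb k U l V).
Proof.
move=> [mU [dU dUx dUy] [Ux Uy] [Uxx Uxy Uyy]] [mV [dV dVx dVy] [Vx Vy] [Vxx Vxy Vyy]].
split.
- by apply: measurable_funD; apply: measurable_funM => //; exact: measurable_cst.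
- by split; apply: has_gradientD; exact: has_gradientZ.
- by split; apply: bounded_lipschitzD; exact: bounded_lipschitzZ.
- by split; apply: bounded_lipschitzD; exact: bounded_lipschitzZ.
Qed.

End smooth_jets.

Section log_sqnorm.
Context {R : realType}.
Variable c : R.
Hypothesis c0 : 0 < c.

Definition shifted_sqnorm x y : R := c + x ^+ 2 + y ^+ 2.
Definition inv_sqnorm x y : R := (shifted_sqnorm x y)^-1.
Definition inv_sqnorm_mulx x y : R := x * inv_sqnorm x y.
Definition inv_sqnorm_muly x y : R := y * inv_sqnorm x y.

Lemma shifted_sqnorm_ge x y : c <= shifted_sqnorm x y.
Proof. by rewrite /shifted_sqnorm -addrA lerDl addr_ge0// sqr_ge0. Qed.

Lemma shifted_sqnorm_gt0 x y : 0 < shifted_sqnorm x y.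
Proof. exact: lt_le_trans (shifted_sqnorm_ge x y). Qed.

Let p_neq0 x y : shifted_sqnorm x y != 0. Proof. by rewrite gt_eqF// shifted_sqnorm_gt0. Qed.

Lemma inv_sqnorm_gt0 x y : 0 < inv_sqnorm x y.
Proof. by rewrite invr_gt0 shifted_sqnorm_gt0. Qed.

Lemma inv_sqnorm_le x y : inv_sqnorm x y <= c^-1.
Proof. by rewrite lef_pV2 ?posrE ?shifted_sqnorm_gt0// shifted_sqnorm_ge. Qed.

Lemma inv_sqnorm_mul_sqr_le x y :
  inv_sqnorm_mulx x y ^+ 2 + inv_sqnorm_muly x y ^+ 2 <= inv_sqnorm x y.
Proof.
have -> : inv_sqnorm_mulx x y ^+ 2 + inv_sqnorm_muly x y ^+ 2 =
    inv_sqnorm x y * ((x ^+ 2 + y ^+ 2) / shifted_sqnorm x y).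
  by rewrite /inv_sqnorm_mulx /inv_sqnorm_muly /inv_sqnorm; field.
rewrite ler_piMr ?(ltW (inv_sqnorm_gt0 _ _))// ler_pdivrMr ?shifted_sqnorm_gt0// mul1r.
by rewrite /shifted_sqnorm -addrA lerDr ltW.
Qed.

Let mulx_sqr_le x y : inv_sqnorm_mulx x y ^+ 2 <= c^-1.
Proof.
apply: le_trans (inv_sqnorm_le x y); apply: le_trans (inv_sqnorm_mul_sqr_le x y).
by rewrite lerDl sqr_ge0.
Qed.

Let mul_le x y : `|inv_sqnorm_mulx x y * inv_sqnorm_muly x y| <= c^-1.
Proof.
apply: le_trans (inv_sqnorm_le x y); apply: le_trans (inv_sqnorm_mul_sqr_le x y).
rewrite normrM -(real_normK (num_real (inv_sqnorm_mulx x y))).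
rewrite -(real_normK (num_real (inv_sqnorm_muly x y))).
by have := sqr_ge0 (`|inv_sqnorm_mulx x y| - `|inv_sqnorm_muly x y|); nra.
Qed.

Let mulx_le x y : `|inv_sqnorm_mulx x y| <= 1 + c^-1.
Proof.
have := mulx_sqr_le x y; rewrite -(real_normK (num_real _)).
by have := sqr_ge0 (`|inv_sqnorm_mulx x y| - 1); have := normr_ge0 (inv_sqnorm_mulx x y); nra.
Qed.

Lemma inv_sqnorm_mulyE x y : inv_sqnorm_muly x y = inv_sqnorm_mulx y x.
Proof. by rewrite /inv_sqnorm_mulx /inv_sqnorm /shifted_sqnorm addrAC. Qed.

Lemma has_gradient_shifted_sqnorm :
  has_gradient shifted_sqnorm (fun x _ => 2 * x) (fun _ y => 2 * y).
Proof.
have sqr : has_gradient (fun x _ : R => x * x) (fun x _ => 1 * x + x * 1)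
    (fun x _ => 0 * x + x * 0).
  exact: (has_gradientM has_gradient_fst has_gradient_fst).
have := has_gradientD (has_gradientD (has_gradient_cst c) sqr) (has_gradient_swap sqr).
by apply: has_gradient_eq => x y; ring.
Qed.

Lemma has_gradient_inv_sqnorm : has_gradient inv_sqnorm
  (fun x y => -2 * (inv_sqnorm_mulx x y * inv_sqnorm x y))
  (fun x y => -2 * (inv_sqnorm_muly x y * inv_sqnorm x y)).
Proof.
have := has_gradientV p_neq0 has_gradient_shifted_sqnorm; apply: has_gradient_eq => x y.
  by rewrite /inv_sqnorm_mulx /inv_sqnorm; field.
by rewrite /inv_sqnorm_muly /inv_sqnorm; field.
Qed.

Lemma has_gradient_inv_sqnorm_mulx : has_gradient inv_sqnorm_mulx
  (fun x y => inv_sqnorm x y - 2 * (inv_sqnorm_mulx x y * inv_sqnorm_mulx x y))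
  (fun x y => -2 * (inv_sqnorm_mulx x y * inv_sqnorm_muly x y)).
Proof.
have := has_gradientM has_gradient_fst has_gradient_inv_sqnorm; apply: has_gradient_eq => x y.
  by rewrite /inv_sqnorm_mulx; ring.
by rewrite /inv_sqnorm_mulx /inv_sqnorm_muly; ring.
Qed.

Lemma has_gradient_inv_sqnorm_muly : has_gradient inv_sqnorm_muly
  (fun x y => -2 * (inv_sqnorm_mulx x y * inv_sqnorm_muly x y))
  (fun x y => inv_sqnorm x y - 2 * (inv_sqnorm_muly x y * inv_sqnorm_muly x y)).
Proof.
have -> : inv_sqnorm_muly = fun x y => inv_sqnorm_mulx y x.
  by apply/funext => x; apply/funext => y; exact: inv_sqnorm_mulyE.
apply: has_gradient_eq (has_gradient_swap has_gradient_inv_sqnorm_mulx) => x y.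
  by rewrite inv_sqnorm_mulyE mulrC (mulrC (inv_sqnorm_mulx y x)) mulrC.
by rewrite /inv_sqnorm /shifted_sqnorm addrAC.
Qed.

Lemma measurable_shifted_sqnorm : measurable2 shifted_sqnorm.
Proof.
apply: measurable_funD; last by apply: measurable_funX; exact: measurable_snd.
apply: measurable_funD; first exact: measurable_cst.
by apply: measurable_funX; exact: measurable_fst.
Qed.

Let measurable_inv_sqnorm : measurable2 inv_sqnorm.
Proof. by apply: measurableT_comp; [exact: measurable_invr|exact: measurable_shifted_sqnorm]. Qed.

Lemma bounded_lipschitz_inv_sqnorm : bounded_lipschitz inv_sqnorm.
Proof.
have cV : 0 < c^-1 by rewrite invr_gt0.
have muly_le x y : `|inv_sqnorm_muly x y| <= 1 + c^-1 by rewrite inv_sqnorm_mulyE.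
have bound u x y : `|u| <= 1 + c^-1 -> `|-2 * (u * inv_sqnorm x y)| <= 2 * (1 + c^-1) * c^-1.
  move=> uc; rewrite normrM normrN (@ger0_norm _ 2)// -mulrA ler_pM2l// normrM.
  by apply: ler_pM => //; rewrite gtr0_norm ?inv_sqnorm_gt0 ?inv_sqnorm_le.
exists (2 * (1 + c^-1) * c^-1); split => //.
  move=> x y; rewrite gtr0_norm ?inv_sqnorm_gt0//; apply: le_trans (inv_sqnorm_le x y) _.
  by nra.
by apply: has_gradient_lipschitz2 has_gradient_inv_sqnorm _ _ => x y; exact: bound.
Qed.

Lemma bounded_lipschitz_inv_sqnorm_mulx : bounded_lipschitz inv_sqnorm_mulx.
Proof.
have cV : 0 < c^-1 by rewrite invr_gt0.
exists (1 + 3 * c^-1); split.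
- by move=> x y; apply: le_trans (mulx_le x y) _; lra.
- apply: has_gradient_lipschitz2 has_gradient_inv_sqnorm_mulx _ _ => x y.
    apply: le_trans (ler_normB _ _) _; rewrite gtr0_norm ?inv_sqnorm_gt0//.
    rewrite normrM (@ger0_norm _ 2)// -expr2 ger0_norm ?sqr_ge0//.
    by have := inv_sqnorm_le x y; have := mulx_sqr_le x y; lra.
  by rewrite normrM normrN (@ger0_norm _ 2)//; have := mul_le x y; lra.
- by apply: measurable_funM => //; exact: measurable_fst.
Qed.

Lemma bounded_lipschitz_inv_sqnorm_muly : bounded_lipschitz inv_sqnorm_muly.
Proof.
have := bounded_lipschitz_swap bounded_lipschitz_inv_sqnorm_mulx; congr bounded_lipschitz.
by apply/funext => x; apply/funext => y; rewrite inv_sqnorm_mulyE.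
Qed.

Definition log_sqnorm : jet2 R := Jet2
  (fun x y => ln (shifted_sqnorm x y))
  (fun x y => 2 * inv_sqnorm_mulx x y) (fun x y => 2 * inv_sqnorm_muly x y)
  (fun x y => 2 * (inv_sqnorm x y - 2 * (inv_sqnorm_mulx x y * inv_sqnorm_mulx x y)))
  (fun x y => 2 * (-2 * (inv_sqnorm_mulx x y * inv_sqnorm_muly x y)))
  (fun x y => 2 * (inv_sqnorm x y - 2 * (inv_sqnorm_muly x y * inv_sqnorm_muly x y))).

Lemma smooth_log_sqnorm : smooth_jet log_sqnorm.
Proof.
have nr := bounded_lipschitz_inv_sqnorm; have nx := bounded_lipschitz_inv_sqnorm_mulx.
have ny := bounded_lipschitz_inv_sqnorm_muly.
split.
- by apply: measurableT_comp; [exact: measurable_ln|exact: measurable_shifted_sqnorm].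
- split; [|exact: has_gradientZ has_gradient_inv_sqnorm_mulx
    |exact: has_gradientZ has_gradient_inv_sqnorm_muly].
  apply: has_gradient_eq (has_gradient_ln shifted_sqnorm_gt0 has_gradient_shifted_sqnorm) => x y.
    by rewrite /= /inv_sqnorm_mulx mulrA.
  by rewrite /= /inv_sqnorm_muly mulrA.
- by split; exact: bounded_lipschitzZ.
- by split; apply: bounded_lipschitzZ;
    [apply: bounded_lipschitzB => //| |apply: bounded_lipschitzB => //];
    apply: bounded_lipschitzZ; exact: bounded_lipschitzM.
Qed.

End log_sqnorm.

(** * Avoidance of the origin *)

Section barrier.
Context {R : realType}.
Variable e : R.
Hypothesis e0 : 0 < e.
Implicit Types x y : R.

Let e1 : 0 < 1 + e. Proof. by rewrite addr_gt0. Qed.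

Definition barrier : jet2 R := jet_comb 2^-1 (log_sqnorm (1 + e)) (- 2^-1) (log_sqnorm e).

Lemma test_barrier : exists K, test_jet K barrier.
Proof. by apply/smooth_jet_test/smooth_jet_comb; exact: smooth_log_sqnorm. Qed.

Lemma barrierE x y : barrier x y = ln (1 + (e + (x ^+ 2 + y ^+ 2))^-1) / 2.
Proof.
have q0 : 0 <= x ^+ 2 + y ^+ 2 by rewrite addr_ge0// sqr_ge0.
have p0 : 0 < e + (x ^+ 2 + y ^+ 2) by apply: ltr_pwDl.
have -> : 1 + (e + (x ^+ 2 + y ^+ 2))^-1 =
    (1 + e + x ^+ 2 + y ^+ 2) / (e + x ^+ 2 + y ^+ 2).
  by rewrite -!addrA; field; rewrite gt_eqF.
rewrite ln_div ?posrE; last 2 first.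
- by rewrite -!addrA addr_gt0.
- by rewrite -addrA.
by rewrite /barrier /= /shifted_sqnorm; field.
Qed.

Lemma barrier_ge0 x y : 0 <= barrier x y.
Proof.
rewrite barrierE divr_ge0// ln_ge0// lerDl invr_ge0 addr_ge0 ?(ltW e0)//.
by rewrite addr_ge0// sqr_ge0.
Qed.

Lemma barrier_ge x y : x ^+ 2 + y ^+ 2 <= e -> ln (1 + (2 * e)^-1) / 2 <= barrier x y.
Proof.
have q0 : 0 <= x ^+ 2 + y ^+ 2 by rewrite addr_ge0// sqr_ge0.
have p0 : 0 < e + (x ^+ 2 + y ^+ 2) by apply: ltr_pwDl.
move=> qe; rewrite barrierE ler_pM2r ?invr_gt0//.
have i0 : 0 < (2 * e)^-1 by rewrite invr_gt0 mulr_gt0.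
have j0 : 0 < 1 + (e + (x ^+ 2 + y ^+ 2))^-1 by rewrite addr_gt0 ?invr_gt0.
have l0 : 0 < 1 + (2 * e)^-1 by rewrite addr_gt0.
rewrite ler_ln ?posrE// lerD2l lef_pV2 ?posrE//; last by rewrite mulr_gt0.
by have := qe; lra.
Qed.

Lemma barrier_le x y (c : R) : 0 < c -> c <= x ^+ 2 + y ^+ 2 -> barrier x y <= ln (1 + c^-1) / 2.
Proof.
move=> c0 cq; have p0 : 0 < e + (x ^+ 2 + y ^+ 2) by have := e0; lra.
rewrite barrierE ler_pM2r ?invr_gt0//.
have j0 : 0 < 1 + (e + (x ^+ 2 + y ^+ 2))^-1 by rewrite addr_gt0 ?invr_gt0.
have l0 : 0 < 1 + c^-1 by rewrite addr_gt0 ?invr_gt0.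
rewrite ler_ln ?posrE// lerD2l lef_pV2 ?posrE//.
by have := e0; lra.
Qed.

Lemma inv_sqnorm_succB x y :
  inv_sqnorm e x y - inv_sqnorm (1 + e) x y = inv_sqnorm e x y * inv_sqnorm (1 + e) x y.
Proof.
have p0 := shifted_sqnorm_gt0 e0 x y; have p1 := shifted_sqnorm_gt0 e1 x y.
rewrite /inv_sqnorm -[shifted_sqnorm (1 + e) x y]/(1 + e + x ^+ 2 + y ^+ 2) in p1 *.
rewrite (_ : 1 + e + x ^+ 2 + y ^+ 2 = 1 + shifted_sqnorm e x y) in p1 *; last first.
  by rewrite /shifted_sqnorm; ring.
by field; rewrite !gt_eqF.
Qed.

Lemma barrier_generatorE (s11 s12 s22 x y dx dy : R) :
  let r := inv_sqnorm e x y in let s := inv_sqnorm (1 + e) x y in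
  jet_linear barrier x y dx dy + diffusion s11 s12 s22 barrier x y / 2 =
  - (r * s * (x * dx + y * dy + (s11 + s22) / 2
              - (s11 * x ^+ 2 + 2 * s12 * x * y + s22 * y ^+ 2) * (s + r))).
Proof.
move=> r s; rewrite /r /s -inv_sqnorm_succB.
by rewrite /jet_linear /diffusion /= /inv_sqnorm_mulx /inv_sqnorm_muly; field.
Qed.

Lemma barrier_generator_le (s11 s12 s22 x y dx dy k : R) : 0 <= k ->
  k <= x * dx + y * dy + (s11 + s22) / 2 ->
  s11 * x ^+ 2 + 2 * s12 * x * y + s22 * y ^+ 2 <= k * (x ^+ 2 + y ^+ 2) ->
  jet_linear barrier x y dx dy + diffusion s11 s12 s22 barrier x y / 2 <= k.
Proof.
move=> k0 drift quad; rewrite barrier_generatorE.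
set q := x ^+ 2 + y ^+ 2 in quad.
set r := inv_sqnorm e x y; set s := inv_sqnorm (1 + e) x y.
have q0 : 0 <= q by rewrite addr_ge0// sqr_ge0.
have r0 : 0 <= r by rewrite ltW// inv_sqnorm_gt0.
have s0 : 0 <= s by rewrite ltW// inv_sqnorm_gt0.
have s1 : s <= 1.
  by apply: le_trans (inv_sqnorm_le e1 x y) _; rewrite invf_le1// lerDl ltW.
have qr1 : q * r <= 1.
  rewrite ler_pdivrMr ?shifted_sqnorm_gt0// mul1r /shifted_sqnorm -addrA lerDr.
  exact: ltW.
set A := x * dx + y * dy + (s11 + s22) / 2 in drift *.
set Q := s11 * x ^+ 2 + 2 * s12 * x * y + s22 * y ^+ 2 in quad *.
have lower : - (k * q * s) <= A - Q * (s + r).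
  have : Q * (s + r) <= k * q * (s + r) by rewrite ler_wpM2r// addr_ge0.
  have : k * (q * r) <= k by rewrite ler_piMr.
  by lra.
have := ler_wpM2l (mulr_ge0 r0 s0) lower.
have : r * s * (k * q * s) <= k.
  have -> : r * s * (k * q * s) = k * ((q * r) * (s * s)) by ring.
  by rewrite ler_piMr// mulr_ile1 ?mulr_ge0// mulr_ile1.
by lra.
Qed.

End barrier.

Section barrier_level.
Context {R : realType}.

Definition barrier_level (j : nat) : R := ln (1 + (2 * j.+1%:R^-1)^-1) / 2.

Lemma barrier_level_gt0 j : 0 < barrier_level j.
Proof. by rewrite divr_gt0// ln_gt0// ltrDl invr_gt0 mulr_gt0// invr_gt0. Qed.

Lemma div_barrier_level_cvg (k : R) : 0 <= k -> (fun j => k / barrier_level j) @ \oo --> 0.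
Proof.
move=> k0; apply/cvgrPdist_le => eps eps0.
near=> j; have level0 := barrier_level_gt0 j.
have ratio0 : 0 <= k / barrier_level j by rewrite divr_ge0// ltW.
rewrite sub0r normrN (ger0_norm ratio0) ler_pdivrMr// -ler_pdivrMl//.
rewrite /barrier_level ler_pdivlMr// -[leLHS]expRK ler_ln ?posrE ?expR_gt0//.
rewrite invfM invrK.
have : expR (eps^-1 * k * 2) * 2 <= j%:R by near: j; exact: nbhs_infty_ger.
by rewrite -[j.+1%:R]natr1; lra.
Unshelve. all: by end_near. Qed.

End barrier_level.

Section liminf_set.
Context {d : measure_display} {Omega : measurableType d} {R : realType}.
Variable P : probability Omega R.
Implicit Types A : nat -> set Omega.

Definition liminf_set A : set Omega := \bigcup_i \bigcap_(n in [set n | (i <= n)%N]) A n.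

Lemma near_liminf_set A w : (\forall n \near \oo, A n w) -> liminf_set A w.
Proof. by move=> [i _ iA]; exists i. Qed.

Let measurable_tail A i : (forall n, measurable (A n)) ->
  measurable (\bigcap_(n in [set n | (i <= n)%N]) A n).
Proof. by move=> mA; apply: bigcap_measurable => //; exists i => /=. Qed.

Lemma measurable_liminf_set A : (forall n, measurable (A n)) -> measurable (liminf_set A).
Proof. by move=> mA; apply: bigcup_measurable => i _; exact: measurable_tail. Qed.

Lemma liminf_set_le A c : (forall n, measurable (A n)) -> (forall n, (P (A n) <= c)%E) ->
  (P (liminf_set A) <= c)%E.
Proof.
move=> mA Ac; have nd : nondecreasing_seq (fun i => \bigcap_(n in [set n | (i <= n)%N]) A n).
  by move=> i i' ii'; apply/subsetPset => w Aw n /= i'n; apply: Aw => /=; exact: leq_trans i'n.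
have lim := nondecreasing_cvg_mu (mu := P) (fun i => measurable_tail i mA)
  (measurable_liminf_set mA) nd.
move: (lim) => /cvg_lim <-//; apply: lime_le; first by apply/cvg_ex; eexists; exact: lim.
apply: nearW => i /=; apply: le_trans (Ac i).
apply: le_measure; rewrite ?inE//; first exact: measurable_tail.
by move=> w; apply => /=.
Qed.

Lemma ae_not_liminf_set (A_ : nat -> nat -> set Omega) (c : nat -> R) :
  (forall j n, measurable (A_ j n)) -> (forall j n, (P (A_ j n) <= (c j)%:E)%E) ->
  c @ \oo --> 0 -> {ae P, forall w, exists j, ~ liminf_set (A_ j) w}.
Proof.
move=> mA Ac c0.
have mlim j : measurable (liminf_set (A_ j)) by exact: measurable_liminf_set.
have mall : measurable (\bigcap_j liminf_set (A_ j)) by exact: bigcapT_measurable.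
exists (\bigcap_j liminf_set (A_ j)); split => //.
- apply/eqP; rewrite eq_le measure_ge0 andbT.
  rewrite -(fineK (fin_num_measure P _ mall)) lee_fin.
  apply: cvgr_to_ge c0 _; apply: nearW => j.
  rewrite -lee_fin fineK ?fin_num_measure//; apply: le_trans (liminf_set_le (mA j) (Ac j)).
  by apply: le_measure; rewrite ?inE//; exact: bigcap_inf.
- by move=> w /= /forallNP allA j _; exact: contrapT (allA j).
Qed.

End liminf_set.

Section avoidance.
Context {R : realType} {d : measure_display} {Omega : measurableType d}.
Variable P : probability Omega R.
Variables (F : R -> set (set Omega)) (rho : R) (B C : R -> Omega -> R).
Hypotheses (uF : usual_filtration P F) (rho1 : -1 <= rho <= 1) (bm : correlated_BM P F rho B C).
Notation E f := (Rintegral P setT f).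
Notation mu := (@lebesgue_measure R).

Variables (l1 m1 l2 m2 k : R) (U1 U2 : R -> Omega -> R).
Local Notation M1 := (BM_comb B C l1 m1).
Local Notation M2 := (BM_comb B C l2 m2).
Local Notation s11 := (BM_var rho l1 m1).
Local Notation s12 := (BM_cov rho l1 m1 l2 m2).
Local Notation s22 := (BM_var rho l2 m2).

Definition drift_path w := exists dx dy : R -> R,
  [/\ forall T, increasing_drift (U1^~ w) (M1^~ w) dx 0 T,
      forall T, increasing_drift (U2^~ w) (M2^~ w) dy 0 T &
      {ae mu, forall r, 0 <= r ->
        k <= U1 r w * dx r + U2 r w * dy r + (s11 + s22) / 2 /\
        s11 * U1 r w ^+ 2 + 2 * s12 * U1 r w * U2 r w + s22 * U2 r w ^+ 2
          <= k * (U1 r w ^+ 2 + U2 r w ^+ 2)}].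

Hypotheses (k0 : 0 <= k) (aU1 : adapted F U1) (aU2 : adapted F U2).
Hypothesis iU1 : forall T, 0 <= T ->
  P.-integrable setT (EFin \o (fun w => U1 T w - U1 0 w - M1 T w)).
Hypothesis iU2 : forall T, 0 <= T ->
  P.-integrable setT (EFin \o (fun w => U2 T w - U2 0 w - M2 T w)).
Hypothesis path : {ae P, forall w, [/\ continuous (fun r : R => U1 (Num.max r 0) w),
     continuous (fun r : R => U2 (Num.max r 0) w) & drift_path w]}.

Let fF : filtration F := usual_filtration_filtration uF.
Let sF t : 0 <= t -> sigma_algebra setT (F t) := @usual_sigma_algebra _ _ _ _ _ uF t.

Definition sqnorm t w : R := U1 t w ^+ 2 + U2 t w ^+ 2.

Let V e t w := barrier e (U1 t w) (U2 t w).

Let ito_path_barrier e s t w : 0 < e -> 0 <= s -> s <= t -> drift_path w ->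
  ito_path rho (barrier e) l1 m1 l2 m2 s t (U1^~ w) (U2^~ w) (M1^~ w) (M2^~ w) (k * (t - s)).
Proof.
move=> e0 s0 st [dx [dy [Dx Dy drift]]].
exists dx, dy, (fun=> k); split.
- exact: increasing_driftS (Dx t).
- exact: increasing_driftS (Dy t).
- exact: itv_integrable_cst.
- apply: (ae_imply _ drift) => r driftr /andP[sr _].
  have [drift_ge quadratic_le] := driftr (le_trans s0 sr).
  exact: barrier_generator_le.
- by rewrite itv_integral_cst.
Qed.

Lemma barrier_supermartingale e s t (phi : Omega -> R) : 0 < e -> 0 <= s -> s < t ->
  G_measurable (F s) phi -> (forall w, 0 <= phi w <= 1) ->
  P.-integrable setT (EFin \o (fun w => phi w * (V e t w - V e s w))) /\
  E (fun w => phi w * (V e t w - V e s w)) <= k * (t - s).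
Proof.
move=> e0 s0 st gphi phi01; have t0 : 0 <= t by exact: le_trans (ltW st).
have [K tV] := test_barrier e0.
have kst : 0 <= k * (t - s) by rewrite mulr_ge0// subr_ge0 ltW.
have icst := probability_integrable_cst P.
have iD (U M : R -> Omega -> R) : (forall T, 0 <= T ->
     P.-integrable setT (EFin \o (fun w => U T w - U 0 w - M T w))) ->
   P.-integrable setT (EFin \o (fun w => U t w - U s w - (M t w - M s w))).
  move=> iU; have := integrableB_EFin measurableT (iU t t0) (iU s s0).
  by apply: eq_integrable => // w _ /=; congr EFin; ring.
have ito : {ae P, forall w, [/\ continuous (fun r : R => U1 (Num.max r 0) w),
    continuous (fun r : R => U2 (Num.max r 0) w) &
    ito_path rho (barrier e) l1 m1 l2 m2 s t (U1^~ w) (U2^~ w) (M1^~ w) (M2^~ w) (k * (t - s))]}.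
  apply: (ae_imply _ path) => w [c1 c2 dp]; split => //.
  exact: ito_path_barrier (ltW st) dp.
split; first exact: (dynkin_integrable uF rho1 bm tV s0 st aU1 aU2 (iD _ _ iU1) (iD _ _ iU2) ito).
apply: le_trans (dynkin_formula uF rho1 bm tV s0 st aU1 aU2 (icst _) (iD _ _ iU1) (iD _ _ iU2)
  ito gphi phi01) _.
have phi_le w : 0 <= phi w * (k * (t - s)) <= k * (t - s).
  by have /andP[p0 p1] := phi01 w; rewrite mulr_ge0// ler_piMl.
rewrite -[leRHS](probability_Rintegral_cst P); apply: le_Rintegral => // [|w _];
  last by case/andP: (phi_le w).
apply: (@le_integrable_EFin _ _ _ P setT _ (fun=> k * (t - s))) => //.
  by apply: measurable_funM => //; exact: (usual_measurable_fun uF s0 gphi).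
by move=> w _; have /andP[ge0 le] := phi_le w; rewrite ger0_norm.
Qed.

Section grid_maximal.
Variables (s T e c : R) (A : set Omega) (c1 : R) (n : nat).
Hypotheses (s0 : 0 <= s) (sT : s < T) (e0 : 0 < e) (c0 : 0 < c) (FA : F s A).
Hypothesis Vs : forall w, A w -> V e s w <= c1.
Hypothesis c10 : 0 <= c1.

Let g i := grid s T n i.
Let g0 i : 0 <= g i. Proof. exact: le_trans (grid_ge (ltW sT) _ _). Qed.
Let g_lt i : g i < g i.+1.
Proof. by rewrite /g gridS ltrDl divr_gt0// subr_gt0. Qed.

Fixpoint below_level (i : nat) : set Omega :=
  (if i is i'.+1 then below_level i' else A) `&` [set w | V e (g i) w < c].

Definition grid_hits : set Omega :=
  A `&` [set w | exists2 i, (i <= n.+1)%N & c <= V e (g i) w].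

Let below_level_le i j w : (i <= j)%N -> below_level j w -> below_level i w.
Proof. by move=> /subnK <-; elim: (j - i)%N => // m IH; rewrite addSn => -[/IH]. Qed.

Let below_level_sub i : below_level i `<=` A.
Proof. by move=> w /(below_level_le (leq0n i))[]. Qed.

Lemma grid_hitsE : grid_hits = A `\` below_level n.+1.
Proof.
apply/seteqP; split=> w [Aw hit]; split => //.
  move=> /below_level_le below; case: hit => i ni.
  by case: i ni => [|i] /below[_ /= Vi]; rewrite leNgt Vi.
apply: contrapT => nohit; apply: hit.
have Vlt i : (i <= n.+1)%N -> V e (g i) w < c.
  by move=> ni; rewrite ltNge; apply/negP => Vi; apply: nohit; exists i.
elim: n.+1 Vlt => [|i IH] Vlt; split; rewrite /= ?Vlt//.
by apply: IH => j ji; exact/Vlt/leqW.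
Qed.

Let gV i : G_measurable (F (g i)) (V e (g i)).
Proof.
have [K [[_ mV] _ _ _]] := test_barrier e0.
exact: (G_measurable_comp2 (sF (g0 i)) mV (aU1 (g0 i)) (aU2 (g0 i))).
Qed.

Let F_below i : F (g i) [set w | V e (g i) w < c].
Proof.
have := gV i (measurable_itv `]-oo, c[).
by congr (F (g i)); apply/seteqP; split => w; rewrite /= in_itv.
Qed.

Let F_below_level i : F (g i) (below_level i).
Proof.
elim: i => [|i IH]; apply: (sigma_algebraI (sF (g0 _))) => //; first by rewrite /g grid0.
exact: (fF.2 _ _ (g0 i) (ltW (g_lt i)) _ IH).
Qed.

Let measurable_below_level i : measurable (below_level i).
Proof. exact: (usual_sub_measurable uF (g0 i) (F_below_level i)). Qed.

Let measurableA : measurable A. Proof. exact: (usual_sub_measurable uF s0 FA). Qed.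

Lemma measurable_grid_hits : measurable grid_hits.
Proof. by rewrite grid_hitsE; exact: measurableD. Qed.

(* The barrier along the grid, frozen at [c] from the first time it reaches [c], on [A]. *)
Let stopped_barrier i w : R := if w \in below_level i then V e (g i) w else c * \1_A w.

Let V0 t w : 0 <= V e t w. Proof. exact: barrier_ge0. Qed.

Let stopped_barrier_ge0 i w : 0 <= stopped_barrier i w.
Proof. by rewrite /stopped_barrier; case: ifP => // _; rewrite mulr_ge0 ?indicE// ltW. Qed.

Let stopped_barrier_step i w : stopped_barrier i.+1 w <=
  stopped_barrier i w + \1_(below_level i) w * (V e (g i.+1) w - V e (g i) w).
Proof.
rewrite /stopped_barrier [\1_(below_level i) w]indicE.
case: (boolP (w \in below_level i)) => [/set_mem below|/negP nbelow].
  rewrite mul1r addrC subrK; case: ifPn => // /negP nbelow'.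
  rewrite indicE mem_set ?mulr1; last exact: below_level_sub below.
  by rewrite leNgt; apply/negP => Vc; apply: nbelow'; apply/mem_set.
rewrite mul0r addr0 ifF//; apply/negP => /set_mem[below _].
by apply: nbelow; apply/mem_set.
Qed.

Let stopped_barrier0_le w : stopped_barrier 0 w <= c1.
Proof.
rewrite /stopped_barrier /= /g grid0; case: ifPn => [/set_mem[Aw _]|]; first exact: Vs.
rewrite indicE; case: (boolP (w \in A)) => [/set_mem Aw|_ _]; last by rewrite mulr0.
move=> /negP nbelow; rewrite mulr1; apply: le_trans (Vs Aw); rewrite leNgt; apply/negP => Vc.
by apply: nbelow; apply/mem_set; split; rewrite //= /g grid0.
Qed.

Let measurable_stopped_barrier i : measurable_fun setT (stopped_barrier i).
Proof.
have FiA : F (g i) A by apply: (fF.2 _ _ s0 _ A FA); exact: grid_ge (ltW sT) _ _.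
apply: (usual_measurable_fun uF (g0 i)); apply: (G_measurable_if (sF (g0 i))) => //.
apply: (G_measurableZ (sF (g0 i))); apply: (G_measurable_indic (sF (g0 i))).
exact: FiA.
Qed.

Let stopped_barrier_integral_le i : P.-integrable setT (EFin \o stopped_barrier i) /\
  E (stopped_barrier i) <= c1 + k * (g i - s).
Proof.
elim: i => [|i [IHi IHe]].
  have ic1 := probability_integrable_cst P c1.
  have i0 : P.-integrable setT (EFin \o stopped_barrier 0).
    by apply: (le_integrable_EFin _ _ _ ic1) => // w _; rewrite ger0_norm.
  split => //; rewrite /g grid0 subrr mulr0 addr0 -[leRHS](probability_Rintegral_cst P).
  exact: (le_Rintegral _ i0 ic1).
have ind01 w : 0 <= (\1_(below_level i) w : R) <= 1.
  by rewrite indicE; case: (_ \in _); rewrite /= ?lexx ?ler01.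
have [istep step_le] := barrier_supermartingale e0 (g0 i) (g_lt i)
  (G_measurable_indic (sF (g0 i)) (F_below_level i)) ind01.
have isum := integrableD_EFin measurableT IHi istep.
have inext : P.-integrable setT (EFin \o stopped_barrier i.+1).
  by apply: (le_integrable_EFin _ _ _ isum) => // w _; rewrite ger0_norm.
split => //; apply: le_trans (le_Rintegral _ inext isum _) _ => //.
by rewrite RintegralD//; lra.
Qed.

Lemma grid_hits_le : (P grid_hits <= ((c1 + k * (T - s)) / c)%:E)%E.
Proof.
have [istop stop_le] := stopped_barrier_integral_le n.+1; rewrite /g grid_last in stop_le.
have ihits : P.-integrable setT (EFin \o (\1_grid_hits : Omega -> R)).
  by apply: integrable_indic => //; exact: measurable_grid_hits.
have -> : P grid_hits = (E (\1_grid_hits : Omega -> R))%:E.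
  by rewrite -integral_EFin_Rintegral// integral_indic ?setIT//; exact: measurable_grid_hits.
rewrite lee_fin ler_pdivlMr// mulrC -RintegralZl//; apply: le_trans stop_le.
apply: le_Rintegral => //; first exact: integrableZ_EFin.
move=> w _; case: (boolP (w \in grid_hits)) => [|_].
  rewrite grid_hitsE => /set_mem[Aw nbelow].
  by rewrite memNset//= indicE mem_set.
by rewrite mulr0; exact: stopped_barrier_ge0.
Qed.

End grid_maximal.

Let near_grid_small (q : R -> R) s T t e : 0 <= s -> continuous (fun r : R => q (Num.max r 0)) ->
  s <= t <= T -> q t = 0 -> 0 < e ->
  \forall n \near \oo, exists2 i, (i <= n.+1)%N & q (grid s T n i) <= e.
Proof.
move=> s0 cq tsT qt0 e0; have sT : s <= T by case/andP: tsT => /le_trans; apply.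
have [h h0 osc] := max0_unif_continuous T cq s0 e0.
near=> n; have [i ni ti] := exists_grid_near sT n tsT; exists i => //.
have close : `|t - grid s T n i| < h by apply: le_lt_trans ti _; near: n; exact: mesh_lt.
have gsT : s <= grid s T n i <= T by rewrite grid_ge// grid_le.
have := osc _ _ tsT gsT close; rewrite qt0 sub0r normrN => /ltW; exact: le_trans (ler_norm _).
Unshelve. all: by end_near. Qed.

Let continuous_sqnorm w : continuous (fun r : R => U1 (Num.max r 0) w) ->
  continuous (fun r : R => U2 (Num.max r 0) w) ->
  continuous (fun r : R => sqnorm (Num.max r 0) w).
Proof.
move=> cU1 cU2 r; rewrite /sqnorm; apply: cvgD.
  by apply: (@continuous_comp _ _ _ _ (fun x : R => x ^+ 2)); [exact: cU1|exact: exprn_continuous].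
by apply: (@continuous_comp _ _ _ _ (fun x : R => x ^+ 2)); [exact: cU2|exact: exprn_continuous].
Qed.

Let G_measurable_sqnorm s : 0 <= s -> G_measurable (F s) (sqnorm s).
Proof.
move=> s0; apply: (G_measurable_comp2 (sF s0) (f := fun x y => x ^+ 2 + y ^+ 2)).
- by apply: measurable_funD; apply: measurable_funX; [exact: measurable_fst|exact: measurable_snd].
- exact: aU1.
- exact: aU2.
Qed.

Lemma ae_sqnorm_neq0 s T m : 0 <= s -> s < T ->
  {ae P, forall w, m.+1%:R^-1 <= sqnorm s w -> forall t, s <= t <= T -> sqnorm t w != 0}.
Proof.
move=> s0 sT; pose A := [set w | m.+1%:R^-1 <= sqnorm s w].
have FA : F s A.
  have := G_measurable_sqnorm s0 (measurable_itv `[m.+1%:R^-1, +oo[).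
  by congr F; apply/seteqP; split => w; rewrite /A /= in_itv/= andbT.
have e0 (j : nat) : (0 : R) < j.+1%:R^-1 by rewrite invr_gt0.
pose c1 : R := ln (1 + (m.+1%:R^-1)^-1) / 2.
have c10 : 0 <= c1 by rewrite divr_ge0// ln_ge0// lerDl invr_ge0 invr_ge0.
have Vs j w : A w -> V j.+1%:R^-1 s w <= c1.
  by move=> Aw; apply: barrier_le => //; rewrite invr_gt0.
pose hits j n := grid_hits s T j.+1%:R^-1 (barrier_level j) A n.
have hits_le j n : (P (hits j n) <= ((c1 + k * (T - s)) / barrier_level j)%:E)%E.
  exact: (grid_hits_le n s0 sT (e0 j) (barrier_level_gt0 j) FA (Vs j) c10).
have mhits j n : measurable (hits j n) by exact: (measurable_grid_hits _ _ s0 sT (e0 j) FA).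
have bound0 : 0 <= c1 + k * (T - s) by rewrite addr_ge0// mulr_ge0// subr_ge0 ltW.
apply: (ae_imply2 _ path (ae_not_liminf_set mhits hits_le (div_barrier_level_cvg bound0))).
move=> w [cU1 cU2 _] [j nohit] Aw t tsT; apply/negP => /eqP qt0; apply: nohit.
apply: near_liminf_set.
have := near_grid_small (q := sqnorm^~ w) s0 (continuous_sqnorm cU1 cU2) tsT qt0 (e0 j).
apply: filterS => n [i ni small].
by split => //; exists i => //; exact: (barrier_ge (e0 j) small).
Qed.

Theorem avoid_zero s : 0 <= s ->
  {ae P, forall w, 0 < sqnorm s w -> forall t, s <= t -> sqnorm t w != 0}.
Proof.
move=> s0.
have : {ae P, forall w, forall i m : nat, m.+1%:R^-1 <= sqnorm s w ->
    forall t, s <= t <= s + i.+1%:R -> sqnorm t w != 0}.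
  apply: ae_foralln => i; apply: ae_foralln => m; apply: ae_sqnorm_neq0 => //.
  by rewrite ltrDl.
apply: ae_imply => w h q0 t st.
pose m := Num.truncn (sqnorm s w)^-1.
pose i := Num.truncn (t - s).
apply: (h i m); last first.
  by rewrite st/= -lerBlDl ltW// truncnS_gt.
rewrite -[leRHS]invrK lef_pV2 ?posrE ?invr_gt0//.
by rewrite ltW// truncnS_gt.
Qed.
End avoidance.

(** * Bessel processes started at the origin *)

Section xlog.
Context {R : realType}.
Implicit Types u v : R.

Definition jet_fst (f f1 f2 : R -> R) : jet2 R := Jet2 (fun x _ => f x)
  (fun x _ => f1 x) (fun _ _ => 0) (fun x _ => f2 x) (fun _ _ => 0) (fun _ _ => 0).

Lemma bounded_lipschitz_fst (f : R -> R) (K L : R) : (forall x, `|f x| <= K) ->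
  (forall x y, `|f x - f y| <= L * `|x - y|) -> measurable_fun setT f ->
  bounded_lipschitz (fun x _ => f x).
Proof.
move=> bf lf mf; have K0 : 0 <= K by exact: le_trans (bf 0).
have L0 : 0 <= L.
  by apply: le_trans (normr_ge0 _) _; have := lf 1 0; rewrite subr0 normr1 mulr1; exact.
exists (K + L); split => [x y|x y x' y'|].
- by apply: le_trans (bf x) _; rewrite lerDl.
- by apply: le_trans (lf _ _) _; apply: ler_pM; rewrite ?lerDl ?lerDr.
- by apply: measurableT_comp => //; exact: measurable_fst.
Qed.

Lemma bounded_lipschitz_posinv (c : R) : 0 < c -> bounded_lipschitz (fun x _ => posinv c x).
Proof.
move=> c0; apply: (bounded_lipschitz_fst (K := c^-1) (L := c^-1 * c^-1)).
- by move=> x; rewrite gtr0_norm ?posinv_gt0 ?posinv_le.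
- exact: posinv_lipschitz.
- exact: measurable_posinv.
Qed.

Definition poslog (b u : R) : R := ln (1 + posinv b u).

Variable b : R.
Hypothesis b0 : 0 < b.
Let b1 : 0 < 1 + b. Proof. by rewrite addr_gt0. Qed.
Let bV : 0 < b^-1. Proof. by rewrite invr_gt0. Qed.
Notation L := (poslog b).
Notation r := (posinv b).
Notation s := (posinv (1 + b)).
Let r0 u : 0 < r u. Proof. exact: posinv_gt0. Qed.
Let s0 u : 0 < s u. Proof. exact: posinv_gt0. Qed.

Lemma poslog_ge0 u : 0 <= L u.
Proof. by rewrite ln_ge0// lerDl ltW. Qed.

Lemma poslog_le u : L u <= r u.
Proof. by apply: le_ln1Dx; have := r0 u; lra. Qed.

Lemma poslog_antitone u v : u <= v -> L v <= L u.
Proof.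
move=> uv; rewrite /poslog ler_ln ?posrE ?lerD2l ?posinv_antitone//; first by have := r0 v; lra.
by have := r0 u; lra.
Qed.

Lemma poslogB_le u v : u <= v -> L u - L v <= (r u - r v) / (1 + r v).
Proof.
move=> uv; rewrite /poslog; have ru := r0 u; have rv := r0 v.
have ruv := posinv_antitone b0 uv.
have -> : 1 + r u = (1 + r v) * (1 + (r u - r v) / (1 + r v)).
  by field; rewrite gt_eqF//; lra.
have q0 : 0 <= (r u - r v) / (1 + r v) by apply: divr_ge0; lra.
rewrite lnM ?posrE; [|lra|lra].
by rewrite addrC addKr; apply: le_ln1Dx; lra.
Qed.

Lemma poslog_lipschitz u v : `|L u - L v| <= (b^-1 * b^-1) * `|u - v|.
Proof.
wlog uv : u v / u <= v.
  by move=> h; have [/h//|/ltW /h] := leP u v; rewrite distrC (distrC v).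
rewrite ger0_norm ?subr_ge0 ?poslog_antitone//; apply: le_trans (poslogB_le uv) _.
have ruv := posinv_antitone b0 uv; have rv := r0 v.
apply: (@le_trans _ _ (r u - r v)).
  by rewrite ler_pdivrMr; [rewrite ler_peMr; lra|lra].
by apply: le_trans (ler_norm _) _; exact: posinv_lipschitz.
Qed.

Lemma measurable_poslog : measurable_fun setT L.
Proof.
apply: measurableT_comp; first exact: measurable_ln.
by apply: measurable_funD; [exact: measurable_cst|exact: measurable_posinv].
Qed.

Lemma continuous_poslog (f : R -> R) : continuous f -> continuous (fun t => L (f t)).
Proof.
move=> cf t; apply: (@continuous_comp _ _ _ f L); first exact: cf.
have k0 : 0 < (b^-1 * b^-1)^-1 by rewrite invr_gt0 mulr_gt0.
apply/cvgrPdist_le => e e0.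
near=> v; apply: le_trans (poslog_lipschitz _ _) _; rewrite -ler_pdivlMl ?mulr_gt0//.
by near: v; apply: cvgr_dist_le; [exact: cvg_id|rewrite mulr_gt0].
Unshelve. all: by end_near. Qed.

(* [- u log (1 + 1 / (b + u))] on the half line, extended linearly; [xlog2] is only an upper
   bound for the second derivative, which jumps at [0]. *)
Definition xlog u : R := - (u * L u).
Definition xlog1 u : R := - (L u - (1 + b) * s u + b * r u).
Definition xlog2 u : R := 2 * r u.

Let xlog_pos u : R := - (u * ln (1 + (b + u)^-1)).
Let xlog1_pos u : R := - (ln (1 + (b + u)^-1) - (1 + b) * (1 + b + u)^-1 + b * (b + u)^-1).
Let xlog2_pos u : R :=
  (b + u)^-1 * (1 + b + u)^-1 - (1 + b) * (1 + b + u)^-1 ^+ 2 + b * (b + u)^-1 ^+ 2.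

Let xlog_posE u : 0 <= u -> xlog u = xlog_pos u.
Proof. by move=> u0; rewrite /xlog /poslog posinv_ge0. Qed.

Let xlog1_posE u : 0 <= u -> xlog1 u = xlog1_pos u.
Proof. by move=> u0; rewrite /xlog1 /poslog !posinv_ge0. Qed.

Let s_le u : (1 + b) * s u <= 1.
Proof. by rewrite -ler_pdivlMl// mulr1 posinv_le. Qed.

Let r_le u : b * r u <= 1.
Proof. by rewrite -ler_pdivlMl// mulr1 posinv_le. Qed.

Lemma xlog1_le u : xlog1 u <= 1 - L u.
Proof.
have := s_le u; have : 0 <= b * r u by rewrite mulr_ge0// ltW.
by rewrite /xlog1; lra.
Qed.

Let xlog1_ge u : - (1 + b^-1) <= xlog1 u.
Proof.
have := r_le u; have : 0 <= (1 + b) * s u by rewrite mulr_ge0// ltW.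
by have := poslog_le u; have := posinv_le b0 u; rewrite /xlog1; lra.
Qed.

Let xlog2_pos_le u : 0 <= u -> xlog2_pos u <= xlog2 u.
Proof.
move=> u0; rewrite /xlog2_pos -!(posinv_ge0 _ u0) /xlog2.
have s1 : s u <= 1 by apply: le_trans (posinv_le b1 _) _; rewrite invf_le1// lerDl ltW.
have rs : r u * s u <= r u by rewrite ler_piMr// ltW.
have brr : b * r u ^+ 2 <= r u by rewrite expr2 mulrA ler_piMl// ltW.
have : 0 <= (1 + b) * s u ^+ 2 by rewrite mulr_ge0 ?sqr_ge0// ltW.
by lra.
Qed.

Let is_derive_addc c u : is_derive u 1 (fun v => c + v) 1.
Proof. exact: is_derive_addcf (is_derive_id u 1). Qed.

Let is_derive_log_pos u : 0 <= u ->
  is_derive u 1 (fun v => ln (1 + (b + v)^-1)) (- (b + u)^-1 * (1 + b + u)^-1).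
Proof.
move=> u0; have bu : b + u != 0 by rewrite gt_eqF// ltr_wpDr.
have bu1 : 1 + b + u != 0 by rewrite gt_eqF// ltr_wpDr.
have l0 : 0 < 1 + (b + u)^-1 by rewrite addr_gt0// invr_gt0 ltr_wpDr.
apply: (is_derive_eq (is_derive_lnf (f := fun v => 1 + (b + v)^-1) l0 (is_derive_addcf 1
  (is_derive_invf (f := fun v => b + v) bu (is_derive_addc b u))))).
by field; rewrite bu bu1.
Qed.

Let is_derive_xlog_pos u : 0 <= u -> is_derive u 1 xlog_pos (xlog1_pos u).
Proof.
move=> u0; have bu : b + u != 0 by rewrite gt_eqF// ltr_wpDr.
have bu1 : 1 + b + u != 0 by rewrite gt_eqF// ltr_wpDr.
apply: (is_derive_eq (is_deriveN (is_derive_mulf (is_derive_id u 1) (is_derive_log_pos u0)))).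
by rewrite /xlog1_pos; field; rewrite bu bu1.
Qed.

Let is_derive_xlog1_pos u : 0 <= u -> is_derive u 1 xlog1_pos (xlog2_pos u).
Proof.
move=> u0; have bu : b + u != 0 by rewrite gt_eqF// ltr_wpDr.
have bu1 : 1 + b + u != 0 by rewrite gt_eqF// ltr_wpDr.
have dlog := is_derive_log_pos u0.
have dr := is_derive_invf (f := fun v => b + v) bu (is_derive_addc b u).
have ds := is_derive_invf (f := fun v => 1 + b + v) bu1 (is_derive_addc (1 + b) u).
apply: (is_derive_eq (is_deriveN (is_derive_addf (is_derive_addf dlog
  (is_deriveN (is_derive_scalef (1 + b) ds))) (is_derive_scalef b dr)))).
by rewrite /xlog2_pos; field; rewrite bu bu1.
Qed.

Let xlog_taylor_pos u a : 0 <= u -> 0 <= u + a ->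
  xlog (u + a) <= xlog u + xlog1 u * a + xlog2 u * a ^+ 2 / 2 + 2 * (b^-1 * b^-1) * `|a| ^+ 3.
Proof.
move=> u0 ua0; pose z (h : R) := u + h * a.
have z0 h : 0 <= h <= 1 -> 0 <= z h.
  by rewrite /z => /andP[h0 h1]; have [a0|a0] := leP 0 a; nra.
have f_derive (h : R) : 0 <= h <= 1 ->
    is_derive h 1 (xlog_pos \o z) (xlog1_pos (z h) * a).
  move=> h01; have := is_derive_xlog_pos (z0 h h01); move/is_derive1_comp; apply.
  exact: is_derive_affine.
have df_derive (h : R) : 0 <= h <= 1 ->
    is_derive h 1 (fun h => xlog1_pos (z h) * a) (xlog2_pos (z h) * a ^+ 2).
  move=> h01; have dz := is_derive_affine u a h.
  have df := is_derive1_comp (is_derive_xlog1_pos (z0 h h01)) dz.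
  by under eq_fun do rewrite mulrC; apply: (is_derive_eq (is_derive_scalef a df)); ring.
have k0 : 0 <= 2 * (b^-1 * b^-1) * `|a| ^+ 3 by rewrite !mulr_ge0// ?ltW// exprn_ge0.
have := taylor2_le (c := xlog2 u * a ^+ 2) k0 f_derive df_derive.
rewrite /= /z mul0r addr0 mul1r -!xlog_posE// -xlog1_posE//; apply => h h01.
have [h0 h1] := andP h01.
have a3 : `|a| * a ^+ 2 = `|a| ^+ 3.
  by rewrite [RHS]exprS -normrX (@ger0_norm _ (a ^+ 2))// sqr_ge0.
have -> : xlog2 u * a ^+ 2 + 2 * (b^-1 * b^-1) * `|a| ^+ 3 =
    (2 * (r u + b^-1 * b^-1 * `|a|)) * a ^+ 2 by rewrite /xlog2 -a3; ring.
apply: ler_wpM2r; first exact: sqr_ge0.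
apply: le_trans (xlog2_pos_le (z0 h h01)) _; rewrite /xlog2 ler_pM2l// -lerBlDl.
apply: le_trans (ler_norm _) _; apply: le_trans (posinv_lipschitz b0 _ _) _.
apply: ler_wpM2l; first by rewrite mulr_ge0// ltW.
by rewrite /z addrC addKr normrM (ger0_norm h0) ler_piMl.
Qed.

Let xlog_neg u : u <= 0 -> [/\ xlog u = - (u * L 0), xlog1 u = - L 0 & xlog2 u = 2 * b^-1].
Proof.
move=> u0; have Lu : L u = L 0 by rewrite /poslog !posinv_le0.
rewrite /xlog /xlog1 /xlog2 Lu !posinv_le0//; split => //.
by field; rewrite !gt_eqF.
Qed.

Let xlog1_growth u : 0 <= u -> xlog1 u - xlog1 0 <= xlog2 u * u + b^-1 * b^-1 * u ^+ 2.
Proof.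
move=> u0; have [_ -> _] := xlog_neg (lexx 0).
have logB := poslogB_le u0; have su := s_le u; have ru := r0 u.
have r0E : r 0 = b^-1 by rewrite posinv_le0.
have rB : r 0 - r u = u * (r 0 * r u).
  by rewrite (posinvB b0) (max_idPl u0) (max_idPl (lexx 0)); ring.
have br : b * r u = 1 - u * r u.
  by rewrite posinv_ge0//; field; rewrite gt_eqF// ltr_wpDr.
have quotient_le : (r 0 - r u) / (1 + r u) <= u * b^-1.
  rewrite ler_pdivrMr; last by lra.
  rewrite rB r0E mulrA; apply: ler_wpM2l; last by lra.
  by rewrite mulr_ge0// ltW.
have linear_le : u * b^-1 <= u * r u + b^-1 * b^-1 * u ^+ 2.
  have -> : u * b^-1 = u * r u + u * u * b^-1 * r u.
    by rewrite posinv_ge0//; field; rewrite !gt_eqF// ltr_wpDr.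
  rewrite lerD2l; have -> : b^-1 * b^-1 * u ^+ 2 = u * u * b^-1 * b^-1 by ring.
  by apply: ler_wpM2l; [rewrite !mulr_ge0// ltW|exact: posinv_le].
by rewrite /xlog1 /xlog2; lra.
Qed.

Let K : R := b^-1 * b^-1.
Let K0 : 0 < K. Proof. by rewrite mulr_gt0. Qed.

(* From [u] down to [0], then linearly from [0] to [- v]. *)
Let xlog_taylor_down u v : 0 <= u -> 0 < v -> xlog (- v) <=
  xlog u + xlog1 u * - (u + v) + xlog2 u * (u + v) ^+ 2 / 2 + 2 * K * (u + v) ^+ 3.
Proof.
have vN0 : 0 < v -> - v <= 0 by move=> /ltW; rewrite oppr_le0.
move=> u0 v0; have [-> _ _] := xlog_neg (vN0 v0).
have to0 := @xlog_taylor_pos u (- u) u0.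
rewrite subrr normrN (ger0_norm u0) (_ : xlog 0 = 0) in to0; last by rewrite /xlog mul0r oppr0.
have {}to0 := to0 (lexx 0).
have slope : (xlog1 u + L 0) * v <= (xlog2 u * u + K * u ^+ 2) * v.
  have [_ xlog10 _] := xlog_neg (lexx 0).
  by rewrite ler_wpM2r ?(ltW v0)//; have := xlog1_growth u0; rewrite xlog10 /K; lra.
have curvature : 0 <= xlog2 u * v ^+ 2 by rewrite mulr_ge0 ?sqr_ge0// mulr_ge0// ltW.
have cubes : 2 * K * u ^+ 3 + K * u ^+ 2 * v <= 2 * K * (u + v) ^+ 3.
  have -> : 2 * K * (u + v) ^+ 3 = 2 * K * u ^+ 3 + K * u ^+ 2 * v +
    (5 * (K * u ^+ 2 * v) + 6 * (K * u * v ^+ 2) + 2 * (K * v ^+ 3)) by ring.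
  have v0' := ltW v0; have K0' := ltW K0.
  by rewrite lerDl; apply: addr_ge0; [apply: addr_ge0|]; rewrite !mulr_ge0 ?(ltW bV)// ?exprn_ge0.
by rewrite /K in slope cubes *; lra.
Qed.

Let xlog_taylor_up u a : u < 0 -> 0 <= u + a ->
  xlog (u + a) <= xlog u + xlog1 u * a + xlog2 u * a ^+ 2 / 2 + 2 * K * `|a| ^+ 3.
Proof.
move=> u0 v0; have a0 : 0 <= a by lra.
have := @xlog_taylor_pos 0 (u + a) (lexx 0); rewrite add0r => /(_ v0).
have [-> -> ->] := xlog_neg (lexx 0); have [-> -> ->] := xlog_neg (ltW u0).
rewrite (ger0_norm v0) (ger0_norm a0) => from0.
have squares : 2 * b^-1 * (u + a) ^+ 2 <= 2 * b^-1 * a ^+ 2.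
  apply: ler_wpM2l; first by rewrite mulr_ge0// ltW.
  by rewrite ler_pXn2r// ?nnegrE//; lra.
have cubes : 2 * K * (u + a) ^+ 3 <= 2 * K * a ^+ 3.
  apply: ler_wpM2l; first by rewrite mulr_ge0// ltW.
  by rewrite ler_pXn2r// ?nnegrE//; lra.
by rewrite /K in cubes *; lra.
Qed.

Lemma xlog_taylor u a :
  xlog (u + a) <= xlog u + xlog1 u * a + xlog2 u * a ^+ 2 / 2 + 2 * (b^-1 * b^-1) * `|a| ^+ 3.
Proof.
have [u0|u0] := leP 0 u; have [v0|v0] := leP 0 (u + a).
- exact: xlog_taylor_pos.
- have v0' : 0 < - (u + a) by rewrite oppr_gt0.
  have aE : a = - (u + - (u + a)) by ring.
  have := xlog_taylor_down u0 v0'; rewrite opprK.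
  have -> : u + - (u + a) = - a by ring.
  by rewrite opprK sqrrN [`|a|]ltr0_norm//; lra.
- exact: xlog_taylor_up.
- have [-> -> ->] := xlog_neg (ltW u0); have [-> _ _] := xlog_neg (ltW v0).
  have : 0 <= 2 * b^-1 * a ^+ 2 by rewrite mulr_ge0 ?sqr_ge0// mulr_ge0// ltW.
  have : 0 <= 2 * (b^-1 * b^-1) * `|a| ^+ 3 by rewrite !mulr_ge0 ?(ltW bV)// ?exprn_ge0.
  by lra.
Qed.

Let xlog_lipschitz_pos u v : 0 <= u -> u <= v -> `|xlog u - xlog v| <= (1 + b^-1) * (v - u).
Proof.
move=> u0 uv; have on_pos w : u <= w <= v -> 0 <= w by move=> /andP[uw _]; exact: le_trans uw.
rewrite !xlog_posE ?(le_trans u0 uv)//; apply/ler_normlP; split.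
  have := is_derive_le_segment (k := 1) uv (fun w wuv => is_derive_xlog_pos (on_pos w wuv)).
  rewrite mul1r => upper; have {}upper : xlog_pos v <= xlog_pos u + (v - u).
    apply: upper => w wuv; rewrite -xlog1_posE ?(on_pos w wuv)//.
    by have := xlog1_le w; have := poslog_ge0 w; lra.
  have : 0 <= b^-1 * (v - u) by rewrite mulr_ge0 ?(ltW bV)// subr_ge0.
  by lra.
have := is_derive_le_segment (k := 1 + b^-1) uv
  (fun w wuv => is_deriveN (is_derive_xlog_pos (on_pos w wuv))).
move=> lower; have {}lower : - xlog_pos v <= - xlog_pos u + (1 + b^-1) * (v - u).
  by apply: lower => w wuv; rewrite lerNl -xlog1_posE ?(on_pos w wuv)// xlog1_ge.
by lra.
Qed.

Let xlog_lipschitz_neg u v : u <= 0 -> v <= 0 -> `|xlog u - xlog v| <= (1 + b^-1) * `|u - v|.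
Proof.
move=> u0 v0; have [-> _ _] := xlog_neg u0; have [-> _ _] := xlog_neg v0.
have -> : - (u * L 0) - - (v * L 0) = L 0 * (v - u) by ring.
rewrite normrM (ger0_norm (poslog_ge0 0)) (distrC v) ler_wpM2r//.
by have := poslog_le 0; have := posinv_le b0 0; lra.
Qed.

Lemma xlog_lipschitz u v : `|xlog u - xlog v| <= (1 + b^-1) * `|u - v|.
Proof.
wlog uv : u v / u <= v.
  by move=> h; have [/h//|/ltW /h] := leP u v; rewrite distrC (distrC v).
have [u0|/ltW u0] := leP 0 u.
  by rewrite (distrC u) [`|v - u|]ger0_norm ?subr_ge0 ?xlog_lipschitz_pos.
have [v0|/ltW v0] := leP v 0; first exact: xlog_lipschitz_neg.
have -> : xlog u - xlog v = (xlog u - xlog 0) + (xlog 0 - xlog v) by ring.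
apply: le_trans (ler_normD _ _) _.
apply: le_trans (lerD (xlog_lipschitz_neg u0 (lexx 0)) (xlog_lipschitz_pos (lexx 0) v0)) _.
by rewrite -mulrDr subr0 (ler0_norm u0) distrC ger0_norm ?subr_ge0// subr0 [- u + v]addrC.
Qed.

Lemma xlog_ge u : -1 <= xlog u.
Proof.
rewrite /xlog lerN2; have [u0|u0] := leP 0 u.
  apply: le_trans (ler_wpM2l u0 (poslog_le u)) _.
  by rewrite posinv_ge0// ler_pdivrMr ?ltr_wpDr// mul1r lerDr ltW.
by apply: le_trans (_ : 0 <= 1) => //; rewrite nmulr_rle0// poslog_ge0.
Qed.

Lemma bounded_lipschitz_poslog : bounded_lipschitz (fun x _ => L x).
Proof.
apply: (bounded_lipschitz_fst (K := b^-1) (L := b^-1 * b^-1)).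
- by move=> x; rewrite ger0_norm ?poslog_ge0// (le_trans (poslog_le x))// posinv_le.
- exact: poslog_lipschitz.
- exact: measurable_poslog.
Qed.

Lemma test_xlog : exists K, test_jet K (jet_fst xlog xlog1 xlog2).
Proof.
have zero : bounded_lipschitz (fun _ _ : R => 0 : R) by exact: bounded_lipschitz_cst.
have nL := bounded_lipschitz_poslog; have nr := bounded_lipschitz_posinv b0.
have ns := bounded_lipschitz_posinv b1.
apply: exists_test_jet => //=.
- exists (1 + b^-1) => x y x' y'; apply: le_trans (xlog_lipschitz _ _) _.
  by rewrite ler_wpM2l ?lerDl// addr_ge0// ltW.
- apply: (measurableT_comp (f := xlog)); last exact: measurable_fst.
  by apply: measurableT_comp => //; apply: measurable_funM => //; exact: measurable_poslog.
- have := bounded_lipschitzZ (-1) (bounded_lipschitzD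
    (bounded_lipschitzB nL (bounded_lipschitzZ (1 + b) ns)) (bounded_lipschitzZ b nr)).
  by congr bounded_lipschitz; apply/funext => x; apply/funext => y; rewrite /xlog1 mulN1r.
- exact: bounded_lipschitzZ nr.
- exists (2 * K) => x y a c; rewrite /jet_linear /jet_quadratic /=.
  have := mulr_ge0 (mulr_ge0 (ler0n R 2) (ltW K0)) (exprn_ge0 3 (normr_ge0 c)).
  by have := xlog_taylor x a; rewrite -/K; lra.
Qed.

End xlog.

Section bessel_path.
Context {R : realType}.
Notation mu := (@lebesgue_measure R).

Lemma capinv_field (alpha : R) n : 0 < alpha -> monotone_field (alpha * n.+1%:R)
  (alpha * n.+1%:R ^+ 2) (fun _ u => - (alpha * capinv n u)).
Proof.
move=> alpha0; split.
- by rewrite mulr_ge0 ?exprn_ge0// ltW.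
- move=> _ u; rewrite normrN gtr0_norm ?mulr_gt0 ?capinv_gt0// ler_pM2l//.
  exact: capinv_le.
- by move=> _ u v uv; rewrite lerN2 ler_pM2l//; exact: capinv_antitone.
- move=> _ u v; rewrite -opprD normrN -mulrN -mulrDr normrM (gtr0_norm alpha0) -mulrA ler_pM2l//.
  exact: capinv_lipschitz.
- by move=> u cu s; apply: cvgN; apply: cvgMl_tmp; exact: continuous_capinv.
Qed.

Variables (alpha : R) (M : R -> R).

Definition capped_bessel n : R -> R :=
  ode_solution M (fun _ u => - (alpha * capinv n u)) (alpha * n.+1%:R).
Definition bessel (t : R) : R := limn (fun n => capped_bessel n t).

Hypotheses (alpha0 : 0 < alpha) (cM : continuous M) (M0 : forall t, t <= 0 -> M t = 0).
Local Notation X := capped_bessel.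
Local Notation Z := bessel.

Lemma continuous_capped_bessel n : continuous (X n).
Proof. by have [] := ode_solutionP cM (capinv_field n alpha0). Qed.

Let capinv_integrable m n a b : itv_integrable (fun s => capinv m (X n s)) a b.
Proof. exact/continuous_itv_integrable/continuous_capinv/continuous_capped_bessel. Qed.

Lemma capped_besselE n t :
  X n t = M t + alpha * itv_integral (fun s => capinv n (X n s)) 0 t.
Proof.
have [_ XE] := ode_solutionP cM (capinv_field n alpha0).
rewrite [LHS]XE -/(X n).
rewrite (_ : itv_integral _ 0 t = itv_integral (fun s => - alpha * capinv n (X n s)) 0 t).
  by rewrite itv_integralZ// mulNr opprK.
by apply: eq_itv_integral => s _; rewrite mulNr.
Qed.

Lemma capped_bessel_le0 n t : t <= 0 -> X n t = 0.
Proof.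
move=> t0; rewrite capped_besselE M0// add0r; move: t0; rewrite le_eqVlt => /orP[/eqP ->|t0].
  by rewrite itv_integral_point mulr0.
by rewrite itv_integral_set0// mulr0.
Qed.

Lemma capped_bessel_nondecreasing n t : X n t <= X n.+1 t.
Proof.
have [t0|t0] := leP t 0; first by rewrite !capped_bessel_le0.
have drift k T : itv_integrable (fun s => (- alpha) * capinv k (X k s)) 0 T.
  exact: itv_integrableZ.
have XE k s : 0 <= s -> X k s = M s - itv_integral (fun s => (- alpha) * capinv k (X k s)) 0 s.
  by move=> _; rewrite itv_integralZ// mulNr opprK -capped_besselE.
apply: (comparison (@continuous_capped_bessel n) (@continuous_capped_bessel n.+1)
  (drift n) (drift n.+1) (XE n) (XE n.+1) (lexx _)) => //; last exact: ltW.
  by move=> s r _ _; rewrite !subrr.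
apply: aeW => s s0 lt; rewrite !mulNr lerN2 ler_pM2l//.
apply: le_trans (capinv_nondecreasing _ (leqnSn n)) _; exact/capinv_antitone/ltW.
Qed.

(* After the last time it was below [1], the drift of [X n] is at most [alpha]. *)
Lemma capped_bessel_bounded t : exists c, forall n, X n t <= c.
Proof.
have [t0|t0] := ltP t 0; first by exists 0 => n; rewrite capped_bessel_le0// ltW.
have [K MK] : exists K, forall s, 0 <= s <= t -> `|M s| <= K.
  have [K [_ KP]] : bounded_set (M @` `[0, t]).
    apply: compact_bounded; apply: continuous_compact; last exact: segment_compact.
    exact: continuous_subspaceT.
  exists (K + 1) => s st; apply: (KP (K + 1)); first by rewrite ltrDl.
  by exists s => //=; rewrite in_itv.
exists (1 + 2 * K + alpha * t) => n; rewrite leNgt; apply/negP => large.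
have K0 : 0 <= K by apply: le_trans (MK 0 _); rewrite ?lexx.
have alpha_t0 : 0 <= alpha * t by rewrite mulr_ge0// ltW.
have c1 : continuous (fun s => 1 - X n s).
  by move=> s; apply: cvgB; [exact: cvg_cst|exact: continuous_capped_bessel].
have [||s [s0 st Xs above]] := exists_last_zero c1 t0.
- by rewrite capped_bessel_le0// subr0.
- by lra.
have drift_le : itv_integral (fun r => capinv n (X n r)) s t <= t - s.
  rewrite -[leRHS]mul1r -itv_integral_cst ?(ltW st)//.
  apply: le_itv_integral => //; [exact: itv_integrable_cst|move=> r /andP[sr rt]].
  have X1 : 1 <= X n r.
    move: sr; rewrite le_eqVlt => /orP[/eqP <-|sr]; first by lra.
    by have := above r; rewrite sr rt => /(_ isT); lra.
  have X0 : 0 < X n r by exact: lt_le_trans X1.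
  by apply: le_trans (capinv_le_inv _ X0) _; rewrite invf_le1.
have := capped_besselE n t; have := capped_besselE n s.
rewrite (itv_integral_cat s0 (ltW st) (capinv_integrable n n 0 t)) mulrDr.
have := MK s; rewrite s0 (ltW st) => /(_ isT) /ler_normlP[Ms _].
have := MK t; rewrite t0 lexx => /(_ isT) /ler_normlP[_ Mt].
have : alpha * itv_integral (fun r => capinv n (X n r)) s t <= alpha * (t - s) by rewrite ler_pM2l.
have : alpha * (t - s) <= alpha * t by rewrite ler_pM2l// gerBl.
by lra.
Qed.

Lemma bessel_cvg t : (fun n => X n t) @ \oo --> Z t.
Proof.
have [c Xc] := capped_bessel_bounded t.
apply: nondecreasing_is_cvgn; last by exists c => _ [n _ <-].
by apply/nondecreasing_seqP => n; exact: capped_bessel_nondecreasing.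
Qed.

Lemma bessel_le0 t : t <= 0 -> Z t = 0.
Proof.
move=> t0; apply: cvg_lim => //.
by under eq_fun do rewrite capped_bessel_le0//; exact: cvg_cst.
Qed.

Let measurable_bessel (a b : R) : measurable_fun `[a, b] Z.
Proof.
apply: (@measurable_fun_cvg _ _ _ _ X) => [n|s _]; last exact: bessel_cvg.
by apply: measurable_funTS; apply: continuous_measurable_fun; exact: continuous_capped_bessel.
Qed.

Lemma capinv_bessel_cvg m a b : itv_integrable (fun s => capinv m (Z s)) a b /\
  (fun n => itv_integral (fun s => capinv m (X n s)) a b) @ \oo -->
  itv_integral (fun s => capinv m (Z s)) a b.
Proof.
apply: (@itv_integral_dominated_cvg R _ _ (fun=> m.+1%:R)).
- by move=> n; exact: itv_integrable_measurable.
- by apply: measurableT_comp; [exact: measurable_capinv|exact: measurable_bessel].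
- apply: aeW => s _; apply: continuous_cvg; last exact: bessel_cvg.
  by apply: (@continuous_capinv _ m id) => u; exact: cvg_id.
- exact: itv_integrable_cst.
- by apply: aeW => s n _; rewrite gtr0_norm ?capinv_gt0// capinv_le.
Qed.

Let capinv_bessel_integrable m a b : itv_integrable (fun s => capinv m (Z s)) a b.
Proof. by have [] := capinv_bessel_cvg m a b. Qed.

Lemma bessel_drift_ge m s t : 0 <= s -> s <= t ->
  alpha * itv_integral (fun r => capinv m (Z r)) s t <= Z t - Z s - (M t - M s).
Proof.
move=> s0 st; have [_ cJ] := capinv_bessel_cvg m s t.
have drift_cvg : (fun n => alpha * itv_integral (fun r => capinv m (X n r)) s t) @ \oo -->
    alpha * itv_integral (fun r => capinv m (Z r)) s t by exact: cvgMl_tmp.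
have incr_cvg : (fun n => X n t - X n s - (M t - M s)) @ \oo --> Z t - Z s - (M t - M s).
  by apply: cvgB; [apply: cvgB; exact: bessel_cvg|exact: cvg_cst].
apply: (ler_cvg_to drift_cvg incr_cvg); near=> n.
rewrite (capped_besselE n t) (capped_besselE n s).
rewrite (itv_integral_cat s0 st (capinv_integrable n n 0 t)).
rewrite [leRHS](_ : _ = alpha * itv_integral (fun r => capinv n (X n r)) s t); last by ring.
rewrite ler_pM2l//; apply: le_itv_integral => // r _.
by apply: capinv_nondecreasing; near: n; exact: nbhs_infty_ge.
Unshelve. all: by end_near. Qed.

Let bessel_nonpos (T : R) : set R := `[0, T] `&` [set s | Z s <= 0].

Let measurable_bessel_nonpos T : measurable (bessel_nonpos T).
Proof.
have := @measurable_bessel 0 T (measurable_itv _) _ (measurable_itv `]-oo, (0 : R)]).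
by congr measurable; apply/seteqP; split => s /= [s0T Zs]; split => //; move: Zs; rewrite in_itv.
Qed.

(* On [Z <= 0] the capped inverse is [m + 1], while its integral is bounded in [m]. *)
Let bessel_nonpos_null (T : nat) : mu (bessel_nonpos T%:R) = 0%E.
Proof.
set A := bessel_nonpos _; have mA : measurable A by exact: measurable_bessel_nonpos.
have A_le : (mu A <= mu `[0%R, T%:R%R])%E by apply: le_measure; rewrite ?inE//; exact: subIsetl.
have A_fin : mu A \is a fin_num.
  by rewrite ge0_fin_numE// (le_lt_trans A_le)// lebesgue_measure_itv_lty.
have indic_integrable : itv_integrable (\1_A : R -> R) 0 T%:R.
  apply: (@bounded_itv_integrable _ _ _ _ 1); first exact: measurable_indic.
  by move=> s _; rewrite indicE; case: (_ \in _); rewrite ?normr1 ?normr0.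
have indic_integral : itv_integral (\1_A : R -> R) 0 T%:R = fine (mu A).
  rewrite /itv_integral /Rintegral integral_indic//; congr (fine (mu _)).
  by rewrite setIidl//; exact: subIsetl.
set D := Z T%:R - Z 0 - (M T%:R - M 0).
have linear_le m : alpha * m.+1%:R * fine (mu A) <= D.
  apply: le_trans (bessel_drift_ge m (lexx 0) (ler0n _ T)).
  rewrite -mulrA ler_pM2l// -indic_integral -itv_integralZ//.
  apply: le_itv_integral => // [|s _]; first exact: itv_integrableZ.
  rewrite indicE; case: (boolP (s \in A)) => [/set_mem[_ Zs]|_].
    by rewrite mulr1 capinv_le0.
  by rewrite mulr0 ltW// capinv_gt0.
rewrite -(fineK A_fin); congr EFin; apply/eqP; rewrite eq_le fine_ge0// andbT leNgt.
apply/negP => A_gt0.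
have := linear_le (Num.truncn (D / (alpha * fine (mu A)))).
rewrite mulrAC mulrC -ler_pdivlMr ?mulr_gt0// => le_ratio.
by have := lt_le_trans (truncnS_gt _) le_ratio; rewrite ltxx.
Qed.

Lemma bessel_gt0_ae : {ae mu, forall s, 0 <= s -> 0 < Z s}.
Proof.
have : {ae mu, forall s, forall T : nat, ~ bessel_nonpos T%:R s}.
  apply: ae_foralln => T; exists (bessel_nonpos T%:R); split; [exact: measurable_bessel_nonpos|
    exact: bessel_nonpos_null|by move=> s nonneg; exact: (contrapT nonneg)].
apply: ae_imply => s pos s0; rewrite ltNge; apply/negP => Zs.
by apply: (pos (Num.truncn s).+1); split => //=; rewrite in_itv/= s0 ltW// truncnS_gt.
Qed.

Lemma bessel_inv_integrable_from s t : 0 <= s -> s <= t -> itv_integrable (fun r => (Z r)^-1) s t.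
Proof.
move=> s0 st; pose Zp r := Num.max (Z r) 0; pose c := alpha^-1 * (Z t - Z s - (M t - M s)).
have mZp : measurable_fun `[s, t] Zp by apply: measurable_maxr => //; exact: measurable_cst.
have mZpV : measurable_fun `[s, t] (fun r => (Zp r)^-1).
  by apply: measurableT_comp; [exact: measurable_invr|].
pose f m r := capinv m (Z r) * (Zp r / Zp r).
have f_bounds m r : 0 <= f m r <= capinv m (Z r).
  have c0 := capinv_gt0 m (Z r); rewrite /f /Zp; have [Zr|Zr] := leP (Z r) 0.
    by rewrite mul0r mulr0 lexx ltW.
  by rewrite mulfV ?mulr1 ?lexx ?gt_eqF// ltW.
have f_integrable m : itv_integrable (f m) s t.
  apply: (le_itv_integrable _ _ (capinv_bessel_integrable m s t)).
    apply: measurable_funM; last exact: measurable_funM.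
    exact: itv_integrable_measurable (capinv_bessel_integrable m s t).
  by move=> r _; case/andP: (f_bounds m r) => f0 f1; rewrite ger0_norm.
have [ZpV_integrable _] : itv_integrable (fun r => (Zp r)^-1) s t /\
    itv_integral (fun r => (Zp r)^-1) s t <= c.
  apply: (@fatou_Rintegral _ _ _ mu `[s, t] f) => //.
  - by move=> m r _; case/andP: (f_bounds m r).
  - move=> r _; rewrite /f /Zp; have [Zr|Zr] := leP (Z r) 0.
      by under eq_fun do rewrite mul0r mulr0; rewrite invr0; exact: cvg_cst.
    by under eq_fun do rewrite mulfV ?gt_eqF// mulr1; exact: capinv_cvg.
  - move=> m; rewrite ler_pdivlMl//; apply: le_trans (bessel_drift_ge m s0 st).
    by rewrite ler_pM2l//; apply: le_itv_integral => // r _; case/andP: (f_bounds m r).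
have := @itv_integral_dominated_cvg R (fun (_ : nat) r => (Zp r)^-1) (fun r => (Z r)^-1)
  (fun r => (Zp r)^-1) s t; case => //.
- by apply: measurableT_comp; [exact: measurable_invr|exact: measurable_bessel].
- apply: (ae_imply _ bessel_gt0_ae) => r Z0 /andP[sr _].
  by rewrite /Zp (max_idPl (ltW (Z0 (le_trans s0 sr)))); exact: cvg_cst.
- by apply: aeW => r _ _; rewrite ger0_norm// invr_ge0 maxr0_ge0.
Qed.

Lemma bessel_inv_integral_cvg s t : 0 <= s -> s <= t ->
  (fun m => itv_integral (fun r => capinv m (Z r)) s t) @ \oo -->
    itv_integral (fun r => (Z r)^-1) s t.
Proof.
move=> s0 st.
apply: (@itv_integral_dominated_cvg R _ _ (fun r => `|(Z r)^-1|) _ _ _ _ _ _ _).2 => //.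
- by move=> m; exact: itv_integrable_measurable (capinv_bessel_integrable m s t).
- by apply: measurableT_comp; [exact: measurable_invr|exact: measurable_bessel].
- apply: (ae_imply _ bessel_gt0_ae) => r Z0 /andP[sr _].
  by apply: capinv_cvg; apply: Z0; exact: le_trans sr.
- exact/itv_integrable_norm/bessel_inv_integrable_from.
- apply: (ae_imply _ bessel_gt0_ae) => r Z0 m /andP[sr _]; have {}Z0 := Z0 (le_trans s0 sr).
  by rewrite gtr0_norm ?capinv_gt0// gtr0_norm ?invr_gt0// capinv_le_inv.
Qed.

Lemma bessel_inv_drift_le s t : 0 <= s -> s <= t ->
  alpha * itv_integral (fun r => (Z r)^-1) s t <= Z t - Z s - (M t - M s).
Proof.
move=> s0 st.
have lim : (fun m => alpha * itv_integral (fun r => capinv m (Z r)) s t) @ \oo -->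
    alpha * itv_integral (fun r => (Z r)^-1) s t.
  by apply: cvgMl_tmp; exact: bessel_inv_integral_cvg.
by apply: (cvgr_to_le lim); apply: nearW => m; exact: bessel_drift_ge.
Qed.

Lemma bessel_inv_integrable : inv_integrable Z.
Proof.
move=> t; have := bessel_inv_integrable_from (lexx 0) (maxr0_ge0 t).
by apply: itv_integrableS => //; rewrite le_max lexx.
Qed.

Lemma ae_gt0_ge0 (f : R -> R) : continuous f -> f 0 = 0 -> {ae mu, forall s, 0 <= s -> 0 < f s} ->
  forall t, 0 <= t -> 0 <= f t.
Proof.
move=> cf f0 [A [mA A0 Asub]] t; rewrite le_eqVlt => /orP[/eqP <-|t0]; first by rewrite f0.
rewrite leNgt; apply/negP => ft0.
have [e e0 neg] : exists2 e : R, 0 < e & forall r, `|t - r| < e -> f r < 0.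
  have /cvgrPdist_lt /(_ (- f t)) := cf t; rewrite oppr_gt0 => /(_ ft0).
  move=> /nbhs_ballP[e /= e0 close]; exists e => // r /close.
  by rewrite distrC => /(le_lt_trans (ler_norm _)); lra.
have : (mu `]t, (t + e)%R[ <= mu A)%E.
  apply: le_measure; rewrite ?inE//.
  move=> r /=; rewrite in_itv/= => /andP[tr re]; apply: Asub => /= pos.
  have fr : f r < 0 by apply: neg; rewrite ltr0_norm ?subr_lt0// opprB ltrBlDl.
  by have := lt_trans (pos (ltW (lt_trans t0 tr))) fr; rewrite ltxx.
by rewrite A0 lebesgue_measure_itv/= lte_fin ltrDl e0 -EFinB lee_fin; lra.
Qed.

(* [Z - M - alpha * int 1 / Z] is nondecreasing and vanishes at [0]: it vanishes on [0, +oo) as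
   soon as it is nonpositive at the integers. *)
Lemma besselP : (forall N : nat, Z N%:R <= M N%:R + alpha * inv_integral Z N%:R) ->
  regular_path Z /\ forall t, Z t = M t + alpha * inv_integral Z t.
Proof.
move=> at_integers; have iZ := bessel_inv_integrable.
have ZE t : Z t = M t + alpha * inv_integral Z t.
  have [t0|t0] := ltP t 0.
    by rewrite bessel_le0 ?ltW// M0 ?ltW// itv_integral_set0// mulr0 addr0.
  have tN : t <= (Num.truncn t).+1%:R by rewrite ltW// truncnS_gt.
  have from0 := bessel_inv_drift_le (lexx 0) t0; have toN := bessel_inv_drift_le t0 tN.
  have := at_integers (Num.truncn t).+1; rewrite (itv_integral_cat t0 tN (iZ _)).
  rewrite (bessel_le0 (lexx 0)) (M0 (lexx 0)) in from0.
  by move=> atN; apply/eqP; rewrite eq_le; apply/andP; split; lra.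
have cZ : continuous Z.
  rewrite (funext ZE) => t; apply: cvgD; first exact: cM.
  by apply: cvgMl_tmp; apply: continuous_itv_integral.
split=> //; split=> //; last exact: bessel_gt0_ae.
move=> t; have [t0|/ltW t0] := leP t 0; first by rewrite bessel_le0.
exact: ae_gt0_ge0 cZ (bessel_le0 (lexx 0)) bessel_gt0_ae t t0.
Qed.

End bessel_path.

Section adapted_bessel.
Context {R : realType} {d : measure_display} {Omega : measurableType d}.
Variable H : R -> set (set Omega).
Hypothesis fH : filtration H.
Variables (alpha : R) (M : R -> Omega -> R).
Hypotheses (alpha0 : 0 < alpha) (cM : forall w, continuous (M^~ w))
  (M0 : forall w t, t <= 0 -> M t w = 0) (aM : adapted H M).
Local Notation X n t w := (capped_bessel alpha (M^~ w) n t).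
Local Notation Z t w := (bessel alpha (M^~ w) t).

Let sH t : 0 <= t -> sigma_algebra setT (H t). Proof. by case: fH => + _; exact. Qed.

Lemma adapted_capped_bessel n : adapted H (fun t w => X n t w).
Proof.
apply: (adapted_ode_solution fH (phi := fun _ _ u => - (alpha * capinv n u))
  (L := alpha * n.+1%:R ^+ 2)) => //.
  by move=> w; exact: capinv_field.
move=> Y aY s s0; apply: (G_measurable_comp (sH s0) (h := fun u => - (alpha * capinv n u))).
  by apply: measurableT_comp => //; apply: measurable_funM => //; exact: measurable_capinv.
exact: aY.
Qed.

Lemma adapted_capinv_capped_bessel m n :
  adapted H (fun t w => itv_integral (fun s => capinv m (X n s w)) 0 t).
Proof.
apply: (adapted_itv_integral fH (Z := fun s w => capinv m (X n s w))).
  by move=> w; exact/continuous_capinv/continuous_capped_bessel.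
by move=> s s0; apply: (G_measurable_comp (sH s0));
  [exact: measurable_capinv|exact: adapted_capped_bessel].
Qed.

Lemma adapted_bessel : adapted H (fun t w => Z t w).
Proof.
move=> t t0; apply: (G_measurable_cvg (sH t0) (f_ := fun n w => X n t w)).
  by move=> n; exact: adapted_capped_bessel.
by move=> w; apply: bessel_cvg => // s s0; exact: M0.
Qed.

Lemma adapted_capinv_bessel m : adapted H (fun t w => itv_integral (fun s => capinv m (Z s w)) 0 t).
Proof.
move=> t t0; apply: (G_measurable_cvg (sH t0)
  (f_ := fun n w => itv_integral (fun s => capinv m (X n s w)) 0 t)).
  by move=> n; exact: adapted_capinv_capped_bessel.
by move=> w; have [] := capinv_bessel_cvg alpha0 (@cM w) (@M0 w) m 0 t.
Qed.

Lemma adapted_with_inv_bessel : adapted_with_inv H (fun t w => Z t w).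
Proof.
split; first exact: adapted_bessel.
move=> t t0; apply: (G_measurable_cvg (sH t0)
  (f_ := fun m w => itv_integral (fun s => capinv m (Z s w)) 0 t)).
  by move=> m; exact: adapted_capinv_bessel.
by move=> w; exact: (bessel_inv_integral_cvg alpha0 (@cM w) (@M0 w) (lexx 0) t0).
Qed.

End adapted_bessel.

Section bessel_process.
Context {R : realType} {d : measure_display} {Omega : measurableType d}.
Variable P : probability Omega R.
Variables (F : R -> set (set Omega)) (rho : R) (B C : R -> Omega -> R).
Hypotheses (uF : usual_filtration P F) (rho1 : -1 <= rho <= 1) (bm : correlated_BM P F rho B C).
Notation E f := (Rintegral P setT f).
Variables (l m alpha : R).
Hypotheses (alpha0 : 0 < alpha) (var1 : BM_var rho l m = 1).

Let fF : filtration F := usual_filtration_filtration uF.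
Let sF t : 0 <= t -> sigma_algebra setT (F t) := @usual_sigma_algebra _ _ _ _ _ uF t.

Definition driver (t : R) w := BM_comb B C l m (Num.max t 0) w.
Local Notation N := driver.
Local Notation X n t w := (capped_bessel alpha (N^~ w) n t).
Local Notation Z t w := (bessel alpha (N^~ w) t).

Lemma continuous_driver w : continuous (N^~ w).
Proof. exact: (continuous_BM_comb bm). Qed.

Lemma driver_le0 w t : t <= 0 -> N t w = 0.
Proof.
have [BC0 _ _ _] := bm; have [B0 C0] := BC0 w.
by move=> t0; rewrite /driver (max_idPr t0) /BM_comb B0 C0 !mulr0 addr0.
Qed.

Lemma driver_ge0 w t : 0 <= t -> N t w = BM_comb B C l m t w.
Proof. by move=> t0; rewrite /driver (max_idPl t0). Qed.

Lemma adapted_driver : adapted F N.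
Proof. by move=> t t0; rewrite /driver (max_idPl t0); exact: (adapted_BM_comb uF bm). Qed.

Let aX n : adapted F (fun t w => X n t w).
Proof. exact: (adapted_capped_bessel fF alpha0 continuous_driver adapted_driver n). Qed.

Let cX n w : continuous (fun t => X n t w).
Proof. exact: (continuous_capped_bessel alpha0 (@continuous_driver w)). Qed.

Let XE n w t : X n t w = N t w + alpha * itv_integral (fun s => capinv n (X n s w)) 0 t.
Proof. exact: (capped_besselE alpha0 (@continuous_driver w) n t). Qed.

Let X0 n w : X n 0 w = 0.
Proof. exact: (capped_bessel_le0 alpha0 (@continuous_driver w) (@driver_le0 w) n (lexx 0)). Qed.

Let Z0 w : Z 0 w = 0.
Proof. exact: (bessel_le0 alpha0 (@continuous_driver w) (@driver_le0 w) (lexx 0)). Qed.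

Let capinvX_integrable k n w a b : itv_integrable (fun s => capinv k (X n s w)) a b.
Proof. by apply: continuous_itv_integrable; exact: continuous_capinv. Qed.

Let capinvZ_integrable k w a b : itv_integrable (fun s => capinv k (Z s w)) a b.
Proof. exact: (capinv_bessel_cvg alpha0 (@continuous_driver w) (@driver_le0 w) k a b).1. Qed.

Let b n : R := n.+1%:R^-1.
Let b0 n : 0 < b n. Proof. by rewrite invr_gt0. Qed.

(* Upper bound for the generator of [X n] applied to [xlog (b n)]. *)
Definition xlog_drift n u : R := capinv n u * (alpha + 1 - alpha * poslog (b n) u).

Lemma xlog_generator_le n u :
  xlog1 (b n) u * (alpha * capinv n u) + xlog2 (b n) u / 2 <= xlog_drift n u.
Proof.
have cap0 : 0 <= alpha * capinv n u by rewrite mulr_ge0// ltW// capinv_gt0.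
have first_order := ler_wpM2r cap0 (xlog1_le (b0 n) u).
have second_order : posinv (b n) u <= capinv n u.
  rewrite lef_pV2 ?posrE ?floorr_gt0//; last by rewrite ltr_wpDr ?maxr0_ge0.
  by rewrite ge_max -/(b n); have := b0 n; have [u0|u0] := leP u 0; rewrite ?addr0; lra.
by rewrite /xlog2 /xlog_drift; lra.
Qed.

Lemma continuous_xlog_drift n w : continuous (fun s => xlog_drift n (X n s w)).
Proof.
move=> s; apply: cvgM; first exact: continuous_capinv.
by apply: cvgB; [exact: cvg_cst|apply: cvgMl_tmp; exact: continuous_poslog].
Qed.

Lemma xlog_drift_le n u : `|xlog_drift n u| <= n.+1%:R * (alpha + 1 + alpha * n.+1%:R).
Proof.
have log_le : poslog (b n) u <= n.+1%:R.
  by apply: le_trans (poslog_le (b0 n) u) _; rewrite -[leRHS]invrK; exact: posinv_le.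
rewrite normrM gtr0_norm ?capinv_gt0//; apply: ler_pM => //; first by rewrite ltW// capinv_gt0.
  exact: capinv_le.
apply: le_trans (ler_normB _ _) _.
rewrite (ger0_norm (_ : 0 <= alpha + 1)) ?addr_ge0 ?(ltW alpha0)// lerD2l.
by rewrite normrM (gtr0_norm alpha0) (ger0_norm (poslog_ge0 (b0 n) u)) ler_pM2l.
Qed.

Lemma measurable_xlog_drift n : measurable_fun setT (xlog_drift n).
Proof.
apply: measurable_funM; first exact: measurable_capinv.
by apply: measurable_funB => //; apply: measurable_funM => //; exact: measurable_poslog.
Qed.

Let drift_integrable n w a c : itv_integrable (fun s => xlog_drift n (X n s w)) a c.
Proof. by apply: continuous_itv_integrable; exact: continuous_xlog_drift. Qed.

Definition log_level (k : nat) : R := ln (1 + k.+1%:R / 2).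

Lemma le_log_level k0 k : (k0 <= k)%N -> log_level k0 <= log_level k.
Proof.
move=> k0k; rewrite /log_level ler_ln ?posrE ?addr_gt0 ?divr_gt0// lerD2l ler_pM2r ?invr_gt0//.
by rewrite ler_nat ltnS.
Qed.

Lemma log_level_ge (c : R) : exists k0, forall k, (k0 <= k)%N -> c <= log_level k.
Proof.
exists (Num.truncn (expR c * 2)) => k k0k.
rewrite /log_level -[leLHS]expRK ler_ln ?posrE ?expR_gt0//.
have : expR c * 2 <= k.+1%:R.
  by apply: le_trans (ltW (truncnS_gt _)) _; rewrite ler_nat ltnS.
by lra.
Qed.

Lemma poslog_ge_log_level n k u : (k <= n)%N -> u < k.+1%:R^-1 -> log_level k <= poslog (b n) u.
Proof.
move=> kn uk; have k0 : 0 < k.+1%:R^-1 :> R by rewrite invr_gt0.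
have bk : b n <= k.+1%:R^-1 by rewrite lef_pV2 ?posrE// ler_nat ltnS.
have mk : Num.max u 0 <= k.+1%:R^-1 by rewrite ge_max !ltW.
have r0 := posinv_gt0 (b0 n) u.
rewrite /log_level /poslog ler_ln ?posrE; [|by rewrite addr_gt0// divr_gt0|by rewrite addr_gt0].
rewrite lerD2l -[leLHS]invrK lef_pV2 ?posrE ?invr_gt0 ?divr_gt0//; last first.
  by rewrite ltr_wpDr ?maxr0_ge0.
have -> : (k.+1%:R / 2)^-1 = 2 * k.+1%:R^-1 :> R by rewrite invfM invrK mulrC.
by rewrite mulr2n mulrDl mul1r lerD.
Qed.

Lemma xlog_drift_le_cst n k u : alpha + 1 <= alpha * log_level k -> (k <= n)%N ->
  xlog_drift n u <= (alpha + 1) * k.+1%:R.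
Proof.
move=> large kn; have a1 : 0 <= alpha + 1 by rewrite addr_ge0// ltW.
have [uk|uk] := ltP u k.+1%:R^-1.
  have : alpha * log_level k <= alpha * poslog (b n) u.
    by rewrite ler_pM2l//; exact: poslog_ge_log_level.
  move=> log_large; apply: (@le_trans _ _ 0); last by rewrite mulr_ge0.
  by rewrite /xlog_drift pmulr_rle0 ?capinv_gt0//; lra.
have u0 : 0 < u by apply: lt_le_trans uk; rewrite invr_gt0.
have cap_le : capinv n u <= k.+1%:R.
  by apply: le_trans (capinv_le_inv _ u0) _; rewrite -[leRHS]invrK lef_pV2 ?posrE ?invr_gt0.
apply: (@le_trans _ _ (capinv n u * (alpha + 1))).
  by rewrite ler_pM2l ?capinv_gt0// gerBl mulr_ge0 ?(ltW alpha0)// poslog_ge0.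
by rewrite mulrC ler_wpM2l.
Qed.

(* The logarithm makes the part of the drift beyond level [k] uniformly small. *)
Lemma capinv_excess_le n k k0 u : alpha + 2 <= alpha * log_level k0 -> (k0 <= k)%N -> (k <= n)%N ->
  (capinv n u - capinv k u) * (alpha * log_level k - alpha - 1) <=
    (alpha + 1) * k0.+1%:R - xlog_drift n u.
Proof.
move=> large0 k0k kn; have cap0 := capinv_gt0 n u.
have large : alpha + 2 <= alpha * log_level k.
  by apply: le_trans large0 _; rewrite ler_pM2l// le_log_level.
have [uk|uk] := ltP u k.+1%:R^-1; last first.
  have nk : n.+1%:R^-1 <= k.+1%:R^-1 :> R by rewrite lef_pV2 ?posrE// ler_nat ltnS.
  have -> : capinv n u = capinv k u.
    by rewrite /capinv /floorr !(max_idPl _)//; exact: le_trans nk uk.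
  rewrite subrr mul0r subr_ge0; apply: xlog_drift_le_cst; last exact: leq_trans kn.
  by lra.
have log_large : alpha * log_level k <= alpha * poslog (b n) u.
  by rewrite ler_pM2l//; exact: poslog_ge_log_level.
have drop_k : (capinv n u - capinv k u) * (alpha * log_level k - alpha - 1) <=
    capinv n u * (alpha * log_level k - alpha - 1).
  by rewrite ler_wpM2r//; have := capinv_gt0 k u; lra.
have to_log : capinv n u * (alpha * log_level k - alpha - 1) <=
    capinv n u * (alpha * poslog (b n) u - alpha - 1).
  by rewrite ler_wpM2l ?(ltW cap0)//; lra.
have c0 : 0 <= (alpha + 1) * k0.+1%:R by rewrite mulr_ge0// addr_ge0// ltW.
by rewrite /xlog_drift; lra.
Qed.

Section fixed_time.
Variable T : R.
Hypothesis T0 : 0 < T.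

Let D n w : R := itv_integral (fun s => xlog_drift n (X n s w)) 0 T.
Let J k n w : R := itv_integral (fun s => capinv k (X n s w)) 0 T.
Let JZ k w : R := itv_integral (fun s => capinv k (Z s w)) 0 T.

Let time_integral_integrable (k : R) (f : R -> Omega -> R) :
  (forall w, itv_integrable (f^~ w) 0 T) ->
  G_measurable (F T) (fun w => itv_integral (f^~ w) 0 T) -> (forall w s, `|f s w| <= k) ->
  P.-integrable setT (EFin \o (fun w => itv_integral (f^~ w) 0 T)).
Proof.
move=> fi gf fk; have mf := usual_measurable_fun uF (ltW T0) gf.
apply: (@bounded_integrable_EFin _ _ _ P setT _ (k * T)) => //.
  by rewrite -ge0_fin_numE//; exact: fin_num_measure.
move=> w _; apply: le_trans (le_normr_itv_integral (fi w)) _.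
rewrite -[T in k * T]subr0 -itv_integral_cst ?(ltW T0)//.
by apply: le_itv_integral; [exact: itv_integrable_norm|exact: itv_integrable_cst|].
Qed.

Let D_integrable n : P.-integrable setT (EFin \o D n).
Proof.
apply: (time_integral_integrable (f := fun s w => xlog_drift n (X n s w))) => //.
  apply: (adapted_itv_integral fF (Z := fun s w => xlog_drift n (X n s w))); last exact: ltW.
    exact: continuous_xlog_drift.
  move=> t t0; apply: (G_measurable_comp (sF t0)); first exact: measurable_xlog_drift.
  exact: aX.
by move=> w s; exact: xlog_drift_le.
Qed.

Let J_integrable k n : P.-integrable setT (EFin \o J k n).
Proof.
apply: (time_integral_integrable (k := k.+1%:R) (f := fun s w => capinv k (X n s w))) => //.
  by apply: (adapted_capinv_capped_bessel fF alpha0 continuous_driver adapted_driver); exact: ltW.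
by move=> w s; rewrite gtr0_norm ?capinv_gt0// capinv_le.
Qed.

Let JZ_integrable k : P.-integrable setT (EFin \o JZ k).
Proof.
apply: (time_integral_integrable (k := k.+1%:R) (f := fun s w => capinv k (Z s w))) => //.
  exact: (adapted_capinv_bessel fF alpha0 continuous_driver driver_le0 adapted_driver k (ltW T0)).
by move=> w s; rewrite gtr0_norm ?capinv_gt0// capinv_le.
Qed.

Let ito_path_xlog n w : ito_path rho (jet_fst (xlog (b n)) (xlog1 (b n)) (xlog2 (b n))) l m 0 0 0 T
  (fun t => X n t w) (fun=> 0) (BM_comb B C l m ^~ w) (BM_comb B C 0 0 ^~ w) (D n w).
Proof.
exists (fun s => alpha * capinv n (X n s w)), (fun=> 0), (fun s => xlog_drift n (X n s w)).
split => //.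
- split; first exact: itv_integrableZ.
    by move=> r _; rewrite mulr_ge0 ?(ltW alpha0)// ltW// capinv_gt0.
  move=> r /andP[r0 _]; rewrite itv_integralZ// -(driver_ge0 w r0) -(driver_ge0 w (lexx 0)).
  by rewrite X0 (driver_le0 w (lexx 0)) XE; ring.
- split=> // [|r /andP[r0 _]]; first exact: itv_integrable_cst.
  by rewrite /BM_comb itv_integral_cst//; ring.
- apply: aeW => r _; apply: le_trans (xlog_generator_le n (X n r w)).
  by rewrite /jet_linear /diffusion /= var1; lra.
Qed.

(* Ito's formula for [- x log (1 + 1 / (b + x))] yields a logarithmic gain over the
   mere boundedness of the expected drift. *)
Let E_drift_ge n : -1 <= E (D n).
Proof.
have [K tV] := test_xlog (b0 n).
have g1 : G_measurable (F 0) (fun=> 1 : R) by apply: G_measurable_cst; exact: sF.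
have iD : P.-integrable setT (EFin \o (fun w =>
    X n T w - X n 0 w - (BM_comb B C l m T w - BM_comb B C l m 0 w))).
  have := integrableZ_EFin alpha measurableT (J_integrable n n).
  apply: eq_integrable => // w _ /=; congr EFin.
  rewrite X0 -(driver_ge0 w (ltW T0)) -(driver_ge0 w (lexx 0)) (driver_le0 w (lexx 0)).
  by rewrite (XE n w T) /J; ring.
have i0 : P.-integrable setT (EFin \o (fun w : Omega =>
    0 - 0 - (BM_comb B C 0 0 T w - BM_comb B C 0 0 0 w))).
  have := probability_integrable_cst P 0; apply: eq_integrable => // w _ /=; congr EFin.
  by rewrite /BM_comb !mul0r; ring.
have paths : {ae P, forall w, [/\ continuous (fun r : R => X n (Num.max r 0) w),
    continuous (fun _ : R => 0 : R) &
    ito_path rho (jet_fst (xlog (b n)) (xlog1 (b n)) (xlog2 (b n))) l m 0 0 0 T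
      (fun t => X n t w) (fun=> 0) (BM_comb B C l m ^~ w) (BM_comb B C 0 0 ^~ w) (D n w)]}.
  apply: aeW => w; split=> [r|r|]; [|exact: cvg_cst|exact: ito_path_xlog].
  apply: (continuous_comp (f := fun r : R => Num.max r 0) (g := fun t => X n t w)); last exact: cX.
  by apply: continuous_maxr => t; [exact: cvg_id|exact: cvg_cst].
have one01 (w : Omega) : 0 <= (1 : R) <= 1 by rewrite ler01 lexx.
have a0 := adapted_cst fF (0 : R).
have -> : E (D n) = E (fun w => 1 * D n w) by apply: eq_Rintegral => w _; rewrite mul1r.
apply: le_trans (dynkin_formula uF rho1 bm tV (lexx 0) T0 (aX n) a0 (D_integrable n) iD i0
  paths g1 one01).
rewrite -[leLHS](probability_Rintegral_cst P); apply: le_Rintegral => //.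
- exact: probability_integrable_cst.
- exact: (dynkin_integrable uF rho1 bm tV (lexx 0) T0 (aX n) a0 iD i0 paths g1 one01).
- by move=> w _; rewrite mul1r X0 /= [xlog _ 0]/xlog mul0r oppr0 subr0 xlog_ge.
Qed.

Let rest k w : R := Z T w - N T w - alpha * JZ k w.
Let excess k n w : R := X n T w - N T w - alpha * J k n w.
Let excess_bound k0 k : R :=
  alpha * (1 + (alpha + 1) * k0.+1%:R * T) / (alpha * log_level k - alpha - 1).

Let excessE k n w :
  excess k n w = alpha * itv_integral (fun s => capinv n (X n s w) - capinv k (X n s w)) 0 T.
Proof. by rewrite /excess (XE n w T) itv_integralB// /J; ring. Qed.

Let excess_integrable k n : P.-integrable setT (EFin \o excess k n).
Proof.
have := integrableB_EFin measurableT (integrableZ_EFin alpha measurableT (J_integrable n n))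
  (integrableZ_EFin alpha measurableT (J_integrable k n)).
by apply: eq_integrable => // w _ /=; congr EFin; rewrite /excess (XE n w T) /J; ring.
Qed.

Let excess_path_le k0 k n w : alpha + 2 <= alpha * log_level k0 -> (k0 <= k)%N -> (k <= n)%N ->
  (alpha * log_level k - alpha - 1) * excess k n w <=
    alpha * ((alpha + 1) * k0.+1%:R * T - D n w).
Proof.
move=> large k0k kn; rewrite excessE mulrCA ler_pM2l// -itv_integralZ; last exact: itv_integrableB.
have -> : (alpha + 1) * k0.+1%:R * T - D n w =
    itv_integral (fun s => (alpha + 1) * k0.+1%:R - xlog_drift n (X n s w)) 0 T.
  rewrite itv_integralB//; last exact: itv_integrable_cst.
  by rewrite itv_integral_cst ?subr0// ltW.
apply: le_itv_integral => [||s _].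
- by apply: itv_integrableZ; exact: itv_integrableB.
- by apply: itv_integrableB => //; exact: itv_integrable_cst.
- by rewrite mulrC; exact: capinv_excess_le.
Qed.

Let E_excess_le k0 k n : alpha + 2 <= alpha * log_level k0 -> (k0 <= k)%N -> (k <= n)%N ->
  E (excess k n) <= excess_bound k0 k.
Proof.
move=> large k0k kn.
have denom : 0 < alpha * log_level k - alpha - 1.
  have : alpha * log_level k0 <= alpha * log_level k by rewrite ler_pM2l// le_log_level.
  by lra.
set c := (alpha + 1) * k0.+1%:R.
have idiff : P.-integrable setT (EFin \o (fun w => c * T - D n w)).
  exact: (integrableB_EFin measurableT (probability_integrable_cst P _) (D_integrable n)).
rewrite ler_pdivlMr// mulrC -RintegralZl//; last exact: excess_integrable.
apply: (@le_trans _ _ (E (fun w => alpha * (c * T - D n w)))).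
  apply: le_Rintegral => // [||w _]; last exact: excess_path_le.
    exact: (integrableZ_EFin _ measurableT (excess_integrable k n)).
  exact: (integrableZ_EFin _ measurableT idiff).
rewrite RintegralZl// ler_pM2l// RintegralB//; last exact: probability_integrable_cst.
by rewrite probability_Rintegral_cst -/c addrC lerD2r lerNl; exact: E_drift_ge.
Qed.

Let rest_ge0 k w : 0 <= rest k w.
Proof.
have := bessel_drift_ge alpha0 (@continuous_driver w) (@driver_le0 w) k (lexx 0) (ltW T0).
by rewrite Z0 (driver_le0 w (lexx 0)) /rest /JZ; lra.
Qed.

Let E_rest_le k0 k : alpha + 2 <= alpha * log_level k0 -> (k0 <= k)%N ->
  P.-integrable setT (EFin \o rest k) /\ E (rest k) <= excess_bound k0 k.
Proof.
move=> large k0k.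
apply: (@fatou_Rintegral _ _ _ P setT (fun i => excess k (i + k)%N)) => //.
- move=> i w _; rewrite excessE mulr_ge0 ?(ltW alpha0)// itv_integral_ge0// => s _.
  by rewrite subr_ge0 capinv_nondecreasing// leq_addl.
- move=> w _; rewrite (cvg_shiftn k (fun n => excess k n w)).
  have ZP := capinv_bessel_cvg alpha0 (@continuous_driver w) (@driver_le0 w) k 0 T.
  apply: cvgB; last by apply: cvgMl_tmp; exact: ZP.2.
  apply: cvgB; last exact: cvg_cst.
  exact: (bessel_cvg alpha0 (@continuous_driver w) (@driver_le0 w)).
- by move=> i; apply: E_excess_le => //; exact: leq_addl.
Qed.

Let log_level_large : exists k0, alpha + 2 <= alpha * log_level k0.
Proof.
have [k0 large] := log_level_ge (alpha^-1 * (alpha + 2)).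
by exists k0; rewrite -ler_pdivrMl//; exact: large.
Qed.

Lemma bessel_drift_integrable : P.-integrable setT (EFin \o (fun w => Z T w - N T w)).
Proof.
have [k0 large] := log_level_large; have [irest _] := E_rest_le large (leqnn k0).
have := integrableD_EFin measurableT irest (integrableZ_EFin alpha measurableT (JZ_integrable k0)).
by apply: eq_integrable => // w _ /=; congr EFin; rewrite /rest; ring.
Qed.

Let defect w : R := Z T w - N T w - alpha * inv_integral (fun s => Z s w) T.

Let rest_cvg w : rest^~ w @ \oo --> defect w.
Proof.
apply: cvgB; first exact: cvg_cst.
apply: cvgMl_tmp.
exact: (bessel_inv_integral_cvg alpha0 (@continuous_driver w) (@driver_le0 w) (lexx 0) (ltW T0)).
Qed.

Let defect_ge0 w : 0 <= defect w.
Proof. by apply: cvgr_to_ge (@rest_cvg w) _; apply: nearW => k; exact: rest_ge0. Qed.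

Let defect_le k w : defect w <= rest k w.
Proof.
apply: cvgr_to_le (@rest_cvg w) _; near=> j; rewrite lerD2l lerN2 ler_pM2l//.
by apply: le_itv_integral => // s _; apply: capinv_nondecreasing; near: j; exact: nbhs_infty_ge.
Unshelve. all: by end_near. Qed.

Let measurable_defect : measurable_fun setT defect.
Proof.
apply: (@measurable_fun_cvg _ _ _ _ rest) => // k.
have gT := ltW T0; apply: (usual_measurable_fun uF gT); apply: (G_measurableB (sF gT)).
  apply: (G_measurableB (sF gT)); last exact: adapted_driver.
  exact: (adapted_bessel fF alpha0 continuous_driver driver_le0 adapted_driver).
apply: (G_measurableZ (sF gT)).
exact: (adapted_capinv_bessel fF alpha0 continuous_driver driver_le0 adapted_driver k gT).
Qed.

Let E_defect : P.-integrable setT (EFin \o defect) /\ E defect = 0.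
Proof.
have [k0 large] := log_level_large; have [irest _] := E_rest_le large (leqnn k0).
have idefect : P.-integrable setT (EFin \o defect).
  by apply: (le_integrable_EFin _ _ _ irest) => // w _; rewrite ger0_norm.
split => //; apply/eqP; rewrite eq_le; apply/andP; split; last first.
  by apply: Rintegral_ge0 => w _; exact: defect_ge0.
apply/ler_addgt0Pr => e e0; rewrite add0r.
set c := alpha * (1 + (alpha + 1) * k0.+1%:R * T).
have c0 : 0 <= c by rewrite mulr_ge0 ?addr_ge0 ?mulr_ge0 ?addr_ge0 ?(ltW alpha0) ?(ltW T0).
have [k1 level_ge] := log_level_ge (alpha^-1 * (alpha + 1 + (e^-1 * c + 1))).
have [irestk rest_le] := E_rest_le large (leq_maxl k0 k1).
apply: (@le_trans _ _ (E (rest (maxn k0 k1)))).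
  by apply: le_Rintegral => // w _; exact: defect_le.
apply: le_trans rest_le _; rewrite /excess_bound -/c.
have := level_ge (maxn k0 k1) (leq_maxr _ _); rewrite ler_pdivrMl// => level_large.
have ec : 0 <= e^-1 * c by rewrite mulr_ge0// invr_ge0 ltW.
by rewrite ler_pdivrMr -?ler_pdivrMl//; lra.
Qed.

Lemma bessel_le_at : {ae P, forall w,
  Z T w <= N T w + alpha * inv_integral (fun s => Z s w) T}.
Proof.
have [idefect E0] := E_defect.
have : {ae P, forall w, setT w -> (EFin \o defect) w = cst 0%E w}.
  apply/(ae_eq_integral_abs P measurableT (measurableT_comp _ measurable_defect)) => //.
  rewrite (_ : (\int[P]_(x in setT) _)%E = (\int[P]_(x in setT) (defect x)%:E)%E).
    by rewrite integral_EFin_Rintegral// E0.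
  by apply: eq_integral => w _ /=; rewrite ger0_norm.
by apply: ae_imply => w /(_ I) [] defect0; have := defect0; rewrite /defect; lra.
Qed.

End fixed_time.

Theorem bessel_process : {ae P, forall w, regular_path (fun t => Z t w) /\
  forall t, Z t w = N t w + alpha * inv_integral (fun s => Z s w) t}.
Proof.
have : {ae P, forall w, forall n : nat, Z n.+1%:R w <=
    N n.+1%:R w + alpha * inv_integral (fun s => Z s w) n.+1%:R}.
  by apply: ae_foralln => n; exact: bessel_le_at.
apply: ae_imply => w at_integers; apply: (besselP alpha0 (@continuous_driver w) (@driver_le0 w)).
move=> [|n]; last exact: at_integers.
by rewrite Z0 (driver_le0 w (lexx 0)) itv_integral_point mulr0 addr0.
Qed.

Theorem bessel_integrable T : 0 <= T -> P.-integrable setT (EFin \o (fun w => Z T w - N T w)).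
Proof.
rewrite le_eqVlt => /orP[/eqP <-|]; last exact: bessel_drift_integrable.
have := probability_integrable_cst P 0.
apply: eq_integrable => // w _ /=; congr EFin.
by rewrite Z0 (driver_le0 w (lexx 0)) subr0.
Qed.

End bessel_process.

(** * Existence, corner avoidance and uniqueness *)

Section augmented_filtration.
Context {R : realType} {d : measure_display} {Omega : measurableType d}.
Variables (P : probability Omega R) (B C : R -> Omega -> R) (X0 Y0 : Omega -> R).
Notation H := (augmented_natural_filtration P B C X0 Y0).

Let Pnull_sub (A A' : set Omega) : A `<=` A' -> Pnull P A' -> Pnull P A.
Proof. by move=> AA [N [mN N0 AN]]; exists N; split => //; exact: subset_trans AN. Qed.

Let Pnull0 : Pnull P set0.
Proof. by exists set0; split. Qed.

Lemma augmented_sigma_algebra t : sigma_algebra setT (H t).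
Proof.
have [s0 sC sU] := smallest_sigma_algebra setT (generators B C X0 Y0 t).
split.
- by exists set0; split => //; rewrite setDv setU0.
- move=> A [G [sG nG]]; exists (setT `\` G); split; first exact: sC.
  apply: Pnull_sub nG => w /= [[[_ nA] nnG]|[[_ nG] nnA]].
    by right; split => //; apply: contrapT => nG; apply: nnG.
  by left; split => //; apply: contrapT => nA; apply: nnA.
- move=> A /choice[G GP].
  exists (\bigcup_n G n); split; first by apply: sU => n; have [] := GP n.
  apply: (@Pnull_sub _ (\bigcup_n ((A n `\` G n) `|` (G n `\` A n)))); last first.
    by apply: negligible_bigcup => n; have [] := GP n.
  move=> w [[[n _ An] nG]|[[n _ Gn] nA]]; exists n => //; [left|right]; split => //.
    by move=> Gn; apply: nG; exists n.
  by move=> An; apply: nA; exists n.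
Qed.

Lemma augmented_filtration : filtration H.
Proof.
split=> [t _|s t _ st A [G [sG nG]]]; first exact: augmented_sigma_algebra.
exists G; split => //; move: sG.
apply: smallest_sub; first exact: smallest_sigma_algebra.
move=> {nG}A [U [mU AE]]; apply: sub_sigma_algebra; exists U; split => //.
case: AE => [->|[->|[u [u0 us AE]]]]; [by left|by right; left|].
by right; right; exists u; split => //; exact: le_trans us st.
Qed.

Lemma augmented_generators t A : generators B C X0 Y0 t A -> H t A.
Proof.
move=> gA; exists A; split; first exact: sub_sigma_algebra.
by rewrite setDv setU0.
Qed.

Lemma augmented_Pnull t A : Pnull P A -> H t A.
Proof.
move=> nA; exists set0; split; last by rewrite setD0 set0D setU0.
by have [] := smallest_sigma_algebra setT (generators B C X0 Y0 t).
Qed.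

Lemma augmented_adapted :
  [/\ adapted H B, adapted H C, G_measurable (H 0) X0 & G_measurable (H 0) Y0].
Proof.
split=> [t t0 U mU|t t0 U mU|U mU|U mU]; apply: augmented_generators; exists U; split => //.
- by right; right; exists t; split => //; left.
- by right; right; exists t; split => //; right.
- by left.
- by right; left.
Qed.

End augmented_filtration.

Section path_conversion.
Context {R : realType}.
Notation mu := (@lebesgue_measure R).
Implicit Types X Y Z : R -> R.

Definition null_zeros Z := forall t, 0 <= t -> mu (`[0%R, t] `&` [set s | Z s = 0]) = 0%E.

Definition inv_summable Z := forall t, 0 <= t ->
  (\int[mu]_(s in `[0%R, t]) ((Z s)^-1)%:E < +oo)%E.

(* The clauses of [O2BP] for a single path. *)
Definition O2BP_path (alpha beta gamma delta x0 y0 : R) (b c X Y : R -> R) :=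
  forall t, 0 <= t ->
  [/\ mu (`[0%R, t] `&` [set s | X s = 0]) = 0%E /\ mu (`[0%R, t] `&` [set s | Y s = 0]) = 0%E,
      (\int[mu]_(s in `[0%R, t]) ((X s)^-1)%:E < +oo)%E,
      (\int[mu]_(s in `[0%R, t]) ((Y s)^-1)%:E < +oo)%E,
      X t = x0 + b t + alpha * Rintegral mu `[0%R, t] (fun s => (X s)^-1)
                     + beta * Rintegral mu `[0%R, t] (fun s => (Y s)^-1) &
      Y t = y0 + c t + gamma * Rintegral mu `[0%R, t] (fun s => (X s)^-1)
                     + delta * Rintegral mu `[0%R, t] (fun s => (Y s)^-1)].

Lemma ae_gt0_null_zeros Z : continuous Z -> {ae mu, forall s, 0 <= s -> 0 < Z s} ->
  null_zeros Z.
Proof.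
move=> cZ [A [mA A0 AP]] t t0; apply: (subset_measure0 _ mA _ A0).
  apply: measurableI => //; rewrite -[X in measurable X]setTI.
  exact: (continuous_measurable_fun cZ measurableT (measurable_set1 (0 : R))).
move=> s [/= + Z0]; rewrite in_itv/= => /andP[s0 _]; apply: AP => /= pos.
by have := pos s0; rewrite Z0 ltxx.
Qed.

Lemma inv_integrable_summable Z : inv_integrable Z -> inv_summable Z.
Proof. by move=> iZ t _; rewrite integral_EFin_Rintegral ?ltry//; exact: iZ. Qed.

Lemma path_solution_O2BP_path alpha beta gamma delta x0 y0 (b c X Y : R -> R) :
  path_solution alpha beta gamma delta (fun t => x0 + b t) (fun t => y0 + c t) X Y ->
  O2BP_path alpha beta gamma delta x0 y0 b c X Y.
Proof.
move=> [[cX cY] ge0 pos [iX iY] E] t t0; have [XE YE] := E t t0.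
split=> //; [split|exact: inv_integrable_summable|exact: inv_integrable_summable].
- by apply: ae_gt0_null_zeros => //; apply: (ae_imply _ pos) => s XY0 /XY0[].
- by apply: ae_gt0_null_zeros => //; apply: (ae_imply _ pos) => s XY0 /XY0[].
Qed.

Section nonneg_path.
Variable Z : R -> R.
Hypotheses (Z0 : forall t, 0 <= t -> 0 <= Z t) (cZ : {within `[0, +oo[, continuous Z}).

Lemma null_zeros_ae_gt0 : null_zeros Z -> {ae mu, forall s, 0 <= s -> 0 < Z (Num.max s 0)}.
Proof.
move=> nZ.
have : {ae mu, forall s, forall n : nat, ~ (`[0%R, n%:R] `&` [set s | Z s = 0]) s}.
  apply: ae_foralln => n; exists (`[0%R, n%:R] `&` [set s | Z s = 0]); split.
  - have := continuous_measurable_fun (continuous_max0 cZ) measurableT (measurable_set1 (0 : R)).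
    rewrite setTI => /(measurableI _ _ (measurable_itv `[0, n%:R])).
    congr measurable; apply/seteqP.
    by split => s /= [sn]; have := sn; rewrite in_itv/= => /andP[s0 _]; rewrite (max_idPl s0).
  - by apply: nZ; rewrite ler0n.
  - by move=> s; exact: contrapT.
apply: ae_imply => s nonzero s0; rewrite (max_idPl s0) lt_neqAle Z0// andbT eq_sym.
apply/eqP => Zs; apply: (nonzero (Num.truncn s).+1); split => //=.
by rewrite in_itv/= s0 ltW// truncnS_gt.
Qed.

Lemma inv_summable_integrable : inv_summable Z ->
  inv_integrable (fun s => Z (Num.max s 0)).
Proof.
move=> sZ T; apply: (@itv_integrableS _ _ 0 (Num.max T 0)) => //; first by rewrite le_max lexx.
apply/integrableP; split.
  apply/measurable_EFinP; apply: measurable_funTS; apply: measurableT_comp measurable_invr _.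
  exact: (continuous_measurable_fun (continuous_max0 cZ)).
apply: le_lt_trans (sZ _ (maxr0_ge0 T)); rewrite le_eqVlt; apply/orP; left; apply/eqP.
apply: eq_integral => s; rewrite inE/= in_itv/= => /andP[s0 _].
by rewrite (max_idPl s0) ger0_norm// invr_ge0 Z0.
Qed.

End nonneg_path.

Lemma inv_integral_max0 Z t :
  inv_integral (fun s => Z (Num.max s 0)) t = Rintegral mu `[0%R, t] (fun s => (Z s)^-1).
Proof. by apply: eq_itv_integral => s /andP[s0 _]; rewrite (max_idPl s0). Qed.

Lemma O2BP_path_solution alpha beta gamma delta x0 y0 (b c X Y : R -> R) :
  {within `[0, +oo[, continuous X} -> {within `[0, +oo[, continuous Y} ->
  (forall t, 0 <= t -> 0 <= X t /\ 0 <= Y t) ->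
  O2BP_path alpha beta gamma delta x0 y0 b c X Y ->
  path_solution alpha beta gamma delta (fun t => x0 + b t) (fun t => y0 + c t)
    (fun t => X (Num.max t 0)) (fun t => Y (Num.max t 0)).
Proof.
move=> cX cY ge0 E.
have X0 t (t0 : 0 <= t) := (ge0 t t0).1; have Y0 t (t0 : 0 <= t) := (ge0 t t0).2.
split=> [|t t0|||t t0]; first by split; exact: continuous_max0.
- by rewrite (max_idPl t0); exact: ge0.
- have nX : null_zeros X by move=> t /E[[]].
  have nY : null_zeros Y by move=> t /E[[]].
  apply: (ae_imply2 _ (null_zeros_ae_gt0 X0 cX nX) (null_zeros_ae_gt0 Y0 cY nY)).
  by move=> s Xs Ys s0; split; [exact: Xs|exact: Ys].
- by split; apply: inv_summable_integrable => // t /E[].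
- by have [_ _ _ XE YE] := E t t0; rewrite (max_idPl t0) !inv_integral_max0.
Qed.

End path_conversion.

Lemma O2BP_path_solution_ae (R : realType) (d : measure_display) (Omega : measurableType d)
  (P : probability Omega R) (F : R -> set (set Omega)) (B C : R -> Omega -> R)
  (alpha beta gamma delta : R) (X0 Y0 : Omega -> R) (X Y : R -> Omega -> R) :
  O2BP P F B C alpha beta gamma delta X0 Y0 X Y ->
  {ae P, forall w, path_solution alpha beta gamma delta (fun t => X0 w + B t w)
    (fun t => Y0 w + C t w) (fun t => X (Num.max t 0) w) (fun t => Y (Num.max t 0) w)}.
Proof.
move=> [_ [cX cY] ge0 _ E]; apply: (ae_imply _ E) => w Ew.
by apply: (O2BP_path_solution (cX w) (cY w)) => // t; exact: ge0.
Qed.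

Section path_solution_sol.
Context {R : realType}.
Variables (alpha beta gamma delta p q : R) (x y b c : R -> R).
Hypotheses (alpha0 : 0 < alpha) (beta0 : 0 <= beta) (gamma0 : 0 <= gamma) (delta0 : 0 < delta)
  (p0 : 0 <= p) (q0 : 0 <= q) (rx : regular_path x) (ry : regular_path y).
Notation X := (solX alpha beta gamma delta p q x y).
Notation Y := (solY alpha beta gamma delta p q x y).

Lemma sol_init : X 0 = x 0 + p /\ Y 0 = y 0 + q.
Proof.
have XE := solXE alpha0 beta0 gamma0 delta0 p0 q0 rx ry 0.
have YE := solYE alpha0 beta0 gamma0 delta0 p0 q0 rx ry 0.
by move: (X) (Y) XE YE => u v -> ->; rewrite !itv_integral_point; split; ring.
Qed.

Lemma path_solution_sol :
  (forall t, 0 <= t -> x t = b t + alpha * inv_integral x t) ->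
  (forall t, 0 <= t -> y t = c t + delta * inv_integral y t) ->
  path_solution alpha beta gamma delta (fun t => p + b t) (fun t => q + c t) X Y.
Proof.
move=> xE yE.
have xX := solX_above alpha0 beta0 gamma0 delta0 p0 q0 rx ry.
have yY := solY_above alpha0 beta0 gamma0 delta0 p0 q0 rx ry.
have XE := @solXE _ _ _ _ _ _ _ _ _ alpha0 beta0 gamma0 delta0 p0 q0 rx ry.
have YE := @solYE _ _ _ _ _ _ _ _ _ alpha0 beta0 gamma0 delta0 p0 q0 rx ry.
move: (X) (Y) xX yY XE YE => u v xu yv uE vE.
split.
- by have [] := xu; have [] := yv.
- by move=> t t0; split; [exact: path_above_ge0 rx xu t0|exact: path_above_ge0 ry yv t0].
- apply: (ae_imply2 _ (path_above_gt0 rx xu) (path_above_gt0 ry yv)) => s us vs s0.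
  by split; [exact: us|exact: vs].
- by split; [exact: (path_above_inv_integrable rx xu)|exact: (path_above_inv_integrable ry yv)].
- by move=> t t0; rewrite {1}uE {1}vE xE// yE//; split; ring.
Qed.

End path_solution_sol.

Section path_increments.
Context {R : realType}.

Lemma path_solution_increment alpha beta gamma delta p q (b c X Y : R -> R) T : 0 <= T ->
  path_solution alpha beta gamma delta (fun t => p + b t) (fun t => q + c t) X Y ->
  X T - X 0 - (b T - b 0) = alpha * inv_integral X T + beta * inv_integral Y T /\
  Y T - Y 0 - (c T - c 0) = gamma * inv_integral X T + delta * inv_integral Y T.
Proof.
move=> T0 [_ _ _ _ E]; have [XT YT] := E T T0; have [X0 Y0] := E 0 (lexx 0).
by rewrite {1}XT {1}YT X0 Y0 !itv_integral_point; split; ring.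
Qed.

Lemma path_above_inv_integral_bounds (k n T : R) (x X : R -> R) : 0 < k -> 0 <= T ->
  regular_path x -> path_above x X -> x T = n + k * inv_integral x T ->
  0 <= inv_integral X T <= k^-1 * (x T - n).
Proof.
move=> k0 T0 rx xX xE; rewrite xE addrC addKr mulKf ?gt_eqF//.
rewrite itv_integral_ge0 => [|s /andP[s0 _]]/=.
  by apply: (le_inv_integral rx (path_above_refl rx) xX) => //; have [] := xX.
by rewrite invr_ge0; exact: path_above_ge0 rx xX s0.
Qed.

End path_increments.

Section bessel_from0.
Context {R : realType} {d : measure_display} {Omega : measurableType d}.
Variable P : probability Omega R.

Definition bessel_from0 (M : R -> Omega -> R) (alpha : R) (x : R -> Omega -> R) :=
  [/\ forall w, x 0 w = 0,
   {ae P, forall w, regular_path (x^~ w) /\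
     forall t, 0 <= t -> x t w = M t w + alpha * inv_integral (x^~ w) t},
   forall H, filtration H -> adapted H M -> adapted_with_inv H x &
   forall T, 0 <= T -> P.-integrable setT (EFin \o (fun w => x T w - M T w))].

Lemma bessel_exists (F : R -> set (set Omega)) (rho : R) (B C : R -> Omega -> R) (l m alpha : R) :
  usual_filtration P F -> -1 <= rho <= 1 -> correlated_BM P F rho B C ->
  0 < alpha -> BM_var rho l m = 1 -> exists x, bessel_from0 (BM_comb B C l m) alpha x.
Proof.
move=> uF rho1 bm alpha0 var1.
have cN w : continuous ((driver B C l m)^~ w) by exact: (continuous_driver bm).
have N0 w t : t <= 0 -> driver B C l m t w = 0 by exact: (driver_le0 bm).
exists (fun t w => bessel alpha ((driver B C l m)^~ w) t); split.
- by move=> w; exact: (bessel_le0 alpha0 (cN w) (N0 w) (lexx 0)).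
- apply: (ae_imply _ (bessel_process uF rho1 bm alpha0 var1)) => w [rx xE]; split; first exact: rx.
  by move=> t t0; rewrite -(driver_ge0 B C l m w t0); exact: xE.
- move=> H fH aM; apply: (adapted_with_inv_bessel fH alpha0 cN N0).
  by move=> t t0; rewrite /driver (max_idPl t0); exact: aM.
- move=> T T0; have := bessel_integrable uF rho1 bm alpha0 var1 T0.
  by apply: eq_integrable => // w _ /=; rewrite (driver_ge0 _ _ _ _ _ T0).
Qed.

End bessel_from0.

Section solution.
Context {R : realType} {d : measure_display} {Omega : measurableType d}.
Variable P : probability Omega R.
Variables (F : R -> set (set Omega)) (rho : R) (B C : R -> Omega -> R) (alpha beta gamma delta : R).
Hypotheses (uF : usual_filtration P F) (bm : correlated_BM P F rho B C).
Hypotheses (alpha0 : 0 < alpha) (delta0 : 0 < delta) (beta0 : 0 <= beta) (gamma0 : 0 <= gamma).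
Variables (x y : R -> Omega -> R).
Hypotheses (bx : bessel_from0 P (BM_comb B C 1 0) alpha x)
  (by_ : bessel_from0 P (BM_comb B C 0 1) delta y).

Let bessel_pair w :=
  (regular_path (x^~ w) /\
    forall t, 0 <= t -> x t w = BM_comb B C 1 0 t w + alpha * inv_integral (x^~ w) t) /\
  (regular_path (y^~ w) /\
    forall t, 0 <= t -> y t w = BM_comb B C 0 1 t w + delta * inv_integral (y^~ w) t).

Let ae_bessel_pair : {ae P, forall w, bessel_pair w}.
Proof.
have [_ aex _ _] := bx; have [_ aey _ _] := by_.
exact: (ae_imply2 (fun w xw yw => conj xw yw) aex aey).
Qed.

Let exceptional : set Omega := sval (cid ae_bessel_pair).
Let exceptionalP : [/\ measurable exceptional, P exceptional = 0%E &
  ~` [set w | bessel_pair w] `<=` exceptional].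
Proof. exact: (svalP (cid ae_bessel_pair)). Qed.

Let not_exceptional w : w \notin exceptional -> bessel_pair w.
Proof.
move=> nN; have [_ _ sub] := exceptionalP; apply: contrapT => bad.
by move/negP: nN; apply; apply/mem_set/sub.
Qed.

Let ae_not_exceptional : {ae P, forall w, w \notin exceptional}.
Proof.
have [mN N0 _] := exceptionalP; exists exceptional; split => // w /= inN.
by apply: contrapT => nN; apply: inN; rewrite notin_setE.
Qed.

Let unexceptional (z : R -> Omega -> R) t w := if w \in exceptional then 1 else z t w.

Let regular_cst1 : regular_path (fun=> 1 : R).
Proof.
by split; [move=> r; exact: cvg_cst| |exact: aeW|move=> T; exact: itv_integrable_cst].
Qed.

Let rx w : regular_path ((unexceptional x)^~ w).
Proof.
rewrite /unexceptional; have [_|/negP/negP nN] := boolP (w \in exceptional).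
  exact: regular_cst1.
by have [[]] := not_exceptional nN.
Qed.

Let ry w : regular_path ((unexceptional y)^~ w).
Proof.
rewrite /unexceptional; have [_|/negP/negP nN] := boolP (w \in exceptional).
  exact: regular_cst1.
by have [_ []] := not_exceptional nN.
Qed.

Variables X0 Y0 : Omega -> R.
Hypothesis XY0 : forall w, 0 <= X0 w /\ 0 <= Y0 w.
Let X00 w : 0 <= X0 w. Proof. by have [] := XY0 w. Qed.
Let Y00 w : 0 <= Y0 w. Proof. by have [] := XY0 w. Qed.

(* On the exceptional null set, where the Bessel paths may fail to exist, the processes are
   frozen. *)
Definition solutionX t w : R := if w \in exceptional then X0 w
  else solX alpha beta gamma delta (X0 w) (Y0 w) ((unexceptional x)^~ w) ((unexceptional y)^~ w) t.
Definition solutionY t w : R := if w \in exceptional then Y0 w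
  else solY alpha beta gamma delta (X0 w) (Y0 w) ((unexceptional x)^~ w) ((unexceptional y)^~ w) t.
Notation X := solutionX.
Notation Y := solutionY.

Section adapted_solution.
Variable H : R -> set (set Omega).
Hypotheses (fH : filtration H) (nullH : forall N, Pnull P N -> H 0 N).

Let H_exceptional t : 0 <= t -> H t exceptional.
Proof.
move=> t0; apply: (fH.2 _ _ (lexx 0) t0); apply: nullH.
by have [mN N0 _] := exceptionalP; exists exceptional; split.
Qed.

Let adapted_with_inv_unexceptional z : adapted_with_inv H z -> adapted_with_inv H (unexceptional z).
Proof.
move=> [az aI]; split=> t t0; have sHt := fH.1 t t0; have Ht := H_exceptional t0.
  by apply: (G_measurable_if sHt Ht) (az t t0); exact: G_measurable_cst.
have -> : (fun w => inv_integral ((unexceptional z)^~ w) t) =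
    (fun w => if w \in exceptional then itv_integral (fun=> 1^-1) 0 t else inv_integral (z^~ w) t).
  by apply/funext => w; rewrite /unexceptional; case: (w \in exceptional).
by apply: (G_measurable_if sHt Ht) (aI t t0); exact: G_measurable_cst.
Qed.

Lemma solution_adapted : adapted H B -> adapted H C ->
  G_measurable (H 0) X0 -> G_measurable (H 0) Y0 -> adapted H X /\ adapted H Y.
Proof.
move=> aB aC gX gY.
have aM l m : adapted H (BM_comb B C l m).
  move=> t t0; have sHt := fH.1 t t0.
  by apply: (G_measurableD sHt); apply: (G_measurableZ sHt); [exact: aB|exact: aC].
have [_ _ aIx _] := bx; have [_ _ aIy _] := by_.
have ax := adapted_with_inv_unexceptional (aIx H fH (aM _ _)).
have ay := adapted_with_inv_unexceptional (aIy H fH (aM _ _)).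
have [aX aY] := adapted_sol fH alpha0 beta0 gamma0 delta0 X00 Y00 gX gY rx ry ax ay.
split=> t t0; apply: (G_measurable_if (fH.1 t t0) (H_exceptional t0)) => //.
- exact: (G_measurable_mono fH (lexx 0)).
- exact: aX.
- exact: (G_measurable_mono fH (lexx 0)).
- exact: aY.
Qed.

End adapted_solution.

Let aboveX w := solX_above alpha0 beta0 gamma0 delta0 (X00 w) (Y00 w) (rx w) (ry w).
Let aboveY w := solY_above alpha0 beta0 gamma0 delta0 (X00 w) (Y00 w) (rx w) (ry w).

Lemma solution_continuous w : continuous (X^~ w) /\ continuous (Y^~ w).
Proof.
rewrite /solutionX /solutionY; case: (w \in exceptional); first by split => r; exact: cvg_cst.
by split; [have [] := aboveX w|have [] := aboveY w].
Qed.

Lemma solution_ge0 t w : 0 <= t -> 0 <= X t w /\ 0 <= Y t w.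
Proof.
move=> t0; rewrite /solutionX /solutionY; case: (w \in exceptional); first exact: XY0.
by split; [exact: (path_above_ge0 (rx w) (aboveX w) t0)|
  exact: (path_above_ge0 (ry w) (aboveY w) t0)].
Qed.

Lemma solution_init w : X 0 w = X0 w /\ Y 0 w = Y0 w.
Proof.
have [inN|nN] := boolP (w \in exceptional); first by rewrite /solutionX /solutionY inN.
have x0 : unexceptional x 0 w = 0 by rewrite /unexceptional (negbTE nN); have [-> _ _ _] := bx.
have y0 : unexceptional y 0 w = 0 by rewrite /unexceptional (negbTE nN); have [-> _ _ _] := by_.
have [XE YE] := sol_init alpha0 beta0 gamma0 delta0 (X00 w) (Y00 w) (rx w) (ry w).
rewrite /solutionX /solutionY (negbTE nN); split.
  by apply: (etrans XE); rewrite x0 add0r.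
by apply: (etrans YE); rewrite y0 add0r.
Qed.

Let unexceptionalE z w : w \notin exceptional -> (unexceptional z)^~ w = z^~ w.
Proof. by move=> /negbTE nN; apply/funext => t; rewrite /unexceptional nN. Qed.

Let solution_path w : w \notin exceptional ->
  path_solution alpha beta gamma delta (fun t => X0 w + B t w) (fun t => Y0 w + C t w)
    (X^~ w) (Y^~ w).
Proof.
move=> nN; have [[rxw xE] [ryw yE]] := not_exceptional nN.
rewrite /solutionX /solutionY (negbTE nN) !(unexceptionalE _ nN).
apply (path_solution_sol alpha0 beta0 gamma0 delta0 (X00 w) (Y00 w) rxw ryw) => t t0.
  by rewrite xE// /BM_comb; ring.
by rewrite yE// /BM_comb; ring.
Qed.

Lemma solution_path_ae : {ae P, forall w,
  path_solution alpha beta gamma delta (fun t => X0 w + B t w) (fun t => Y0 w + C t w)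
    (X^~ w) (Y^~ w)}.
Proof. by apply: (ae_imply _ ae_not_exceptional) => w; exact: solution_path. Qed.

Hypotheses (gX0 : G_measurable (F 0) X0) (gY0 : G_measurable (F 0) Y0).

Let adapted_F : adapted F X /\ adapted F Y.
Proof.
have [_ _ nF _] := uF; have [_ _ [aB aC] _] := bm.
exact: (solution_adapted (usual_filtration_filtration uF) nF aB aC gX0 gY0).
Qed.

Theorem solution_O2BP : strong_O2BP P F B C alpha beta gamma delta X0 Y0 X Y.
Proof.
have [aB aC gX gY] := augmented_adapted P B C X0 Y0.
split; last first.
  by apply: (solution_adapted (augmented_filtration P B C X0 Y0)) => // N; exact: augmented_Pnull.
split; [exact: adapted_F| |by move=> t w; exact: solution_ge0|exact: solution_init|].
  by split=> w; [exact (continuous_subspaceT (solution_continuous w).1)|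
    exact (continuous_subspaceT (solution_continuous w).2)].
by apply: (ae_imply _ solution_path_ae) => w; exact: path_solution_O2BP_path.
Qed.

Section drift_integrable.
Variable T : R.
Hypothesis T0 : 0 <= T.

Let inv_integral_bounds w : w \notin exceptional ->
  0 <= inv_integral (X^~ w) T <= alpha^-1 * (x T w - BM_comb B C 1 0 T w) /\
  0 <= inv_integral (Y^~ w) T <= delta^-1 * (y T w - BM_comb B C 0 1 T w).
Proof.
move=> nN; have [[rxw xE] [ryw yE]] := not_exceptional nN.
have xX := aboveX w; have yY := aboveY w.
rewrite /solutionX /solutionY (negbTE nN); rewrite !(unexceptionalE _ nN) in xX yY *.
split; first exact: (path_above_inv_integral_bounds alpha0 T0 rxw xX (xE T T0)).
exact: (path_above_inv_integral_bounds delta0 T0 ryw yY (yE T T0)).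
Qed.

Let drift_le (k h k' I u I' u' : R) : 0 < k -> 0 <= h -> 0 <= I <= k^-1 * u ->
  0 <= I' <= k'^-1 * u' -> `|k * I + h * I'| <= 1 * u + h * k'^-1 * u'.
Proof.
move=> k0 h0 /andP[I0 Iu] /andP[I'0 I'u'].
rewrite ger0_norm; last by rewrite addr_ge0// mulr_ge0// ltW.
by apply: lerD; [rewrite mul1r -ler_pdivlMl|rewrite -mulrA ler_wpM2l].
Qed.

Let measurable_drift (Z : R -> Omega -> R) l m : adapted F Z ->
  measurable_fun setT (fun w => Z T w - Z 0 w - BM_comb B C l m T w).
Proof.
move=> aZ; apply: (usual_measurable_fun uF T0); have sFT := usual_sigma_algebra uF T0.
apply: (G_measurableB sFT); last exact: (adapted_BM_comb uF bm).
apply: (G_measurableB sFT); first exact: aZ.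
exact: (G_measurable_mono (usual_filtration_filtration uF) (lexx 0) T0 (aZ 0 (lexx 0))).
Qed.

Let drift_eq w : w \notin exceptional ->
  X T w - X 0 w - BM_comb B C 1 0 T w =
    alpha * inv_integral (X^~ w) T + beta * inv_integral (Y^~ w) T /\
  Y T w - Y 0 w - BM_comb B C 0 1 T w =
    delta * inv_integral (Y^~ w) T + gamma * inv_integral (X^~ w) T.
Proof.
move=> nN; have [XE YE] := path_solution_increment T0 (solution_path nN).
have [BC0 _ _ _] := bm; have [B0 C0] := BC0 w.
have -> : BM_comb B C 1 0 T w = B T w - B 0 w by rewrite B0 /BM_comb; ring.
have -> : BM_comb B C 0 1 T w = C T w - C 0 w by rewrite C0 /BM_comb; ring.
by split; [exact: XE|exact: (etrans YE (addrC _ _))].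
Qed.

(* The solution lies above the Bessel processes, so its drifts are dominated by theirs. *)
Lemma solution_drift_integrable :
  P.-integrable setT (EFin \o (fun w => X T w - X 0 w - BM_comb B C 1 0 T w)) /\
  P.-integrable setT (EFin \o (fun w => Y T w - Y 0 w - BM_comb B C 0 1 T w)).
Proof.
have [aX aY] := adapted_F.
have [_ _ _ /(_ T T0) ix] := bx; have [_ _ _ /(_ T T0) iy] := by_.
have ixy := integrableD_EFin measurableT (integrableZ_EFin 1 measurableT ix)
   (integrableZ_EFin (beta * delta^-1) measurableT iy).
have iyx := integrableD_EFin measurableT (integrableZ_EFin 1 measurableT iy)
   (integrableZ_EFin (gamma * alpha^-1) measurableT ix).
split.
  apply: (ae_le_integrable (measurable_drift 1 0 aX) ixy).
  apply: (ae_imply _ ae_not_exceptional) => w nN; have [IX IY] := inv_integral_bounds nN.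
  by rewrite (drift_eq nN).1; exact: (drift_le alpha0 beta0 IX IY).
apply: (ae_le_integrable (measurable_drift 0 1 aY) iyx).
apply: (ae_imply _ ae_not_exceptional) => w nN; have [IX IY] := inv_integral_bounds nN.
by rewrite (drift_eq nN).2; exact: (drift_le delta0 gamma0 IY IX).
Qed.

End drift_integrable.
End solution.

Theorem O2BP_existence (R : realType) (d : measure_display) (Omega : measurableType d)
  (P : probability Omega R) (F : R -> set (set Omega)) (rho : R) (B C : R -> Omega -> R)
  (alpha beta gamma delta : R) (X0 Y0 : Omega -> R) :
  usual_filtration P F -> -1 <= rho <= 1 -> correlated_BM P F rho B C ->
  0 < alpha -> 0 < delta -> 0 <= beta -> 0 <= gamma ->
  G_measurable (F 0) X0 -> G_measurable (F 0) Y0 -> (forall w, 0 <= X0 w /\ 0 <= Y0 w) ->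
  exists X Y : R -> Omega -> R, [/\ strong_O2BP P F B C alpha beta gamma delta X0 Y0 X Y,
    forall w, continuous (X^~ w) /\ continuous (Y^~ w),
    {ae P, forall w, path_solution alpha beta gamma delta (fun t => X0 w + B t w)
       (fun t => Y0 w + C t w) (X^~ w) (Y^~ w)} &
    forall T, 0 <= T ->
      P.-integrable setT (EFin \o (fun w => X T w - X 0 w - BM_comb B C 1 0 T w)) /\
      P.-integrable setT (EFin \o (fun w => Y T w - Y 0 w - BM_comb B C 0 1 T w))].
Proof.
move=> uF rho1 bm alpha0 delta0 beta0 gamma0 gX gY XY0.
have var10 : BM_var rho 1 0 = 1 by rewrite /BM_var; ring.
have var01 : BM_var rho 0 1 = 1 by rewrite /BM_var; ring.
have [x bx] := bessel_exists uF rho1 bm alpha0 var10.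
have [y by_] := bessel_exists uF rho1 bm delta0 var01.
exists (solutionX beta gamma bx by_ X0 Y0), (solutionY beta gamma bx by_ X0 Y0); split.
- exact (solution_O2BP uF bm alpha0 delta0 beta0 gamma0 bx by_ XY0 gX gY).
- exact (solution_continuous alpha0 delta0 beta0 gamma0 bx by_ XY0).
- exact (solution_path_ae alpha0 delta0 beta0 gamma0 bx by_ XY0).
- exact (solution_drift_integrable uF bm alpha0 delta0 beta0 gamma0 bx by_ XY0 gX gY).
Qed.

Section positive_times.
Context {R : realType}.
Notation mu := (@lebesgue_measure R).
Implicit Types (X : R -> R) (t : R).

Lemma exists_gt0_before X t : {ae mu, forall s, 0 <= s -> 0 < X s} -> 0 < t ->
  exists r, [/\ 0 < r, r < t & 0 < X r].
Proof.
move=> [A [mA A0 AP]] t0; apply: contrapT => no.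
have : (mu `]0%R, t[ <= mu A)%E.
  apply: le_measure; rewrite ?inE// => r /=; rewrite in_itv/= => /andP[r0 rt].
  by apply: AP => /= pos; apply: no; exists r; split => //; exact/pos/ltW.
by rewrite A0 lebesgue_measure_itv/= lte_fin t0 -EFinB lee_fin subr0 leNgt t0.
Qed.

Lemma exists_rational_gt0 X t : continuous X -> {ae mu, forall s, 0 <= s -> 0 < X s} -> 0 < t ->
  exists i j : nat, i%:R / j.+1%:R <= t /\ 0 < X (i%:R / j.+1%:R).
Proof.
move=> cX pos t0; have [r [r0 rt Xr]] := exists_gt0_before pos t0.
have /cvgrPdist_lt /(_ _ Xr) /nbhs_ballP[e /= e0 Xe] := cX r.
pose j := Num.truncn e^-1; pose i := Num.truncn (r * j.+1%:R).
have je : j.+1%:R^-1 < e.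
  by rewrite -[ltRHS]invrK ltf_pV2 ?posrE ?invr_gt0// truncnS_gt.
have /andP[ile ltiS] := truncn_itv (mulr_ge0 (ltW r0) (ler0n R j.+1)).
rewrite -/i in ile ltiS.
have qr : i%:R / j.+1%:R <= r by rewrite ler_pdivrMr.
have rq : r < i%:R / j.+1%:R + j.+1%:R^-1.
  by rewrite -{2}[j.+1%:R^-1]mul1r -mulrDl ltr_pdivlMr// natr1.
exists i, j; split; first by apply: le_trans qr (ltW rt).
have := Xe (i%:R / j.+1%:R); rewrite /ball/= ger0_norm ?subr_ge0// => near_r.
have /near_r : r - i%:R / j.+1%:R < e by apply: lt_trans je; rewrite ltrBlDl.
by move=> /ltr_normlW; lra.
Qed.

End positive_times.

Section drift_inequalities.
Context {R : realType}.
Implicit Types (a b l m u v : R).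

Lemma sqr_sqrtD_le l m u v a b : 0 < l -> 0 < m -> 0 <= u -> 0 <= v -> 0 < a -> 0 < b ->
  (Num.sqrt (l * u) + Num.sqrt (m * v)) ^+ 2 <= (l * a + m * b) * (u / a + v / b).
Proof.
move=> l0 m0 u0 v0 a0 b0.
have := sqr_sqrtr (mulr_ge0 (ltW l0) u0); have := sqr_sqrtr (mulr_ge0 (ltW m0) v0).
move: (Num.sqrt (l * u)) (Num.sqrt (m * v)) => p q qE pE.
have uE : u = p ^+ 2 / l by rewrite pE mulrC mulKf// gt_eqF.
have vE : v = q ^+ 2 / m by rewrite qE mulrC mulKf// gt_eqF.
(* Cauchy-Schwarz *)
rewrite -subr_ge0.
have -> : (l * a + m * b) * (u / a + v / b) - (p + q) ^+ 2 =
   (m * b * p - l * a * q) ^+ 2 / (l * a * (m * b)).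
  by rewrite uE vE; field; rewrite !gt_eqF.
by rewrite divr_ge0 ?sqr_ge0// !mulr_ge0// ltW.
Qed.

Lemma radial_drift_ge alpha beta gamma delta a b : 0 <= beta -> 0 <= gamma -> 0 < a -> 0 < b ->
  alpha + delta <= a * (alpha / a + beta / b) + b * (gamma / a + delta / b).
Proof.
move=> beta0 gamma0 a0 b0.
have -> : a * (alpha / a + beta / b) + b * (gamma / a + delta / b) =
    alpha + delta + (beta * (a / b) + gamma * (b / a)) by field; rewrite !gt_eqF.
by rewrite lerDl addr_ge0// mulr_ge0// divr_ge0// ltW.
Qed.

Lemma correlated_quadratic_le rho a b : 0 <= a -> 0 <= b ->
  a ^+ 2 + 2 * rho * a * b + b ^+ 2 <= (1 + Num.max rho 0) * (a ^+ 2 + b ^+ 2).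
Proof.
move=> a0 b0.
have rho_le : rho * (a * b) <= Num.max rho 0 * (a * b).
  by rewrite ler_wpM2r ?mulr_ge0// le_max lexx.
have am_gm : Num.max rho 0 * (2 * (a * b)) <= Num.max rho 0 * (a ^+ 2 + b ^+ 2).
  by rewrite ler_wpM2l ?maxr0_ge0//; have := sqr_ge0 (a - b); rewrite sqrrB; lra.
by lra.
Qed.

Lemma path_solution_increasing_drift alpha beta gamma delta p q l m T (b c X Y : R -> R) :
  0 <= l * alpha + m * gamma -> 0 <= l * beta + m * delta ->
  path_solution alpha beta gamma delta (fun t => p + b t) (fun t => q + c t) X Y ->
  increasing_drift (fun t => l * X t + m * Y t) (fun t => l * b t + m * c t)
    (fun r => (l * alpha + m * gamma) / X r + (l * beta + m * delta) / Y r) 0 T.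
Proof.
move=> u0 v0 S; have [_ ge0 _ [iX iY] _] := S.
split=> [|r /andP[r0 _]|r /andP[r0 _]].
- by apply: itv_integrableD; exact: itv_integrableZ.
- by have [Xr Yr] := ge0 r r0; rewrite addr_ge0// divr_ge0.
- have [XE YE] := path_solution_increment r0 S.
  rewrite itv_integralD ?itv_integralZ//; try exact: itv_integrableZ.
  move: XE YE; move: (inv_integral X r) (inv_integral Y r) => I J XE YE.
  have -> : X r = X 0 + (b r - b 0) + (alpha * I + beta * J) by rewrite -XE; ring.
  have -> : Y r = Y 0 + (c r - c 0) + (gamma * I + delta * J) by rewrite -YE; ring.
  by ring.
Qed.

End drift_inequalities.

Section corner.
Context {R : realType} {d : measure_display} {Omega : measurableType d}.
Variable P : probability Omega R.
Variables (F : R -> set (set Omega)) (rho : R) (B C : R -> Omega -> R) (alpha beta gamma delta : R).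
Hypotheses (uF : usual_filtration P F) (rho1 : -1 <= rho <= 1) (bm : correlated_BM P F rho B C).
Hypotheses (alpha0 : 0 < alpha) (delta0 : 0 < delta) (beta0 : 0 <= beta) (gamma0 : 0 <= gamma).
Notation mu := (@lebesgue_measure R).
Variables (X0 Y0 : Omega -> R) (X Y : R -> Omega -> R).
Hypotheses (XY : O2BP P F B C alpha beta gamma delta X0 Y0 X Y)
  (cXY : forall w, continuous (X^~ w) /\ continuous (Y^~ w))
  (path : {ae P, forall w, path_solution alpha beta gamma delta (fun t => X0 w + B t w)
     (fun t => Y0 w + C t w) (X^~ w) (Y^~ w)})
  (drift_integrable : forall T, 0 <= T ->
      P.-integrable setT (EFin \o (fun w => X T w - X 0 w - BM_comb B C 1 0 T w)) /\
      P.-integrable setT (EFin \o (fun w => Y T w - Y 0 w - BM_comb B C 0 1 T w))).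
Hypotheses (gX0 : G_measurable (F 0) X0) (gY0 : G_measurable (F 0) Y0)
  (start : P [set w | X0 w = 0 /\ Y0 w = 0] = 0%E).

Definition off_corner w := forall t, 0 <= t -> ~ (X t w = 0 /\ Y t w = 0).

Let ae_start_off_corner : {ae P, forall w, ~ (X 0 w = 0 /\ Y 0 w = 0)}.
Proof.
exists [set w | X0 w = 0 /\ Y0 w = 0]; split => //.
  have zero_set (Z : Omega -> R) : G_measurable (F 0) Z -> measurable [set w | Z w = 0].
    by move=> gZ; apply: (usual_sub_measurable uF (lexx 0)); exact: (gZ _ (measurable_set1 0)).
  by have := measurableI _ _ (zero_set _ gX0) (zero_set _ gY0).
by have [_ _ _ XY0 _] := XY; move=> w /= in0; have [<- <-] := XY0 w; exact: contrapT in0.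
Qed.

Let lin l m t w : R := l * X t w + m * Y t w.

Let adapted_lin l m : adapted F (lin l m).
Proof.
have [[aX aY] _ _ _ _] := XY; move=> t t0; have sFt := usual_sigma_algebra uF t0.
by apply: (G_measurableD sFt); apply: (G_measurableZ sFt); [exact: aX|exact: aY].
Qed.

Let continuous_lin l m w : continuous ((lin l m)^~ w).
Proof.
by have [cX cY] := cXY w; move=> r; apply: cvgD; apply: cvgMl_tmp; [exact: cX|exact: cY].
Qed.

Let continuous_lin_max0 l m w : continuous (fun r : R => lin l m (Num.max r 0) w).
Proof. exact: (continuous_max0 (continuous_subspaceT (@continuous_lin l m w))). Qed.

Let lin_drift_integrable l m T : 0 <= T ->
  P.-integrable setT (EFin \o (fun w => lin l m T w - lin l m 0 w - BM_comb B C l m T w)).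
Proof.
move=> T0; have [iX iY] := drift_integrable T0.
have := integrableD_EFin measurableT (integrableZ_EFin l measurableT iX)
  (integrableZ_EFin m measurableT iY).
by apply: eq_integrable => // w _ /=; congr EFin; rewrite /lin /BM_comb; ring.
Qed.

Let lin_drift l m (a b : R) : R := (l * alpha + m * gamma) / a + (l * beta + m * delta) / b.

Let lin_avoid_zero l1 m1 l2 m2 k s : 0 <= k -> 0 <= s ->
  0 <= l1 * alpha + m1 * gamma -> 0 <= l1 * beta + m1 * delta ->
  0 <= l2 * alpha + m2 * gamma -> 0 <= l2 * beta + m2 * delta ->
  (forall a b, 0 < a -> 0 < b -> let u := l1 * a + m1 * b in let v := l2 * a + m2 * b in
     k <= u * lin_drift l1 m1 a b + v * lin_drift l2 m2 a b
       + (BM_var rho l1 m1 + BM_var rho l2 m2) / 2 /\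
     BM_var rho l1 m1 * u ^+ 2 + 2 * BM_cov rho l1 m1 l2 m2 * u * v + BM_var rho l2 m2 * v ^+ 2
       <= k * (u ^+ 2 + v ^+ 2)) ->
  {ae P, forall w, 0 < sqnorm (lin l1 m1) (lin l2 m2) s w ->
    forall t, s <= t -> sqnorm (lin l1 m1) (lin l2 m2) t w != 0}.
Proof.
move=> k0 s0 u10 v10 u20 v20 drift_ge.
apply: (avoid_zero uF rho1 bm k0 (adapted_lin l1 m1) (adapted_lin l2 m2)
  (lin_drift_integrable l1 m1) (lin_drift_integrable l2 m2) _ s0).
apply: (ae_imply _ path) => w S; split; [exact: continuous_lin_max0|exact: continuous_lin_max0|].
exists (fun r => lin_drift l1 m1 (X r w) (Y r w)), (fun r => lin_drift l2 m2 (X r w) (Y r w)).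
split=> [T|T|].
- exact: (path_solution_increasing_drift T u10 v10 S).
- exact: (path_solution_increasing_drift T u20 v20 S).
- have [_ _ pos _ _] := S; apply: (ae_imply _ pos) => r XYr r0; have [Xr Yr] := XYr r0.
  exact: drift_ge.
Qed.

Let off_corner_linear l m : 0 <= l -> 0 <= m -> 0 < l + m ->
  0 <= l * alpha + m * gamma -> 0 <= l * beta + m * delta ->
  (forall a b, 0 < a -> 0 < b -> BM_var rho l m / 2 <= (l * a + m * b) * lin_drift l m a b) ->
  {ae P, forall w, off_corner w}.
Proof.
move=> l0 m0 lm0 u0 v0 drift_ge.
have lin_gt0 (a b : R) : 0 < a -> 0 < b -> 0 < l * a + m * b.
  move=> a0 b0; have [l_gt0|l_le0] := ltP 0 l.
    by rewrite ltr_pwDl ?mulr_gt0 ?mulr_ge0// ltW.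
  by rewrite ltr_wpDl ?mulr_ge0 ?mulr_gt0 ?(ltW a0)//; move: l_le0 lm0; lra.
have avoid : {ae P, forall w, forall i j : nat, 0 < lin l m (i%:R / j.+1%:R) w ->
    forall t, i%:R / j.+1%:R <= t -> lin l m t w != 0}.
  apply: ae_foralln => i; apply: ae_foralln => j.
  have s0 : 0 <= i%:R / j.+1%:R :> R by rewrite divr_ge0.
  have var0 : BM_var rho 0 0 = 0 by rewrite /BM_var; ring.
  have cov0 : BM_cov rho l m 0 0 = 0 by rewrite /BM_cov; ring.
  have := @lin_avoid_zero l m 0 0 (BM_var rho l m) _ (BM_var_ge0 rho1 l m) s0 u0 v0.
  rewrite !mul0r !addr0 => /(_ (lexx 0) (lexx 0)) av; apply: (ae_imply _ (av _)).
    move=> w avoid_w pos t st.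
    have sqE r : sqnorm (lin l m) (lin 0 0) r w = lin l m r w ^+ 2 by rewrite /sqnorm /lin; ring.
    by have := avoid_w _ t st; rewrite !sqE sqrf_eq0 exprn_gt0//; apply.
  by move=> a b a0 b0 /=; rewrite !mul0r var0 cov0; have := drift_ge a b a0 b0; lra.
apply: (ae_imply2 _ ae_start_off_corner (ae_imply2 (fun w S av => conj S av) path avoid)).
move=> w start_w [[_ _ pos _ _] avoid_w] t; rewrite le_eqVlt => /orP[/eqP <- //|t0 [Xt Yt]].
have lin_pos : {ae mu, forall s, 0 <= s -> 0 < lin l m s w}.
  by apply: (ae_imply _ pos) => s XYs s0; have [Xs Ys] := XYs s0; exact: lin_gt0.
have [i [j [ijt lin_ij]]] := exists_rational_gt0 (@continuous_lin l m w) lin_pos t0.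
by have /eqP[] := avoid_w i j lin_ij t ijt; rewrite /lin Xt Yt !mulr0 addr0.
Qed.

Lemma off_corner_C1 : cond_C1 rho alpha beta gamma delta -> {ae P, forall w, off_corner w}.
Proof.
move=> [_ _ /andP[_ rho_le]].
have k0 : 0 <= 1 + Num.max rho 0 by rewrite addr_ge0// maxr0_ge0.
have max_le : Num.max rho 0 <= alpha + delta by rewrite ge_max rho_le addr_ge0// ltW.
have var10 : BM_var rho 1 0 = 1 by rewrite /BM_var; ring.
have var01 : BM_var rho 0 1 = 1 by rewrite /BM_var; ring.
have cov : BM_cov rho 1 0 0 1 = rho by rewrite /BM_cov; ring.
have := @lin_avoid_zero 1 0 0 1 _ _ k0 (lexx 0).
rewrite !mul1r !mul0r !addr0 !add0r => /(_ (ltW alpha0) beta0 gamma0 (ltW delta0)) av.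
apply: (ae_imply2 _ ae_start_off_corner (av _)) => [w start_w avoid_w t t0 [Xt Yt]|a b a0 b0 /=].
  have [_ _ ge0 _ _] := XY; have [X_ge0 Y_ge0] := ge0 0 w (lexx 0).
  have sqE s : sqnorm (lin 1 0) (lin 0 1) s w = X s w ^+ 2 + Y s w ^+ 2.
    by rewrite /sqnorm /lin; ring.
  have := avoid_w _ t t0; rewrite !sqE Xt Yt expr0n addr0 eqxx => /(_ _)/negP[]//.
  rewrite lt_neqAle addr_ge0 ?sqr_ge0// andbT eq_sym paddr_eq0 ?sqr_ge0// !sqrf_eq0.
  by apply/negP => /andP[/eqP X00 /eqP Y00]; exact: start_w.
rewrite var10 var01 cov /lin_drift !mul1r !mul0r !addr0 !add0r; split.
  by have := radial_drift_ge alpha delta beta0 gamma0 a0 b0; lra.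
exact: (correlated_quadratic_le rho (ltW a0) (ltW b0)).
Qed.

Lemma off_corner_C2a : cond_C2a alpha beta -> {ae P, forall w, off_corner w}.
Proof.
move=> [alpha_ge _]; apply: (@off_corner_linear 1 0) => //; rewrite ?mul1r ?mul0r ?addr0//.
  exact: ltW.
move=> a b a0 b0; have -> : BM_var rho 1 0 / 2 = 1 / 2 by rewrite /BM_var; field.
have -> : (1 * a + 0 * b) * lin_drift 1 0 a b = alpha + beta * (a / b).
  by rewrite /lin_drift; field; rewrite !gt_eqF.
by apply: le_trans alpha_ge _; rewrite lerDl mulr_ge0// divr_ge0// ltW.
Qed.

Lemma off_corner_C2b : cond_C2b gamma delta -> {ae P, forall w, off_corner w}.
Proof.
move=> [delta_ge _]; apply: (@off_corner_linear 0 1) => //; rewrite ?mul1r ?mul0r ?add0r//.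
  exact: ltW.
move=> a b a0 b0; have -> : BM_var rho 0 1 / 2 = 1 / 2 by rewrite /BM_var; field.
have -> : (0 * a + 1 * b) * lin_drift 0 1 a b = delta + gamma * (b / a).
  by rewrite /lin_drift; field; rewrite !gt_eqF.
by apply: le_trans delta_ge _; rewrite lerDl mulr_ge0// divr_ge0// ltW.
Qed.

Lemma off_corner_C3 : cond_C3 rho alpha beta gamma delta -> {ae P, forall w, off_corner w}.
Proof.
move=> [l [m [l0 m0 u0 v0 sqrt_ge]]].
apply: (off_corner_linear (ltW l0) (ltW m0) (addr_gt0 l0 m0) u0 v0) => a b a0 b0.
have -> : BM_var rho l m / 2 = (l ^+ 2 + m ^+ 2 + 2 * rho * l * m) / 2 by rewrite /BM_var; ring.
exact: le_trans sqrt_ge (sqr_sqrtD_le l0 m0 u0 v0 a0 b0).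
Qed.

Theorem ae_off_corner : cond_C1 rho alpha beta gamma delta \/ cond_C2a alpha beta \/
  cond_C2b gamma delta \/ cond_C3 rho alpha beta gamma delta -> {ae P, forall w, off_corner w}.
Proof.
case=> [|[|[|]]]; [exact: off_corner_C1|exact: off_corner_C2a|exact: off_corner_C2b|].
exact: off_corner_C3.
Qed.

End corner.

Section pathwise_uniqueness.
Context {R : realType} {d : measure_display} {Omega : measurableType d}.
Variables (P : probability Omega R) (F : R -> set (set Omega)) (B C : R -> Omega -> R).
Variables (alpha beta gamma delta : R) (X0 Y0 : Omega -> R).
Hypotheses (alpha0 : 0 < alpha) (beta0 : 0 <= beta) (gamma0 : 0 <= gamma) (delta0 : 0 < delta).

Lemma pathwise_unique_off_corner (X Y : R -> Omega -> R) :
  {ae P, forall w, path_solution alpha beta gamma delta (fun t => X0 w + B t w)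
    (fun t => Y0 w + C t w) (X^~ w) (Y^~ w)} ->
  {ae P, forall w, off_corner X Y w} -> pathwise_unique P F B C alpha beta gamma delta X0 Y0.
Proof.
move=> S off.
have equal_ref X' Y' : O2BP P F B C alpha beta gamma delta X0 Y0 X' Y' ->
    {ae P, forall w, forall t, 0 <= t -> X t w = X' t w /\ Y t w = Y' t w}.
  move=> /O2BP_path_solution_ae S'; have SS' := ae_imply2 (fun w s s' => conj s s') S S'.
  apply: (ae_imply2 _ SS' off) => w [Sw Sw'] offw t t0.
  have := path_solution_unique_off_corner alpha0 beta0 gamma0 delta0 Sw Sw' offw t0.
  by rewrite (max_idPl t0).
move=> X1 Y1 X2 Y2 /equal_ref ref1 /equal_ref ref2.
apply: (ae_imply2 _ ref1 ref2) => w XY1 XY2 t t0.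
by have [<- <-] := XY1 t t0; exact: XY2.
Qed.

Lemma pathwise_unique_weak_coupling : beta * gamma <= alpha * delta ->
  pathwise_unique P F B C alpha beta gamma delta X0 Y0.
Proof.
move=> weak X1 Y1 X2 Y2 /O2BP_path_solution_ae S1 /O2BP_path_solution_ae S2.
apply: (ae_imply2 _ S1 S2) => w S1w S2w t t0.
have := path_solution_unique_weak_coupling alpha0 beta0 gamma0 delta0 weak S1w S2w t0.
by rewrite (max_idPl t0).
Qed.

End pathwise_uniqueness.

Theorem mainTheorem8 (R : realType) (d : measure_display) (Omega : measurableType d)
  (P : probability Omega R) (F : R -> set (set Omega)) (rho : R) (B C : R -> Omega -> R)
  (alpha beta gamma delta : R) :
  complete_prob_space P -> usual_filtration P F ->
  -1 <= rho <= 1 -> correlated_BM P F rho B C ->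
  0 < alpha -> 0 < delta -> 0 <= beta -> 0 <= gamma ->
  (cond_C1 rho alpha beta gamma delta \/ cond_C2a alpha beta \/
   cond_C2b gamma delta \/ cond_C3 rho alpha beta gamma delta) ->
  [/\
   (* (1) *)
   (forall X0 Y0 : Omega -> R,
      G_measurable (F 0) X0 -> G_measurable (F 0) Y0 ->
      (forall w, 0 <= X0 w /\ 0 <= Y0 w) ->
      P [set w | X0 w = 0 /\ Y0 w = 0] = 0%E ->
      (exists X Y : R -> Omega -> R,
         strong_O2BP P F B C alpha beta gamma delta X0 Y0 X Y /\
         {ae P, forall w, forall t, 0 <= t -> ~ (X t w = 0 /\ Y t w = 0)})
      /\ pathwise_unique P F B C alpha beta gamma delta X0 Y0),
   (* (2) *)
   (exists X Y : R -> Omega -> R,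
      O2BP P F B C alpha beta gamma delta (fun _ => 0) (fun _ => 0) X Y) &
   (* (3) *)
   (beta * gamma <= alpha * delta ->
    forall X0 Y0 : Omega -> R,
      G_measurable (F 0) X0 -> G_measurable (F 0) Y0 ->
      (forall w, 0 <= X0 w /\ 0 <= Y0 w) ->
      (exists X Y : R -> Omega -> R, O2BP P F B C alpha beta gamma delta X0 Y0 X Y)
      /\ pathwise_unique P F B C alpha beta gamma delta X0 Y0)].
Proof.
move=> _ uF rho1 bm alpha0 delta0 beta0 gamma0 cond.
have existence := O2BP_existence uF rho1 bm alpha0 delta0 beta0 gamma0.
split=> [X0 Y0 gX gY XY0 start||weak X0 Y0 gX gY XY0].
- have [X [Y [strong cXY path drifts]]] := existence X0 Y0 gX gY XY0.
  have off := ae_off_corner uF rho1 bm alpha0 delta0 beta0 gamma0 strong.1 cXY path drifts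
    gX gY start cond.
  by split; [exists X, Y|exact: pathwise_unique_off_corner path off].
- have g0 : G_measurable (F 0) (fun=> 0 : R).
    by apply: G_measurable_cst; exact: usual_sigma_algebra uF _ (lexx 0).
  have [X [Y [[sol _] _ _ _]]] := existence _ _ g0 g0 (fun=> conj (lexx 0) (lexx 0)).
  by exists X, Y.
- split; last exact: pathwise_unique_weak_coupling.
  by have [X [Y [[sol _] _ _ _]]] := existence X0 Y0 gX gY XY0; exists X, Y.
Qed.
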